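(* For any integer $d\geqslant 4$ there exists an integer $c_d$ such that, for any smooth surface $S$ in $\mathbb{P}^3$ of degree $d$ and any integer $g\geqslant c_d$, $S$ carries a reduced, irreducible nodal curve of geometric genus $g$, whose nodes can be prescribed generically on $S$.
   Context: The base field is $\mathbb{C}$. A curve is nodal if it has at most nodes (ordinary double points) as singularities. The geometric genus of an irreducible curve is the genus of its normalization. ''Nodes can be prescribed generically on $S$'' means: there is an integer $k\geqslant 0$ (the number of nodes) such that for a general choice of $k$ points of $S$ there is such a curve whose nodes are exactly those $k$ points. *)

(* Defs.v *)
From HB Require Import structures.
From mathcomp Require Import all_boot all_order all_algebra.
From mathcomp Require Import classical_sets reals.
From mathcomp Require Import complex mpoly.

Set Implicit Arguments.
Unset Strict Implicit.
Unset Printing Implicit Defensive.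

Import GRing.Theory.
Local Open Scope ring_scope.
Local Open Scope classical_set_scope.

(** A point of P^n is represented by its nonzero homogeneous coordinate
    vectors [x : 'rV_n.+1]; two of them give the same point when they span
    the same line, [(x == y)%MS].  A subset of P^n is represented by the set
    of all coordinate vectors of its points (a cone without its vertex). *)

Definition eval_at (K : closedFieldType) n (f : {mpoly K[n]}) (x : 'rV[K]_n) : K :=
  f.@[fun i => x 0 i].

Section Varieties.
Variables (K : closedFieldType) (n : nat).
Implicit Types (X Y Z : set 'rV[K]_n.+1) (x y p u v w : 'rV[K]_n.+1).
Implicit Types f h : {mpoly K[n.+1]}.

Definition zero_locus (E : set {mpoly K[n.+1]}) : set 'rV[K]_n.+1 :=
  [set x | x != 0 /\ forall f, E f -> eval_at f x = 0].

Definition Zariski_closed X : Prop :=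
  exists E : set {mpoly K[n.+1]},
    (forall f, E f -> exists m, f \is m.-homog) /\ X = zero_locus E.

Definition irreducible X : Prop :=
  X !=set0 /\
  forall Y Z, Zariski_closed Y -> Zariski_closed Z ->
    X `<=` Y `|` Z -> X `<=` Y \/ X `<=` Z.

Definition single_point X : Prop :=
  exists2 x : 'rV[K]_n.+1, x != 0 & X = [set y : 'rV[K]_n.+1 | (y == x)%MS].

(** Reduced irreducible projective curves: irreducible closed sets of Krull
    dimension one (with their reduced structure). *)
Definition integral_curve X : Prop :=
  [/\ Zariski_closed X, irreducible X, ~ single_point X &
      forall Z, Zariski_closed Z -> irreducible Z ->
        Z `<=` X -> Z <> X -> single_point Z].

(** The polynomials vanishing on the cone over [X]; this is the homogeneous
    ideal of [X] when [X] is closed and nonempty. *)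
Definition vanishing_ideal X : set {mpoly K[n.+1]} :=
  [set f | forall x, X x -> eval_at f x = 0].

Definition differential f x v : K := \sum_i eval_at f^`M(i) x * v 0 i.

(** Tangent space at [x] of the cone over [X]; the Zariski tangent space of
    [X] at the point [x] is its quotient by the line spanned by [x]. *)
Definition cone_tangent_space X x : set 'rV[K]_n.+1 :=
  [set v | forall f, vanishing_ideal X f -> differential f x v = 0].

Definition curve_regular_at X x : Prop :=
  exists2 T : 'M[K]_(2, n.+1), row_free T &
    forall v, cone_tangent_space X x v <-> (v <= T)%MS.

Definition curve_singular_at X x : Prop := X x /\ ~ curve_regular_at X x.

Definition smooth_curve X : Prop :=
  integral_curve X /\ forall x, X x -> curve_regular_at X x.

(** [f (p + 'X)]. *)
Definition translate p f : {mpoly K[n.+1]} :=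
  f \mPo [tuple 'X_i + (p 0 i)%:MP | i < n.+1].

(** The degree [k] part of the ideal of the tangent cone at [p] of the cone
    over [X]: the forms [h] such that some [f] in the ideal of [X] satisfies
    [f (p + t) = h t + O(t ^ (k + 1))]. *)
Definition tangent_cone_ideal X p (k : nat) : set {mpoly K[n.+1]} :=
  [set h | h \is k.-homog /\
     exists2 f, vanishing_ideal X f &
       forall m, m \in msupp (translate p f - h) -> (k < mdeg m)%N].

(** [p] is an ordinary double point of [X]: the tangent cone of [X] at [p] is,
    as a scheme, the union of two distinct lines, each with multiplicity one.
    In terms of the cone over [X], near [p] the product of [X] with the line
    spanned by [p], the ideal of initial forms at [p] is the ideal of two
    distinct planes meeting along the line spanned by [p]. *)
Definition is_node X p : Prop :=
  X p /\ exists u v, row_free (col_mx p (col_mx u v)) /\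
    forall k h, h \is k.-homog ->
      (tangent_cone_ideal X p k h <->
       forall w, (w <= col_mx p u)%MS || (w <= col_mx p v)%MS -> eval_at h w = 0).

Definition nodal X : Prop := forall x, curve_singular_at X x -> is_node X x.

(** A regular 1-form on a smooth [X], as a function of a point [y] and of a
    tangent vector [v] at [y] of the cone over [X].  The vanishing at [v = y]
    and the degrees make [omega y v] depend only on the induced tangent vector
    of [X]. *)
Definition regular_1form X (omega : 'rV[K]_n.+1 -> 'rV[K]_n.+1 -> K) : Prop :=
  (forall y, X y -> omega y y = 0) /\
  forall x, X x ->
    exists (e : nat) (A : 'I_n.+1 -> {mpoly K[n.+1]}) (B : {mpoly K[n.+1]}),
      [/\ forall i, A i \is e.-homog, B \is e.+1.-homog, eval_at B x != 0 &
          forall y v, X y -> eval_at B y != 0 -> cone_tangent_space X y v ->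
            omega y v = (\sum_i eval_at (A i) y * v 0 i) / eval_at B y].

(** The genus of a smooth projective curve: the dimension of its space of
    regular 1-forms, two of which are equal when they agree on all tangent
    vectors. *)
Definition has_genus X (g : int) : Prop :=
  exists (r : nat) (b : 'I_r -> 'rV[K]_n.+1 -> 'rV[K]_n.+1 -> K),
    [/\ g = r%:Z,
        forall i, regular_1form X (b i),
        forall a : 'I_r -> K,
          (forall y v, X y -> cone_tangent_space X y v ->
             \sum_i a i * b i y v = 0) -> forall i, a i = 0 &
        forall omega, regular_1form X omega ->
          exists a : 'I_r -> K, forall y v, X y -> cone_tangent_space X y v ->
            omega y v = \sum_i a i * b i y v].

End Varieties.

Section Morphisms.
Variables (K : closedFieldType) (n m : nat).
Implicit Types (X : set 'rV[K]_n.+1) (Y : set 'rV[K]_m.+1).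

Definition eval_forms (G : 'I_m.+1 -> {mpoly K[n.+1]}) (x : 'rV[K]_n.+1) :
    'rV[K]_m.+1 :=
  \row_j eval_at (G j) x.

(** [phi] acts on coordinate vectors; its values only matter on [X] and up to
    scalars. *)
Definition morphism_to X Y (phi : 'rV[K]_n.+1 -> 'rV[K]_m.+1) : Prop :=
  (forall x, X x -> Y (phi x)) /\
  forall x, X x ->
    exists (e : nat) (G : 'I_m.+1 -> {mpoly K[n.+1]}),
      [/\ forall j, G j \is e.-homog, eval_forms G x != 0 &
          forall y, X y -> eval_forms G y != 0 -> (phi y == eval_forms G y)%MS].

End Morphisms.

(** [nu : Xt -> X] has a rational inverse, given by forms [H] on a nonempty
    open subset of [X]. *)
Definition birational_to (K : closedFieldType) (n m : nat)
    (Xt : set 'rV[K]_n.+1) (X : set 'rV[K]_m.+1)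
    (nu : 'rV[K]_n.+1 -> 'rV[K]_m.+1) : Prop :=
  exists (e : nat) (H : 'I_n.+1 -> {mpoly K[m.+1]}),
    [/\ forall j, H j \is e.-homog,
        exists2 x, X x & eval_forms H x != 0,
        forall x, X x -> eval_forms H x != 0 ->
          Xt (eval_forms H x) /\ (nu (eval_forms H x) == x)%MS &
        forall y, Xt y -> eval_forms H (nu y) != 0 ->
          (eval_forms H (nu y) == y)%MS].

(** For curves normal means smooth, and a birational morphism between
    projective curves is automatically finite. *)
Definition normalization (K : closedFieldType) (n m : nat)
    (Xt : set 'rV[K]_n.+1) (X : set 'rV[K]_m.+1)
    (nu : 'rV[K]_n.+1 -> 'rV[K]_m.+1) : Prop :=
  [/\ smooth_curve Xt, morphism_to Xt X nu & birational_to Xt X nu].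

Definition has_geometric_genus (K : closedFieldType) (m : nat)
    (X : set 'rV[K]_m.+1) (g : int) : Prop :=
  exists (n : nat) (Xt : set 'rV[K]_n.+1) (nu : 'rV[K]_n.+1 -> 'rV[K]_m.+1),
    normalization Xt X nu /\ has_genus Xt g.

Definition hypersurface (K : closedFieldType) (n : nat) (F : {mpoly K[n.+1]}) :
    set 'rV[K]_n.+1 :=
  zero_locus [set F].

(** Jacobian criterion for the scheme [F = 0] in P^n. *)
Definition smooth_hypersurface (K : closedFieldType) (n : nat)
    (F : {mpoly K[n.+1]}) : Prop :=
  forall x, hypersurface F x -> exists i, eval_at F^`M(i) x != 0.

(** [P] holds for a general [k]-tuple of points of [S], [S] irreducible: it
    holds on a nonempty principal open subset of [S^k], the nonvanishing locus
    of a multihomogeneous polynomial [Phi] in [k] groups of [n + 1] variables.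
    The rows of a matrix are the points of the tuple; [mxvec_index i j] is the
    variable for the [j]-th coordinate of the [i]-th point. *)
Definition for_general_points (K : closedFieldType) (n k : nat)
    (S : set 'rV[K]_n.+1) (P : 'M[K]_(k, n.+1) -> Prop) : Prop :=
  exists (e : 'I_k -> nat) (Phi : {mpoly K[k * n.+1]}),
    [/\ forall mon, mon \in msupp Phi ->
          forall i, (\sum_(j < n.+1) mon (mxvec_index i j))%N = e i,
        exists2 q : 'M[K]_(k, n.+1),
          forall i, S (row i q) & eval_at Phi (mxvec q) != 0 &
        forall q : 'M[K]_(k, n.+1),
          (forall i, S (row i q)) -> eval_at Phi (mxvec q) != 0 -> P q].

(* Main.v *)
(** On the surface [F = 0], k general points [q_i] admit forms [f_i] of degree
    about [sqrt k] with [f_i (q_j)] nonzero exactly when [i = j].  Products of pairs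
    of forms vanishing at all [q_i] therefore span, in every large degree [n], a
    linear system of forms singular along the [q_i], with general quadratic parts
    there and no other base point.  By Bertini, a general member [G] cuts out on the
    surface a curve [X] whose only singularities are nodes, at the [q_i].  Both
    general members and Bertini are expressed by derivations of the ground field:
    parameters are general when a derivation that kills the coefficients of the data
    moves them independently.

    The ideal [(F, G)] is prime: the coordinate ring of the cone is Cohen-Macaulay,
    so two components could only be disjoint or meet in nodes, and in both cases an
    idempotent-like form of too small a degree would have to lie in the ideal.

    The normalization blows up the nodes: it is the closure in [P^(4M-1)] of the image
    of [x |-> (x_l h_j(x))], for forms [h_j] generating the ideal of the nodes in a
    large degree.  Cramer's rule identifies its regular 1-forms with the forms of
    degree [n + d - 4] modulo [(F, G)] that vanish at the nodes, whence the genus is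
    [C(n+d-1, 3) - C(n-1, 3) - C(d-1, 3) - k].  As [n] grows, the possible ranges
    of [k] make this take every large value. *)

Require Import Defs.
From HB Require Import structures.
From mathcomp Require Import all_boot all_order all_algebra.
From mathcomp Require Import classical_sets boolp functions cardinality reals.
From mathcomp Require Import complex mpoly.
From mathcomp Require Import finmap.
From mathcomp Require Import ring lra zify.

Set Implicit Arguments.
Unset Strict Implicit.
Unset Printing Implicit Defensive.

Import Order.TTheory GRing.Theory Num.Theory.

Local Open Scope ring_scope.
Local Open Scope classical_set_scope.

(** * Polynomials, differentials and ideals *)

Section Basics.
Variable K : numClosedFieldType.

(** What matters about the ground field is that it is algebraically closed, of characteristic zero
    and uncountable. Uncountability serves twice: it gives the Nullstellensatz by a dependence count
    among inverses of [X_i - a], and it supplies elements transcendental over any finite set of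
    data, hence derivations that move chosen parameters. Sheaf cohomology is replaced by one depth
    statement: two linear forms without common zero on the curve are a regular sequence modulo
    [(F, G)], so a quotient that exists locally at every point exists globally. Primality of
    [(F, G)] and the description of regular 1-forms both rest on it. The shape [n = 2 m + r] with
    [r > 0] comes from primality: the idempotent-like form has degree [m], its quadratic equation
    has degree [2 m < n], so it holds modulo [F] alone, and [F] is prime by the same argument
    applied to a plane section. The number of nodes is the gap between [g] and the genus of a smooth
    complete intersection; consecutive such genera differ by about [n d], whereas about [n^2 / 16]
    nodes are available, so [n] must be large compared with [d]. *)

Lemma mpoly_ring_ind n (Q : {mpoly K[n]} -> Prop) :
  (forall c, Q c%:MP) -> (forall i, Q 'X_i) ->
  (forall f g, Q f -> Q g -> Q (f + g)) -> (forall f g, Q f -> Q g -> Q (f * g)) ->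
  forall f, Q f.
Proof.
move=> QC QX QD QM f; elim/mpolyind: f => [|c m p _ _ IH]; first exact: QC 0.
apply: QD => //; rewrite -mul_mpolyC; apply: (QM) => //.
rewrite mpolyXE_id; elim/big_rec: _ => [|i p' _ Hp']; first exact: QC 1.
apply: (QM) => //; elim: (m i) => [|k IHk]; first by rewrite expr0; exact: QC 1.
by rewrite exprS; apply: QM.
Qed.

Section Eval.
Variable n : nat.
Implicit Types (f g : {mpoly K[n]}) (x v w : 'rV[K]_n).

Lemma eval_atD x f g : eval_at (f + g) x = eval_at f x + eval_at g x.
Proof. exact: mevalD. Qed.
Lemma eval_atB x f g : eval_at (f - g) x = eval_at f x - eval_at g x.
Proof. exact: mevalB. Qed.
Lemma eval_atN x f : eval_at (- f) x = - eval_at f x.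
Proof. exact: mevalN. Qed.
Lemma eval_atM x f g : eval_at (f * g) x = eval_at f x * eval_at g x.
Proof. exact: mevalM. Qed.
Lemma eval_atC x c : eval_at (c%:MP : {mpoly K[n]}) x = c.
Proof. exact: mevalC. Qed.
Lemma eval_at0 x : eval_at (0 : {mpoly K[n]}) x = 0.
Proof. exact: meval0. Qed.
Lemma eval_at1 x : eval_at (1 : {mpoly K[n]}) x = 1.
Proof. exact: meval1. Qed.
Lemma eval_atZ x c f : eval_at (c *: f) x = c * eval_at f x.
Proof. exact: mevalZ. Qed.
Lemma eval_atU x i : eval_at ('X_i : {mpoly K[n]}) x = x 0 i.
Proof. exact: mevalXU. Qed.
Lemma eval_atXn x f k : eval_at (f ^+ k) x = eval_at f x ^+ k.
Proof. exact: rmorphXn. Qed.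
Lemma eval_at_sum x I (r : seq I) (P : pred I) (F : I -> {mpoly K[n]}) :
  eval_at (\sum_(i <- r | P i) F i) x = \sum_(i <- r | P i) eval_at (F i) x.
Proof. exact: rmorph_sum. Qed.
Lemma eval_at_prod x I (r : seq I) (P : pred I) (F : I -> {mpoly K[n]}) :
  eval_at (\prod_(i <- r | P i) F i) x = \prod_(i <- r | P i) eval_at (F i) x.
Proof. exact: rmorph_prod. Qed.
End Eval.
Definition evE := (eval_atD, eval_atB, eval_atN, eval_atM, eval_atC, eval_at0, eval_at1,
  eval_atZ, eval_atU, eval_atXn).

Section Scale.
Variable n : nat.
Implicit Types (f : {mpoly K[n]}) (x : 'rV[K]_n).

Lemma eval_scale f m x a : f \is m.-homog -> eval_at f (a *: x) = a ^+ m * eval_at f x.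
Proof.
move=> hf; rewrite /eval_at !mevalE big_distrr /= big_seq [RHS]big_seq.
apply: eq_bigr => k kf; rewrite mulrCA; congr (_ * _).
have <- : mdeg k = m := dhomog_mf hf kf.
rewrite mdegE -prodrXr -big_split /=; apply: eq_bigr => i _.
by rewrite mxE exprMn.
Qed.

Lemma eval_homog0 f m : f \is m.-homog -> (0 < m)%N -> eval_at f 0 = 0.
Proof. by move=> /(eval_scale 0 0) + m0; rewrite scaler0 expr0n eqn0Ngt m0 mul0r. Qed.
End Scale.

Section Compose.
Variable n : nat.
Implicit Type f : {mpoly K[n]}.
Variables (S : comNzRingType) (phi : {rmorphism K -> S}).

(** The target ring is arbitrary because two are used: with [S] a ring of polynomials in several
    variables this gives ideal membership, with [S = {poly K}] it compares two arcs. *)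
Lemma taylor0 f (a b : 'I_n -> S) : exists c : 'I_n -> S,
  mmap phi a f - mmap phi b f = \sum_i c i * (a i - b i).
Proof.
elim/mpoly_ring_ind: f => [c|i|f g [c1 E1] [c2 E2]|f g [c1 E1] [c2 E2]].
- by exists (fun=> 0); rewrite !mmapC subrr big1 // => i _; rewrite mul0r.
- exists (fun j => (j == i)%:R); rewrite !mmapX !mmap1U (bigD1 i) //= eqxx mul1r.
  by rewrite big1 ?addr0 // => j /negbTE ->; rewrite mul0r.
- exists (fun i => c1 i + c2 i); rewrite !mmapD opprD addrACA E1 E2 -big_split.
  by apply: eq_bigr => i _; rewrite mulrDl.
- exists (fun i => c1 i * mmap phi a g + mmap phi b f * c2 i); rewrite !rmorphM /=.
  transitivity ((mmap phi a f - mmap phi b f) * mmap phi a g +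
     mmap phi b f * (mmap phi a g - mmap phi b g)); first by ring.
  rewrite E1 E2 mulr_suml mulr_sumr -big_split; apply: eq_bigr => i _ /=; ring.
Qed.

(** The remainder is left unspecified, so no division by 2 occurs and the product rule alone proves
    it. *)
Lemma taylor1 f (x y : 'I_n -> S) (t : S) : exists c : S,
  mmap phi (fun i => x i + t * y i) f =
    mmap phi x f + t * (\sum_i mmap phi x f^`M(i) * y i) + t ^+ 2 * c.
Proof.
elim/mpoly_ring_ind: f => [c|i|f g [c1 E1] [c2 E2]|f g [c1 E1] [c2 E2]].
- exists 0; rewrite !mmapC big1 ?mulr0 ?addr0 // => i _; rewrite mderivC mmap0 mul0r //.
- exists 0; rewrite !mmapX !mmap1U mulr0 addr0 (bigD1 i) //= big1 => [|j ji].
    rewrite addr0 mderivX mnm1E eqxx -[X in (X - _)%MM]add0m addmK mpolyX0 scale1r.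
    by rewrite rmorph1 mul1r.
  by rewrite mderivX mnm1E eq_sym (negbTE ji) scale0r mmap0 mul0r.
- exists (c1 + c2); rewrite !mmapD E1 E2.
  have -> : \sum_i mmap phi x (f + g)^`M(i) * y i =
    \sum_i mmap phi x f^`M(i) * y i + \sum_i mmap phi x g^`M(i) * y i.
    by rewrite -big_split; apply: eq_bigr => i _ /=; rewrite mderivD mmapD mulrDl.
  ring.
- pose df := \sum_i mmap phi x f^`M(i) * y i; pose dg := \sum_i mmap phi x g^`M(i) * y i.
  have E : \sum_i mmap phi x (f * g)^`M(i) * y i = df * mmap phi x g + mmap phi x f * dg.
    rewrite /df /dg mulr_suml mulr_sumr -big_split; apply: eq_bigr => i _ /=.
    by rewrite mderivM mmapD !rmorphM /=; ring.
  exists (df * dg + c1 * (mmap phi x g + t * dg) + c2 * (mmap phi x f + t * df) + t ^+ 2 * c1 * c2).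
  rewrite !rmorphM /= E1 E2 E -/df -/dg; ring.
Qed.
End Compose.

Section Diff.
Variable n' : nat.
Local Notation n := n'.+1.
Implicit Types (f g : {mpoly K[n]}) (x v w : 'rV[K]_n).

Lemma dfD f g x v : differential (f + g) x v = differential f x v + differential g x v.
Proof. by rewrite -big_split; apply: eq_bigr => i _ /=; rewrite mderivD evE mulrDl. Qed.
Lemma dfN f x v : differential (- f) x v = - differential f x v.
Proof. by rewrite -sumrN; apply: eq_bigr => i _ /=; rewrite mderivN evE mulNr. Qed.
Lemma dfB f g x v : differential (f - g) x v = differential f x v - differential g x v.
Proof. by rewrite dfD dfN. Qed.
Lemma dfM f g x v : differential (f * g) x v =
  differential f x v * eval_at g x + eval_at f x * differential g x v.
Proof.
rewrite /differential mulr_suml mulr_sumr -big_split; apply: eq_bigr => i _ /=.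
rewrite mderivM !evE; ring.
Qed.
Lemma dfC c x v : differential (c%:MP : {mpoly K[n]}) x v = 0.
Proof. by apply: big1 => i _; rewrite mderivC evE mul0r. Qed.
Lemma df0 x v : differential (0 : {mpoly K[n]}) x v = 0.
Proof. by rewrite -(mpolyC0 n) dfC. Qed.
Lemma df1 x v : differential (1 : {mpoly K[n]}) x v = 0.
Proof. by rewrite -mpolyC1 dfC. Qed.
Lemma dfU i x v : differential ('X_i : {mpoly K[n]}) x v = v 0 i.
Proof.
rewrite /differential (bigD1 i) //= big1 ?addr0 => [|j ji]; rewrite mderivX mnm1E evE.
  by rewrite eqxx -[X in (X - _)%MM]add0m addmK mpolyX0 evE !mul1r.
by rewrite eq_sym (negbTE ji) !mul0r.
Qed.
Lemma dfZ c f x v : differential (c *: f) x v = c * differential f x v.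
Proof. by rewrite -mul_mpolyC dfM dfC evE mul0r add0r. Qed.
Lemma df_sum x v I (r : seq I) (P : pred I) (F : I -> {mpoly K[n]}) :
  differential (\sum_(i <- r | P i) F i) x v = \sum_(i <- r | P i) differential (F i) x v.
Proof. by apply: (big_morph (fun f => differential f x v)) => [f g|]; rewrite ?dfD ?df0. Qed.
Definition dfE := (dfD, dfB, dfN, dfM, dfC, df0, df1, dfZ, dfU).

Lemma dfDv f x v w : differential f x (v + w) = differential f x v + differential f x w.
Proof. by rewrite -big_split; apply: eq_bigr => i _ /=; rewrite mxE mulrDr. Qed.
Lemma dfZv f x c v : differential f x (c *: v) = c * differential f x v.
Proof. rewrite mulr_sumr; apply: eq_bigr => i _ /=; rewrite mxE; ring. Qed.
Lemma df0v f x : differential f x 0 = 0.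
Proof. by apply: big1 => i _; rewrite mxE mulr0. Qed.
Lemma dfNv f x v : differential f x (- v) = - differential f x v.
Proof. by rewrite -scaleN1r dfZv mulN1r. Qed.
Lemma dfBv f x v w : differential f x (v - w) = differential f x v - differential f x w.
Proof. by rewrite dfDv dfNv. Qed.
Definition dfvE := (dfDv, dfBv, dfNv, dfZv, df0v).

Definition grad f x : 'rV[K]_n := \row_i eval_at f^`M(i) x.
Lemma differential_grad f x v : differential f x v = (v *m (grad f x)^T) 0 0.
Proof. by rewrite mxE; apply: eq_bigr => i _; rewrite !mxE mulrC. Qed.


Lemma mderiv_homog f m i : f \is m.-homog -> f^`M(i) \is (m.-1).-homog.
Proof.
move=> hf; apply/dhomogP => k; rewrite mcoeff_msupp mcoeff_deriv => nz.
suff H : (k + U_(i))%MM \in msupp f.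
  have : mdeg (k + U_(i))%MM = m := dhomog_mf hf H.
  by rewrite mdegD mdeg1 addn1 => <-.
by rewrite mcoeff_msupp; apply: contraNneq nz => ->; rewrite mul0rn.
Qed.

Lemma euler f m x : f \is m.-homog -> differential f x x = m%:R * eval_at f x.
Proof.
move=> hf; have : forall k, k \in msupp f -> mdeg k = m by move=> k; exact: (dhomog_mf hf).
rewrite {2 3}[f]mpolyE df_sum eval_at_sum big_distrr /= big_seq => H.
rewrite [RHS]big_seq; apply: eq_bigr => k kf; rewrite dfZ evE mulrCA; congr (_ * _).
rewrite -(H k kf) => {H kf}; rewrite mdegE natr_sum mulr_suml; apply: eq_bigr => i _.
rewrite mderivX evE -mulrA; have [->|ki] := eqVneq (k i) 0%N; first by rewrite !mul0r.
congr (_ * _).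
by rewrite -[k in RHS](submK (m := U_(i)%MM)) ?lep1mP // mpolyXD !evE.
Qed.


Lemma df_homog f m x a v : f \is m.-homog ->
  differential f (a *: x) v = a ^+ m.-1 * differential f x v.
Proof.
move=> hf; rewrite mulr_sumr; apply: eq_bigr => i _.
by rewrite (eval_scale _ _ (mderiv_homog i hf)) mulrA.
Qed.

End Diff.
End Basics.

Section Ideals.
Variables (K : numClosedFieldType) (n : nat).
Implicit Types (f g h : {mpoly K[n]}) (J : set {mpoly K[n]}) (x : 'rV[K]_n).

Definition is_ideal J : Prop :=
  [/\ J 0, forall f g, J f -> J g -> J (f + g) & forall a f, J f -> J (a * f)].

(** The ideal [J + (g)], written as divisibility by [g] modulo [J]: the form in which regular
    sequences and local quotients are used. *)
Definition adj J g : set {mpoly K[n]} := [set h | exists a, J (h - a * g)].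

Definition idl (s : seq {mpoly K[n]}) : set {mpoly K[n]} := foldr (fun g J => adj J g) [set 0] s.

Lemma idlc J a f b g h : is_ideal J -> J f -> J g -> h = a * f + b * g -> J h.
Proof. by case=> _ JD JM Jf Jg ->; apply: JD; apply: JM. Qed.

Lemma idl1 J a f h : is_ideal J -> J f -> h = a * f -> J h.
Proof. by case=> _ _ JM Jf ->; apply: JM. Qed.

Lemma idl_eq J f g : is_ideal J -> J (f - g) -> J g -> J f.
Proof. by move=> HJ H1 H2; apply: (idlc (a := 1) (b := 1) HJ H1 H2); ring. Qed.

Lemma idl_sum J I (r : seq I) (P : pred I) (F : I -> {mpoly K[n]}) : is_ideal J ->
  (forall i, P i -> J (F i)) -> J (\sum_(i <- r | P i) F i).
Proof. by case=> J0 JD _ H; elim/big_ind: _. Qed.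

Lemma is_ideal0 : is_ideal [set 0].
Proof.
by split=> // [f g /= -> ->|a f /= ->]; rewrite ?addr0 ?mulr0.
Qed.

Lemma is_ideal_adj J g : is_ideal J -> is_ideal (adj J g).
Proof.
move=> HJ; split=> [|f1 f2 [a1 H1] [a2 H2]|a f [b H]].
- by exists 0; rewrite mul0r subr0; case: HJ.
- by exists (a1 + a2); apply: (idlc (a := 1) (b := 1) HJ H1 H2); ring.
- by exists (a * b); apply: (idl1 (a := a) HJ H); ring.
Qed.

Lemma is_ideal_idl s : is_ideal (idl s).
Proof. by elim: s => [|g s IH]; [exact: is_ideal0|exact: is_ideal_adj]. Qed.
Hint Resolve is_ideal_idl : core.

Lemma adj_sub J g h : J h -> adj J g h.
Proof. by exists 0; rewrite mul0r subr0. Qed.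

Lemma adj_in J g : is_ideal J -> adj J g g.
Proof. by case=> J0 _ _; exists 1; rewrite mul1r subrr. Qed.

Lemma adj_min J J' g : is_ideal J' -> (J `<=` J') -> J' g -> adj J g `<=` J'.
Proof.
by move=> HJ' JJ' J'g h [a /JJ' H]; apply: (idlc (a := 1) (b := a) HJ' H J'g); ring.
Qed.

Lemma idl_mem s g : g \in s -> idl s g.
Proof.
elim: s => //= h s IH; rewrite inE => /orP[/eqP ->|/IH]; first exact: adj_in.
exact: adj_sub.
Qed.

Lemma idl_min J s : is_ideal J -> (forall g, g \in s -> J g) -> idl s `<=` J.
Proof.
move=> HJ; elim: s => [_ f ->|g s IH H]; first by case: HJ.
by apply: adj_min => //; [apply: IH => h hs|]; apply: H; rewrite inE ?hs ?orbT ?eqxx.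
Qed.

Lemma idl_zero s x f : (forall g, g \in s -> eval_at g x = 0) -> idl s f -> eval_at f x = 0.
Proof.
move=> H; apply: (@idl_min [set f | eval_at f x = 0]) => //; split=> [|g h|g h] /=.
- by rewrite evE.
- by rewrite evE => -> ->; rewrite addr0.
- by rewrite evE => ->; rewrite mulr0.
Qed.

(** The polynomials that fall into the localization of [J] at the affine point [x]; [s] is the
    denominator. *)
Definition loc x J : set {mpoly K[n]} := [set f | exists2 s, eval_at s x != 0 & J (s * f)].

Lemma is_ideal_loc x J : is_ideal J -> is_ideal (loc x J).
Proof.
move=> HJ; split=> [|f1 f2 [s1 n1 H1] [s2 n2 H2]|a f [s ns H]].
- by exists 1; rewrite ?evE ?oner_neq0 // mul1r; case: HJ.
- exists (s1 * s2); first by rewrite evE mulf_neq0.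
  by apply: (idlc (a := s2) (b := s1) HJ H1 H2); ring.
- by exists s => //; apply: (idl1 (a := a) HJ H); ring.
Qed.

Lemma loc_sub x J : is_ideal J -> J `<=` loc x J.
Proof. by move=> HJ f Jf; exists 1; rewrite ?evE ?oner_neq0 ?mul1r. Qed.

Lemma locM x J s f : eval_at s x != 0 -> loc x J (s * f) -> loc x J f.
Proof. by move=> ns [t nt H]; exists (t * s); rewrite ?evE ?mulf_neq0 // -mulrA. Qed.

(** * The Nullstellensatz over an uncountable field *)

Section Null.
Hypothesis unc : ~ countable [set: K].

Lemma uncountable_fiber (h : K -> nat * nat) : exists v, infinite_set (h @^-1` [set v]).
Proof.
apply: contrapT => /forallNP H; apply: unc.
have -> : [set: K] = \bigcup_(v in [set: nat * nat]) (h @^-1` [set v]).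
  by apply/seteqP; split=> // x _; exists (h x).
by apply: bigcup_countable => // v _; apply: finite_set_countable; apply: contrapT; exact: H.
Qed.

Lemma linear_dep D M (b : 'I_M -> {mpoly K[n]}) : (forall j, (msize (b j) <= D)%N) ->
  (#|{: 'X_{1..n < D}}| < M)%N ->
  exists c : 'rV[K]_M, c != 0 /\ \sum_j c 0 j *: b j = 0.
Proof.
move=> Hb HM; pose B : 'M[K]_(M, #|{: 'X_{1..n < D}}|) := \matrix_(j, k) (b j)@_(enum_val k : 'X_{1..n < D}).
have nf : ~~ row_free B.
  by rewrite -row_leq_rank -ltnNge (leq_ltn_trans (rank_leq_col B)).
exists (nz_row (kermx B)); rewrite nz_row_eq0 kermx_eq0 nf; split=> //.
have /sub_kermxP := nz_row_sub (kermx B); move: (nz_row _) => c /matrixP H.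
apply/mpolyP => m; rewrite mcoeff0 raddf_sum /=.
have [mD|mD] := ltnP (mdeg m) D; last first.
  apply: big1 => j _; rewrite mcoeffZ (memN_msupp_eq0 (msize_mdeg_ge _)) ?mulr0 //.
  exact: leq_trans mD.
transitivity ((c *m B) 0 (enum_rank (BMultinom mD))); last by rewrite H mxE.
rewrite [RHS]mxE; apply: eq_bigr => j _.
by rewrite mcoeffZ mxE enum_rankK.
Qed.

(** Suppose each [a] makes a power of [f] a multiple of ['X_i - a] modulo [J]. Uncountably many [a]
    share the exponent and the size of the cofactor, so finitely many of those cofactors are
    linearly dependent. Clearing denominators puts [p('X_i) f ^+ N] in [J] for a nonzero
    one-variable [p], and the linear factors of [p] can be removed one by one. *)
Lemma null_step J f i : is_ideal J -> (forall N, ~ J (f ^+ N)) ->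
  exists a : K, forall N, ~ adj J ('X_i - a%:MP) (f ^+ N).
Proof.
move=> HJ HN; apply: contrapT => /forallNP H.
have {}H (a : K) : {Nb : nat * {mpoly K[n]} | J (f ^+ Nb.1 - Nb.2 * ('X_i - a%:MP))}.
  apply: cid; have /existsNP[N /contrapT [b Hb]] := H a.
  by exists (N, b).
pose Nb (a : K) := sval (H a).
have HNb (a : K) : J (f ^+ (Nb a).1 - (Nb a).2 * ('X_i - a%:MP)) by rewrite /Nb; case: (H a).
have [[N D] inf] := uncountable_fiber (fun a => ((Nb a).1, msize (Nb a).2)).
pose M := #|{: 'X_{1..n < D}}|.+1.
have [B BA BM] := infinite_set_fset M inf.
pose s := finmap.enum_fset B.
have us : uniq s by exact: finmap.fset_uniq.
pose al (j : 'I_(size s)) := nth 0 s j.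
have Hal j : (Nb (al j)).1 = N /\ msize (Nb (al j)).2 = D.
  by have : [set` B] (al j) by [exact: mem_nth]; move=> /BA /= [-> ->].
have [||c [c0 Hc]] := @linear_dep D (size s) (fun j => (Nb (al j)).2) _ _.
- by move=> j; rewrite (Hal j).2.
- exact: BM.
pose Pj j : {poly K} := \prod_(k | k != j) ('X - (al k)%:P).
(* The dependence relation multiplied by all ['X - al k]. Its value at [al j] is [c 0 j] times a
   nonzero product, whence [p != 0]. *)
pose p := \sum_j c 0 j *: Pj j.
pose ev (q : {poly K}) : {mpoly K[n]} := (map_poly (@mpolyC n K) q).['X_i].
have evX r : ev ('X - r%:P) = 'X_i - r%:MP.
  by rewrite /ev rmorphB /= map_polyX map_polyC /= hornerD hornerN hornerX hornerC.
have evM q r : ev (q * r) = ev q * ev r by rewrite /ev rmorphM hornerM.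
have evZ k q : ev (k *: q) = k%:MP * ev q by rewrite /ev -mul_polyC rmorphM /= map_polyC hornerM hornerC.
have Jp : J (ev p * f ^+ N).
  pose Q := ev (\prod_k ('X - (al k)%:P)).
  have EQ j : Q = ('X_i - (al j)%:MP) * ev (Pj j).
    by rewrite /Q (bigD1 j) //= evM evX.
  have -> : ev p * f ^+ N = \sum_j (c 0 j)%:MP * ev (Pj j) *
      (f ^+ N - (Nb (al j)).2 * ('X_i - (al j)%:MP)).
    have Z : \sum_j (c 0 j)%:MP * ev (Pj j) * ((Nb (al j)).2 * ('X_i - (al j)%:MP)) = 0.
      transitivity (Q * \sum_j c 0 j *: (Nb (al j)).2); last by rewrite Hc mulr0.
      rewrite mulr_sumr; apply: eq_bigr => j _; rewrite (EQ j) -mul_mpolyC; ring.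
    rewrite -[LHS]subr0 -[X in _ - X = _]Z /ev /p rmorph_sum /= horner_sum mulr_suml -sumrB.
    by apply: eq_bigr => j _; rewrite -!/(ev _) evZ; ring.
  apply: idl_sum => // j _; case: HJ => _ _; apply.
  by have := HNb (al j); rewrite (Hal j).1.
have p0 : p != 0.
  apply: contraNneq c0 => p0; apply/eqP/rowP => j; rewrite mxE.
  have := congr1 (fun q => q.[al j]) p0; rewrite /p horner_sum horner0 (bigD1 j) //=.
  rewrite big1 => [|k kj]; last first.
    rewrite hornerZ /Pj horner_prod (bigD1 j) 1?eq_sym //= hornerXsubC subrr mul0r mulr0 //.
  rewrite addr0 hornerZ => /eqP; rewrite mulf_eq0 => /orP[/eqP //|].
  rewrite /Pj horner_prod prodf_seq_eq0 => /hasP[k _ /andP[kj]].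
  rewrite hornerXsubC subr_eq0 nth_uniq // => /eqP E.
  by move: kj; rewrite (ord_inj E) eqxx.
have [rs Ers] := closed_field_poly_normal p.
have {}Jp : J (ev (\prod_(z <- rs) ('X - z%:P)) * f ^+ N).
  have l0 : lead_coef p != 0 by rewrite lead_coef_eq0.
  apply: (idl1 (a := ((lead_coef p)^-1)%:MP) HJ Jp); rewrite {2}Ers evZ.
  rewrite !mulrA -rmorphM /= mulVf // rmorph1 mul1r //.
(* A factor ['X_i - r] is absorbed by the relation attached to [r] itself, at the price of a higher
   power of [f]. *)
elim: rs N {Ers Hal inf BA BM} Jp => [|r rs IH] N.
  rewrite big_nil /ev rmorph1 hornerC mul1r; exact: HN.
rewrite big_cons evM evX => JN; apply: (IH ((Nb r).1 + N)%N); rewrite exprD.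
apply: (idlc (a := ev (\prod_(z <- rs) ('X - z%:P)) * f ^+ N) (b := (Nb r).2) HJ (HNb r) JN).
ring.
Qed.

(** Adjoining ['X_i - a i] for every variable, while no power of [f] enters, ends in an ideal that
    identifies each polynomial with its value at the point [a]. That point is a zero of [J], so [f]
    vanishes there and lies in the ideal, a contradiction. *)
Theorem nullstellensatz J f : is_ideal J ->
  (forall x, (forall g, J g -> eval_at g x = 0) -> eval_at f x = 0) -> exists N, J (f ^+ N).
Proof.
move=> HJ Hz; apply: contrapT => /forallNP HN.
suff H m : (m <= n)%N -> exists J' : set {mpoly K[n]}, [/\ is_ideal J', J `<=` J',
    forall N, ~ J' (f ^+ N) & exists a : 'I_n -> K, forall i : 'I_n, (i < m)%N -> J' ('X_i - (a i)%:MP)].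
  have [J' [HJ' JJ' HN' [a Ha]]] := H n (leqnn n); pose x : 'rV[K]_n := \row_i a i.
  have Hev g : J' (g - (eval_at g x)%:MP).
    elim/mpoly_ring_ind: g => [c|i|g h Hg Hh|g h Hg Hh]; rewrite evE.
    - by rewrite subrr; case: HJ'.
    - by rewrite mxE; apply: Ha.
    - by rewrite rmorphD /=; apply: (idlc (a := 1) (b := 1) HJ' Hg Hh); ring.
    - rewrite rmorphM /=; apply: (idlc (a := h) (b := (eval_at g x)%:MP) HJ' Hg Hh); ring.
  have H1 c : c != 0 -> ~ J' c%:MP.
    move=> c0 Jc; apply: (HN' 0%N); apply: (idl1 (a := c^-1%:MP) HJ' Jc).
    by rewrite -rmorphM /= mulVf // rmorph1 expr0.
  have fx : eval_at f x = 0.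
    apply: Hz => g /JJ' Jg; apply/eqP/negPn/negP => /H1; apply.
    by apply: (idlc (a := 1) (b := -1) HJ' Jg (Hev g)); ring.
  by apply: (HN' 1%N); have := Hev f; rewrite fx rmorph0 subr0 expr1.
elim: m => [|m IH] mn.
  by exists J; split=> //; exists (fun=> 0) => i; rewrite ltn0.
  have [J' [HJ' JJ' HN' [a Ha]]] := IH (ltnW mn).
  have [b Hb] := null_step (Ordinal mn) HJ' HN'.
  exists (adj J' ('X_(Ordinal mn) - b%:MP)); split=> //; first exact: is_ideal_adj.
    by move=> h /JJ' H; exact: adj_sub.
  exists (fun i : 'I_n => if i == m :> nat then b else a i) => i; rewrite ltnS leq_eqVlt.
  case: eqP => [E _|_ /= im]; last by apply: adj_sub; exact: Ha.
  have -> : i = Ordinal mn by exact: val_inj.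
  exact: adj_in.
Qed.

Lemma eval_inj0 f : (forall x, eval_at f x = 0) -> f = 0.
Proof.
move=> H; have [N] := nullstellensatz is_ideal0 (fun x _ => H x).
by move=> /eqP; rewrite expf_eq0 => /andP[_ /eqP].
Qed.

End Null.
End Ideals.
#[export] Hint Resolve is_ideal_idl : core.

(** * Derivations of the ground field *)

Section Derivations.
Variable K : numClosedFieldType.

Definition is_der (D : K -> K) : Prop :=
  (forall x y, D (x + y) = D x + D y) /\ (forall x y, D (x * y) = D x * y + x * D y).

(** Graph of a derivation defined on a subfield: a set of pairs closed under the operations of the
    dual numbers, the last clause making it single-valued. Domain and map are thus carried by one
    set, to which Zorn's lemma applies directly. *)
Definition dgraph (G : set (K * K)) : Prop :=
  [/\ G (1, 0) /\ G (-1, 0),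
      forall x y, G x -> G y -> G (x.1 + y.1, x.2 + y.2),
      forall x y, G x -> G y -> G (x.1 * y.1, x.2 * y.1 + x.1 * y.2),
      forall x, G x -> G (x.1^-1, - x.2 / x.1 ^+ 2) &
      forall c, G (0, c) -> c = 0].

Section Extension.
Variables (G : set (K * K)) (HG : dgraph G).

Let G1 : G (1, 0). Proof. by case: HG => -[]. Qed.
Let GN1 : G (-1, 0). Proof. by case: HG => -[]. Qed.
Let GD x y x' y' : G (x, x') -> G (y, y') -> G (x + y, x' + y').
Proof. by case: HG => _ H _ _ _ a b; exact: (H _ _ a b). Qed.
Let GM x y x' y' : G (x, x') -> G (y, y') -> G (x * y, x' * y + x * y').
Proof. by case: HG => _ _ H _ _ a b; exact: (H _ _ a b). Qed.
Let GV x x' : G (x, x') -> G (x^-1, - x' / x ^+ 2).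
Proof. by case: HG => _ _ _ H _ a; exact: (H _ a). Qed.
Let G0 c : G (0, c) -> c = 0. Proof. by case: HG => _ _ _ _ H; exact: H. Qed.
Let GN x x' : G (x, x') -> G (- x, - x').
Proof. by move=> /(GM GN1); rewrite mul0r add0r !mulN1r. Qed.
Let Gfun x y z : G (x, y) -> G (x, z) -> y = z.
Proof.
by move=> H1 /GN /(GD H1); rewrite subrr => /G0 /eqP; rewrite subr_eq0 => /eqP.
Qed.

Let L (x : K) : Prop := exists x', G (x, x').
Let D (x : K) : K := xget 0 [set x' | G (x, x')].
Let GDx x : L x -> G (x, D x).
Proof. by move=> Lx; apply: (xgetPex 0 (P := [set x' | G (x, x')]) Lx). Qed.
Let DE x x' : G (x, x') -> D x = x'.
Proof. by move=> Hx; apply: (Gfun (GDx _) Hx); exists x'. Qed.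
Let L0 : L 0. Proof. by have := GD G1 GN1; rewrite subrr addr0; exists 0. Qed.
Let D0 : D 0 = 0. Proof. exact: G0 (GDx L0). Qed.
Let LD x y : L x -> L y -> L (x + y) /\ D (x + y) = D x + D y.
Proof. by move=> /GDx Hx /GDx Hy; have H := GD Hx Hy; split; [exists (D x + D y)|exact: DE]. Qed.
Let LM x y : L x -> L y -> L (x * y) /\ D (x * y) = D x * y + x * D y.
Proof. by move=> /GDx Hx /GDx Hy; have H := GM Hx Hy; split; [exists (D x * y + x * D y)|exact: DE]. Qed.
Let LV x : L x -> L x^-1.
Proof. by move=> /GDx /GV H; exists (- D x / x ^+ 2). Qed.
Let LN x : L x -> L (- x).
Proof. by move=> /GDx /GN H; exists (- D x). Qed.
Let Lsum I (r : seq I) (P : pred I) (F : I -> K) : (forall i, P i -> L (F i)) ->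
  L (\sum_(i <- r | P i) F i) /\ D (\sum_(i <- r | P i) F i) = \sum_(i <- r | P i) D (F i).
Proof.
move=> H; elim: r => [|i r [IH1 IH2]]; first by rewrite !big_nil.
by rewrite !big_cons; case: ifP => // /H Hi; rewrite -IH2; exact: LD.
Qed.

Let LD1 x y (Lx : L x) (Ly : L y) : L (x + y) := (LD Lx Ly).1.
Let LD2 x y (Lx : L x) (Ly : L y) : D (x + y) = D x + D y := (LD Lx Ly).2.
Let LM1 x y (Lx : L x) (Ly : L y) : L (x * y) := (LM Lx Ly).1.
Let LM2 x y (Lx : L x) (Ly : L y) : D (x * y) = D x * y + x * D y := (LM Lx Ly).2.
Let Ls1 I (r : seq I) (P : pred I) (F : I -> K) (H : forall i, P i -> L (F i)) :
  L (\sum_(i <- r | P i) F i) := (Lsum r H).1.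
Let Ls2 I (r : seq I) (P : pred I) (F : I -> K) (H : forall i, P i -> L (F i)) :
  D (\sum_(i <- r | P i) F i) = \sum_(i <- r | P i) D (F i) := (Lsum r H).2.

Let LP (p : {poly K}) : Prop := forall i, L p`_i.
Let LPC c : L c -> LP c%:P. Proof. by move=> Lc i; rewrite coefC; case: eqP. Qed.
Let LPD p q : LP p -> LP q -> LP (p + q).
Proof. by move=> Lp Lq i; rewrite coefD; exact: LD1. Qed.
Let LPM p q : LP p -> LP q -> LP (p * q).
Proof. by move=> Lp Lq i; rewrite coefM; apply: Ls1 => j _; exact: LM1. Qed.
Let LPN p : LP p -> LP (- p). Proof. by move=> Lp i; rewrite coefN; exact: LN. Qed.
Let LPXn k : LP 'X^k.
Proof. by move=> i; rewrite coefXn; case: eqP => _ //; exists 0. Qed.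
Let LPder p : LP p -> LP p^`().
Proof.
move=> Lp i; rewrite coef_deriv -mulr_natr; apply: LM1 => //.
by elim: i.+1 => // k IH; rewrite -natr1; apply: (LD1 IH); exists 0.
Qed.

Let Dp p := map_poly D p.
Let coefDp p i : (Dp p)`_i = D p`_i. Proof. exact: coef_map_id0. Qed.
(** The derivative that [p.[a]] must have if [a] is given the derivative [a']. *)
Let Ev a a' p : K := (Dp p).[a] + p^`().[a] * a'.
Let ED a a' p q : LP p -> LP q -> Ev a a' (p + q) = Ev a a' p + Ev a a' q.
Proof.
move=> Lp Lq; have -> : Ev a a' (p + q) = (Dp p + Dp q).[a] + (p + q)^`().[a] * a'.
  by congr (_.[a] + _); apply/polyP => i; rewrite coefD !coefDp coefD LD2.
by rewrite derivD !hornerD /Ev; ring.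
Qed.
Let EMv a a' p q : LP p -> LP q -> Ev a a' (p * q) = Ev a a' p * q.[a] + p.[a] * Ev a a' q.
Proof.
move=> Lp Lq; have -> : Ev a a' (p * q) = (Dp p * q + p * Dp q).[a] + (p * q)^`().[a] * a'.
  congr (_.[a] + _); apply/polyP => i; rewrite coefD coefDp !coefM.
  rewrite Ls2 => [|j _]; last exact: LM1.
  rewrite -big_split; apply: eq_bigr => j _ /=; rewrite !coefDp LM2 //.
by rewrite derivM !hornerD !hornerM /Ev; ring.
Qed.
Let EC a a' c : Ev a a' c%:P = D c.
Proof.
rewrite /Ev derivC horner0 mul0r addr0 (_ : Dp _ = (D c)%:P) ?hornerC //.
by apply/polyP => i; rewrite coefDp !coefC; case: eqP.
Qed.
Section Adjoin.
Variables (a a' : K).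
Local Notation E := (Ev a a').
Hypothesis E0 : forall p, LP p -> p.[a] = 0 -> E p = 0.

(** The extension to the field generated by [a]: [z.1] is the quotient [p.[a] / q.[a]] and [z.2]
    follows the quotient rule. The hypothesis [E0] makes this independent of [p] and [q]. *)
Definition dadjoin : set (K * K) := [set z | exists p q,
  [/\ LP p, LP q, q.[a] != 0, z.1 * q.[a] = p.[a] & z.2 * q.[a] + z.1 * E q = E p]].

Let L1 : L 1. Proof. by exists 0. Qed.
Let D1 : D 1 = 0. Proof. exact: DE. Qed.

Lemma dadjoin_sub : G `<=` dadjoin.
Proof.
move=> [c c'] Gc; exists c%:P, 1; rewrite -polyC1; split=> /=.
- by apply: LPC; exists c'.
- exact: LPC.
- by rewrite hornerC oner_neq0.
- by rewrite !hornerC mulr1.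
- by rewrite !EC hornerC D1 (DE Gc) mulr1 mulr0 addr0.
Qed.

Lemma dadjoin_in : dadjoin (a, a').
Proof.
have Lx : LP 'X by rewrite -['X]expr1; exact: LPXn.
exists 'X, 1; rewrite -polyC1; split=> //=.
- exact: LPC.
- by rewrite hornerC oner_neq0.
- by rewrite hornerC hornerX mulr1.
- rewrite EC D1 hornerC mulr1 mulr0 addr0 /Ev derivX hornerC mul1r.
  rewrite (_ : Dp _ = 0) ?horner0 ?add0r //; apply/polyP => i.
  by rewrite coefDp coefX coef0; case: eqP.
Qed.

Lemma dadjoin_dgraph : dgraph dadjoin.
Proof.
have F0 c : dadjoin (0, c) -> c = 0.
  case=> p [q [Lp Lq q0 /= E1 E2]]; move: E2; rewrite mul0r addr0 (E0 Lp); last by rewrite -E1 mul0r.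
  by move/eqP; rewrite mulf_eq0 (negbTE q0) orbF => /eqP.
split=> //; first by split; apply: dadjoin_sub.
- move=> [x x'] [y y'] [p1 [q1 [Lp1 Lq1 n1 /= A1 B1]]] [p2 [q2 [Lp2 Lq2 n2 /= A2 B2]]].
  have La := LPM Lp1 Lq2; have Lb := LPM Lp2 Lq1.
  exists (p1 * q2 + p2 * q1), (q1 * q2); split=> /=.
  + exact: LPD.
  + exact: LPM.
  + by rewrite hornerM mulf_neq0.
  + by rewrite hornerD !hornerM -A1 -A2; ring.
  + by rewrite ED // !EMv // hornerM -A1 -A2 -B1 -B2; ring.
- move=> [x x'] [y y'] [p1 [q1 [Lp1 Lq1 n1 /= A1 B1]]] [p2 [q2 [Lp2 Lq2 n2 /= A2 B2]]].
  exists (p1 * p2), (q1 * q2); split=> /=; try exact: LPM.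
  + by rewrite hornerM mulf_neq0.
  + by rewrite !hornerM -A1 -A2; ring.
  + by rewrite !EMv // !hornerM -A1 -A2 -B1 -B2; ring.
- move=> [x x'] H; have [x0|x0] := eqVneq x 0.
    move: H; rewrite /= x0 => /F0 ->; rewrite invr0 expr0n /= invr0 mulr0.
    by apply: dadjoin_sub; have := GDx L0; rewrite D0.
  case: H => p [q [Lp Lq q0 /= A1 B1]]; exists q, p; split=> //=.
  + by rewrite -A1 mulf_neq0.
  + by rewrite -A1 mulKf.
  + by rewrite -A1 -B1; field.
Qed.
End Adjoin.

(** If no nonzero polynomial over the domain kills [a], the derivative of [a] is free and [a0] is
    chosen. If [a] is algebraic, a polynomial of least size that kills it is separable, and its
    equation forces the derivative. *)
Lemma dgraph_extend (a a0 : K) : exists G', [/\ dgraph G', G `<=` G',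
  exists a', G' (a, a') &
  (forall p : {poly K}, (forall i, exists x', G (p`_i, x')) -> p.[a] = 0 -> p = 0) -> G' (a, a0)].
Proof.
have [H|/existsNP[p0 Hp0]] := pselect (forall p, LP p -> p.[a] = 0 -> p = 0).
  have Z p : LP p -> p.[a] = 0 -> (map_poly D p).[a] + p^`().[a] * a0 = 0.
    by move=> Lp /H -> //; rewrite map_poly0 deriv0 horner0 mul0r addr0.
  exists (dadjoin a a0); split; [exact: dadjoin_dgraph|exact: dadjoin_sub| |move=> _].
    by exists a0; exact: dadjoin_in.
  exact: dadjoin_in.
pose Q k := `[< exists p, [/\ LP p, p != 0, p.[a] = 0 & size p = k] >].
have exQ : exists k, Q k.
  have /existsNP[Lp /existsNP[ra /eqP nz]] := Hp0.
  by exists (size p0); apply/asboolP; exists p0.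
case: (ex_minnP exQ) => k /asboolP[p [Lp nz pa sp]] kmin.
have lc0 : lead_coef p != 0 by rewrite lead_coef_eq0.
have d0 : p^`().[a] != 0.
  apply/eqP => da.
  have sp1 : (1 < size p)%N.
    rewrite ltnNge; apply: contraNN nz => /size1_polyC E; move: pa; rewrite E hornerC => ->.
    by rewrite polyC0.
  have dnz : p^`() != 0.
    apply/eqP => d0; have := congr1 (fun q : {poly K} => q`_(size p).-2) d0.
    rewrite coef_deriv coef0 (_ : (size p).-2.+1 = (size p).-1); last by case: (size p) sp1 => [|[|]].
    by move/eqP; rewrite -lead_coefE mulrn_eq0 (negbTE lc0) orbF; case: (size p) sp1 => [|[|]].
  have : (k <= size p^`())%N by apply: kmin; apply/asboolP; exists p^`(); split=> //; exact: LPder.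
  by rewrite leqNgt -sp lt_size_deriv.
(* Solves [Ev a a' p = 0]; by minimality of [p] and characteristic zero, the derivative of [p] does
   not vanish at [a]. *)
pose a' := - (map_poly D p).[a] / p^`().[a].
exists (dadjoin a a').
(* Any other relation is reduced in size by cancelling its leading term with a multiple of [p]. *)
have Z q : LP q -> q.[a] = 0 -> (map_poly D q).[a] + q^`().[a] * a' = 0.
  have Ep : (map_poly D p).[a] + p^`().[a] * a' = 0 by rewrite /a'; field.
  have [s] := ubnP (size q); elim: s q => // s IH q; rewrite ltnS => sq Lq qa.
  have [->|q0] := eqVneq q 0; first by rewrite map_poly0 deriv0 horner0 mul0r addr0.
  have spq : (size p <= size q)%N.
    by rewrite sp; apply: kmin; apply/asboolP; exists q.
  pose c := lead_coef q / lead_coef p; pose m := c%:P * 'X^(size q - size p).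
  have Lm : LP m.
    apply: LPM (LPXn _); apply: LPC; apply: LM1; first exact: Lq.
    by apply: LV; exact: Lp.
  have Lmp := LPM Lm Lp; have LNmp := LPN Lmp.
  have Lr : LP (q - m * p) by exact: LPD.
  have mp0 : (m * p).[a] = 0 by rewrite hornerM pa mulr0.
  have Er : (map_poly D (q - m * p)).[a] + (q - m * p)^`().[a] * a' = 0.
    apply: IH => //; last by rewrite hornerD hornerN mp0 qa subr0.
    apply: leq_trans sq; have sm : size (m * p) = size q.
      rewrite /m mulrAC size_mulXn ?mul_polyC ?scaler_eq0 ?negb_or ?nz ?andbT; last first.
        by rewrite mulf_neq0 ?invr_eq0 // lead_coef_eq0.
      by rewrite size_scale ?subnK // mulf_neq0 ?invr_eq0 // lead_coef_eq0.
    have lm : lead_coef (m * p) = lead_coef q.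
      by rewrite /m !lead_coefM lead_coefC lead_coefXn mulr1 divfK.
    have ltq : (0 < size q)%N by rewrite size_poly_gt0.
    rewrite -(ltn_predK ltq) ltnS; apply/leq_sizeP => j; rewrite leq_eqVlt => /orP[/eqP <-|jq].
      by rewrite coefB -lead_coefE -sm -lead_coefE lm subrr.
    rewrite coefB !nth_default ?subrr // ?sm -(ltn_predK ltq) //.
  have := EMv a a' Lm Lp; rewrite {3}/Ev Ep pa !mulr0 addr0 => Emp.
  by have := ED a a' Lr Lmp; rewrite subrK Emp addr0 /Ev => ->.
split; [exact: dadjoin_dgraph|exact: dadjoin_sub|by exists a'; exact: dadjoin_in|].
by move=> H; have /existsNP[Lp0 /existsNP[ra []]] := Hp0; exact: H.
Qed.
End Extension.

Lemma dgraph_total (G0 : set (K * K)) : dgraph G0 ->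
  exists D, is_der D /\ forall x x', G0 (x, x') -> D x = x'.
Proof.
move=> HG0; pose P (A : set (K * K)) := A = set0 \/ (dgraph A /\ G0 `<=` A).
have [|A [[A0|[dA GA]] Amax]] := @Zorn_bigcup _ P.
- move=> F FP Ftot; have [[X [FX X0]]|none] := pselect (exists X, F X /\ X !=set0); last first.
    left; apply/seteqP; split=> // z [X FX Xz]; apply: none; exists X; split=> //.
    by exists z.
  have Fd Y : F Y -> Y !=set0 -> dgraph Y /\ G0 `<=` Y.
    by move=> /FP [->|//] [z []].
  have [dX G0X] := Fd X FX X0.
  have two Y Z y z : F Y -> F Z -> Y y -> Z z -> exists W, [/\ F W, W y & W z].
    by move=> FY FZ Yy Zz; case: (Ftot _ _ FY FZ) => H; [exists Z|exists Y]; split=> //; exact: H.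
  right; split; last by move=> z /G0X Xz; exists X.
  split.
  + by case: dX => -[a b] _ _ _ _; split; exists X.
  + move=> x y [Y FY Yx] [Z FZ Zy]; have [W [FW Wx Wy]] := two _ _ _ _ FY FZ Yx Zy; exists W => //.
    by have [[_ H _ _ _] _] := Fd W FW (ex_intro _ x Wx); exact: H.
  + move=> x y [Y FY Yx] [Z FZ Zy]; have [W [FW Wx Wy]] := two _ _ _ _ FY FZ Yx Zy; exists W => //.
    by have [[_ _ H _ _] _] := Fd W FW (ex_intro _ x Wx); exact: H.
  + move=> x [W FW Wx].
    by exists W => //; have [[_ _ _ H _] _] := Fd W FW (ex_intro _ x Wx); exact: H.
  + by move=> c [W FW Wx]; have [[_ _ _ _ H] _] := Fd W FW (ex_intro _ _ Wx); exact: H.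
- exfalso; apply: (Amax G0); last by right; split.
  by rewrite A0; split=> [z []|H]; have [[G1 _] _ _ _ _] := HG0; exact: (H _ G1).
have tot x : exists x', A (x, x').
  have [B [dB AB [x' Bx] _]] := dgraph_extend dA x 0; exists x'; apply: contrapT => nA.
  apply: (Amax B); last by right; split=> // z /GA /AB.
  by split=> // BA; apply: nA; exact: BA.
pose D x := sval (cid (tot x)); have AD x : A (x, D x) by rewrite /D; case: (cid _).
have [[A1 AN1] addA mulA _ zA] := dA.
have Afun x y z : A (x, y) -> A (x, z) -> y = z.
  move=> H1 /(mulA _ _ AN1) /= /(addA _ _ H1) /=; rewrite mul0r add0r !mulN1r subrr => /zA.
  by move/eqP; rewrite subr_eq0 => /eqP.
exists D; split; last by move=> x x' /GA; exact: Afun (AD x).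
split=> x y; apply: (Afun _ _ _ (AD _)); first exact: (addA _ _ (AD x) (AD y)).
exact: (mulA _ _ (AD x) (AD y)).
Qed.

Section Countable.
Variable C : seq K.

(** Labels from 5 on choose a root, by its rank, of the polynomial whose coefficients are the
    arguments. *)
Definition interp_op (k : nat) (s : seq K) : K :=
  match k with
  | 0 => s`_0 + s`_1
  | 1 => s`_0 * s`_1
  | 2 => (s`_0)^-1
  | 3 => -1
  | 4 => 1
  | k'.+4.+1 => (sval (closed_field_poly_normal (Poly s)))`_k'
  end.

(** Trees denote the elements of the algebraic closure in [K] of the field
    generated by [C]; that closure is therefore countable. *)
Fixpoint interp (t : GenTree.tree nat) : K :=
  match t with
  | GenTree.Leaf i => C`_i
  | GenTree.Node k s => interp_op k (map interp s)
  end.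

Lemma interp_root (p : {poly K}) (a : K) : p != 0 -> p.[a] = 0 ->
  (forall i, exists t, interp t = p`_i) -> exists t, interp t = a.
Proof.
move=> p0 pa H; have /choice[e He] := H.
pose s := mkseq e (size p).
have Es : Poly (map interp s) = p.
  rewrite -[RHS]polyseqK; congr Poly; apply: (@eq_from_nth _ 0); rewrite !size_map size_iota //.
  by move=> i ip; rewrite -map_comp (nth_map 0%N) ?size_iota // nth_iota //= He.
pose rs := sval (closed_field_poly_normal (Poly (map interp s))).
have Ers : Poly (map interp s) = lead_coef (Poly (map interp s)) *: \prod_(z <- rs) ('X - z%:P).
  by rewrite /rs; case: (closed_field_poly_normal _).
have ars : a \in rs.
  rewrite -root_prod_XsubC /root.
  have := congr1 (fun q => q.[a]) Ers; rewrite hornerZ Es pa => /esym /eqP.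
  by rewrite mulf_eq0 lead_coef_eq0 (negbTE p0).
exists (GenTree.Node (index a rs).+4.+1 s) => /=.
by rewrite -/rs nth_index.
Qed.

End Countable.

Hypothesis unc : ~ countable [set: K].

(** An element [t] outside the countable algebraic closure of the field of [C] is transcendental
    over it, so the zero derivation of that closure extends with value 1 at [t], and then to all of
    [K]. *)
Theorem der_exists (C : seq K) : exists D (t : K),
  [/\ is_der D, forall c, c \in C -> D c = 0 & D t = 1].
Proof.
pose L := range (interp C).
have cL : countable L by apply: sub_countable (card_image_le _ _) _; exact: countableP.
have [t Lt] : exists t, ~ L t.
  by apply/existsNP => H; apply: unc; rewrite (_ : [set: K] = L) //; apply/seteqP; split.
have LG : dgraph [set z | L z.1 /\ z.2 = 0].
  split=> /=.
  - by split; split=> //; [exists (GenTree.Node 4 [::])|exists (GenTree.Node 3 [::])].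
  - move=> [x x'] [y y'] /= [[u _ <-] ->] [[v _ <-] ->]; rewrite addr0; split=> //.
    by exists (GenTree.Node 0 [:: u; v]).
  - move=> [x x'] [y y'] /= [[u _ <-] ->] [[v _ <-] ->]; rewrite mul0r mulr0 addr0; split=> //.
    by exists (GenTree.Node 1 [:: u; v]).
  - move=> [x x'] /= [[u _ <-] ->]; rewrite oppr0 mul0r; split=> //.
    by exists (GenTree.Node 2 [:: u]).
  - by move=> c [].
have [G' [dG' sG' _ Gt]] := dgraph_extend LG t 1.
have [D [derD HD]] := dgraph_total dG'.
exists D, t; split=> //.
  move=> c /(nthP 0)[i ic <-]; apply: HD; apply: sG'; split=> //=.
  by exists (GenTree.Leaf i).
apply: HD; apply: Gt => p Lp pt; apply: contrapT => /eqP p0; apply: Lt.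
have [|u <-] := interp_root (C := C) p0 pt; last by exists u.
by move=> i; have [x' [[u _ Eu] _]] := Lp i; exists u; exact: Eu.
Qed.

End Derivations.

Section DerEval.
Variable K : numClosedFieldType.
Variable D : K -> K.
Hypothesis derD : is_der D.

Lemma der0 : D 0 = 0.
Proof. by have E := derD.1 0 0; rewrite addr0 in E; apply: (addrI (D 0)); rewrite addr0 -E. Qed.
Lemma der1 : D 1 = 0.
Proof. by have E := derD.2 1 1; rewrite !mulr1 mul1r in E; apply: (addrI (D 1)); rewrite addr0 -E. Qed.
Lemma der_sum I (r : seq I) (P : pred I) (F : I -> K) :
  D (\sum_(i <- r | P i) F i) = \sum_(i <- r | P i) D (F i).
Proof. exact: (big_morph D derD.1 der0). Qed.

Variable n : nat.
Implicit Types (f : {mpoly K[n.+1]}) (x : 'rV[K]_n.+1).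

Lemma der_eval f x : (forall m, D f@_m = 0) -> D (eval_at f x) = differential f x (map_mx D x).
Proof.
move=> Hf; pose Q g := D (eval_at g x) = differential g x (map_mx D x).
have QM g h : Q g -> Q h -> Q (g * h).
  by rewrite /Q !evE derD.2 !dfE => -> ->; ring.
have QX k : Q 'X_[k].
  rewrite mpolyXE_id; elim/big_rec: _ => [|i g _ Qg]; first by rewrite /Q evE der1 df1.
  apply: (QM) => //; elim: (k i) => [|j IHj]; first by rewrite expr0 /Q evE der1 df1.
  by rewrite exprS; apply: (QM) => //; rewrite /Q evE dfU mxE.
rewrite [f]mpolyE eval_at_sum der_sum df_sum; apply: eq_bigr => k _.
by rewrite evE derD.2 Hf mul0r add0r QX dfZ.
Qed.

(** Differentiates the equation of a member whose parameters move while the family is constant. At a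
    zero of the member the two terms are opposite, which is the relation behind Bertini. *)
Lemma der_eval_comb r (t : seq K) (Q : nat -> {mpoly K[n.+1]}) x :
  (forall i m, (i < r)%N -> D (Q i)@_m = 0) ->
  D (eval_at (\sum_(i < r) t`_i *: Q i) x) =
    \sum_(i < r) D t`_i * eval_at (Q i) x +
    differential (\sum_(i < r) t`_i *: Q i) x (map_mx D x).
Proof.
move=> H; rewrite eval_at_sum der_sum df_sum -big_split; apply: eq_bigr => i _ /=.
by rewrite evE derD.2 der_eval ?dfZ // => m; exact: H.
Qed.
End DerEval.

Section Generic.
Variable K : numClosedFieldType.
Hypothesis unc : ~ countable [set: K].

(** Parameters are added one at a time, each with a derivation that kills [C] and its predecessors
    and sends it to 1. The conclusion is phrased as it is used: a linear relation on the [D t_i]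
    that holds for every such [D] has zero coefficients. *)
Lemma generic_params r (C : seq K) : exists2 t : seq K, size t = r &
  forall Q : nat -> K, (forall D, is_der D -> (forall c, c \in C -> D c = 0) ->
     \sum_(i < r) D t`_i * Q i = 0) -> forall i, (i < r)%N -> Q i = 0.
Proof.
elim: r => [|r [t st Ht]]; first by exists [::].
have [D [u [derD HD Du]]] := der_exists unc (C ++ t).
exists (rcons t u) => [|Q HQ]; first by rewrite size_rcons st.
have Qr : Q r = 0.
  have HDC c : c \in C -> D c = 0 by move=> cC; apply: HD; rewrite mem_cat cC.
  have := HQ D derD HDC; rewrite big_ord_recr /= nth_rcons st ltnn eqxx Du mul1r.
  rewrite big1 ?add0r => [-> //|i _].
  by rewrite nth_rcons st ltn_ord HD ?mul0r // mem_cat mem_nth ?orbT ?st.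
move=> i; rewrite ltnS leq_eqVlt => /orP[/eqP -> //|]; apply: Ht => D' derD' HD'.
have := HQ D' derD' HD'; rewrite big_ord_recr /= Qr mulr0 addr0 => E0; rewrite -[RHS]E0.
by apply: eq_bigr => j _; rewrite nth_rcons st ltn_ord.
Qed.

End Generic.

(** * Local equations *)

Section Cramer.
Variable K : numClosedFieldType.
Hypothesis unc : ~ countable [set: K].

Lemma mmap_id n (f : {mpoly K[n]}) : mmap (@mpolyC n K) (fun i => 'X_i) f = f.
Proof.
rewrite -[RHS]comp_mpoly_id /comp_mpoly; apply: eq_bigr => m _; congr (_ * _).
by apply: mmap1_eq => i; rewrite tnth_mktuple.
Qed.

Lemma eval_mmap n m (f : {mpoly K[n]}) (a : 'I_n -> {mpoly K[m]}) (y : 'rV[K]_m) :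
  eval_at (mmap (@mpolyC m K) a f) y = eval_at f (\row_i eval_at (a i) y).
Proof.
elim/mpoly_ring_ind: f => [c|i|f g Hf Hg|f g Hf Hg].
- by rewrite mmapC !evE.
- by rewrite mmapX mmap1U evE mxE.
- by rewrite mmapD !evE Hf Hg.
- by rewrite rmorphM /= !evE Hf Hg.
Qed.

Definition lin n (a : 'rV[K]_n) : {mpoly K[n]} := \sum_i a 0 i *: 'X_i.

Lemma eval_lin n (a x : 'rV[K]_n) : eval_at (lin a) x = \sum_i a 0 i * x 0 i.
Proof. by rewrite eval_at_sum; apply: eq_bigr => i _; rewrite !evE. Qed.

Lemma df_lin n (a x v : 'rV[K]_n.+1) : differential (lin a) x v = eval_at (lin a) v.
Proof. by rewrite df_sum eval_lin; apply: eq_bigr => i _; rewrite !dfE. Qed.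

Lemma lin_homog n (a : 'rV[K]_n) : lin a \is 1.-homog.
Proof. by apply: rpred_sum => i _; apply: rpredZ; rewrite dhomogX; apply/eqP; exact: mdeg1. Qed.

Lemma linZ n c (a : 'rV[K]_n) : lin (c *: a) = c *: lin a.
Proof. by rewrite scaler_sumr; apply: eq_bigr => i _; rewrite mxE scalerA. Qed.
Lemma linD n (a b : 'rV[K]_n) : lin (a + b) = lin a + lin b.
Proof. by rewrite -big_split; apply: eq_bigr => i _; rewrite mxE scalerDl. Qed.

(** The forms on the right are the coordinates of [y - y A]. Since [f] vanishes after substituting
    [y A], its Taylor difference with that substitution is [f] itself. Used with [A] a projection
    onto a line or a plane. *)
Lemma proj_ideal n (A : 'M[K]_n) (f : {mpoly K[n]}) : (forall y, eval_at f (y *m A) = 0) ->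
  exists c : 'I_n -> {mpoly K[n]}, f = \sum_j c j * lin (\row_i ((i == j)%:R - A i j)).
Proof.
move=> H; have [c Hc] := taylor0 (@mpolyC n K) f (fun i => 'X_i) (fun j => lin (\row_i A i j)).
exists c; have Z : mmap (@mpolyC n K) (fun j => lin (\row_i A i j)) f = 0.
  apply: (eval_inj0 unc) => y; rewrite eval_mmap -[RHS](H y); congr eval_at.
  apply/rowP => j; rewrite !mxE eval_lin; apply: eq_bigr => i _; rewrite !mxE mulrC //.
rewrite -[LHS]mmap_id -[LHS]subr0 -[X in _ - X = _]Z Hc; apply: eq_bigr => j _; congr (_ * _).
rewrite /lin (bigD1 j) //= [in RHS](bigD1 j) //= !mxE eqxx scalerBl scale1r opprD addrA.
congr (_ + _); rewrite -sumrN; apply: eq_bigr => i /negbTE ij; rewrite !mxE ij sub0r scaleNr //.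
Qed.

Definition on_line n (f : {mpoly K[n]}) (x : 'rV[K]_n) : Prop := forall a, eval_at f (a *: x) = 0.

Lemma homog_on_line n (f : {mpoly K[n]}) m x : f \is m.-homog -> eval_at f x = 0 -> on_line f x.
Proof. by move=> hf fx a; rewrite (eval_scale _ _ hf) fx mulr0. Qed.

Lemma line_ideal n (x : 'rV[K]_n.+1) i0 (f : {mpoly K[n.+1]}) : x 0 i0 != 0 -> on_line f x ->
  exists c : 'I_n -> {mpoly K[n.+1]},
    f = \sum_j c j * (x 0 i0 *: 'X_(lift i0 j) - x 0 (lift i0 j) *: 'X_i0).
Proof.
(* The projection onto the line of [x] whose kernel is the hyperplane where coordinate [i0]
   vanishes. *)
move=> x0 fx; pose A : 'M[K]_n.+1 := \matrix_(i, j) ((i == i0)%:R * (x 0 j / x 0 i0)).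
have yA (y : 'rV[K]_n.+1) : y *m A = (y 0 i0 / x 0 i0) *: x.
  apply/rowP => j; rewrite !mxE (bigD1 i0) //= mxE eqxx mul1r big1 ?addr0 => [|i /negbTE ii].
    by rewrite mulrA mulrAC.
  by rewrite mxE ii mul0r mulr0.
have [|c Hc] := @proj_ideal _ A f; first by move=> y; rewrite yA.
exists (fun j => (x 0 i0)^-1 *: c (lift i0 j)); rewrite {1}Hc (bigD1_ord i0) //=.
have Ej j : lin (\row_i ((i == j)%:R - A i j)) = 'X_j - (x 0 j / x 0 i0) *: 'X_i0.
  transitivity (\sum_i ((i == j)%:R *: 'X_i - ((i == i0)%:R * (x 0 j / x 0 i0)) *: 'X_i) : {mpoly K[n.+1]}).
    by apply: eq_bigr => i _; rewrite !mxE scalerBl.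
  rewrite sumrB (bigD1 j) //= eqxx scale1r big1 ?addr0 => [|i /negbTE ->]; last by rewrite scale0r.
  rewrite (bigD1 i0) //= eqxx mul1r big1 ?addr0 => [|i /negbTE ->] //; by rewrite mul0r scale0r.
rewrite Ej divff // scale1r subrr mulr0 add0r; apply: eq_bigr => j _.
rewrite Ej -scalerAl scalerAr scalerBr !scalerA mulVf // scale1r.
by rewrite [_^-1 * _]mulrC.
Qed.

(** Local form of the implicit function theorem: near [x] the ideal of the line
    spanned by [x] is generated by any [n] polynomials of that ideal whose
    differentials at [x] cut out this line. *)
Lemma cramer n (x : 'rV[K]_n.+1) (g : 'I_n -> {mpoly K[n.+1]}) (f : {mpoly K[n.+1]}) :
  x != 0 -> (forall i, on_line (g i) x) ->
  (forall v, (forall i, differential (g i) x v = 0) -> (v <= x)%MS) ->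
  on_line f x ->
  exists s c, eval_at s x != 0 /\ s * f = \sum_i c i * g i.
Proof.
move=> /rV0Pn[i0 x0] gx ker fx.
pose la j : {mpoly K[n.+1]} := x 0 i0 *: 'X_(lift i0 j) - x 0 (lift i0 j) *: 'X_i0.
have lax j : eval_at (la j) x = 0 by rewrite !evE mulrC subrr.
have [a Ha] : exists a : 'I_n -> 'I_n -> {mpoly K[n.+1]}, forall i, g i = \sum_j a i j * la j.
  by have /choice[a Ha] := fun i => line_ideal x0 (gx i); exists a.
have [b Hb] := line_ideal x0 fx.
(* The [g i] are [A] times the linear forms [la j] that define the line. The condition on
   differentials makes [A] invertible at [x], and the adjugate puts each [la j], multiplied by the
   determinant, in the ideal of the [g i]. *)
pose A : 'M[{mpoly K[n.+1]}]_n := \matrix_(i, j) a i j.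
have dA : eval_at (\det A) x != 0.
  pose ev : {rmorphism {mpoly K[n.+1]} -> K} := meval (fun i => x 0 i).
  rewrite -[eval_at _ x]/(ev (\det A)) -det_map_mx -det_tr; apply/det0P => -[c cn0 Hc].
  pose w : 'rV[K]_n.+1 := \row_k oapp (fun j => c 0 j / x 0 i0) 0 (unlift i0 k).
  have wi0 : w 0 i0 = 0 by rewrite mxE unlift_none.
  have wj j : w 0 (lift i0 j) = c 0 j / x 0 i0 by rewrite mxE liftK.
  have wx : (w <= x)%MS.
    apply: ker => i; rewrite Ha df_sum.
    transitivity ((c *m (map_mx ev A)^T) 0 i); last by rewrite Hc mxE.
    rewrite mxE; apply: eq_bigr => j _; rewrite dfM lax mulr0 add0r !mxE !dfE wi0 wj.
    by rewrite mulr0 subr0 [x 0 i0 * _]mulrC divfK // mulrC.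
  have /sub_rVP[k wk] := wx.
  have k0 : k = 0.
    by move: wi0; rewrite wk mxE => /eqP; rewrite mulf_eq0 (negbTE x0) orbF => /eqP.
  case/eqP: cn0; apply/rowP => j; have := wj j; rewrite wk k0 scale0r !mxE => /eqP.
  by rewrite eq_sym mulf_eq0 invr_eq0 (negbTE x0) orbF => /eqP.
exists (\det A), (fun i => \sum_j b j * (\adj A) j i); split=> //.
have Hla j : \det A * la j = \sum_i (\adj A) j i * g i.
  have /matrixP E := mul_adj_mx A.
  transitivity (\sum_k (\adj A *m A) j k * la k).
    rewrite (bigD1 j) //= E mxE eqxx big1 ?addr0 // => k kj.
    by rewrite E mxE eq_sym (negbTE kj) mul0r.
  transitivity (\sum_k \sum_i (\adj A) j i * a i k * la k).
    by apply: eq_bigr => k _; rewrite mxE mulr_suml; apply: eq_bigr => i _; rewrite [A i k]mxE.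
  rewrite exchange_big; apply: eq_bigr => i _; rewrite Ha mulr_sumr.
  by apply: eq_bigr => k _; rewrite mulrA.
rewrite Hb mulr_sumr; under eq_bigr => j _ do rewrite mulrCA Hla mulr_sumr.
rewrite exchange_big; apply: eq_bigr => i _; rewrite mulr_suml.
by apply: eq_bigr => j _; rewrite mulrA.
Qed.

Lemma pihomogMr n m d (s f : {mpoly K[n]}) : f \is m.-homog ->
  pihomog mdeg (d + m) (s * f) = pihomog mdeg d s * f.
Proof.
move=> hf; elim/mpolyind: s => [|c k p _ _ IH]; first by rewrite mul0r !pihomog0 mul0r.
rewrite mulrDl !pihomogD IH mulrDl; congr (_ + _).
rewrite -scalerAl !linearZ /= -scalerAl; congr (_ *: _); rewrite pihomogX.
have hk : 'X_[k] * f \is (mdeg k + m).-homog.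
  by apply: dhomogM => //; rewrite dhomogX.
case: eqP => [<-|/eqP ne]; first by rewrite pihomog_dE.
by rewrite mul0r (pihomog_ne0 _ hk) // eqn_add2r.
Qed.

Lemma pihomogMr0 n m d (s f : {mpoly K[n]}) : f \is m.-homog -> (d < m)%N ->
  pihomog mdeg d (s * f) = 0.
Proof.
move=> hf dm; elim/mpolyind: s => [|c k p _ _ IH]; first by rewrite mul0r pihomog0.
rewrite mulrDl pihomogD IH addr0 -scalerAl linearZ /=.
have hk : 'X_[k] * f \is (mdeg k + m).-homog by apply: dhomogM => //; rewrite dhomogX.
rewrite (pihomog_ne0 _ hk) ?scaler0 //.
by rewrite neq_ltn (leq_trans dm) ?orbT ?leq_addl.
Qed.

Lemma eval_comp_neq0 n (s : {mpoly K[n]}) x : eval_at s x != 0 ->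
  exists e, eval_at (pihomog mdeg e s) x != 0.
Proof.
apply: contraNP => /forallNP H.
have -> : eval_at s x = \sum_(d < msize s) eval_at (pihomog mdeg d s) x.
  by rewrite -eval_at_sum -pihomog_partitionE.
rewrite big1 //.
by move=> i _; apply/eqP/negPn/negP; exact: H.
Qed.

(** Some homogeneous component of [s] survives at [x], and the corresponding component of the
    relation is again a relation. Local statements thereby get forms as denominators, with known
    degrees. *)
Lemma homog_relation n r (x : 'rV[K]_n) (f s : {mpoly K[n]}) (m : nat) (e : 'I_r -> nat)
    (g c : 'I_r -> {mpoly K[n]}) :
  f \is m.-homog -> (forall i, g i \is (e i).-homog) ->
  eval_at s x != 0 -> s * f = \sum_i c i * g i ->
  exists d s' c', [/\ s' \is d.-homog, eval_at s' x != 0,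
    forall i, c' i \is (d + m - e i).-homog & s' * f = \sum_i c' i * g i].
Proof.
move=> hf hg sx E; have [d nd] := eval_comp_neq0 sx.
exists d, (pihomog mdeg d s),
  (fun i => if (e i <= d + m)%N then pihomog mdeg (d + m - e i) (c i) else 0).
split=> //; first exact: pihomogP.
  by move=> i; case: ifP => _; [exact: pihomogP|exact: dhomog0].
rewrite -(pihomogMr _ _ hf) E linear_sum /=; apply: eq_bigr => i _; case: leqP => ei.
  by rewrite -{1}(subnK ei) (pihomogMr _ _ (hg i)).
by rewrite mul0r (pihomogMr0 _ (hg i)).
Qed.
End Cramer.

(** * Complete intersections in projective space *)

Section Regular.
Variable K : numClosedFieldType.
Hypothesis unc : ~ countable [set: K].
Local Notation P := {mpoly K[4]}.
Local Notation P2 := {mpoly K[2]}.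
Local Notation P3 := {mpoly K[3]}.
Implicit Types (f g h : P).

Local Notation j0 := (inord 0 : 'I_4).
Local Notation j1 := (inord 1 : 'I_4).
Local Notation j2 := (inord 2 : 'I_4).
Local Notation j3 := (inord 3 : 'I_4).

Lemma idl_pihomog n (s : seq {mpoly K[n]}) (f : {mpoly K[n]}) e :
  (forall g : {mpoly K[n]}, g \in s -> exists m, g \is m.-homog) ->
  idl s f -> idl s (pihomog mdeg e f).
Proof.
elim: s f => [f _ ->|g s IH f H [a Ha]]; first by rewrite pihomog0.
have [m hg] := H g (mem_head _ _).
have {IH}Hs := IH _ (fun (h : {mpoly K[n]}) hs => H h (mem_behead (s := g :: s) hs)) Ha.
have [em|em] := leqP m e; last first.
  by apply: adj_sub; move: Hs; rewrite linearB /= (pihomogMr0 _ hg em) subr0.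
exists (pihomog mdeg (e - m) a).
by move: Hs; rewrite linearB /= -{2}(subnK em) (pihomogMr _ _ hg).
Qed.

Lemma ord4_sum (V : nmodType) (F : 'I_4 -> V) : \sum_i F i = F j0 + F j1 + F j2 + F j3.
Proof.
rewrite !big_ord_recl big_ord0 addr0 !addrA.
by congr (F _ + F _ + F _ + F _); apply: val_inj; rewrite /= inordK.
Qed.

Lemma ord4_prod (V : comNzRingType) (F : 'I_4 -> V) : \prod_i F i = F j0 * F j1 * F j2 * F j3.
Proof.
rewrite !big_ord_recl big_ord0 mulr1 !mulrA.
by congr (F _ * F _ * F _ * F _); apply: val_inj; rewrite /= inordK.
Qed.

Lemma ord3_prod (V : comNzRingType) (F : 'I_3 -> V) :
  \prod_i F i = F (inord 0) * F (inord 1) * F (inord 2).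
Proof.
rewrite !big_ord_recl big_ord0 mulr1 !mulrA.
by congr (F _ * F _ * F _); apply: val_inj; rewrite /= inordK.
Qed.

(** Reduction modulo the first [j] variables, kept as an endomorphism so that [j = 0, 1, 2] are
    treated by one argument. *)
Definition cut (j : nat) : {rmorphism P -> P} :=
  mmap (@mpolyC 4 K) (fun i : 'I_4 => if (i < j)%N then 0 else 'X_i).

Lemma cutX j i : cut j 'X_i = if (i < j)%N then 0 else 'X_i.
Proof. by rewrite /cut /= mmapX mmap1U. Qed.

Lemma cut_id j f : cut j (cut j f) = cut j f.
Proof.
rewrite /cut /=; elim/mpoly_ring_ind: f => [c|i|f g Hf Hg|f g Hf Hg].
- by rewrite !mmapC.
- by rewrite mmapX mmap1U; case: ifP => H; rewrite ?mmap0 // mmapX mmap1U H.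
- by rewrite !mmapD Hf Hg.
- by rewrite !rmorphM /= Hf Hg.
Qed.

Lemma eval_cut j f y : eval_at (cut j f) y = eval_at f (\row_i if (i < j)%N then 0 else y 0 i).
Proof.
rewrite /cut /= eval_mmap; congr eval_at; apply/rowP => i; rewrite !mxE.
by case: ifP; rewrite !evE.
Qed.

Lemma cut1P f : exists h, f = cut 1 f + 'X_j0 * h.
Proof.
have [c] := taylor0 (@mpolyC 4 K) f (fun i => 'X_i) (fun i : 'I_4 => if (i < 1)%N then 0 else 'X_i).
rewrite mmap_id => /eqP; rewrite subr_eq => /eqP E; exists (c j0); rewrite {1}E addrC.
rewrite ord4_sum /cut /= !inordK // !subrr !mulr0 !addr0 subr0; congr (_ + _); exact: mulrC.
Qed.

Lemma cut2P f : exists h h', f = cut 2 f + 'X_j0 * h + 'X_j1 * h'.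
Proof.
have [c] := taylor0 (@mpolyC 4 K) f (fun i => 'X_i) (fun i : 'I_4 => if (i < 2)%N then 0 else 'X_i).
rewrite mmap_id => /eqP; rewrite subr_eq => /eqP E; exists (c j0), (c j1); rewrite {1}E.
rewrite ord4_sum /cut /= !inordK // !subrr !mulr0 !addr0 !subr0; ring.
Qed.

Definition toPoly : {rmorphism P -> {poly P3}} :=
  mmap (polyC \o @mpolyC 3 K)
    (fun i : 'I_4 => if (i < 3)%N then ('X_(inord i))%:P else 'X).
Definition widen3 : {rmorphism P3 -> P} :=
  mmap (@mpolyC 4 K) (fun i : 'I_3 => 'X_(inord i)).
Definition ofPoly (q : {poly P3}) : P := (map_poly widen3 q).['X_j3].

Lemma ofPolyK f : ofPoly (toPoly f) = f.
Proof.
have M p q : ofPoly (p * q) = ofPoly p * ofPoly q by rewrite /ofPoly rmorphM hornerM.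
have D p q : ofPoly (p + q) = ofPoly p + ofPoly q by rewrite /ofPoly rmorphD hornerD.
elim/mpoly_ring_ind: f => [c|i|f g Hf Hg|f g Hf Hg].
- by rewrite /toPoly /= mmapC /ofPoly map_polyC hornerC /widen3 /= mmapC.
- rewrite /toPoly /= mmapX mmap1U /ofPoly; case: ifP => i3.
    rewrite map_polyC hornerC /widen3 /= mmapX mmap1U inordK //.
    by congr 'X_ _; apply: val_inj; rewrite /= inordK.
  rewrite map_polyX hornerX; congr 'X_ _; apply: val_inj; rewrite /= inordK //.
  by case: i i3 => [[|[|[|[|]]]]].
- exact: (etrans (congr1 ofPoly (rmorphD toPoly f g)) (etrans (D _ _) (congr2 +%R Hf Hg))).
- exact: (etrans (congr1 ofPoly (rmorphM toPoly f g)) (etrans (M _ _) (congr2 *%R Hf Hg))).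
Qed.

Definition e3 : 'rV[K]_4 := delta_mx 0 j3.

(** In a form of degree [d] only the pure power of the last variable reaches exponent [d]; hence a
    form that does not vanish at [e3] is monic in that variable up to a constant. *)
Lemma toPoly_homog f d : f \is d.-homog ->
  (size (toPoly f) <= d.+1)%N /\ (toPoly f)`_d = (eval_at f e3)%:MP.
Proof.
move=> hf; have E : toPoly f = \sum_(m <- msupp f)
    ((f@_m)%:MP * \prod_(i < 3) 'X_i ^+ m (inord i : 'I_4))%:P * 'X^(m j3).
  rewrite /toPoly /=; apply: eq_bigr => m _ /=; rewrite polyCM -mulrA; congr (_ * _).
  by rewrite /mmap1 ord4_prod ord3_prod !inordK // !rmorphM !rmorphXn /=.
have dm m : m \in msupp f -> mdeg m = d by exact: (dhomog_mf hf).
have m3 m : m \in msupp f -> (m j3 <= d)%N.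
  by move=> /dm <-; rewrite mdegE ord4_sum leq_addl.
split.
  rewrite E; apply: (leq_trans (size_sum _ _ _)); apply/bigmax_leqP_seq => m mf _.
  by rewrite mul_polyC (leq_trans (size_scale_leq _ _)) // size_polyXn ltnS m3.
rewrite E coef_sum /eval_at mevalE rmorph_sum /= big_seq [RHS]big_seq; apply: eq_bigr => m mf.
rewrite mul_polyC coefZ coefXn ord4_prod !mxE !eqxx /= expr1n mulr1.
rewrite -!val_eqE /= !inordK //= !expr0n.
have := dm m mf; rewrite mdegE ord4_sum => dE.
rewrite ord3_prod !inordK //.
have [dm3|dm3] := eqVneq d (m j3); last first.
  have : (0 < m j0 + m j1 + m j2)%N by move/eqP: dm3 dE; lia.
  rewrite mulr0; case: (m j0) => [|?] /=; last by rewrite !(mul0r, mulr0).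
  case: (m j1) => [|?] /=; last by rewrite !(mul0r, mulr0).
  by case: (m j2) => [|?] //= _; rewrite !(mul0r, mulr0).
have : (m j0 + m j1 + m j2 == 0)%N by apply/eqP; move: dm3 dE; lia.
rewrite !addn_eq0 => /andP[/andP[/eqP z0 /eqP z1] /eqP z2].
by rewrite z0 z1 z2 !expr0 !mulr1.
Qed.

(** From [rho = al F + be G] the syzygy gives [rho b = (al b - be a) F]. As [rho] is free of the
    last variable and [F] is monic in it up to a unit, comparing degrees shows that [F] divides
    [b]. *)
Lemma monic_division (F G rho : P) (r3 : P3) d a b al be : (0 < d)%N ->
  F \is d.-homog -> eval_at F e3 != 0 -> rho = widen3 r3 -> toPoly rho = r3%:P -> rho != 0 ->
  rho = al * F + be * G -> a * F + b * G = 0 -> exists c, b = c * F /\ a = - (c * G).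
Proof.
move=> d0 hF F3 rE tr rn0 rFG ab.
pose e := al * b - be * a.
have eF : e * F = rho * b.
  have -> : rho * b = e * F + be * (a * F + b * G) by rewrite rFG /e; ring.
  by rewrite ab mulr0 addr0.
have [sF lF] := toPoly_homog hF.
have uF : (eval_at F e3)%:MP \is a @GRing.unit P3.
  by apply/unitrP; exists ((eval_at F e3)^-1)%:MP; rewrite -!rmorphM /= mulVf // mulfV // rmorph1.
have sF' : size (toPoly F) = d.+1.
  apply/eqP; rewrite eqn_leq sF ltnNge; apply/negP => H.
  move: lF; rewrite nth_default // => /esym /eqP; rewrite mpolyC_eq0; exact/negP.
have lcF : lead_coef (toPoly F) \is a GRing.unit by rewrite lead_coefE sF' /= lF.
have Edv := Pdiv.IdomainUnit.divp_eq lcF (toPoly b).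
set q := (toPoly b %/ toPoly F)%R in Edv; set r := (toPoly b %% toPoly F)%R in Edv.
have F0 : toPoly F != 0 by rewrite -size_poly_eq0 sF'.
have sr : (size r < size (toPoly F))%N by rewrite ltn_modp.
have r30 : r3 != 0 by apply: contraNneq rn0 => z; rewrite rE z rmorph0.
have E : (toPoly e - r3 *: q) * toPoly F = r3 *: r.
  have := congr1 toPoly eF; rewrite !rmorphM /= tr Edv -mul_polyC => E.
  by rewrite mulrBl E -mul_polyC; ring.
have r0 : r = 0.
  have [z|z] := eqVneq (toPoly e - r3 *: q) 0.
    by move: E; rewrite z mul0r => /esym /eqP; rewrite -mul_polyC mulf_eq0 polyC_eq0 (negbTE r30) => /eqP.
  have := congr1 (fun p : {poly P3} => size p) E.
  rewrite size_mul // size_scale // => S.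
  have : (0 < size (toPoly e - r3 *: q)%R)%N by rewrite size_poly_gt0.
  by move: sr; rewrite -S sF' addnS /=; case: (size _) => // k; rewrite addSn ltnNge ltnS leq_addl.
have bE : b = ofPoly q * F.
  by rewrite -[b]ofPolyK Edv r0 addr0 -{2}[F]ofPolyK /ofPoly rmorphM hornerM.
exists (ofPoly q); split=> //.
have Fn0 : F != 0 by apply: contraNneq F3 => ->; rewrite evE.
apply: (mulIf Fn0); apply/eqP; rewrite -subr_eq0; apply/eqP.
by transitivity (a * F + b * G); [rewrite bE; ring|].
Qed.

End Regular.
Arguments cut {K} j.
Arguments toPoly {K}.
Arguments widen3 {K}.

Section Integral.
Variable K : numClosedFieldType.
Hypothesis unc : ~ countable [set: K].
Local Notation P := {mpoly K[4]}.
Local Notation P2 := {mpoly K[2]}.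
Local Notation P3 := {mpoly K[3]}.
Implicit Types (f g h : P).

Local Notation j0 := (inord 0 : 'I_4).
Local Notation j1 := (inord 1 : 'I_4).
Local Notation j2 := (inord 2 : 'I_4).
Local Notation j3 := (inord 3 : 'I_4).

Lemma X_homog m (j : 'I_m) : ('X_j : {mpoly K[m]}) \is 1.-homog.
Proof. by rewrite dhomogX; apply/eqP; exact: mdeg1. Qed.

Lemma Xn_homog m (j : 'I_m) k : ('X_j ^+ k : {mpoly K[m]}) \is k.-homog.
Proof. by have := dhomogMn k (X_homog j); rewrite mul1n. Qed.

Lemma idl2P n (F G f : {mpoly K[n]}) : idl [:: F; G] f <-> exists a b, f = a * F + b * G.
Proof.
split=> [[a [b /= E]]|[a [b ->]]].
  by exists a, b; apply/eqP; rewrite -subr_eq0 opprD addrA E.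
by exists a, b => /=; ring.
Qed.

Variables (F G : P) (d n : nat).
Hypothesis (d0 : (0 < d)%N) (hF : F \is d.-homog) (hG : G \is n.-homog).
Local Notation I := (idl [:: F; G]).

Let Ihom f e : I f -> I (pihomog mdeg e f).
Proof.
apply: idl_pihomog => g; rewrite !inE => /orP[] /eqP ->; eexists; eassumption.
Qed.

Hypothesis Hz : forall y : 'rV[K]_4, y 0 j0 = 0 -> y 0 j1 = 0 -> eval_at F y = 0 ->
  eval_at G y = 0 -> y = 0.

Lemma pow_in i : exists N, forall M, (N <= M)%N -> idl [:: 'X_j0; 'X_j1; F; G] ('X_i ^+ M).
Proof.
have [|N HN] := nullstellensatz unc (is_ideal_idl [:: 'X_j0; 'X_j1; F; G]) (f := 'X_i).
  move=> y Hy; have m g : g \in [:: 'X_j0; 'X_j1; F; G] -> eval_at g y = 0.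
    by move=> /idl_mem; exact: Hy.
  rewrite (_ : y = 0) ?evE ?mxE //; apply: Hz; try by apply: m; rewrite !inE eqxx ?orbT.
    by rewrite -(eval_atU y); apply: m; rewrite inE eqxx.
  by rewrite -(eval_atU y); apply: m; rewrite !inE eqxx orbT.
exists N => M /subnK <-; rewrite exprD; apply: idl1 HN _ => //; reflexivity.
Qed.

Lemma pow_red i M : idl [:: 'X_j0; 'X_j1; F; G] ('X_i ^+ M.+1) -> exists ga de,
  [/\ ga \is M.-homog, de \is M.-homog & I ('X_i ^+ M.+1 - ga * 'X_j0 - de * 'X_j1)].
Proof.
move=> [a [b H]]; exists (pihomog mdeg M a), (pihomog mdeg M b); split; try exact: pihomogP.
have := Ihom (M + 1) H; rewrite !linearB /= !pihomogMr ?X_homog // pihomog_dE //.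
by rewrite addn1 Xn_homog.
Qed.

Section Finite.
Variable iota2 : {rmorphism P2 -> P}.
Hypothesis (iC : forall c, iota2 c%:MP = c%:MP) (iX : forall i : 'I_2, iota2 'X_i = 'X_(inord i)).
Variable N : nat.
Hypothesis (H2 : idl [:: 'X_j0; 'X_j1; F; G] ('X_j2 ^+ N.+1))
           (H3 : idl [:: 'X_j0; 'X_j1; F; G] ('X_j3 ^+ N.+1)).
(** One index codes two exponents at most [N] as digits in base [N.+1]. *)
Let ee (k : nat) : P := 'X_j2 ^+ (k %/ N.+1) * 'X_j3 ^+ (k %% N.+1).
Let S f := exists p : 'I_(N.+1 * N.+1) -> P2, I (f - \sum_k iota2 (p k) * ee k).

Let SI f : I f -> S f.
Proof. by exists (fun=> 0); rewrite big1 ?subr0 // => k _; rewrite rmorph0 mul0r. Qed.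
Let SD f g : S f -> S g -> S (f + g).
Proof.
move=> [p Hp] [q Hq]; exists (fun k => p k + q k).
apply: (idlc (a := 1) (b := 1) _ Hp Hq) => //.
under eq_bigr => k _ do rewrite rmorphD mulrDl.
by rewrite big_split /=; ring.
Qed.
Let SM (q : P2) f : S f -> S (iota2 q * f).
Proof.
move=> [p Hp]; exists (fun k => q * p k); apply: (idl1 (a := iota2 q) _ Hp) => //.
rewrite mulrBr mulr_sumr; congr (_ - _); apply: eq_bigr => k _.
by rewrite rmorphM -mulrA.
Qed.
Let SZ c f : S f -> S (c *: f).
Proof. by move=> /(SM (c%:MP)); rewrite iC mul_mpolyC. Qed.
Let Seq f g : I (f - g) -> S g -> S f.
Proof. by move=> /SI H1 H2'; have := SD H1 H2'; rewrite subrK. Qed.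

(** Noether normalization. A large power of one of the last two variables lies in the ideal of the
    first two, [F] and [G], so a monomial containing it is rewritten with a pencil variable in front
    of forms of smaller degree; induction on the degree finishes. *)
Lemma finite_generation f : S f.
Proof.
have sums (s : seq 'X_{1..4}) (c : 'X_{1..4} -> K) :
    (forall m, m \in s -> S 'X_[m]) -> S (\sum_(m <- s) c m *: 'X_[m]).
  elim: s => [|m s IH] H; first by rewrite big_nil; apply: SI; have [] := is_ideal_idl [:: F; G].
  rewrite big_cons; apply: SD; first by apply: SZ; apply: H; rewrite mem_head.
  by apply: IH => m' ms; apply: H; rewrite inE ms orbT.
suff mono m : S 'X_[m] by rewrite [f]mpolyE; apply: sums => m _; exact: mono.
have [E] := ubnP (mdeg m); elim: E m => // E IH m; rewrite ltnS => mE.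
have homS f' e : (e < E)%N -> f' \is e.-homog -> S f'.
  move=> eE hf'; rewrite [f']mpolyE; apply: sums => m' m'f; apply: IH.
  by have -> : mdeg m' = e := dhomog_mf hf' m'f.
have Em : 'X_[m] = 'X_j0 ^+ m j0 * 'X_j1 ^+ m j1 * 'X_j2 ^+ m j2 * 'X_j3 ^+ m j3 :> P.
  by rewrite mpolyXE_id ord4_prod.
have dE : mdeg m = (m j0 + m j1 + m j2 + m j3)%N by rewrite mdegE ord4_sum.
have hX (j : 'I_4) k : ('X_j ^+ k : P) \is k.-homog by exact: Xn_homog.
have reduce (j : 'I_4) (h : P) e : (e + N < E)%N -> h \is e.-homog ->
    idl [:: 'X_j0; 'X_j1; F; G] ('X_j ^+ N.+1) -> S (h * 'X_j ^+ N.+1).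
  move=> eE hh /pow_red[ga [de [hga hde HI]]].
  apply: (Seq (g := iota2 'X_(inord 0) * (ga * h) + iota2 'X_(inord 1) * (de * h))).
    by apply: (idl1 (a := h) _ HI) => //; rewrite !iX !inordK //; ring.
  rewrite addnC in eE; apply: SD; apply: SM.
    exact: (homS _ _ eE (dhomogM hga hh)).
  exact: (homS _ _ eE (dhomogM hde hh)).
have [m2|m2] := ltnP (m j2) N.+1; last first.
  have -> : 'X_[m] = ('X_j0 ^+ m j0 * 'X_j1 ^+ m j1 * 'X_j2 ^+ (m j2 - N.+1) * 'X_j3 ^+ m j3) * 'X_j2 ^+ N.+1 :> P.
    by rewrite Em -{1}(subnK m2) exprD; ring.
  apply: (reduce _ _ (m j0 + m j1 + (m j2 - N.+1) + m j3)%N) => //; first by lia.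
  by do ?apply: dhomogM.
have [m3|m3] := ltnP (m j3) N.+1; last first.
  have -> : 'X_[m] = ('X_j0 ^+ m j0 * 'X_j1 ^+ m j1 * 'X_j2 ^+ m j2 * 'X_j3 ^+ (m j3 - N.+1)) * 'X_j3 ^+ N.+1 :> P.
    by rewrite Em -{1}(subnK m3) exprD; ring.
  apply: (reduce _ _ (m j0 + m j1 + m j2 + (m j3 - N.+1))%N) => //; first by lia.
  by do ?apply: dhomogM.
have kN : (m j2 * N.+1 + m j3 < N.+1 * N.+1)%N by nia.
exists (fun k => if k == m j2 * N.+1 + m j3 :> nat then 'X_(inord 0) ^+ m j0 * 'X_(inord 1) ^+ m j1 else 0).
rewrite (bigD1 (Ordinal kN)) //= eqxx big1 => [|k kk]; last first.
  by rewrite ifN ?rmorph0 ?mul0r //; apply: contraNneq kk => kE; apply/eqP/val_inj.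
rewrite addr0 rmorphM !rmorphXn !iX !inordK //.
rewrite /ee divnMDl // modnMDl divn_small // modn_small // addn0 Em.
by rewrite !mulrA subrr; have [] := is_ideal_idl [:: F; G].
Qed.

(** The determinant trick: the characteristic matrix of multiplication by [f] on the generators
    kills the vector of generators, so its determinant kills the generator of index 0, which is
    1. *)
Lemma integral_N f : exists2 chi : {poly P2}, chi \is monic & I ((map_poly iota2 chi).[f]).
Proof.
have /choice[A HA] := fun i : 'I_(N.+1 * N.+1) => finite_generation (f * ee i).
pose M : 'M[P2]_(N.+1 * N.+1) := \matrix_(i, j) A i j.
have cf : commr_rmorph iota2 f by move=> x; exact: mulrC.
pose phi : {rmorphism {poly P2} -> P} := horner_morph cf.
exists (char_poly M); first exact: char_poly_monic.
rewrite -[_.[f]]/(phi (char_poly M)) /char_poly -det_map_mx.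
set B := map_mx phi _.
have BI i : I (\sum_j B i j * ee j).
  apply: (idl1 (a := 1) _ (HA i)) => //; rewrite mul1r.
  transitivity (\sum_j ((f *+ (i == j)) * ee j - iota2 (A i j) * ee j)).
    apply: eq_bigr => j _; rewrite -mulrBl; congr (_ * _).
    rewrite !mxE rmorphB /= /horner_morph map_polyC hornerC; congr (_ - _).
    by rewrite rmorphMn /= map_polyX hornerMn hornerX.
  rewrite sumrB; congr (_ - _); rewrite (bigD1 i) //= eqxx mulr1n big1 ?addr0 // => j ji.
  by rewrite eq_sym (negbTE ji) mulr0n mul0r.
have k0 : (0 < N.+1 * N.+1)%N by [].
have e0 : ee (Ordinal k0) = 1 by rewrite /ee /= div0n mod0n !expr0 mulr1.
have <- : \sum_i (\adj B) (Ordinal k0) i * (\sum_j B i j * ee j) = \det B.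
  under eq_bigr => i _ do rewrite mulr_sumr.
  rewrite exchange_big /=.
  transitivity (\sum_j (\adj B *m B) (Ordinal k0) j * ee j).
    by apply: eq_bigr => j _; rewrite mxE mulr_suml; apply: eq_bigr => i _; rewrite mulrA.
  rewrite mul_adj_mx (bigD1 (Ordinal k0)) //= mxE eqxx mulr1n e0 mulr1 big1 ?addr0 // => j jk.
  by rewrite mxE eq_sym (negbTE jk) mul0r.
by apply: idl_sum => // i _; have [_ _] := is_ideal_idl [:: F; G]; apply.
Qed.
End Finite.

Definition iota2 : {rmorphism P2 -> P} := mmap (@mpolyC 4 K) (fun i : 'I_2 => 'X_(inord i)).

Lemma integral_special f : exists2 chi : {poly P2}, chi \is monic & I ((map_poly iota2 chi).[f]).
Proof.
have [N2 H2] := pow_in j2; have [N3 H3] := pow_in j3.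
apply: (@integral_N iota2 _ _ (N2 + N3)) => [c|i||]; rewrite ?/iota2 /= ?mmapC ?mmapX ?mmap1U //.
  by apply: H2; lia.
by apply: H3; lia.
Qed.

Hypothesis HF3 : eval_at F (e3 K) != 0.

Definition iota23 : {rmorphism P2 -> P3} := mmap (@mpolyC 3 K) (fun i : 'I_2 => 'X_(inord i)).
Definition cut3 (j : nat) : {rmorphism P3 -> P3} :=
  mmap (@mpolyC 3 K) (fun i : 'I_3 => if (i < j)%N then 0 else 'X_i).

Lemma cut_widen3 j (r : P3) : cut j (widen3 r) = widen3 (cut3 j r).
Proof.
rewrite /cut /widen3 /cut3 /=; elim/mpoly_ring_ind: r => [c|i|f g Hf Hg|f g Hf Hg].
- by rewrite !mmapC.
- rewrite !mmapX !mmap1U mmapX mmap1U inordK; last by case: i => i Hi /=; lia.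
  by case: ifP; rewrite ?mmap0 // mmapX mmap1U.
- by rewrite !mmapD Hf Hg.
- by rewrite !rmorphM /= Hf Hg.
Qed.

Lemma toPoly_widen3 (r : P3) : toPoly (widen3 r) = r%:P.
Proof.
rewrite /toPoly /widen3 /=; elim/mpoly_ring_ind: r => [c|i|f g Hf Hg|f g Hf Hg].
- by rewrite !mmapC.
- rewrite !mmapX !mmap1U mmapX mmap1U inordK; last by case: i => i Hi /=; lia.
  rewrite ltn_ord; congr (_ %:P); congr 'X_ _; apply: val_inj; rewrite /= inordK //.
- by rewrite !mmapD Hf Hg polyCD.
- by rewrite !rmorphM /= Hf Hg.
Qed.

Lemma monic_nonroot (p : {poly K}) : p \is monic -> exists c, p.[c] != 0.
Proof.
move=> mp; have [s1|/closed_rootP[c]] := boolP (size (p - 1) == 1%N).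
  have /size1_polyC E : (size (p - 1)%R <= 1)%N by rewrite (eqP s1).
  exists 0; rewrite -[p](subrK 1) E -polyC1 -polyCD hornerC.
  have : p = ((p - 1)`_0 + 1)%:P by rewrite polyCD -E polyC1 subrK.
  by move=> Ep; move: (monic_neq0 mp); rewrite {1}Ep polyC_eq0.
by rewrite /root hornerD hornerN hornerC subr_eq0 => /eqP Ec; exists c; rewrite Ec oner_neq0.
Qed.

(** The integral equation of the third variable over the first two is an element of the ideal free
    of the fourth variable. Being monic in the third, it survives when the first two are set to
    0. *)
Lemma resultant : exists (r3 : P3) al be, widen3 r3 = al * F + be * G /\
  forall j, (j <= 2)%N -> cut j (widen3 r3) != 0.
Proof.
have [chi mchi /idl2P[al [be E]]] := integral_special 'X_j2.
pose r3 := (map_poly iota23 chi).['X_(inord 2)].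
have Er : widen3 r3 = (map_poly iota2 chi).['X_j2].
  rewrite /r3 -horner_map -map_poly_comp /=; congr (_.[_]); last first.
    by rewrite mmapX mmap1U inordK.
  apply: eq_map_poly => q /=; elim/mpoly_ring_ind: q => [c|i|f g Hf Hg|f g Hf Hg].
  - by rewrite !mmapC.
  - by rewrite !mmapX !mmap1U mmapX mmap1U inordK //; case: i => i Hi /=; lia.
  - by rewrite !mmapD Hf Hg.
  - by rewrite !rmorphM /= Hf Hg.
exists r3, al, be; split; first by rewrite Er E.
pose th : {rmorphism P2 -> K} := meval (fun=> 0).
have [c Hc] := monic_nonroot (monic_map th mchi).
move=> j jle; apply: contraNneq Hc => z.
pose y : 'rV[K]_4 := \row_i if i == j2 then c else 0.
have : eval_at (cut j (widen3 r3)) y = 0 by rewrite z evE.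
rewrite eval_cut; have -> : (\row_i (if (i < j)%N then 0 else y 0 i)) = y.
  apply/rowP => i; rewrite !mxE; case: ltnP => // ij; case: eqP => // ii.
  by move: ij; rewrite ii inordK // => /leq_trans /(_ jle); rewrite ltnn.
pose ev : {rmorphism P -> K} := meval (fun i => y 0 i).
rewrite Er -[eval_at _ y]/(ev _) -horner_map -map_poly_comp /=.
rewrite mevalXU mxE eqxx => Z; rewrite -[X in _ == X]Z; apply/eqP; congr (_.[_]).
apply: eq_map_poly => q /=; elim/mpoly_ring_ind: q => [c'|i|f g Hf Hg|f g Hf Hg].
- by rewrite mmapC !mevalC.
- rewrite mmapX mmap1U !mevalXU mxE ifN //; apply/eqP => /(congr1 val); rewrite /= !inordK //.
    by case: i => i Hi /=; lia.
  by case: i => i Hi /=; lia.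
- by rewrite mmapD !mevalD Hf Hg.
- by rewrite !rmorphM /= Hf Hg.
Qed.

Lemma cut_homog j f m : f \is m.-homog -> cut j f \is m.-homog.
Proof.
move=> hf; rewrite [f]mpolyE rmorph_sum /=.
rewrite big_seq; apply: rpred_sum => k kf; rewrite mmapZ mul_mpolyC; apply: rpredZ.
rewrite mmapX -(dhomog_mf hf kf : mdeg k = m) mdegE /mmap1.
elim/big_rec2: _ => [|i e p _ IH]; first exact: dhomog1.
apply: dhomogM => //; have h1 : (if (i < j)%N then 0 else 'X_i : P) \is 1.-homog.
  by case: ifP => _; rewrite ?dhomog0 ?X_homog.
by have := dhomogMn (k i) h1; rewrite mul1n.
Qed.

(** [F] and [G] stay coprime after one or both pencil variables are set to 0; this is the source of
    the regular sequence. *)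
Lemma syzygy_cut j a b : (j <= 2)%N -> cut j (a * F + b * G) = 0 ->
  exists c, cut j b = cut j c * cut j F /\ cut j a = - (cut j c * cut j G).
Proof.
move=> j2' E; have [r3 [al [be [Er nz]]]] := resultant.
have eF3 : eval_at (cut j F) (e3 K) != 0.
  rewrite eval_cut (_ : \row_i _ = e3 K) //; apply/rowP => i; rewrite !mxE eqxx /=.
  case: ltnP => // ij; case: eqP => // ii; move: ij; rewrite ii inordK //.
  by move=> /leq_trans /(_ j2').
have [|||c [Hb Ha]] := @monic_division K unc (cut j F) (cut j G) (cut j (widen3 r3)) (cut3 j r3) d
    (cut j a) (cut j b) (cut j al) (cut j be) d0 (cut_homog j hF) eF3 (cut_widen3 j r3) _ (nz j j2') _ _.
- by rewrite cut_widen3 toPoly_widen3.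
- by rewrite Er rmorphD !rmorphM.
- by rewrite -!rmorphM -rmorphD.
exists c; split.
  by rewrite -[LHS]cut_id Hb rmorphM cut_id.
by rewrite -[LHS]cut_id Ha rmorphN rmorphM cut_id.
Qed.

Lemma cut0 f : cut 0 f = f. Proof. exact: mmap_id. Qed.

Lemma coprime0 a b : a * F + b * G = 0 -> exists c, b = c * F /\ a = - (c * G).
Proof.
move=> E; have [//||c] := @syzygy_cut 0 a b _ _; first by rewrite cut0.
by rewrite !cut0; exists c.
Qed.

Lemma cut1_dvd f : cut 1 f = 0 -> exists h, f = 'X_j0 * h.
Proof. by have [h Hh] := cut1P f => z; exists h; rewrite {1}Hh z add0r. Qed.

(** A relation for ['X_0 f] becomes a syzygy modulo ['X_0]. Subtracting the corresponding trivial
    syzygy makes both coefficients divisible by ['X_0], which is then cancelled; [regular1] does the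
    same modulo two variables. *)
Lemma regular0 f : I ('X_j0 * f) -> I f.
Proof.
move=> /idl2P[a [b E]].
have [//||c [Hb Ha]] := @syzygy_cut 1 a b _ _.
  by rewrite -E rmorphM cutX inordK //= mul0r.
have [|b' Eb] := @cut1_dvd (b - c * F); first by rewrite rmorphB rmorphM Hb subrr.
have [|a' Ea] := @cut1_dvd (a + c * G); first by rewrite rmorphD rmorphM Ha addNr.
apply/idl2P; exists a', b'; apply: (mulfI (x := 'X_j0)).
  by rewrite -(msize_poly_eq0) msizeX.
rewrite E mulrDr !mulrA -Ea -Eb; ring.
Qed.

Lemma regular1 f : adj I 'X_j0 ('X_j1 * f) -> adj I 'X_j0 f.
Proof.
move=> [h /idl2P[a [b E]]].
have {}E : 'X_j1 * f = a * F + b * G + h * 'X_j0 by rewrite -E subrK.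
have [//||c [Hb Ha]] := @syzygy_cut 2 a b _ _.
  have : cut 2 ('X_j1 * f - h * 'X_j0) = 0.
    by rewrite rmorphB !rmorphM !cutX !inordK //= mul0r mulr0 subrr.
  by rewrite E addrK.
have [b1 [b2 Eb]] := cut2P (b - c * F); have [a1 [a2 Ea]] := cut2P (a + c * G).
rewrite rmorphB rmorphM Hb subrr add0r in Eb.
rewrite rmorphD rmorphM Ha addNr add0r in Ea.
have E1 : 'X_j1 * (f - a2 * F - b2 * G) = 'X_j0 * (a1 * F + b1 * G + h).
  have -> : 'X_j1 * (f - a2 * F - b2 * G) = 'X_j1 * f - ('X_j1 * a2) * F - ('X_j1 * b2) * G by ring.
  have -> : 'X_j1 * a2 = a + c * G - 'X_j0 * a1 by rewrite Ea; ring.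
  have -> : 'X_j1 * b2 = b - c * F - 'X_j0 * b1 by rewrite Eb; ring.
  by rewrite E; ring.
have [|k Ek] := @cut1_dvd (f - a2 * F - b2 * G).
  have := congr1 (cut 1) E1; rewrite rmorphM [RHS]rmorphM !cutX !inordK //= mul0r => /eqP.
  by rewrite mulf_eq0 -msize_poly_eq0 msizeX /= => /eqP.
exists k; apply/idl2P; exists a2, b2; rewrite mulrC -Ek; ring.
Qed.
End Integral.

Section Coordinates.
Variable K : numClosedFieldType.
Hypothesis unc : ~ countable [set: K].
Local Notation P := {mpoly K[4]}.
Local Notation P2 := {mpoly K[2]}.
Implicit Types (f g h : P).

Local Notation j0 := (inord 0 : 'I_4).
Local Notation j1 := (inord 1 : 'I_4).
Local Notation j2 := (inord 2 : 'I_4).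
Local Notation j3 := (inord 3 : 'I_4).

Definition subst n (M : 'M[K]_n) : {rmorphism {mpoly K[n]} -> {mpoly K[n]}} :=
  mmap (@mpolyC n K) (fun j => lin (\row_i M i j)).

Lemma eval_subst n (M : 'M[K]_n) (f : {mpoly K[n]}) y : eval_at (subst M f) y = eval_at f (y *m M).
Proof.
rewrite /subst /= eval_mmap; congr eval_at; apply/rowP => j; rewrite mxE eval_lin mxE.
by apply: eq_bigr => i _; rewrite mxE mulrC.
Qed.

Lemma eval_inj n (f g : {mpoly K[n]}) : (forall x, eval_at f x = eval_at g x) -> f = g.
Proof.
by move=> H; apply/eqP; rewrite -subr_eq0; apply/eqP/(eval_inj0 unc) => x; rewrite !evE H subrr.
Qed.

Lemma subst_homog n (M : 'M[K]_n) (f : {mpoly K[n]}) m : f \is m.-homog -> subst M f \is m.-homog.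
Proof.
move=> hf; rewrite [f]mpolyE rmorph_sum /=.
rewrite big_seq; apply: rpred_sum => k kf; rewrite mmapZ mul_mpolyC; apply: rpredZ.
rewrite mmapX -(dhomog_mf hf kf : mdeg k = m) mdegE /mmap1.
elim/big_rec2: _ => [|i e p _ IH]; first exact: dhomog1.
by apply: dhomogM => //; have := dhomogMn (k i) (lin_homog (\row_j M j i)); rewrite mul1n.
Qed.

#[local] Opaque subst.

Section Transport.
Variables (F G : P) (d n : nat) (N : 'M[K]_4) (p3 : 'rV[K]_4).
Hypothesis (uN : N \in unitmx).

Definition el (i : 'I_4) : P := lin (\row_k N k i).

Lemma eval_el i x : eval_at (el i) x = (x *m N) 0 i.
Proof. by rewrite eval_lin mxE; apply: eq_bigr => k _; rewrite mxE mulrC. Qed.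

Lemma el_homog i : el i \is 1.-homog. Proof. exact: lin_homog. Qed.

Let M := invmx N.
Lemma subst_el i : subst M (el i) = 'X_i.
Proof. by apply: eval_inj => x; rewrite eval_subst eval_el mulmxKV // eval_atU. Qed.

Lemma substKV f : subst N (subst M f) = f.
Proof. by apply: eval_inj => x; rewrite !eval_subst mulmxK. Qed.
Lemma substK f : subst M (subst N f) = f.
Proof. by apply: eval_inj => x; rewrite !eval_subst mulmxKV. Qed.

Definition pullback : {rmorphism P2 -> P} := mmap (@mpolyC 4 K) (fun i : 'I_2 => el (inord i)).

Lemma eval_pullback (q : P2) x : eval_at (pullback q) x = eval_at q (\row_i (x *m N) 0 (inord i)).
Proof.
by rewrite /pullback /= eval_mmap; congr eval_at; apply/rowP => i; rewrite [LHS]mxE [RHS]mxE eval_el.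
Qed.

Hypothesis (d0 : (0 < d)%N) (hF : F \is d.-homog) (hG : G \is n.-homog).
Hypothesis (p3N : p3 *m N = e3 K) (Fp3 : eval_at F p3 != 0).
Hypothesis Hz : forall x, eval_at (el j0) x = 0 -> eval_at (el j1) x = 0 ->
  eval_at F x = 0 -> eval_at G x = 0 -> x = 0.
Local Notation I := (idl [:: F; G]).
Let F' := subst M F.
Let G' := subst M G.
Let hF' : F' \is d.-homog. Proof. exact: subst_homog. Qed.
Let hG' : G' \is n.-homog. Proof. exact: subst_homog. Qed.
Let FM : eval_at F' (e3 K) != 0.
Proof. by rewrite eval_subst -p3N mulmxK. Qed.
Let HzM (y : 'rV[K]_4) : y 0 j0 = 0 -> y 0 j1 = 0 -> eval_at F' y = 0 -> eval_at G' y = 0 -> y = 0.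
Proof.
rewrite !eval_subst => y0 y1 Fy Gy.
have yE : y *m M = 0 by apply: Hz; rewrite // eval_el mulmxKV.
by rewrite -[y](mulmxKV uN) yE mul0mx.
Qed.
Let I' f : I f <-> idl [:: F'; G'] (subst M f).
Proof.
rewrite !idl2P; split=> -[a [b E]].
  by exists (subst M a), (subst M b); rewrite E rmorphD !rmorphM.
exists (subst N a), (subst N b); rewrite -[f]substKV E rmorphD !rmorphM.
by rewrite !substKV.
Qed.

Lemma syzygy a b : a * F + b * G = 0 -> exists c, b = c * F /\ a = - (c * G).
Proof.
move=> E; have [|c [Hb Ha]] := coprime0 unc d0 hF' hG' HzM FM (a := subst M a) (b := subst M b).
  by rewrite -!rmorphM -rmorphD E rmorph0.
exists (subst N c); split; first by rewrite -[b]substKV Hb rmorphM substKV.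
by rewrite -[a]substKV Ha rmorphN rmorphM substKV.
Qed.

Lemma regular_el0 f : I (el j0 * f) -> I f.
Proof.
move=> /I'; rewrite rmorphM subst_el => /(regular0 unc d0 hF' hG' HzM FM); exact: (I' f).2.
Qed.

Lemma regular_el1 f : adj I (el j0) (el j1 * f) -> adj I (el j0) f.
Proof.
move=> [h /I']; rewrite rmorphB !rmorphM !subst_el => H.
have [|k Hk] := regular1 unc d0 hF' hG' HzM FM (f := subst M f); first by exists (subst M h).
exists (subst N k); apply/I'; rewrite rmorphB rmorphM subst_el substK //.
Qed.

Lemma integral_pencil f : exists2 chi : {poly P2}, chi \is monic & I ((map_poly pullback chi).[f]).
Proof.
have [chi mchi H] := integral_special unc d0 hF' hG' HzM (subst M f); exists chi => //.
apply/I'; congr (idl _ _): H; rewrite -horner_map -map_poly_comp; congr (_.[_]).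
apply: eq_map_poly => q /=; apply: eval_inj => x.
have /= -> := eval_subst M (pullback q) x; rewrite eval_pullback mulmxKV //.
rewrite eval_mmap; congr eval_at; apply/rowP => i; rewrite !mxE evE //.
Qed.

Lemma pullback_inj (q : P2) : pullback q = 0 -> q = 0.
Proof.
move=> z; apply: (eval_inj0 unc) => y.
pose x : 'rV[K]_4 := (\row_i if (i < 2)%N then y 0 (inord i) else 0) *m M.
have := congr1 (fun f => eval_at f x) z; rewrite evE eval_pullback mulmxKV // => Z.
rewrite -[RHS]Z; congr eval_at; apply/rowP => i; rewrite !mxE inordK; last by case: i => i Hi /=; lia.
by rewrite ltn_ord; congr (y 0 _); apply: val_inj; rewrite /= inordK.
Qed.
End Transport.

Section Pencil.
Variables (F G : P) (d n : nat) (N : 'M[K]_4) (p3 : 'rV[K]_4).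
Hypothesis (uN : N \in unitmx).
Hypothesis (d0 : (0 < d)%N) (hF : F \is d.-homog) (hG : G \is n.-homog).
Hypothesis (p3N : p3 *m N = e3 K) (Fp3 : eval_at F p3 != 0).
Hypothesis Hz : forall x, eval_at (el N j0) x = 0 -> eval_at (el N j1) x = 0 ->
  eval_at F x = 0 -> eval_at G x = 0 -> x = 0.
Local Notation I := (idl [:: F; G]).

Definition pencil a b : P := a *: el N j0 + b *: el N j1.

(** Two independent members of the pencil may replace the first two columns of [N]: they have the
    same common zeros, and [p3] is mapped to the same vector. *)
Lemma pencil_regular a b c e : a * e - b * c != 0 ->
  (forall f, I (pencil a b * f) -> I f) /\
  (forall f, adj I (pencil a b) (pencil c e * f) -> adj I (pencil a b) f).
Proof.
move=> dt; pose N' : 'M[K]_4 := \matrix_(k, j)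
  if j == j0 then a * N k j0 + b * N k j1 else if j == j1 then c * N k j0 + e * N k j1 else N k j.
have j10 : (j1 == j0) = false by rewrite -val_eqE /= !inordK.
have E0 : el N' j0 = pencil a b.
  by rewrite /pencil /el -!linZ -linD; congr lin; apply/rowP => k; rewrite !mxE eqxx.
have E1 : el N' j1 = pencil c e.
  by rewrite /pencil /el -!linZ -linD; congr lin; apply/rowP => k; rewrite !mxE j10 eqxx.
have E2 (x : 'rV[K]_4) : (x *m N') 0 j0 = a * (x *m N) 0 j0 + b * (x *m N) 0 j1 /\
            (x *m N') 0 j1 = c * (x *m N) 0 j0 + e * (x *m N) 0 j1.
  by rewrite -!eval_el E0 E1 /pencil !evE.
have E3 (x : 'rV[K]_4) j : j != j0 -> j != j1 -> (x *m N') 0 j = (x *m N) 0 j.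
  move=> /negbTE n0 /negbTE n1; rewrite [LHS]mxE [RHS]mxE; apply: eq_bigr => k _.
  by rewrite [N' _ _]mxE n0 n1.
have sol u v : a * u + b * v = 0 -> c * u + e * v = 0 -> u = 0 /\ v = 0.
  move=> H1 H2; split; apply: (mulfI dt); rewrite mulr0.
    transitivity (e * (a * u + b * v) - b * (c * u + e * v)); first by ring.
    by rewrite H1 H2; ring.
  transitivity (a * (c * u + e * v) - c * (a * u + b * v)); first by ring.
  by rewrite H1 H2; ring.
have uN' : N' \in unitmx.
  rewrite unitmxE unitfE; apply/det0P => -[v v0 vN].
  have [z0 z1] : (v *m N) 0 j0 = 0 /\ (v *m N) 0 j1 = 0.
    by have [H1 H2] := E2 v; apply: sol; rewrite -?H1 -?H2 vN mxE.
  have vN0 : v *m N = 0.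
    apply/rowP => j; rewrite [RHS]mxE; have [->//|n0] := eqVneq j j0; have [->//|n1] := eqVneq j j1.
    by rewrite -E3 // vN mxE.
  by move: v0; rewrite -[v](mulmxK uN) vN0 mul0mx eqxx.
have p3N' : p3 *m N' = e3 K.
  have [z0 z1] : (p3 *m N) 0 j0 = 0 /\ (p3 *m N) 0 j1 = 0.
    by rewrite p3N !mxE -!val_eqE /= !inordK.
  rewrite -p3N; apply/rowP => j; have [->|n0] := eqVneq j j0.
    by rewrite (E2 _).1 z0 z1 !mulr0 addr0.
  have [->|n1] := eqVneq j j1; last exact: E3.
  by rewrite (E2 _).2 z0 z1 !mulr0 addr0.
have Hz' x : eval_at (el N' j0) x = 0 -> eval_at (el N' j1) x = 0 ->
    eval_at F x = 0 -> eval_at G x = 0 -> x = 0.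
  rewrite !eval_el (E2 x).1 (E2 x).2 => H1 H2; have [z0 z1] := sol _ _ H1 H2.
  by apply: Hz; rewrite eval_el.
split=> f; rewrite -E0 -?E1.
  exact: (regular_el0 uN' d0 hF hG p3N' Fp3 Hz').
exact: (regular_el1 uN' d0 hF hG p3N' Fp3 Hz').
Qed.

Lemma pencil_nzd a b f : (a != 0) || (b != 0) -> I (pencil a b * f) -> I f.
Proof.
move=> ab; have [H|H] := eqVneq a 0.
  have : a * 0 - b * 1 != 0 by rewrite H mul0r sub0r mulr1 oppr_eq0; rewrite H eqxx in ab.
  by move=> /pencil_regular[+ _]; exact.
have : a * 1 - b * 0 != 0 by rewrite mulr0 subr0 mulr1.
by move=> /pencil_regular[+ _]; exact.
Qed.

(** Eliminating [f] shows that [el N j1 ^+ N2] times [b] equals [el N j0 ^+ N1] times [c]. For a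
    regular sequence this makes [b] a multiple of [el N j0 ^+ N1], and that factor cancels in the
    first relation. *)
Lemma regular_pow f N1 N2 a b c : I (el N j0 ^+ N1 * f - a * b) -> I (el N j1 ^+ N2 * f - a * c) ->
  (forall h, I (a * h) -> I h) -> exists h, I (f - a * h).
Proof.
move=> Hb Hc anz.
have r0 : forall h, I (el N j0 * h) -> I h by exact: (regular_el0 uN d0 hF hG p3N Fp3 Hz).
have r1 : forall h, adj I (el N j0) (el N j1 * h) -> adj I (el N j0) h.
  exact: (regular_el1 uN d0 hF hG p3N Fp3 Hz).
have E : I (el N j1 ^+ N2 * b - el N j0 ^+ N1 * c).
  apply: anz; apply: (idlc (a := - el N j1 ^+ N2) (b := el N j0 ^+ N1) _ Hb Hc) => //; ring.
have {E} : exists h, I (b - el N j0 ^+ N1 * h).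
  elim: N1 b c {Hb Hc} E => [|k IH] b c E.
    by exists b; rewrite expr0 mul1r subrr; have [] := is_ideal_idl [:: F; G].
  have : adj I (el N j0) (el N j1 ^+ N2 * b).
    by exists (el N j0 ^+ k * c); apply: (idl1 (a := 1) _ E) => //; rewrite exprS; ring.
  have {}r1 : forall m h, adj I (el N j0) (el N j1 ^+ m * h) -> adj I (el N j0) h.
    by elim=> [h|m IHm h]; rewrite ?expr0 ?mul1r // exprS -mulrA => /r1; exact: IHm.
  move=> /r1[b' Hb']; have [|h Hh] := IH b' c.
    apply: r0; apply: (idlc (a := 1) (b := - el N j1 ^+ N2) _ E Hb') => //; rewrite exprS; ring.
  by exists h; apply: (idlc (a := 1) (b := el N j0) _ Hb' Hh) => //; rewrite exprS; ring.
move=> [h Hh]; exists h.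
have r0n : forall m h, I (el N j0 ^+ m * h) -> I h.
  by elim=> [k|m IHm k]; rewrite ?expr0 ?mul1r // exprS -mulrA => /r0; exact: IHm.
apply: (r0n N1); apply: (idlc (a := 1) (b := a) _ Hb Hh) => //; ring.
Qed.

(** The depth of the coordinate ring of the curve is two. *)
Lemma local_to_global f a : (forall h, I (a * h) -> I h) ->
  (forall x, x != 0 -> eval_at F x = 0 -> eval_at G x = 0 -> loc x (adj I a) f) -> adj I a f.
Proof.
(* The ideal of denominators of [f / a]. By hypothesis no point other than the vertex is a zero of
   it, so it contains powers of both pencil forms. *)
move=> anz H; pose J : set P := [set s | adj I a (s * f)].
have HI := is_ideal_idl [:: F; G]; have HaI := is_ideal_adj a HI.
have HJ : is_ideal J.
  split=> [|s t Hs Ht|s t Ht]; rewrite /J /=.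
  - by rewrite mul0r; have [] := HaI.
  - by rewrite mulrDl; have [_ + _] := HaI; exact.
  - by rewrite -mulrA; have [_ _ +] := HaI; exact.
have IJ h : I h -> J h.
  by move=> Ih; apply: adj_sub; apply: (idl1 (a := f) HI Ih); rewrite mulrC.
have V y : (forall g, J g -> eval_at g y = 0) -> y = 0.
  move=> Hy; apply/eqP; apply: contraT => y0.
  have [||s sy Js] := H y y0; try by apply: Hy; apply: IJ; apply: idl_mem; rewrite !inE eqxx ?orbT.
  by move: sy; rewrite (Hy s Js) eqxx.
have pw i : exists m, adj I a (el N i ^+ m * f).
  apply: (nullstellensatz unc HJ (f := el N i)) => y /V ->.
  by rewrite eval_el mul0mx mxE.
have [m0 [b0 H0]] := pw j0; have [m1 [b1 H1]] := pw j1.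
rewrite [b0 * _]mulrC in H0; rewrite [b1 * _]mulrC in H1.
have [h Hh] := regular_pow H0 H1 anz.
by exists h; rewrite mulrC.
Qed.

End Pencil.
End Coordinates.

(** * Linear algebra of covectors, and binary forms *)

Section LinearAlgebra.
Variable K : numClosedFieldType.
Hypothesis unc : ~ countable [set: K].

Definition dot n (a v : 'rV[K]_n) : K := \sum_i a 0 i * v 0 i.

Lemma dotE n (a v : 'rV[K]_n) : (v *m a^T) 0 0 = dot a v.
Proof. by rewrite mxE; apply: eq_bigr => i _; rewrite mxE mulrC. Qed.
Lemma dotDr n (a v w : 'rV[K]_n) : dot a (v + w) = dot a v + dot a w.
Proof. by rewrite -!dotE mulmxDl mxE. Qed.
Lemma dotZr n (a v : 'rV[K]_n) c : dot a (c *: v) = c * dot a v.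
Proof. by rewrite -!dotE -scalemxAl mxE. Qed.
Lemma dotDl n (a b v : 'rV[K]_n) : dot (a + b) v = dot a v + dot b v.
Proof. by rewrite -!dotE linearD mulmxDr mxE. Qed.
Lemma dotZl n (a v : 'rV[K]_n) c : dot (c *: a) v = c * dot a v.
Proof. by rewrite -!dotE linearZ -scalemxAr mxE. Qed.
Lemma dot0r n (a : 'rV[K]_n) : dot a 0 = 0.
Proof. by rewrite -dotE mul0mx mxE. Qed.
Lemma differential_dot n f (x v : 'rV[K]_n.+1) : differential f x v = dot (grad f x) v.
Proof. by rewrite differential_grad dotE. Qed.
Lemma eval_lin_dot n (a v : 'rV[K]_n) : eval_at (lin a) v = dot a v.
Proof. by rewrite eval_lin. Qed.
Lemma dot_eq0 n (a : 'rV[K]_n) : (forall v, dot a v = 0) -> a = 0.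
Proof.
move=> H; apply/rowP => i; have := H (delta_mx 0 i); rewrite /dot (bigD1 i) //= big1.
  by rewrite !mxE !eqxx mulr1 addr0.
by move=> j /negbTE ji; rewrite mxE ji andbF mulr0.
Qed.

Lemma span_dual n (a b u : 'rV[K]_n) : (forall v, dot a v = 0 -> dot b v = 0 -> dot u v = 0) ->
  exists s t, u = s *: a + t *: b.
Proof.
move=> H; have : (u <= col_mx a b)%MS.
  rewrite submxE; apply/eqP/rowP => j; rewrite [RHS]mxE.
  have dc c : (c *m cokermx (col_mx a b)) 0 j = dot c (col j (cokermx (col_mx a b)))^T.
    by rewrite [LHS]mxE; apply: eq_bigr => i _; rewrite !mxE.
  rewrite dc; have /matrixP E := mulmx_coker (col_mx a b); rewrite mul_col_mx in E.
  apply: H; rewrite -dc; [have := E (lshift 1 0) j|have := E (rshift 1 0) j];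
    by rewrite ?col_mxEu ?col_mxEd [RHS]mxE.
move=> /submxP[c ->]; exists (lsubmx c 0 0), (rsubmx c 0 0).
rewrite -{1}[c]hsubmxK mul_row_col; congr (_ + _).
  by rewrite {1}[lsubmx c]mx11_scalar mul_scalar_mx.
by rewrite {1}[rsubmx c]mx11_scalar mul_scalar_mx.
Qed.

Definition indep n (a b : 'rV[K]_n) : Prop := forall s t, s *: a + t *: b = 0 -> s = 0 /\ t = 0.

Lemma indep_row_free n (a b : 'rV[K]_n) : indep a b -> row_free (col_mx a b).
Proof.
move=> H; rewrite -kermx_eq0; apply/eqP/row_matrixP => i; rewrite row0.
set c := row i _; have : c *m col_mx a b = 0 by rewrite /c -row_mul mulmx_ker row0.
rewrite -[c]hsubmxK mul_row_col {1}[lsubmx c]mx11_scalar {1}[rsubmx c]mx11_scalar !mul_scalar_mx.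
move=> /H[z1 z2]; rewrite [lsubmx c]mx11_scalar [rsubmx c]mx11_scalar z1 z2.
by rewrite !raddf0 row_mx0.
Qed.

Lemma indepC n (a b : 'rV[K]_n) : indep a b -> indep b a.
Proof. by move=> H s t; rewrite addrC => /H[]. Qed.

Lemma indepP n (a b : 'rV[K]_n) : a != 0 -> ~ (b <= a)%MS -> indep a b.
Proof.
move=> a0 nb s t E; have t0 : t = 0.
  apply/eqP/negPn/negP => t0; apply: nb; apply/sub_rVP; exists (- s / t).
  apply: (scalerI t0); rewrite scalerA mulrC divfK // scaleNr.
  by apply/eqP; rewrite -addr_eq0 addrC E.
split=> //; move: E; rewrite t0 scale0r addr0 => /eqP; rewrite scaler_eq0 (negbTE a0) orbF => /eqP //.
Qed.

Lemma dual_pair n (a b : 'rV[K]_n) : indep a b -> exists u, dot u a = 0 /\ dot u b = 1.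
Proof.
move=> /indep_row_free /row_freeP[B HB]; exists (col (rshift 1 0) B)^T.
have dc c : dot (col (rshift 1 0) B)^T c = (c *m B) 0 (rshift 1 0).
  by rewrite [RHS]mxE; apply: eq_bigr => i _; rewrite !mxE mulrC.
rewrite !dc; rewrite mul_col_mx in HB; move/matrixP: HB => HB.
have := HB (lshift 1 0) (rshift 1 0); have := HB (rshift 1 0) (rshift 1 0).
by rewrite col_mxEu col_mxEd !mxE /= => -> ->.
Qed.

Lemma kernel2 (a b x : 'rV[K]_4) : indep a b -> x != 0 -> dot a x = 0 -> dot b x = 0 ->
  exists w, [/\ dot a w = 0, dot b w = 0, indep x w &
    forall v, dot a v = 0 -> dot b v = 0 -> exists s t, v = s *: x + t *: w].
Proof.
move=> ab x0 ax bx; pose A : 'M[K]_(4, 1 + 1) := (col_mx a b)^T.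
have rT : \rank (kermx A) = 2.
  by rewrite mxrank_ker mxrank_tr (eqP (indep_row_free ab)).
have kP m (v : 'M[K]_(m, 4)) : (v <= kermx A)%MS <-> v *m a^T = 0 /\ v *m b^T = 0.
  rewrite sub_kermx /A tr_col_mx mul_mx_row; split=> [/eqP|[-> ->]]; last by rewrite row_mx0.
  by rewrite -row_mx0 => /eq_row_mx.
have kv v : (v <= kermx A)%MS <-> dot a v = 0 /\ dot b v = 0.
  rewrite kP -!dotE; split=> [[-> ->]|[H1 H2]]; first by rewrite !mxE.
  by split; apply/matrixP => i j; rewrite !ord1 [RHS]mxE.
have xk : (x <= kermx A)%MS by apply/kv.
have [i Hi] : exists i, ~~ (row i (kermx A) <= x)%MS.
  apply/row_subPn; apply: contraL (leqnn 2) => /mxrankS; rewrite rT => H.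
  by rewrite leqNgt negbK ltnS (leq_trans H) // rank_leq_row.
pose w := row i (kermx A); have wk : (w <= kermx A)%MS by exact: row_sub.
have [aw bw] := (kv w).1 wk.
have xw : indep x w by apply: indepP => //; exact/negP.
exists w; split=> // v av bv; have : (v <= col_mx x w)%MS.
  apply: submx_trans (_ : kermx A <= col_mx x w)%MS; first exact/kv.
  have H : (col_mx x w <= kermx A)%MS by rewrite col_mx_sub xk.
  by have [_] := mxrank_leqif_eq H; rewrite rT (eqP (indep_row_free xw)) eqxx => /esym /andP[].
move=> /submxP[c ->]; exists (lsubmx c 0 0), (rsubmx c 0 0).
rewrite -{1}[c]hsubmxK mul_row_col {1}[lsubmx c]mx11_scalar {1}[rsubmx c]mx11_scalar.
by rewrite !mul_scalar_mx.
Qed.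

(** The common kernel of [a] and [b] is a plane through [x]; a covector that kills [x] but not this
    plane will do. It becomes a uniformizer at a smooth point. *)
Lemma local_parameter (a b x : 'rV[K]_4) : indep a b -> x != 0 -> dot a x = 0 -> dot b x = 0 ->
  exists u, dot u x = 0 /\
    forall v, dot a v = 0 -> dot b v = 0 -> dot u v = 0 -> (v <= x)%MS.
Proof.
move=> ab x0 ax bx; have [w [aw bw xw Hw]] := kernel2 ab x0 ax bx.
have [u [ux uw]] := dual_pair xw; exists u; split=> // v av bv.
have [s [t ->]] := Hw v av bv; rewrite dotDr !dotZr ux uw mulr0 add0r mulr1 => ->.
by rewrite scale0r addr0 scalemx_sub.
Qed.

Lemma kernel3 (a b u x : 'rV[K]_4) : indep a b -> x != 0 -> dot a x = 0 -> dot b x = 0 ->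
  dot u x = 0 -> (forall s t, u <> s *: a + t *: b) ->
  forall v, dot a v = 0 -> dot b v = 0 -> dot u v = 0 -> (v <= x)%MS.
Proof.
move=> ab x0 ax bx ux nu v av bv uv; have [w [aw bw xw Hw]] := kernel2 ab x0 ax bx.
apply: contrapT => nv; have [s [t Ev]] := Hw v av bv.
have t0 : t != 0 by apply: contra_notN nv => /eqP t0; rewrite Ev t0 scale0r addr0 scalemx_sub.
have uw : dot u w = 0.
  by move: uv; rewrite Ev dotDr !dotZr ux mulr0 add0r => /eqP; rewrite mulf_eq0 (negbTE t0) => /eqP.
have [|s' [t' E]] := span_dual (a := a) (b := b) (u := u); last exact: nu E.
move=> v' av' bv'; have [s' [t' ->]] := Hw v' av' bv'.
by rewrite dotDr !dotZr ux uw !mulr0 addr0.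
Qed.

Lemma cramer3 (g0 g1 g2 : {mpoly K[4]}) x f : x != 0 -> on_line g0 x -> on_line g1 x -> on_line g2 x ->
  (forall v, differential g0 x v = 0 -> differential g1 x v = 0 -> differential g2 x v = 0 ->
     (v <= x)%MS) -> on_line f x ->
  exists s c0 c1 c2, eval_at s x != 0 /\ s * f = c0 * g0 + c1 * g1 + c2 * g2.
Proof.
move=> x0 H0 H1 H2 ker fx.
have [||s [c [sx E]]] := cramer unc (g := fun i : 'I_3 => nth 0 [:: g0; g1; g2] i) x0 _ _ fx.
- by case=> [[|[|[|]]]].
- move=> v Hv; apply: ker; [exact: (Hv ord0)|exact: (Hv (Ordinal (isT : (1 < 3)%N)))|].
  exact: (Hv (Ordinal (isT : (2 < 3)%N))).
exists s, (c ord0), (c (Ordinal (isT : (1 < 3)%N))), (c (Ordinal (isT : (2 < 3)%N))); split=> //.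
rewrite E !big_ord_recl big_ord0 addr0 addrA /=.
by congr (_ + c _ * _ + c _ * _); apply: val_inj.
Qed.

Lemma binary_zero (b : {mpoly K[2]}) e : b \is e.-homog -> (0 < e)%N ->
  exists2 y : 'rV[K]_2, y != 0 & eval_at b y = 0.
Proof.
move=> hb e0; pose pt (u v : K) : 'rV[K]_2 := \row_i if i == 0 then u else v.
have pt0 u v : (u != 0) || (v != 0) -> pt u v != 0.
  apply: contraTneq => /rowP H; have := H 0; have := H 1; rewrite !mxE /= => -> ->.
  by rewrite eqxx.
have ptZ c u v : c *: pt u v = pt (c * u) (c * v).
  by apply/rowP => i; rewrite !mxE; case: ifP.
pose q := mmap (@polyC K) (fun i : 'I_2 => if i == 0 then 'X else 1) b.
have qE z : q.[z] = eval_at b (pt z 1).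
  rewrite /q; elim/mpoly_ring_ind: (b) => [c|i|f g Hf Hg|f g Hf Hg]; rewrite evE.
  - by rewrite mmapC hornerC.
  - by rewrite mmapX mmap1U mxE; case: ifP => _; rewrite ?hornerX ?hornerC.
  - by rewrite mmapD hornerD Hf Hg.
  - by rewrite rmorphM hornerM Hf Hg.
have [s1|/closed_rootP[z /eqP Hz]] := boolP (size q == 1%N); last first.
  by exists (pt z 1); [apply: pt0; rewrite oner_neq0 orbT|rewrite -qE].
have [b0|b0] := eqVneq (eval_at b (pt 1 0)) 0.
  by exists (pt 1 0) => //; apply: pt0; rewrite oner_neq0.
have /size1_polyC Eq : (size q <= 1)%N by rewrite (eqP s1).
have q1 z : eval_at b (pt z 1) = q`_0 by rewrite -qE Eq hornerC coefC.
have q0 : q`_0 != 0.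
  by apply: contraTneq s1 => z; rewrite Eq z polyC0 size_poly0.
pose q' := mmap (@polyC K) (fun i : 'I_2 => if i == 0 then 1 else 'X) b.
have qE' z : q'.[z] = eval_at b (pt 1 z).
  rewrite /q'; elim/mpoly_ring_ind: (b) => [c|i|f g Hf Hg|f g Hf Hg]; rewrite evE.
  - by rewrite mmapC hornerC.
  - by rewrite mmapX mmap1U mxE; case: ifP => _; rewrite ?hornerX ?hornerC.
  - by rewrite mmapD hornerD Hf Hg.
  - by rewrite rmorphM hornerM Hf Hg.
have E z : z != 0 -> eval_at b (pt 1 z) = z ^+ e * q`_0.
  move=> z0; rewrite -(q1 z^-1) -(eval_scale _ _ hb) ptZ mulfV // mulr1 //.
have [s2|/closed_rootP[z /eqP Hz]] := boolP (size q' == 1%N); last first.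
  by exists (pt 1 z); [apply: pt0; rewrite oner_neq0|rewrite -qE'].
have /size1_polyC Eq' : (size q' <= 1)%N by rewrite (eqP s2).
have q'1 z : eval_at b (pt 1 z) = q'`_0 by rewrite -qE' Eq' hornerC coefC.
(* Both charts being constant, [z ^+ e] would be constant off 0; the values at 1 and 2 contradict
   [e > 0]. *)
have := E 2%:R; rewrite q'1 -(q'1 1) (E 1) ?oner_neq0 ?pnatr_eq0 // expr1n => /(_ isT) /(mulIf q0).
rewrite -natrX => /esym/eqP; rewrite pnatr_eq1 => /eqP H.
by have := ltn_expl e (isT : (1 < 2)%N); rewrite H ltnS leqn0 eqn0Ngt e0.
Qed.
End LinearAlgebra.

(** * The ideal of a curve with isolated nodes *)

Section Curve.
Variable K : numClosedFieldType.
Hypothesis unc : ~ countable [set: K].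
Local Notation P := {mpoly K[4]}.
Local Notation P2 := {mpoly K[2]}.
Implicit Types (f g h s : P) (b : P2) (x q : 'rV[K]_4).

Local Notation j0 := (inord 0 : 'I_4).
Local Notation j1 := (inord 1 : 'I_4).

Lemma homog0_const n (f : {mpoly K[n]}) : f \is 0.-homog -> f = (f@_0%MM)%:MP.
Proof.
move=> hf; apply: msize1_polyC; rewrite msizeE; apply/bigmax_leqP_seq => m mf _.
by have -> : mdeg m = 0%N := dhomog_mf hf mf.
Qed.

Lemma poly_nonroot (p : {poly K}) : p != 0 -> exists c, p.[c] != 0.
Proof.
move=> p0; have [|c] := monic_nonroot (p := (lead_coef p)^-1 *: p).
  by rewrite monicE lead_coefZ mulVf // lead_coef_eq0.
by rewrite hornerZ => Hc; exists c; apply: contraNneq Hc => ->; rewrite mulr0.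
Qed.

(** The values along a line through the vertex form a polynomial in the scale, with the values of
    the components as coefficients. The hypothesis excludes the scale 0, hence the factor ['X] in
    the proof. *)
Lemma vanishing_pihomog m (f : {mpoly K[m]}) (y : 'rV[K]_m) :
  (forall a, a != 0 -> eval_at f (a *: y) = 0) -> forall e, eval_at (pihomog mdeg e f) y = 0.
Proof.
move=> Hf e; pose p : {poly K} := \poly_(i < msize f) eval_at (pihomog mdeg i f) y.
have p0 : p = 0.
  apply/eqP/negPn/negP => pn0; have [|c] := @poly_nonroot ('X * p).
    by rewrite mulf_neq0 // polyX_eq0.
  rewrite hornerM hornerX mulf_eq0 negb_or => /andP[c0]; rewrite horner_poly => /eqP; apply.
  transitivity (eval_at f (c *: y)); last exact: Hf.
  transitivity (eval_at (\sum_(i < msize f) pihomog mdeg i f) (c *: y)); last first.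
    by rewrite -pihomog_partitionE.
  rewrite eval_at_sum; apply: eq_bigr => i _.
  by rewrite (eval_scale _ _ (pihomogP _ _ _)) mulrC.
have [ef|ef] := ltnP e (msize f).
  by have := congr1 (fun q : {poly K} => q`_e) p0; rewrite coef_poly ef coef0.
rewrite (_ : pihomog mdeg e f = 0) ?evE // pihomogE big_seq_cond big1 // => k /andP[kf /eqP ke].
by have := msize_mdeg_lt kf; rewrite ke ltnNge ef.
Qed.

(** The linear form on [P^1] whose zero is the point [y]; pulled back, it is the member of the
    pencil lying over [y]. *)
Definition blin (y : 'rV[K]_2) : P2 := y 0 1 *: 'X_0 - y 0 0 *: 'X_1.

Lemma binary_div b e y : b \is e.-homog -> y != 0 -> eval_at b y = 0 ->
  exists2 b', b' \is e.-1.-homog & b = blin y * b'.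
Proof.
move=> hb y0 by0; suff [c Ec] : exists c, b = c * blin y.
  have hl : blin y \is 1.-homog by apply: rpredB; apply: rpredZ; exact: X_homog.
  case: e hb => [|e] hb.
    exists 0; first exact: dhomog0.
    by rewrite mulr0; move: by0; rewrite (homog0_const hb) evE => ->.
  exists (pihomog mdeg e c); first exact: pihomogP.
  by have := pihomogMr e c hl; rewrite addn1 -Ec (pihomog_dE hb) mulrC.
have /rV0Pn[i yi] := y0.
have [c ->] := line_ideal unc yi (homog_on_line hb by0); rewrite big_ord_recl big_ord0 addr0.
have [i0|i1] : i = 0 \/ i = 1 by case: i {yi} => [[|[|//]] Hi]; [left|right]; apply: val_inj.
  exists (- c ord0); rewrite i0 (_ : lift 0 ord0 = 1) ?/blin; last exact: val_inj.
  ring.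
exists (c ord0); rewrite i1 (_ : lift 1 ord0 = 0) //; exact: val_inj.
Qed.

(** Binary forms split into linear factors, so assertions about the pullback of [b] reduce to
    constants and to members of the pencil. *)
Lemma binary_ind (Q : P2 -> Prop) : (forall c, c != 0 -> Q c%:MP) ->
  (forall y b, y != 0 -> Q b -> Q (blin y * b)) -> forall e b, b \is e.-homog -> b != 0 -> Q b.
Proof.
move=> Q0 QS; elim=> [b hb b0|e IH b hb b0].
  by rewrite (homog0_const hb); apply: Q0; apply: contraNneq b0 => z; rewrite (homog0_const hb) z.
have [//|y y0 by0] := binary_zero hb.
have [b' hb' E] := binary_div hb y0 by0; rewrite E; apply: QS => //.
by apply: IH => //; apply: contraNneq b0 => z; rewrite E z mulr0.
Qed.

Lemma binary_factor e b y : b \is e.-homog -> b != 0 -> y != 0 ->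
  exists k c, b = blin y ^+ k * c /\ eval_at c y != 0.
Proof.
move=> + + y0; elim: e b => [b hb b0|e IH b hb b0].
  exists 0%N, b; split; first by rewrite expr0 mul1r.
  by rewrite (homog0_const hb) evE; apply: contraNneq b0 => z; rewrite (homog0_const hb) z.
have [by0|] := eqVneq (eval_at b y) 0; last by exists 0%N, b; rewrite expr0 mul1r.
have [b' hb' E] := binary_div hb y0 by0.
have [|k [c [Ec cy]]] := IH b' hb'; first by apply: contraNneq b0 => z; rewrite E z mulr0.
by exists k.+1, c; split=> //; rewrite E Ec exprS mulrA.
Qed.

Section Package.
Variables (F G : P) (d n : nat) (N : 'M[K]_4) (p3 : 'rV[K]_4).
Hypothesis (uN : N \in unitmx).
Hypothesis (d0 : (0 < d)%N) (n0 : (0 < n)%N) (hF : F \is d.-homog) (hG : G \is n.-homog).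
Hypothesis (p3N : p3 *m N = e3 K) (Fp3 : eval_at F p3 != 0).
Hypothesis Hz : forall x, eval_at (el N j0) x = 0 -> eval_at (el N j1) x = 0 ->
  eval_at F x = 0 -> eval_at G x = 0 -> x = 0.
Variable io : {rmorphism P2 -> P}.
Hypothesis (ioC : forall c, io c%:MP = c%:MP) (ioX : forall i : 'I_2, io 'X_i = el N (inord i)).
Hypothesis ioI : forall b, io b = 0 -> b = 0.
Local Notation I := (idl [:: F; G]).
Hypothesis ioint : forall f, exists2 chi : {poly P2}, chi \is monic & I ((map_poly io chi).[f]).
Let HI : is_ideal I. Proof. exact: is_ideal_idl. Qed.

Definition base x : 'rV[K]_2 := \row_i eval_at (el N (inord i)) x.

Lemma eval_io b x : eval_at (io b) x = eval_at b (base x).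
Proof.
elim/mpoly_ring_ind: b => [c|i|f g Hf Hg|f g Hf Hg].
- by rewrite ioC !evE.
- by rewrite ioX evE mxE.
- by rewrite rmorphD !evE Hf Hg.
- by rewrite rmorphM !evE Hf Hg.
Qed.

Lemma base0 x : x != 0 -> eval_at F x = 0 -> eval_at G x = 0 -> base x != 0.
Proof.
move=> + Fx Gx; apply: contraNneq => /rowP b0; apply/eqP/Hz => //.
  by have := b0 0; rewrite !mxE /=.
by have := b0 1; rewrite !mxE /=.
Qed.

Lemma io_blin y : io (blin y) = pencil N (y 0 1) (- y 0 0).
Proof.
rewrite /blin /pencil -!mul_mpolyC rmorphB !rmorphM !ioC !ioX /= mpolyCN mulNr //.
Qed.

Lemma io_homog b e : b \is e.-homog -> io b \is e.-homog.
Proof.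
move=> hb; rewrite [b]mpolyE rmorph_sum /= big_seq; apply: rpred_sum => k kf.
rewrite -mul_mpolyC rmorphM ioC mul_mpolyC; apply: rpredZ.
rewrite -(dhomog_mf hb kf : mdeg k = e) mpolyXE_id rmorph_prod mdegE.
elim/big_rec2: _ => [|i m p _ IH]; first exact: dhomog1.
rewrite rmorphXn ioX; apply: dhomogM => //.
by have := dhomogMn (k i) (el_homog N (inord i)); rewrite mul1n.
Qed.

Lemma io_pihomog b e : pihomog mdeg e (io b) = io (pihomog mdeg e b).
Proof.
elim/mpolyind: b => [|c m p _ _ IH]; first by rewrite pihomog0 !rmorph0 pihomog0.
rewrite rmorphD !pihomogD IH rmorphD; congr (_ + _).
rewrite -mul_mpolyC rmorphM ioC !mul_mpolyC !linearZ /= pihomogX.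
have hm : io 'X_[m] \is (mdeg m).-homog by apply: io_homog; rewrite dhomogX.
case: eqP => [<-|/eqP ne]; first by rewrite pihomog_dE // -!mul_mpolyC rmorphM ioC.
by rewrite (pihomog_ne0 ne hm) !scaler0 rmorph0.
Qed.

Lemma Ihom f e : I f -> I (pihomog mdeg e f).
Proof. by apply: idl_pihomog => g; rewrite !inE => /orP[] /eqP ->; eexists; eassumption. Qed.

Lemma blin_nzd y f : y != 0 -> I (io (blin y) * f) -> I f.
Proof.
move=> y0; rewrite io_blin; apply: (pencil_nzd unc uN d0 hF hG p3N Fp3 Hz).
rewrite oppr_eq0 -negb_and; apply: contraNN y0 => /andP[/eqP y1 /eqP yy0].
apply/eqP/rowP => i; rewrite mxE; have [->|->] // : i = 0 \/ i = 1.
by case: i => [[|[|//]] Hi]; [left|right]; apply: val_inj.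
Qed.

Lemma io_nzd b e f : b \is e.-homog -> b != 0 -> I (io b * f) -> I f.
Proof.
move=> hb b0; move: f; pose Q b := forall f, I (io b * f) -> I f.
apply: (binary_ind (Q := Q) _ _ hb b0) => [c c0 f|y b' y0 Qb' f].
  rewrite ioC => H; apply: (idl1 (a := c^-1%:MP) HI H).
  by rewrite mulrA -rmorphM mulVf // rmorph1 mul1r.
by rewrite rmorphM -mulrA => /(blin_nzd y0); exact: Qb'.
Qed.

Lemma integral_homog f m : f \is m.-homog -> exists r (b : nat -> P2),
  [/\ b r = 1, forall i, (i <= r)%N -> b i \is ((r - i) * m).-homog &
      I (\sum_(i < r.+1) io (b i) * f ^+ i)].
Proof.
move=> hf; have [chi mchi] := ioint f.
have s0 : (0 < size chi)%N by rewrite size_poly_gt0 monic_neq0.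
pose r := (size chi).-1; have sr : size chi = r.+1 by rewrite /r prednK.
rewrite /map_poly horner_poly sr => /(@Ihom _ (r * m)) H.
exists r, (fun i => pihomog mdeg ((r - i) * m) chi`_i); split.
- rewrite subnn mul0n; move/monicP: mchi; rewrite lead_coefE -/r => ->.
  by rewrite pihomog_dE //; exact: dhomog1.
- by move=> i _; exact: pihomogP.
apply: (idl1 (a := 1) HI H); rewrite mul1r linear_sum /=; apply: eq_bigr => i _.
have ir : (i <= r)%N by rewrite -ltnS.
have hfi : f ^+ i \is (i * m).-homog by rewrite mulnC; exact: dhomogMn.
have -> : (r * m = (r - i) * m + i * m)%N by rewrite -mulnDl subnK.
by rewrite (pihomogMr _ _ hfi) io_pihomog.
Qed.

Variable qs : seq 'rV[K]_4.
Definition isnode x : Prop := exists2 q, q \in qs & (x <= q)%MS.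
Hypothesis Hreg : forall x, x != 0 -> eval_at F x = 0 -> eval_at G x = 0 -> ~ isnode x ->
  indep (grad F x) (grad G x).

Lemma gradx f m x : f \is m.-homog -> eval_at f x = 0 -> dot (grad f x) x = 0.
Proof. by move=> hf fx; rewrite -differential_dot (euler _ hf) fx mulr0. Qed.

Lemma grad_lin (a : 'rV[K]_4) x : grad (lin a) x = a.
Proof.
apply/eqP; rewrite -subr_eq0; apply/eqP/dot_eq0 => v.
by rewrite dotDl -scaleN1r dotZl -differential_dot df_lin eval_lin_dot mulN1r subrr.
Qed.

(** Bertini: a member whose parameter is moved by a derivation of [K] killing the
    coefficients of [F], [G] and of the pencil is transversal to the curve. *)
Lemma transversal_member : exists t, forall y, y != 0 -> eval_at F y = 0 -> eval_at G y = 0 ->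
  eval_at (pencil N t 1) y = 0 ->
  forall v, differential F y v = 0 -> differential G y v = 0 ->
    differential (pencil N t 1) y v = 0 -> (v <= y)%MS.
Proof.
pose c (f : P) : seq K := [seq f@_m | m <- msupp f].
have cP D f : is_der D -> (forall z, z \in c f -> D z = 0) -> forall m, D f@_m = 0.
  move=> dD H m; have [/map_f mf|/memN_msupp_eq0 ->] := boolP (m \in msupp f); last exact: der0.
  by apply: H; exact: mf.
(* The coordinates of the nodes are among the constants, so that [D] fixes the nodes. *)
pose C := c F ++ c G ++ c (el N j0) ++ c (el N j1) ++ flatten [seq [seq q 0 i | i <- enum 'I_4] | q : 'rV[K]_4 <- qs].
have [D [t [dD HD Dt]]] := der_exists unc C.
have HDF := cP D F dD (fun z Hz => HD z _).
have DF m : D F@_m = 0 by apply: cP => // z zc; apply: HD; rewrite !mem_cat zc ?orbT.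
have DG m : D G@_m = 0 by apply: cP => // z zc; apply: HD; rewrite !mem_cat zc ?orbT.
have D0 m : D (el N j0)@_m = 0 by apply: cP => // z zc; apply: HD; rewrite !mem_cat zc ?orbT.
have D1 m : D (el N j1)@_m = 0 by apply: cP => // z zc; apply: HD; rewrite !mem_cat zc ?orbT.
have Dq q : q \in qs -> map_mx D q = 0.
  move=> qq; apply/rowP => i; rewrite !mxE; apply: HD; rewrite !mem_cat; apply/orP; right.
  apply/orP; right; apply/orP; right; apply/orP; right; apply/flattenP.
  by exists [seq q 0 i | i <- enum 'I_4]; apply: map_f; rewrite ?mem_enum.
exists t => y y0 Fy Gy uy.
have Du : eval_at (el N j0) y + differential (pencil N t 1) y (map_mx D y) = 0.
  have := congr1 D uy; rewrite (der0 dD) /pencil !evE dD.1 !dD.2 Dt (der1 dD).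
  by rewrite !(der_eval dD) // !dfE; move=> <-; ring.
have contra : eval_at (el N j0) y = 0 -> False.
  move=> z; move: uy; rewrite /pencil !evE z mulr0 add0r mul1r => z1.
  by move: y0; rewrite (Hz z z1 Fy Gy) eqxx.
(* At a node only the parameter moves, so the differentiated equation says that [el N j0] vanishes
   there, which [contra] excludes. *)
have nn : ~ isnode y.
  case=> q qq /sub_rVP[k yk]; have k0 : k != 0 by apply: contraNneq y0 => k0; rewrite yk k0 scale0r.
  apply: contra; have uq : eval_at (pencil N t 1) q = 0.
    have hu : pencil N t 1 \is 1.-homog by apply: rpredD; apply: rpredZ; exact: el_homog.
    by move: uy; rewrite yk (eval_scale _ _ hu) expr1 => /eqP; rewrite mulf_eq0 (negbTE k0) => /eqP.
  have := congr1 D uq; rewrite (der0 dD) /pencil !evE dD.1 !dD.2 Dt (der1 dD).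
  rewrite !(der_eval dD) // Dq // !df0v yk (eval_scale _ _ (el_homog N j0)) => E.
  by rewrite (_ : eval_at (el N j0) q = 0) ?mulr0 // -[RHS]E; ring.
pose u := t *: (\row_k N k j0) + 1 *: (\row_k N k j1).
have Eu : pencil N t 1 = lin u by rewrite /pencil /el -!linZ -linD.
move=> v; rewrite !differential_dot Eu grad_lin.
apply: kernel3 => //.
- exact: Hreg.
- exact: gradx hF Fy.
- exact: gradx hG Gy.
- by rewrite -eval_lin_dot -Eu.
(* If the differential of the member were a combination of those of [F] and [G], it would vanish on
   [map_mx D y], because [F] and [G] are 0 at [y]; then [Du] contradicts [contra]. *)
move=> s t' E; apply: contra; rewrite -[RHS]Du -[LHS]addr0; congr (_ + _).
rewrite Eu differential_dot grad_lin E dotDl !dotZl -!differential_dot -!der_eval // Fy Gy.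
by rewrite (der0 dD) !mulr0 addr0.
Qed.

(** The transversal member [u] cuts the curve in reduced points, so the ideal of [F], [G] and [u] is
    radical ([key]). Hence [f] is [f1 u] modulo the ideal with [f1] of smaller degree, the same
    power of [f1] lies in the ideal after cancelling [u], and induction on the degree applies. *)
Lemma reduced_homog f e k : f \is e.-homog -> I (f ^+ k) -> I f.
Proof.
have [t Ht] := transversal_member; set u := pencil N t 1 in Ht.
have dt : t * 0 - 1 * 1 != 0 :> K by rewrite mulr0 mulr1 sub0r oppr_eq0 oner_neq0.
have [] := pencil_regular unc uN d0 hF hG p3N Fp3 Hz dt; rewrite -/u => r0 r1.
have HJ3 : is_ideal (adj I u) by exact: is_ideal_adj.
have VJ3 g y : adj I u g -> eval_at F y = 0 -> eval_at G y = 0 -> eval_at u y = 0 -> eval_at g y = 0.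
  move=> Hg Fy Gy uy; apply: (@idl_zero _ _ [:: u; F; G]) Hg => g'.
  by rewrite !inE => /or3P[] /eqP ->.
have hu : u \is 1.-homog by apply: rpredD; apply: rpredZ; exact: el_homog.
have key f' k' : adj I u (f' ^+ k') -> adj I u f'.
  move=> Hk; pose J : set P := [set s | adj I u (s * f')].
  have HJ : is_ideal J.
    split=> [|s s' Hs Hs'|s s' Hs']; rewrite /J /=.
    - by rewrite mul0r; case: HJ3.
    - by rewrite mulrDl; have [_ + _] := HJ3; exact.
    - by rewrite -mulrA; have [_ _ +] := HJ3; exact.
  have JJ g : adj I u g -> J g.
    by move=> Hg; rewrite /J /= mulrC; have [_ _ +] := HJ3; exact.
  have V y : (forall g, J g -> eval_at g y = 0) -> y = 0.
    move=> Hy; apply/eqP; apply: contraT => y0.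
    have HyJ g : adj I u g -> eval_at g y = 0 by move=> /JJ; exact: Hy.
    have Fy : eval_at F y = 0 by apply: HyJ; apply: adj_sub; apply: idl_mem; rewrite inE eqxx.
    have Gy : eval_at G y = 0 by apply: HyJ; apply: adj_sub; apply: idl_mem; rewrite !inE eqxx orbT.
    have uy : eval_at u y = 0 by apply: HyJ; exact: adj_in.
    have f'y : on_line f' y.
      move=> a; have := VJ3 _ (a *: y) Hk (homog_on_line hF Fy a) (homog_on_line hG Gy a) (homog_on_line hu uy a).
      by rewrite eval_atXn => /eqP; rewrite expf_eq0 => /andP[_ /eqP].
    have [s [c0 [c1 [c2 [sy E]]]]] := cramer3 unc y0 (homog_on_line hF Fy) (homog_on_line hG Gy)
      (homog_on_line hu uy) (Ht y y0 Fy Gy uy) f'y.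
    case/eqP: sy; apply: Hy; rewrite /J /= E; exists c2; apply/idl2P; exists c0, c1; ring.
  have [m Hm] : exists m, J (pencil N 1 0 ^+ m).
    apply: (nullstellensatz unc HJ) => y /V ->; rewrite /pencil !evE !eval_el !mul0mx !mxE.
    by rewrite !mulr0 addr0.
  elim: m Hm => [|m IH]; first by rewrite /J /= expr0 mul1r.
  by rewrite /J /= exprS -mulrA => /r1.
elim: e f k => [|e IH] f k hf Hk.
  have Ef := homog0_const hf; rewrite Ef in Hk *.
  have : eval_at ((f@_0%MM)%:MP ^+ k) (0 : 'rV[K]_4) = 0.
    apply: (@idl_zero _ _ [:: F; G]) Hk => g; rewrite !inE => /orP[] /eqP ->.
      exact: eval_homog0 hF d0.
    exact: eval_homog0 hG n0.
  rewrite !evE => /eqP; rewrite expf_eq0 => /andP[_ /eqP ->]; rewrite mpolyC0; by case: HI.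
have [f1 Hf1] : adj I u f by apply: (key _ k); exact: adj_sub.
pose f1' := pihomog mdeg e f1; have hf1 : f1' \is e.-homog by exact: pihomogP.
have Hf1' : I (f - f1' * u).
  have := Ihom (e + 1) Hf1; rewrite linearB /= (pihomogMr _ _ hu) addn1 pihomog_dE //.
suff : I f1' by move=> H; apply: (idlc (a := 1) (b := u) HI Hf1' H); ring.
apply: (IH _ k) => //.
have r0n : forall m h, I (u ^+ m * h) -> I h.
  by elim=> [h|m IHm h]; rewrite ?expr0 ?mul1r // exprS -mulrA => /r0; exact: IHm.
apply: (r0n k); rewrite -exprMn mulrC.
have [w Hw] : exists w, f ^+ k - (f1' * u) ^+ k = w * (f - f1' * u).
  by exists (\sum_(i < k) f ^+ (k.-1 - i) * (f1' * u) ^+ i); rewrite subrXX mulrC.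
by apply: (idlc (a := 1) (b := - w) HI Hk Hf1'); rewrite -[_ ^+ k in LHS](subKr (f ^+ k)) Hw; ring.
Qed.

Lemma vanishing_curve f : (forall x, x != 0 -> eval_at F x = 0 -> eval_at G x = 0 -> eval_at f x = 0) ->
  I f.
Proof.
move=> Hf; have -> : f = \sum_(e < msize f) pihomog mdeg e f by rewrite -pihomog_partitionE.
apply: idl_sum => // e _; set fe := pihomog mdeg e f.
have hfe : fe \is e.-homog by exact: pihomogP.
have fe0 x : x != 0 -> eval_at F x = 0 -> eval_at G x = 0 -> eval_at fe x = 0.
  move=> x0 Fx Gx; apply: vanishing_pihomog => a a0.
  apply: Hf; first by rewrite scaler_eq0 negb_or a0.
    exact: homog_on_line hF Fx a.
  exact: homog_on_line hG Gx a.
(* The factor [el N j0] ensures vanishing at the vertex also when [fe] is a constant; being a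
   nonzerodivisor, it is removed at the end. *)
have [k Hk] : exists k, I ((el N j0 * fe) ^+ k).
  apply: (nullstellensatz unc HI) => y Hy; have [->|y0] := eqVneq y 0.
    by rewrite evE eval_el mul0mx mxE mul0r.
  rewrite evE fe0 ?mulr0 //; by apply: Hy; apply: idl_mem; rewrite !inE eqxx ?orbT.
have h1 : el N j0 * fe \is (1 + e).-homog by apply: dhomogM => //; exact: el_homog.
exact: (regular_el0 unc uN d0 hF hG p3N Fp3 Hz (reduced_homog h1 Hk)).
Qed.

End Package.
End Curve.

(** * Branches at a node *)

Section Branch.
Variables (K : numClosedFieldType) (n : nat).
Local Notation P := {mpoly K[n.+1]}.
Implicit Types (f F G : P) (q w v : 'rV[K]_n.+1).

(** Restriction to an arc with polynomial coordinates. Such arcs, satisfying the equations to any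
    prescribed order, stand for the formal branches of the curve. *)
Definition pev (x : 'I_n.+1 -> {poly K}) : {rmorphism P -> {poly K}} := mmap (@polyC K) x.

Lemma pevC q f : mmap (@polyC K) (fun i => (q 0 i)%:P) f = (eval_at f q)%:P.
Proof.
elim/mpoly_ring_ind: f => [c|i|f g Hf Hg|f g Hf Hg]; rewrite evE.
- by rewrite mmapC.
- by rewrite mmapX mmap1U.
- by rewrite mmapD polyCD Hf Hg.
- by rewrite rmorphM /= polyCM Hf Hg.
Qed.

Definition germ q w (x : 'I_n.+1 -> {poly K}) : Prop :=
  exists c : 'I_n.+1 -> {poly K}, forall i, x i = (q 0 i)%:P + 'X * ((w 0 i)%:P + 'X * c i).

Lemma pev_germ q w x f : germ q w x ->
  exists c, pev x f = (eval_at f q)%:P + 'X * ((differential f q w)%:P + 'X * c).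
Proof.
move=> [c Hc]; have [c' Ec'] := taylor1 (@polyC K) f (fun i => (q 0 i)%:P)
  (fun i => (w 0 i)%:P + 'X * c i) 'X.
exists (\sum_i (eval_at f^`M(i) q)%:P * c i + c'); rewrite /pev /=.
have -> : mmap (@polyC K) x f =
    mmap (@polyC K) (fun i => (q 0 i)%:P + 'X * ((w 0 i)%:P + 'X * c i)) f.
  by apply: eq_bigr => m _; congr (_ * _); apply: mmap1_eq => i; exact: Hc.
rewrite Ec' pevC.
have -> : \sum_i mmap (@polyC K) (fun j => (q 0 j)%:P) f^`M(i) * ((w 0 i)%:P + 'X * c i) =
    (differential f q w)%:P + 'X * \sum_i (eval_at f^`M(i) q)%:P * c i.
  rewrite rmorph_sum mulr_sumr -big_split; apply: eq_bigr => i _ /=.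
  by rewrite pevC mulrDr polyCM; ring.
ring.
Qed.

Definition hess f q v w : K := \sum_i w 0 i * differential f^`M(i) q v.

Lemma hessDr f q v w w' : hess f q v (w + w') = hess f q v w + hess f q v w'.
Proof. by rewrite -big_split; apply: eq_bigr => i _ /=; rewrite mxE mulrDl. Qed.
Lemma hessZr f q v w c : hess f q v (c *: w) = c * hess f q v w.
Proof. by rewrite mulr_sumr; apply: eq_bigr => i _; rewrite mxE mulrA. Qed.

Lemma hessC f q v w : hess f q v w = hess f q w v.
Proof.
rewrite /hess /differential.
under eq_bigr => i _ do rewrite mulr_sumr.
under [RHS]eq_bigr => i _ do rewrite mulr_sumr.
rewrite exchange_big; apply: eq_bigr => i _; apply: eq_bigr => j _ /=.
by rewrite mderiv_comm; ring.
Qed.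

Lemma deriv_pev x f : (pev x f)^`() = \sum_i pev x f^`M(i) * (x i)^`().
Proof.
rewrite /pev /=; elim/mpoly_ring_ind: f => [c|i|f g Hf Hg|f g Hf Hg].
- by rewrite mmapC derivC big1 // => i _; rewrite mderivC mmap0 mul0r.
- rewrite mmapX mmap1U (bigD1 i) //= big1 => [|j ji].
    rewrite addr0 mderivX mnm1E eqxx -[X in (X - _)%MM]add0m addmK mpolyX0 scale1r.
    by rewrite rmorph1 mul1r.
  by rewrite mderivX mnm1E eq_sym (negbTE ji) scale0r mmap0 mul0r.
- rewrite mmapD derivD Hf Hg -big_split; apply: eq_bigr => i _ /=.
  by rewrite mderivD mmapD mulrDl.
- rewrite rmorphM /= derivM Hf Hg mulr_suml mulr_sumr -big_split; apply: eq_bigr => i _ /=.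
  by rewrite mderivM mmapD !rmorphM /=; ring.
Qed.

Lemma poly_split (p : {poly K}) : exists (c : K) (r : {poly K}), p = c%:P + 'X * r.
Proof.
elim/poly_ind: p => [|p c _]; first by exists 0, 0; rewrite polyC0 mulr0 addr0.
by exists c, p; rewrite addrC mulrC.
Qed.

Lemma pev_diff_germ q w x f v : germ q w x -> exists c,
  \sum_i pev x f^`M(i) * (v 0 i)%:P = (differential f q v)%:P + 'X * ((hess f q w v)%:P + 'X * c).
Proof.
move=> gx; have /choice[c Hc] := fun i => pev_germ f^`M(i) gx.
exists (\sum_i c i * (v 0 i)%:P); rewrite /hess /differential !rmorph_sum /= mulr_sumr -big_split.
rewrite mulr_sumr -big_split; apply: eq_bigr => i _ /=; rewrite Hc !polyCM; ring.
Qed.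

Section BranchAt.
Variables (F G : P) (q w w' e : 'rV[K]_n.+1).
Hypothesis (Fq : eval_at F q = 0) (Fw : differential F q w = 0) (Fw' : differential F q w' = 0).
Hypothesis (Fe : differential F q e != 0) (Gq : eval_at G q = 0).
Hypothesis (Gv : forall v, differential G q v = 0) (Gww : hess G q w w = 0) (Gww' : hess G q w w' != 0).

(** Newton's method: a simple tangent direction [w] at a double point of the curve
    [F = G = 0] on the smooth hypersurface [F = 0] integrates to a formal branch. *)
Lemma branch_step r x A B : germ q w x -> pev x F = 'X^(r.+2) * A -> pev x G = 'X^(r.+3) * B ->
  exists v : 'rV[K]_n.+1, let x' i := x i + 'X^(r.+2) * (v 0 i)%:P in
    (exists a, pev x' F = 'X^(r.+3) * a) /\ exists b, pev x' G = 'X^(r.+4) * b.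
Proof.
move=> gx EA EB.
have [A0 [A1 EA0]] := poly_split A; have [B0 [B1 EB0]] := poly_split B.
(* [ga] corrects the leading term of [F] in the direction [e]. As all first derivatives of [G]
   vanish at [q], its leading term is corrected through the Hessian, by [al] along [w']. *)
pose ga := - A0 / differential F q e.
pose al := - (B0 + ga * hess G q w e) / hess G q w w'.
pose v := al *: w' + ga *: e.
have Fv : A0 + differential F q v = 0 by rewrite /v !dfvE Fw' mulr0 add0r /ga divfK // subrr.
have hv : B0 + hess G q w v = 0.
  by rewrite /v hessDr !hessZr /al divfK //; ring.
pose x' i := x i + 'X^(r.+2) * (v 0 i)%:P.
exists v; rewrite -/x'; have [cF EF] := taylor1 (@polyC K) F x (fun i => (v 0 i)%:P) 'X^(r.+2).
have [cG EG] := taylor1 (@polyC K) G x (fun i => (v 0 i)%:P) 'X^(r.+2).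
have [dF EdF] := pev_diff_germ F v gx; have [dG EdG] := pev_diff_germ G v gx.
split.
- exists (A1 + (hess F q w v)%:P + 'X * dF + 'X^(r.+1) * cF).
  rewrite -[LHS]/(mmap (@polyC K) x' F) EF -[mmap _ x F]/(pev x F) EA EA0 EdF.
  have -> : differential F q v = - A0 by apply/eqP; rewrite -addr_eq0 addrC Fv.
  by rewrite polyCN !exprS; ring.
- exists (B1 + dG + 'X^r * cG).
  rewrite -[LHS]/(mmap (@polyC K) x' G) EG -[mmap _ x G]/(pev x G) EB EB0 EdG Gv.
  have -> : hess G q w v = - B0 by apply/eqP; rewrite -addr_eq0 addrC hv.
  by rewrite polyCN polyC0 !exprS; ring.
Qed.


(** After the first one, Newton steps change only higher coefficients, so one [c2] serves for arcs
    of every order; the tangent vectors of lifted arcs will need this uniformity. *)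
Lemma branch_jet : exists c2 : 'rV[K]_n.+1, forall N, exists x c,
  [/\ forall i, x i = (q 0 i)%:P + 'X * ((w 0 i)%:P + 'X * ((c2 0 i)%:P + 'X * c i)),
    exists a, pev x F = 'X^N * a & exists b, pev x G = 'X^N * b].
Proof.
pose x i : {poly K} := (q 0 i)%:P + 'X * ((w 0 i)%:P + 'X * 0).
have gx : germ q w x by exists (fun=> 0).
have [A EA] : exists a, pev x F = 'X^2 * a.
  by have [c ->] := pev_germ F gx; exists c; rewrite Fq Fw; ring.
(* Along the straight line [G] starts with half of [hess G q w w], which is zero; the coefficient is
   read off the derivative. *)
have [B EB] : exists b, pev x G = 'X^3 * b.
  have [c1 E1] := pev_germ G gx; rewrite Gq Gv !polyC0 add0r add0r in E1.
  have [c2 E2] := pev_diff_germ G w gx; rewrite Gv Gww !polyC0 !add0r in E2.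
  have E3 : (pev x G)^`() = 'X * ('X * c2).
  rewrite deriv_pev -E2; apply: eq_bigr => i _; congr (_ * _).
  by rewrite /x !(derivD, derivM, derivC, derivX) !(mulr0, addr0, mul0r, add0r, mul1r).
  have [c0 [c3 E4]] := poly_split c1; rewrite E4 in E1.
  have := congr1 (fun p : {poly K} => p`_1) E3.
  rewrite E1 coef_deriv !coefXM /= coefD coefC coefXM /= addr0 => /eqP.
  rewrite mulrn_eq0 /= => /eqP c00; exists c3.
  by rewrite c00 polyC0; ring.
have [c2 [[A1 EA1] [B1 EB1]]] := branch_step gx EA EB.
exists c2 => N.
suff [y [c [yE [a Ea] [b Eb]]]] : exists y c, [/\ forall i, y i = (q 0 i)%:P + 'X * ((w 0 i)%:P + 'X * ((c2 0 i)%:P + 'X * c i)),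
    exists a, pev y F = 'X^(N.+3) * a & exists b, pev y G = 'X^(N.+4) * b].
  exists y, c; split=> //; first by exists ('X^3 * a); rewrite Ea -addn3 exprD mulrA.
  by exists ('X^4 * b); rewrite Eb -addn4 exprD mulrA.
elim: N => [|N [y [c [yE [a Ea] [b Eb]]]]].
  exists (fun i => x i + 'X^2 * (c2 0 i)%:P), (fun=> 0); split; [|by exists A1|by exists B1].
  by move=> i; rewrite /x; ring.
have gy : germ q w y by exists (fun i => (c2 0 i)%:P + 'X * c i).
have [v Hv] := branch_step gy Ea Eb.
exists (fun i => y i + 'X^(N.+3) * (v 0 i)%:P), (fun i => c i + 'X^N * (v 0 i)%:P); case: Hv => H1 H2.
by split=> // i; rewrite yE -addn3 exprD; ring.
Qed.

Lemma branch N : exists x, [/\ germ q w x, exists a, pev x F = 'X^N * a & exists b, pev x G = 'X^N * b].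
Proof.
have [c2 /(_ N)[x [c [xE Fx Gx]]]] := branch_jet; exists x; split=> //.
by exists (fun i => (c2 0 i)%:P + 'X * c i).
Qed.
End BranchAt.

Lemma pev_ideal F G f x N : idl [:: F; G] f -> (exists a, pev x F = 'X^N * a) ->
  (exists b, pev x G = 'X^N * b) -> exists c, pev x f = 'X^N * c.
Proof.
move=> /idl2P[a [b ->]] [c Hc] [d Hd]; exists (pev x a * c + pev x b * d).
by rewrite rmorphD !rmorphM /= Hc Hd; ring.
Qed.
End Branch.

Section Hessian.
Variables (K : numClosedFieldType) (n : nat).
Local Notation P := {mpoly K[n.+1]}.
Implicit Types (f g : P) (q v w : 'rV[K]_n.+1).

Definition dird w f : P := \sum_i w 0 i *: f^`M(i).
Lemma dirdM w f g : dird w (f * g) = dird w f * g + f * dird w g.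
Proof.
rewrite /dird mulr_suml mulr_sumr -big_split; apply: eq_bigr => i _ /=.
by rewrite mderivM scalerDr scalerAl scalerAr.
Qed.
Lemma eval_dird w f q : eval_at (dird w f) q = differential f q w.
Proof. by rewrite eval_at_sum; apply: eq_bigr => i _; rewrite evE mulrC. Qed.
Lemma hess_dird f q v w : hess f q v w = differential (dird w f) q v.
Proof. by rewrite df_sum; apply: eq_bigr => i _; rewrite dfZ. Qed.
Lemma hessM f g q v w : hess (f * g) q v w = hess f q v w * eval_at g q +
  differential f q w * differential g q v + differential f q v * differential g q w +
  eval_at f q * hess g q v w.
Proof. by rewrite !hess_dird dirdM !dfE !eval_dird; ring. Qed.
Lemma hessD f g q v w : hess (f + g) q v w = hess f q v w + hess g q v w.
Proof. by rewrite -big_split; apply: eq_bigr => i _ /=; rewrite mderivD dfE mulrDr. Qed.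
Lemma hessDl f q v v' w : hess f q (v + v') w = hess f q v w + hess f q v' w.
Proof. by rewrite hessC hessDr !(hessC _ _ w). Qed.
Lemma hessZl f q v w c : hess f q (c *: v) w = c * hess f q v w.
Proof. by rewrite hessC hessZr hessC. Qed.
(** Euler's formula for the partial derivatives: at a singular point the radial direction lies in
    the kernel of the Hessian. *)
Lemma hess_euler f m q w : f \is m.-homog -> (forall v, differential f q v = 0) -> hess f q q w = 0.
Proof.
move=> hf H; transitivity (\sum_i w 0 i * (m.-1%:R * eval_at f^`M(i) q)).
  by apply: eq_bigr => i _; rewrite (euler _ (mderiv_homog i hf)).
transitivity (m.-1%:R * differential f q w); last by rewrite H mulr0.
by rewrite mulr_sumr; apply: eq_bigr => i _; ring.
Qed.
End Hessian.

Lemma ord2E (i : 'I_2) : i = 0 \/ i = 1.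
Proof. by case: i => [[|[|//]] Hi]; [left|right]; apply: val_inj. Qed.

(** * Irreducibility *)

Section Prime.
Variable K : numClosedFieldType.
Hypothesis unc : ~ countable [set: K].
Local Notation P := {mpoly K[4]}.
Local Notation P2 := {mpoly K[2]}.
Implicit Types (f g h s : P) (b : P2) (x q : 'rV[K]_4).

Local Notation j0 := (inord 0 : 'I_4).
Local Notation j1 := (inord 1 : 'I_4).

(** What later arguments need about a curve [F = G = 0]: a pencil, given by the first two columns of
    [N], without base points on it; [F] nonzero at [p3]; the coordinate ring integral over the
    binary forms through [io]; and transversality outside the list [qs]. *)
Record package (F G : P) (d n : nat) (N : 'M[K]_4) (p3 : 'rV[K]_4) (io : {rmorphism P2 -> P})
    (qs : seq 'rV[K]_4) : Prop := Package {
  pk_unit : N \in unitmx;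
  pk_d0 : (0 < d)%N;
  pk_n0 : (0 < n)%N;
  pk_F : F \is d.-homog;
  pk_G : G \is n.-homog;
  pk_p3 : p3 *m N = e3 K;
  pk_Fp3 : eval_at F p3 != 0;
  pk_Hz : forall x, eval_at (el N j0) x = 0 -> eval_at (el N j1) x = 0 ->
    eval_at F x = 0 -> eval_at G x = 0 -> x = 0;
  pk_ioC : forall c, io c%:MP = c%:MP;
  pk_ioX : forall i : 'I_2, io 'X_i = el N (inord i);
  pk_ioI : forall b, io b = 0 -> b = 0;
  pk_int : forall f, exists2 chi : {poly P2}, chi \is monic & idl [:: F; G] ((map_poly io chi).[f]);
  pk_reg : forall x, x != 0 -> eval_at F x = 0 -> eval_at G x = 0 -> ~ isnode qs x ->
    indep (grad F x) (grad G x)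
}.

Section Package.
Variables (F G : P) (d n : nat) (N : 'M[K]_4) (p3 : 'rV[K]_4) (io : {rmorphism P2 -> P})
  (qs : seq 'rV[K]_4).
Hypothesis pk : package F G d n N p3 io qs.
Local Notation I := (idl [:: F; G]).
Local Notation base := (base N).
Let HI : is_ideal I. Proof. exact: is_ideal_idl. Qed.

Definition oncurve x : Prop := [/\ x != 0, eval_at F x = 0 & eval_at G x = 0].

Lemma pk_global f a : (forall h, I (a * h) -> I h) ->
  (forall x, oncurve x -> loc x (adj I a) f) -> adj I a f.
Proof.
move=> Ha H; case: pk => uN d0 n0 hF hG p3N Fp3 Hz ioC ioX ioI ioint Hreg.
apply: (local_to_global unc uN d0 hF hG p3N Fp3 Hz Ha) => x x0 Fx Gx; exact: H.
Qed.

Lemma pk_van f : (forall x, oncurve x -> eval_at f x = 0) -> I f.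
Proof.
move=> H; case: pk => uN d0 n0 hF hG p3N Fp3 Hz ioC ioX ioI ioint Hreg.
apply: (vanishing_curve unc uN d0 n0 hF hG p3N Fp3 Hz Hreg) => x x0 Fx Gx; exact: H.
Qed.

Lemma pk_nzd b e f : b \is e.-homog -> b != 0 -> I (io b * f) -> I f.
Proof.
case: pk => uN d0 n0 hF hG p3N Fp3 Hz ioC ioX ioI ioint Hreg.
exact: (io_nzd unc uN d0 hF hG p3N Fp3 Hz ioC ioX).
Qed.

Lemma pk_integral f m : f \is m.-homog -> exists r (b : nat -> P2),
  [/\ b r = 1, forall i, (i <= r)%N -> b i \is ((r - i) * m).-homog &
      I (\sum_(i < r.+1) io (b i) * f ^+ i)].
Proof.
case: pk => _ _ _ hF hG _ _ _ ioC ioX _ ioint _; exact: (integral_homog hF hG ioC ioX ioint).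
Qed.

Lemma pk_eval b x : eval_at (io b) x = eval_at b (base x).
Proof. case: pk => _ _ _ hF hG _ _ _ ioC ioX _ ioint _; exact: (eval_io ioC ioX). Qed.

Lemma pk_homog b e : b \is e.-homog -> io b \is e.-homog.
Proof. case: pk => _ _ _ hF hG _ _ _ ioC ioX _ ioint _; exact: (io_homog ioC ioX). Qed.

Lemma pk_base x : oncurve x -> base x != 0.
Proof. by case=> x0 Fx Gx; case: pk => *; apply: (@base0 K F G). Qed.

Lemma pk_reduced f e k : f \is e.-homog -> I (f ^+ k) -> I f.
Proof.
case: pk => uN d0 n0 hF hG p3N Fp3 Hz ioC ioX ioI ioint Hreg.
exact: (reduced_homog unc uN d0 n0 hF hG p3N Fp3 Hz Hreg).
Qed.
Lemma pk_hom f e : I f -> I (pihomog mdeg e f).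
Proof. by case: pk => _ _ _ hF hG *; apply: (Ihom hF hG). Qed.

Lemma idl_exp (J : set P) f g k : is_ideal J -> J (f - g) -> J (f ^+ k - g ^+ k).
Proof.
move=> HJ H; elim: k => [|k IH]; first by rewrite !expr0 subrr; case: HJ.
by apply: (idlc (a := f) (b := g ^+ k) HJ IH H); rewrite !exprS; ring.
Qed.

Definition isform f : Prop := exists m, f \is m.-homog.
Lemma formM f g : isform f -> isform g -> isform (f * g).
Proof. by move=> [m hf] [k hg]; exists (m + k)%N; apply: dhomogM. Qed.
Lemma formX f k : isform f -> isform (f ^+ k).
Proof. by move=> [m hf]; exists (m * k)%N; apply: dhomogMn. Qed.
Lemma form_line f x : isform f -> eval_at f x = 0 -> on_line f x.
Proof. by case=> m; apply: homog_on_line. Qed.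
Lemma formF : isform F. Proof. by exists d; case: pk. Qed.
Lemma formG : isform G. Proof. by exists n; case: pk. Qed.

Section Local.
Variable x : 'rV[K]_4.
Hypothesis xX : oncurve x.
Local Notation L := (loc x I).
Let HL : is_ideal L. Proof. exact: is_ideal_loc. Qed.
Let x0 : x != 0. Proof. by case: xX. Qed.
Let Fx : eval_at F x = 0. Proof. by case: xX. Qed.
Let Gx : eval_at G x = 0. Proof. by case: xX. Qed.
Local Notation y := (base x).
Local Notation u0 := (io (blin y)).

Lemma I_van f : I f -> eval_at f x = 0.
Proof. by apply: idl_zero => g; rewrite !inE => /orP[] /eqP ->. Qed.

Lemma L_van f : L f -> eval_at f x = 0.
Proof. by case=> s s0 /I_van; rewrite evE => /eqP; rewrite mulf_eq0 (negbTE s0) => /eqP. Qed.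

(** A local quotient may be chosen among forms. The inductions below divide repeatedly and require
    forms at each stage. *)
Lemma L_form f u s c : isform f -> isform u -> eval_at s x != 0 -> L (s * f - c * u) ->
  exists s' c', [/\ isform s', isform c', eval_at s' x != 0 & L (s' * f - c' * u)].
Proof.
move=> [m hf] [e hu] s0 [t t0 /idl2P[a [b E]]].
have [|||k [s' [c' [hs s'0 hc E']]]] := @homog_relation _ _ 3 x f (t * s) m
  (fun i => [:: e; d; n]`_i) (fun i => [:: u; F; G]`_i) (fun i => [:: t * c; a; b]`_i) hf.
- by case: pk => _ _ _ hF hG _ _ _ _ _ _ _ _; case=> [[|[|[|//]]] //=].
- by rewrite evE mulf_neq0.
- rewrite !big_ord_recl big_ord0 /= addr0.
  have -> : t * s * f = t * (s * f - c * u) + t * c * u by ring.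
  by rewrite E; ring.
exists s', (c' ord0); split=> //; first by exists k.
  by exists (k + m - e)%N; exact: hc ord0.
apply: loc_sub => //; apply/idl2P; exists (c' (lift ord0 ord0)), (c' (lift ord0 (lift ord0 ord0))).
by rewrite E' !big_ord_recl big_ord0 /=; ring.
Qed.

Lemma blin_neq0 : blin y != 0.
Proof.
apply/eqP => z; have y0 := pk_base xX; case/eqP: y0.
have H (v : 'rV[K]_2) : y 0 1 * v 0 0 - y 0 0 * v 0 1 = 0.
  by have := congr1 (fun f : P2 => eval_at f v) z; rewrite /blin !evE.
have := H (delta_mx 0 0); have := H (delta_mx 0 1).
move: (base x) => z'; rewrite !mxE /= !mulr0 !mulr1 subr0 sub0r => /eqP; rewrite oppr_eq0 => /eqP E0 E1.
by apply/rowP => i; case: (ord2E i) => ->; rewrite [RHS]mxE.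
Qed.
Lemma blin_homog (z : 'rV[K]_2) : blin z \is 1.-homog.
Proof. by apply: rpredB; apply: rpredZ; exact: X_homog. Qed.
Lemma u0_form : isform u0.
Proof. by exists 1%N; apply: pk_homog; exact: blin_homog. Qed.
Lemma u0x : eval_at u0 x = 0.
Proof. by rewrite pk_eval /blin !evE; ring. Qed.
Lemma u0_nzd f : I (u0 * f) -> I f.
Proof. exact: pk_nzd (blin_homog _) blin_neq0. Qed.
Lemma u0_nzdL f : L (u0 * f) -> L f.
Proof.
case=> t t0 H; exists t => //; apply: u0_nzd; apply: (idl1 (a := 1) HI H); ring.
Qed.
Lemma u0_nzdXL k f : L (u0 ^+ k * f) -> L f.
Proof.
elim: k f => [|k IH] f; first by rewrite expr0 mul1r.
by rewrite exprS -mulrA => /u0_nzdL/IH.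
Qed.

Lemma base_factor b e : b \is e.-homog -> b != 0 ->
  exists k c, io b = u0 ^+ k * io c /\ eval_at (io c) x != 0.
Proof.
move=> hb b0; have [k [c [E c0]]] := binary_factor unc hb b0 (pk_base xX).
by exists k, c; rewrite E rmorphM rmorphXn pk_eval.
Qed.

Lemma to_adj f a : loc x (adj L a) f -> loc x (adj I a) f.
Proof.
case=> s s0 [h [t t0 H]]; exists (t * s); first by rewrite evE mulf_neq0.
by exists (t * h); apply: (idl1 (a := 1) HI H); ring.
Qed.

Section Regular.
Hypothesis xreg : indep (grad F x) (grad G x).

(** The local ring is a discrete valuation ring with parameter [u], and [R3] bounds the valuation of
    [io b]. If [f] or [io b] is a unit the claim is immediate; otherwise [u] is divided out of both,
    which lowers the bound. *)
Lemma regular_div b e f : b \is e.-homog -> b != 0 -> isform f -> I (f * (f - io b)) ->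
  loc x (adj I (io b)) f.
Proof.
move=> hb b0 hf Hf; apply: to_adj.
have gF := gradx (pk_F pk) Fx; have gG := gradx (pk_G pk) Gx.
have [uv [uvx Hu]] := local_parameter xreg x0 gF gG.
pose u := lin uv; have hu : u \is 1.-homog := lin_homog uv.
have ux : eval_at u x = 0 by rewrite eval_lin_dot.
have R1 g : isform g -> eval_at g x = 0 -> exists s c, [/\ isform s, isform c, eval_at s x != 0 & L (s * g - c * u)].
  move=> hg gx; have fu : isform u by exists 1%N.
  have [|s [c0 [c1 [c2 [s0 E]]]]] := cramer3 unc x0 (form_line formF Fx) (form_line formG Gx)
    (form_line fu ux) _ (form_line hg gx).
    move=> v; rewrite !differential_dot grad_lin => *; exact: Hu.
  apply: (L_form hg fu s0 (c := c2)); apply: loc_sub => //; apply/idl2P; exists c0, c1; rewrite E; ring.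
have R2 h : L (u * h) -> L h.
  move=> Hh; have [s [c [_ _ s0 H]]] := R1 _ u0_form u0x.
  apply: (locM s0); apply: u0_nzdL.
  by apply: (idlc (a := h) (b := c) HL H Hh); ring.
(* In the integral equation of [u], the coefficients below the first [j] that survives at [x] are
   multiples of [u0]; so [u ^+ j] times a unit is a multiple of [u0]. Locally [io b] is a power of
   [u0] times a unit. *)
have R3 : exists J s h, eval_at s x != 0 /\ L (s * u ^+ J - h * io b).
  have [r [bb [br hbb E]]] := pk_integral hu.
  have ex : exists j, eval_at (bb j) y != 0 by exists r; rewrite br evE oner_neq0.
  case: (ex_minnP ex) => j bj jmin.
  have jr : (j <= r)%N by apply: jmin; rewrite br evE oner_neq0.
  pose s := \sum_(j <= i < r.+1) io (bb i) * u ^+ (i - j).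
  have sx : eval_at s x != 0.
    rewrite /s big_ltn ?ltnS // subnn expr0 mulr1 evE pk_eval eval_at_sum big_nat_cond big1 ?addr0 //.
    move=> i; rewrite andbT => /andP[ji _]; by rewrite !evE ux expr0n subn_eq0 leqNgt ji mulr0.
  have [h Hh] : adj L u0 (s * u ^+ j).
    have HA := is_ideal_adj u0 HL; apply: (idl_eq HA (g := 0)); last by case: HA.
    rewrite subr0; have H1 : adj L u0 (\sum_(i < r.+1) io (bb i) * u ^+ i).
      by exists 0; rewrite mul0r subr0; apply: loc_sub.
    have H2 : adj L u0 (\sum_(0 <= i < j) io (bb i) * u ^+ i).
      rewrite big_nat; apply: idl_sum => // i /andP[_ ij].
      have bi : eval_at (bb i) y = 0 by apply/eqP/negPn/negP => /jmin; rewrite leqNgt ij.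
      have [b' _ ->] := binary_div unc (hbb i (leq_trans (ltnW ij) jr)) (pk_base xX) bi.
      exists (io b' * u ^+ i); rewrite rmorphM.
      by have -> : u0 * io b' * u ^+ i - io b' * u ^+ i * u0 = 0 by [ring]; case: HL.
    apply: (idlc (a := 1) (b := -1) HA H1 H2).
    rewrite -(big_mkord xpredT (fun i => io (bb i) * u ^+ i)) (@big_cat_nat _ _ _ j) //=; last exact: leqW.
    rewrite mul1r mulN1r addrAC subrr add0r mulr_suml [LHS]big_nat [RHS]big_nat; apply: eq_bigr => i /andP[ji _].
    by rewrite -mulrA -exprD subnK.
  have [k [c [-> cx]]] := base_factor hb b0.
  exists (j * k)%N, (io c * s ^+ k), (h ^+ k); split; first by rewrite !evE mulf_neq0 ?expf_neq0.
  apply: (idl1 (a := io c) HL (idl_exp k HL Hh)).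
  by rewrite !exprMn exprM; ring.
have [J [s [h [s0 Hs]]]] := R3.
have {}Hf : L (f * (f - io b)) by apply: loc_sub.
have fb : isform (io b) by exists e; apply: pk_homog.
move: (io b) fb Hs Hf => a fa; move: s0; clear R3; elim: J f hf a fa s h => [|J IH] f hf a fa s h s0 Hs Hf.
  have ax : eval_at a x != 0.
    have := L_van Hs; rewrite !evE mulr1 => E; apply: contraNneq s0 => z.
    by rewrite z mulr0 subr0 in E; rewrite E.
  by exists a => //; exists f; rewrite mulrC subrr; case: HL.
have [ax|ax] := eqVneq (eval_at a x) 0; last first.
  by exists a => //; exists f; rewrite mulrC subrr; case: HL.
have [fx|fx] := eqVneq (eval_at f x) 0; last first.
  by exists f => //; exists f; rewrite -mulrBr.
have [s1 [A [fs1 fA s10 HA]]] := R1 _ fa ax; have [s2 [B [fs2 fB s20 HB]]] := R1 _ hf fx.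
have [|||||t t0 [k Hk]] := IH (s1 * B) _ (s2 * A) _ (s1 * s2 * s) h.
- exact: formM.
- exact: formM.
- by rewrite !evE !mulf_neq0.
- apply: R2.
  have H1 := idlc (a := s1 * s2) (b := s2 * h) HL Hs HA (erefl _).
  apply: (idl1 (a := 1) HL H1); rewrite exprS; ring.
- apply: (R2); apply: (R2).
  have E1 : L (s1 * s2 * f - s1 * B * u) by apply: (idl1 (a := s1) HL HB); ring.
  have E2 : L (s1 * s2 * a - s2 * A * u) by apply: (idl1 (a := s2) HL HA); ring.
  have H1 := idlc (a := s1 * s2 * f - s1 * s2 * a + s1 * B * u) (b := - (s1 * B * u)) HL E1 E2 (erefl _).
  by apply: (idlc (a := (s1 * s2) ^+ 2) (b := - 1) HL Hf H1); ring.
exists (t * s1 * s2); first by rewrite !evE !mulf_neq0.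
exists (k * s1 * s2).
have H1 := idlc (a := t * s1) (b := - (k * s2)) HL HB HA (erefl _).
by apply: (idlc (a := u) (b := 1) HL Hk H1); ring.
Qed.
End Regular.

(** [G] itself is singular at [q] while [F] is smooth; [w1] and [w2] are the isotropic directions of
    a nondegenerate quadratic form on the tangent plane of the surface. The last clause keeps both
    branches transversal to the pencil. *)
Definition node_at (q : 'rV[K]_4) : Prop :=
  [/\ forall v, differential G q v = 0, exists e, differential F q e != 0 &
    exists w1 w2, [/\ differential F q w1 = 0, differential F q w2 = 0,
      forall v, differential F q v = 0 -> exists a1 a2 a3 : K, v = a1 *: q + a2 *: w1 + a3 *: w2,
      [/\ hess G q w1 w1 = 0, hess G q w2 w2 = 0 & hess G q w1 w2 != 0] &
      eval_at (blin (base q)) (base w1) != 0 /\ eval_at (blin (base q)) (base w2) != 0]].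

Section Node.
Hypothesis nd : node_at x.

Lemma u0_lin : exists a : 'rV[K]_4, u0 = lin a.
Proof.
case: pk => _ _ _ _ _ _ _ _ ioC ioX _ _ _; rewrite (io_blin ioC ioX) /pencil /el -!linZ -linD.
by eexists.
Qed.

(** Along the branch of direction [w] the product [u0 ^+ 2 * g] has order at least 3, hence so does
    [m ^+ 2], and [m] has no linear term. *)
Lemma branch_tangent w w' (m g : P) : differential F x w = 0 -> differential F x w' = 0 ->
  hess G x w w = 0 -> hess G x w w' != 0 -> L (m ^+ 2 - u0 ^+ 2 * g) ->
  eval_at m x = 0 -> eval_at g x = 0 -> differential m x w = 0.
Proof.
move=> Fw Fw' hw hw' [t t0 Ht] mx gx; have [Gv [e Fe] _] := nd.
have [ga [gga HFa HGa]] := branch Fx Fw Fw' Fe Gx Gv hw hw' 3.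
have [c Ec] := pev_ideal Ht HFa HGa.
have [ct Et] := pev_germ t gga; have [cm Em] := pev_germ m gga.
have [cu Eu] := pev_germ u0 gga; have [cg Eg] := pev_germ g gga.
have H : pev ga (t * (m ^+ 2 - u0 ^+ 2 * g)) =
    pev ga t * (pev ga m ^+ 2 - pev ga u0 ^+ 2 * pev ga g) by rewrite rmorphM rmorphB !rmorphM.
rewrite {}Ec Et Em Eu Eg mx gx u0x !polyC0 !add0r in H.
set dm := differential m x w in H *; set du := differential u0 x w in H.
set dt := differential t x w in H; set dg := differential g x w in H.
have E : 'X^3 * c = 'X^2 * ((eval_at t x * (dm * dm))%:P + 'X * (
   (dt%:P + 'X * ct) * (dm%:P + 'X * cm) ^+ 2 + (eval_at t x)%:P * (cm * (dm%:P *+ 2 + 'X * cm))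
   - ((eval_at t x)%:P + 'X * (dt%:P + 'X * ct)) * (du%:P + 'X * cu) ^+ 2 * (dg%:P + 'X * cg))).
  by rewrite H !polyCM; ring.
have := congr1 (fun p : {poly K} => p`_2) E.
rewrite !coefXnM /= coefD coefC coefXM /= addr0 => /esym/eqP.
by rewrite mulf_eq0 (negbTE t0) /= mulf_eq0 orbb => /eqP.
Qed.

(** At a plane node, functions without linear part are multiples of any function [b] transversal to
    both branches. Here [b], a complementary coordinate [v] and [F] are local coordinates; modulo
    [F] both [g0] and [G] are a multiple of [b] plus a multiple of [v ^+ 2], with a unit for [G],
    and eliminating [v ^+ 2] gives the quotient. *)
Lemma node_quotient w1 w2 (b : P) eb : differential F x w1 = 0 -> differential F x w2 = 0 ->
  (forall v, differential F x v = 0 -> exists a1 a2 a3 : K, v = a1 *: x + a2 *: w1 + a3 *: w2) ->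
  hess G x w1 w1 = 0 -> hess G x w2 w2 = 0 -> hess G x w1 w2 != 0 ->
  b \is eb.-homog -> eval_at b x = 0 -> differential b x w1 != 0 -> differential b x w2 != 0 ->
  forall g, isform g -> eval_at g x = 0 -> differential g x w1 = 0 -> differential g x w2 = 0 ->
    exists s c, [/\ isform s, isform c, eval_at s x != 0 & L (s * g - c * b)].
Proof.
move=> Fw1 Fw2 kerF h11 h22 h12 hb bx u1 u2 g0; have [Gv [e' Fe] _] := nd.
have fb : isform b by exists eb.
have bxx : differential b x x = 0 by rewrite (euler _ hb) bx mulr0.
(* The direction of the tangent plane killed by [b]; the Hessian is nonzero on it, which later makes
   the coefficient [gaG] of [v ^+ 2] a unit. *)
pose w := differential b x w2 *: w1 - differential b x w1 *: w2.
have uw : differential b x w = 0.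
  by rewrite /w !dfvE; ring.
have hww : hess G x w w != 0.
  have -> : hess G x w w = - (2%:R * differential b x w1 * differential b x w2 * hess G x w1 w2).
    rewrite /w -!scaleNr !(hessDr, hessZr, hessDl, hessZl) h11 h22 (hessC G x w2 w1); ring.
  by rewrite oppr_eq0 !mulf_neq0 // pnatr_eq0.
have xw : indep x w.
  apply: (indepP x0) => /sub_rVP[c E]; move/eqP: hww; apply.
  by rewrite {1}E hessZl (hess_euler _ (pk_G pk) Gv) mulr0.
have [vv [vx vw]] := dual_pair xw.
pose v := lin vv; have fv : isform v by exists 1%N; exact: lin_homog.
have dvE z : differential v x z = dot vv z by rewrite df_lin eval_lin_dot.
have vx0 : eval_at v x = 0 by rewrite eval_lin_dot.
rewrite /w dotDr -scaleNr !dotZr in vw.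
have lin2 a c : a * differential b x w1 + c * dot vv w1 = 0 -> a * differential b x w2 + c * dot vv w2 = 0 ->
    a = 0 /\ c = 0.
  set U1 := differential b x w1 in vw *; set U2 := differential b x w2 in vw *.
  set V1 := dot vv w1 in vw *; set V2 := dot vv w2 in vw * => E1 E2; split.
    transitivity (a * (U2 * V1 + - U1 * V2)); first by rewrite vw mulr1.
    transitivity (V1 * (a * U2 + c * V2) - V2 * (a * U1 + c * V1)); first by ring.
    by rewrite E1 E2; ring.
  transitivity (c * (U2 * V1 + - U1 * V2)); first by rewrite vw mulr1.
  transitivity (U2 * (a * U1 + c * V1) - U1 * (a * U2 + c * V2)); first by ring.
  by rewrite E1 E2; ring.
have ker z : differential F x z = 0 -> differential b x z = 0 -> differential v x z = 0 -> (z <= x)%MS.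
  move=> /kerF[a [c1 [c2 E]]]; rewrite E dvE.
  rewrite !dfvE bxx !dotDr !dotZr vx !mulr0 !add0r.
  set U1 := differential b x w1 in vw *; set U2 := differential b x w2 in vw *.
  set V1 := dot vv w1 in vw *; set V2 := dot vv w2 in vw * => E1 E2.
  have -> : c1 = 0.
    transitivity (c1 * (U2 * V1 + - U1 * V2)); first by rewrite vw mulr1.
    transitivity (U2 * (c1 * V1 + c2 * V2) - V2 * (c1 * U1 + c2 * U2)); first by ring.
    by rewrite E1 E2; ring.
  have -> : c2 = 0.
    transitivity (c2 * (U2 * V1 + - U1 * V2)); first by rewrite vw mulr1.
    transitivity (V1 * (c1 * U1 + c2 * U2) - U1 * (c1 * V1 + c2 * V2)); first by ring.
    by rewrite E1 E2; ring.
  by rewrite !scale0r !addr0; apply: scalemx_sub.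
have C2 g : isform g -> eval_at g x = 0 -> exists s c0 c1 c2, [/\ isform c0, isform c1,
    eval_at s x != 0 & s * g = c0 * b + c1 * v + c2 * F].
  move=> fg gx.
  have [|s [c2 [c0 [c1 [s0 E]]]]] := cramer3 unc x0 (form_line formF Fx) (form_line fb bx)
    (form_line fv vx0) _ (form_line fg gx); first by move=> z *; apply: ker.
  have [m hg] := fg.
  have [|||k [s' [c' [hs s'0 hc E']]]] := @homog_relation _ _ 3 x g s m
    (fun i => [:: eb; 1%N; d]`_i) (fun i => [:: b; v; F]`_i) (fun i => [:: c0; c1; c2]`_i) hg.
  - case=> [[|[|[|//]]] _] /=; [exact: hb|exact: lin_homog|exact: pk_F pk].
  - exact: s0.
  - by rewrite !big_ord_recl big_ord0 /= addr0 E; ring.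
  exists s', (c' ord0), (c' (lift ord0 ord0)), (c' (lift ord0 (lift ord0 ord0))); split=> //.
  - by exists (k + m - eb)%N; exact: hc ord0.
  - by exists (k + m - 1)%N; exact: hc (lift ord0 ord0).
  - by rewrite E' !big_ord_recl big_ord0 /= addr0 addrA.
have C3 g : isform g -> eval_at g x = 0 -> differential g x w1 = 0 -> differential g x w2 = 0 ->
    exists s c0 ga c2, [/\ eval_at s x != 0, eval_at c0 x = 0 & s * g = b * c0 + ga * v ^+ 2 + c2 * F].
  move=> fg gx g1 g2; have [s [c0 [c1 [c2 [fc0 fc1 s0 E]]]]] := C2 _ fg gx.
  have D z : differential F x z = 0 -> differential g x z = 0 ->
      eval_at c0 x * differential b x z + eval_at c1 x * dot vv z = 0.
    move=> Fz gz; have := congr1 (fun p => differential p x z) E.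
    by rewrite /= !dfE gx gz bx vx0 Fx Fz dvE !mulr0 !add0r !addr0.
  have [c00 c10] := lin2 _ _ (D _ Fw1 g1) (D _ Fw2 g2).
  have [s1 [a1 [a2 [a3 [_ _ s10 E1]]]]] := C2 _ fc0 c00.
  have [s2 [b1 [b2 [b3 [_ _ s20 E2]]]]] := C2 _ fc1 c10.
  exists (s1 * s2 * s), (s2 * a1 * b + (s2 * a2 + s1 * b1) * v), (s1 * b2),
    (s2 * a3 * b + s1 * b3 * v + s1 * s2 * c2); split.
  - by rewrite !evE !mulf_neq0.
  - by rewrite !evE bx vx0 !mulr0 addr0.
  - transitivity (s1 * s2 * (s * g)); first by ring.
    rewrite E; transitivity (s2 * b * (s1 * c0) + s1 * v * (s2 * c1) + s1 * s2 * c2 * F); first by ring.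
    by rewrite E1 E2; ring.
have [sG [cG [gaG [c2G [sG0 cG0 EG]]]]] := C3 _ formG Gx (Gv w1) (Gv w2).
have gaG0 : eval_at gaG x != 0.
  have c2x : eval_at c2G x = 0.
    have := congr1 (fun p => differential p x e') EG.
    rewrite /= expr2 !dfE !evE Gv Gx cG0 bx vx0 Fx !(mulr0, mul0r, add0r, addr0) => /esym/eqP.
    by rewrite mulf_eq0 (negbTE Fe) orbF => /eqP.
  have Fw : differential F x w = 0 by rewrite /w !dfvE Fw1 Fw2 !mulr0 subrr.
  have := congr1 (fun p => hess p x w w) EG.
  rewrite /= !(hessD, hessM, expr2) !dfE !evE Gv Gx cG0 bx vx0 Fx c2x Fw uw.
  rewrite !(mulr0, mul0r, add0r, addr0) => E; apply: contraNneq hww => z.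
  by move/eqP: E; rewrite z !(mulr0, mul0r, add0r, addr0) mulf_eq0 (negbTE sG0).
move=> fg gx g1 g2; have [s [c0 [ga [c2 [s0 c00 E]]]]] := C3 _ fg gx g1 g2.
  apply: (L_form fg fb (s := gaG * s) (c := gaG * c0 - ga * cG)).
    by rewrite evE mulf_neq0.
  apply: loc_sub => //; apply/idl2P; exists (gaG * c2 - ga * c2G), (ga * sG).
  transitivity (gaG * (s * g0) - (gaG * c0 - ga * cG) * b); first by ring.
  by rewrite -(mulrA ga sG G) E EG; ring.
Qed.

(** On each branch [f] is 0 or [io b], so [f / io b] is bounded but need not be regular at the node;
    a factor [h] vanishing there repairs this. Locally [io b] is a unit times [u0 ^+ ka], and
    [chain] extracts from [u0 f] one power of [u0] at a time: each cofactor [m] satisfies a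
    quadratic equation that kills its value and its derivatives along both branches. *)
Lemma node_div b e f h : b \is e.-homog -> b != 0 -> isform f -> I (f * (f - io b)) ->
  isform h -> eval_at h x = 0 -> loc x (adj I (io b)) (h * f).
Proof.
move=> hb b0 ff Hf fh hx; apply: to_adj; have {}Hf : L (f * (f - io b)) by apply: loc_sub.
have [Gv [e' Fe] [w1 [w2 [Fw1 Fw2 kerF [h11 h22 h12] [u1 u2]]]]] := nd.
have [ua Eua] := u0_lin.
rewrite -!pk_eval in u1 u2.
have duE z : differential u0 x z = eval_at u0 z by rewrite Eua df_lin.
have hu0 : u0 \is 1.-homog by apply: pk_homog; exact: blin_homog.
rewrite -duE in u1; rewrite -duE in u2.
have C5 := node_quotient Fw1 Fw2 kerF h11 h22 h12 hu0 u0x u1 u2.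
have [ka [a2 [Ea a20]]] := base_factor hb b0.
have [ka0|kap] := posnP ka.
  exists (io b); first by rewrite Ea ka0 expr0 mul1r.
  by exists (h * f); rewrite mulrC subrr; case: HL.
have key i s m : (0 < i <= ka)%N -> L (s * u0 * f - u0 ^+ i * m) ->
    L (m ^+ 2 - u0 * (s * u0 ^+ (ka - i) * io a2 * m)).
  move=> /andP[i0 ik] H; apply: (@u0_nzdXL (i + i)); rewrite Ea in Hf.
  have H1 := idlc (a := s * u0 * f + u0 ^+ i * m) (b := - (s ^+ 2 * u0 ^+ 2)) HL H Hf (erefl _).
  have H2 := idlc (a := - 1) (b := s * u0 * (u0 ^+ ka * io a2)) HL H1 H (erefl _).
  apply: (idl1 (a := 1) HL H2).
  have -> : u0 ^+ ka = u0 ^+ i * u0 ^+ (ka - i) by rewrite -exprD subnKC.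
  rewrite exprD; move: (u0 ^+ i) (u0 ^+ (ka - i)) => A B; ring.
have key0 i s m : (0 < i <= ka)%N -> L (s * u0 * f - u0 ^+ i * m) -> eval_at m x = 0.
  move=> hi H; have := L_van (key _ _ _ hi H); rewrite !evE u0x mul0r subr0 => /eqP.
  by rewrite sqrf_eq0 => /eqP.
have chain i : (i < ka)%N -> exists s m, [/\ isform s, isform m, eval_at s x != 0 &
    L (s * u0 * f - u0 ^+ i.+1 * m)].
  elim: i => [_|i IH ik].
    exists 1, f; split=> //; first by exists 0%N; exact: dhomog1.
    - by rewrite evE oner_neq0.
    - by rewrite expr1 mul1r subrr; case: HL.
  have [s [m [fs fm s0 H]]] := IH (ltnW ik).
  have hi : (0 < i.+1 <= ka)%N by rewrite /= ltnW.
  have mx := key0 _ _ _ hi H; have Hk := key _ _ _ hi H.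
  have Hk' : L (m ^+ 2 - u0 ^+ 2 * (s * u0 ^+ (ka - i.+2) * io a2 * m)).
    apply: (idl1 (a := 1) HL Hk).
    have -> : (ka - i.+1 = (ka - i.+2).+1)%N by rewrite -subSn // subSS.
    rewrite (exprS u0 (ka - i.+2)); ring.
  have gx : eval_at (s * u0 ^+ (ka - i.+2) * io a2 * m) x = 0 by rewrite evE mx mulr0.
  have m1 := branch_tangent Fw1 Fw2 h11 h12 Hk' mx gx.
  have m2 : differential m x w2 = 0.
    by apply: (branch_tangent Fw2 Fw1 h22 _ Hk' mx gx); rewrite hessC.
  have [s' [c [fs' fc s'0 H']]] := C5 _ fm mx m1 m2.
  exists (s' * s), c; split=> //; first exact: formM.
    by rewrite evE mulf_neq0.
  apply: (idlc (a := s') (b := u0 ^+ i.+1) HL H H').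
  rewrite [in LHS]exprS; move: (u0 ^+ i.+1) => A; ring.
have [s [m [fs fm s0 H]]] : exists s m, [/\ isform s, isform m, eval_at s x != 0 &
    L (s * u0 * f - u0 ^+ ka * m)].
  by have := chain ka.-1; rewrite prednK //; apply.
have mx := key0 ka s m _ H; rewrite kap leqnn in mx; have {}mx := mx isT.
have [||||s' [c [fs' fc s'0 H']]] := C5 (h * m).
- exact: formM.
- by rewrite evE mx mulr0.
- by rewrite dfE mx hx mulr0 mul0r addr0.
- by rewrite dfE mx hx mulr0 mul0r addr0.
exists (s' * s * io a2); first by rewrite !evE !mulf_neq0.
exists c; apply: u0_nzdL; rewrite Ea.
apply: (idlc (a := s' * io a2 * h) (b := u0 ^+ ka * io a2) HL H H').
move: (u0 ^+ ka) => A; ring.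
Qed.
End Node.
End Local.

Lemma loc_scale q x c f a : x = c *: q -> x != 0 -> isform f -> isform a ->
  loc q (adj I a) f -> loc x (adj I a) f.
Proof.
move=> xE x0 [m hf] [e ha] [s s0 [h /idl2P[al [be E]]]].
have [|||k [s' [c' [hs s'0 hc E']]]] := @homog_relation _ _ 3 q f s m
  (fun i => [:: e; d; n]`_i) (fun i => [:: a; F; G]`_i) (fun i => [:: h; al; be]`_i) hf.
- by case: pk => _ _ _ hF hG _ _ _ _ _ _ _ _; case=> [[|[|[|//]]] //=].
- exact: s0.
- rewrite !big_ord_recl big_ord0 /= addr0.
  have -> : s * f = s * f - h * a + h * a by ring.
  by rewrite E; ring.
exists s'.
  rewrite xE (eval_scale _ _ hs) mulf_neq0 // expf_neq0 //.
  by apply: contraNneq x0 => c0; rewrite xE c0 scale0r.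
exists (c' ord0); apply/idl2P; exists (c' (lift ord0 ord0)), (c' (lift ord0 (lift ord0 ord0))).
by rewrite E' !big_ord_recl big_ord0 /=; ring.
Qed.

(** In the integral equation of [f], surplus powers of [f] are cancelled by reducedness, leaving [f]
    times [io b + f c]. Then [f' = - f c] equals [io b] where [f] is nonzero and 0 where [f]
    vanishes: an idempotent with denominator [io b]. *)
Lemma idempotent f g : isform f -> isform g -> I (f * g) -> ~ I f -> ~ I g ->
  exists b e f', [/\ b \is e.-homog, b != 0, f' \is e.-homog, I (f' * (f' - io b)) &
    ~ I f' /\ ~ I (f' - io b)].
Proof.
move=> [m hf] _ fg nf ng.
have [r [bb [br hbb E]]] := pk_integral hf.
have ex : exists j, bb j != 0 by exists r; rewrite br oner_neq0.
case: (ex_minnP ex) => j bj jmin.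
have jr : (j <= r)%N by apply: jmin; rewrite br oner_neq0.
pose c := \sum_(j.+1 <= i < r.+1) io (bb i) * f ^+ (i - j.+1).
have cE : f * c = \sum_(j.+1 <= i < r.+1) io (bb i) * f ^+ (i - j).
  rewrite mulr_sumr [LHS]big_nat [RHS]big_nat; apply: eq_bigr => i /andP[ji _].
  have -> : (i - j = (i - j.+1).+1)%N by rewrite -subSn.
  by rewrite exprS; ring.
have hfc : f * c \is ((r - j) * m).-homog.
  rewrite cE big_nat; apply: rpred_sum => i /andP[ji ir].
  have -> : ((r - j) * m = (r - i) * m + (i - j) * m)%N.
    by rewrite -mulnDl; congr (_ * _)%N; rewrite addnBA ?(ltnW ji) // subnK.
  apply: dhomogM; first by apply: pk_homog; apply: hbb.
  by rewrite mulnC; apply: dhomogMn.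
have ha : io (bb j) \is ((r - j) * m).-homog by apply: pk_homog; apply: hbb.
have Hac : I (f * (io (bb j) + f * c)).
  apply: (@pk_reduced _ (m + (r - j) * m) j.+1); first by apply: dhomogM => //; apply: rpredD.
  apply: (idl1 (a := f * (io (bb j) + f * c) ^+ j) HI E).
  rewrite -(big_mkord xpredT (fun i => io (bb i) * f ^+ i)) (@big_cat_nat _ _ _ j) //=; last exact: leqW.
  rewrite big_nat big1 ?add0r => [|i /andP[_ ij]]; last first.
    have -> : bb i = 0 by apply/eqP/negPn/negP => /jmin; rewrite leqNgt ij.
    by rewrite rmorph0 mul0r.
  have -> : \sum_(j <= i < r.+1) io (bb i) * f ^+ i = f ^+ j * (io (bb j) + f * c).
    rewrite big_ltn ?ltnS // cE mulrDr mulr_sumr; congr (_ + _); first exact: mulrC.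
    rewrite [LHS]big_nat [RHS]big_nat; apply: eq_bigr => i /andP[ji _].
    by rewrite mulrCA -exprD subnKC // ltnW.
  by rewrite exprMn !exprS; ring.
exists (bb j), ((r - j) * m)%N, (- (f * c)); split=> //.
- exact: hbb.
- by rewrite rpredN.
- by apply: (idl1 (a := c) HI Hac); ring.
split=> H.
- apply: nf; apply: (pk_nzd (hbb _ jr) bj).
  by apply: (idlc (a := 1) (b := f) HI Hac H); ring.
- apply: ng; apply: (pk_nzd (hbb _ jr) bj).
  by apply: (idlc (a := - g) (b := - c) HI H fg); ring.
Qed.

(** For [h] in [V] the quotient [h f' / io b] exists locally everywhere, hence globally as a form
    [E] of degree [m] with [E (E - h)] in the ideal. By [Ve] it is 0 or [h], with the same
    alternative for all [h], and since [V] has no base point off the nodes [f'] is 0 or [io b]. *)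
Lemma nodes_prime m (V : P -> Prop) :
  (forall h, V h -> h \is m.-homog) -> (forall h k, V h -> V k -> V (h + k)) ->
  (forall h q, V h -> q \in qs -> eval_at h q = 0) ->
  (forall q, q \in qs -> oncurve q /\ node_at q) ->
  (forall x, oncurve x -> ~ isnode qs x -> exists2 h, V h & eval_at h x != 0) ->
  (forall e h, V h -> e \is m.-homog -> I (e * (e - h)) -> I e \/ I (e - h)) ->
  forall f g, isform f -> isform g -> I (f * g) -> I f \/ I g.
Proof.
move=> Vm VD Vq Nq Vx Ve f g ff fg Hfg.
apply: contrapT => /not_orP[nf ng].
have [b [e [f' [hb b0 hf' Hf' [nf' ng']]]]] := idempotent ff fg Hfg nf ng.
have ha := pk_homog hb.
(* [phi] vanishes on the curve off the nodes; the factor [bb], a product of pencil members through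
   the nodes, takes care of these and is a nonzerodivisor. *)
have kill phi : (forall h, V h -> I (h * phi)) -> I phi.
  move=> H; pose bb : P2 := \prod_(q <- qs) blin (base q).
  have [[k hk] bb0] : (exists k, bb \is k.-homog) /\ bb != 0.
    rewrite /bb big_seq; elim/big_ind: _ => [|b1 b2 [[k1 h1] n1] [[k2 h2] n2]|q /Nq[qX _]].
    - by split; [exists 0%N; exact: dhomog1|exact: oner_neq0].
    - by split; [exists (k1 + k2)%N; exact: dhomogM|rewrite mulf_neq0].
    - by split; [exists 1%N; exact: blin_homog|exact: blin_neq0].
  apply: (pk_nzd hk bb0); apply: pk_van => x xX; rewrite evE.
  have [[q qq /sub_rVP[c xE]]|nx] := pselect (isnode qs x).
    rewrite pk_eval /bb eval_at_prod (big_rem q) //=.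
    have -> : eval_at (blin (base q)) (base x) = 0; last by rewrite !mul0r.
    have -> : base x = c *: base q.
      by apply/rowP => i; rewrite !mxE xE (eval_scale _ _ (el_homog _ _)) expr1.
    by rewrite (eval_scale _ _ (blin_homog _)) /blin !evE; ring.
  have [h Vh hx] := Vx x xX nx; have := idl_zero _ (H h Vh); move=> /(_ x); rewrite evE => E.
  have /eqP : eval_at h x * eval_at phi x = 0.
    by apply: E => g'; case: xX => _ Fx Gx; rewrite !inE => /orP[] /eqP ->.
  by rewrite mulf_eq0 (negbTE hx) => /eqP ->; rewrite mulr0.
have alt h : V h -> I (h * f') \/ I (h * (f' - io b)).
  move=> Vh; have hh := Vm _ Vh.
  have [] : adj I (io b) (h * f').
    apply: pk_global => [k|x xX]; first exact: pk_nzd hb b0.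
    have ff' : isform f' by exists e.
    have [[q qq /sub_rVP[c xE]]|nx] := pselect (isnode qs x).
      have [qX nq] := Nq q qq; apply: (loc_scale xE); first by case: xX.
      - by apply: formM => //; exists m.
      - by exists e.
      - by apply: (node_div qX nq hb b0 ff' Hf'); [exists m|exact: Vq].
    have HLa : is_ideal (loc x (adj I (io b))) by apply: is_ideal_loc; apply: is_ideal_adj.
    have [x0 Fx Gx] := xX.
    have := regular_div xX (pk_reg pk x0 Fx Gx nx) hb b0 ff' Hf'.
    by move=> H; apply: (idl1 (a := h) HLa H).
  move=> E0 /(@pk_hom _ (m + e)); rewrite linearB /= (pihomogMr _ _ ha).
  rewrite (pihomog_dE (dhomogM hh hf')) => H.
  set E := pihomog mdeg m E0 in H; have hE : E \is m.-homog := pihomogP _ _ _.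
  have [|HE|HE] := Ve E h Vh hE.
  - apply: (pk_nzd hb b0); apply: (pk_nzd hb b0).
    apply: (idlc (a := - (h * f' + E * io b) + h * io b) (b := h ^+ 2) HI H Hf'); ring.
  - by left; apply: (idlc (a := 1) (b := io b) HI H HE); ring.
  - by right; apply: (idlc (a := 1) (b := io b) HI H HE); ring.
(* [V] is not a union of two proper subspaces: if [h1] fails the first alternative and [h] the
   second, the sum [h + h1] fails both. *)
have [H|] := pselect (forall h, V h -> I (h * f')); first exact: nf' (kill _ H).
move=> /existsNP[h1 /not_implyP[V1 n1]]; apply: ng'; apply: kill => h Vh.
have H1 : I (h1 * (f' - io b)) by case: (alt _ V1).
case: (alt _ Vh) => // Hh; case: (alt _ (VD _ _ Vh V1)) => H.
  by case: n1; apply: (idlc (a := 1) (b := -1) HI H Hh); ring.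
by apply: (idlc (a := 1) (b := -1) HI H H1); ring.
Qed.
End Package.

(** [l] is a nonzerodivisor modulo [F]. A factor that falls into the ideal of [F] and [l] is [l]
    times a form of smaller degree modulo [F], and cancelling [l] lowers the total degree. *)
Lemma prime_by_section (F l : P) d N p3 io : package F l d 1 N p3 io [::] ->
  (forall f g, isform f -> isform g -> idl [:: F; l] (f * g) -> idl [:: F; l] f \/ idl [:: F; l] g) ->
  forall f g, isform f -> isform g -> idl [:: F] (f * g) -> idl [:: F] f \/ idl [:: F] g.
Proof.
move=> pk prl; case: (pk) => uN d0 n0 hF hG p3N Fp3 Hz ioC ioX ioI ioint Hreg.
have F1 h : idl [:: F] h <-> exists a, h = a * F.
  split=> [[a /= /eqP]|[a ->]]; first by rewrite subr_eq0 => /eqP; exists a.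
  by exists a => /=; rewrite subrr.
have cop h : idl [:: F] (l * h) -> idl [:: F] h.
  move=> /F1[a E]; have [|c [-> _]] := syzygy unc uN d0 hF hG p3N Fp3 Hz (a := - a) (b := h).
    by rewrite mulNr -E; ring.
  by apply/F1; exists c.
have step f g k : f \is k.-homog -> isform g -> idl [:: F; l] f -> idl [:: F] (f * g) ->
    idl [:: F] f \/ exists k' f1, [/\ k = k'.+1, f1 \is k'.-homog, idl [:: F] (f1 * g) &
      idl [:: F] f1 -> idl [:: F] f].
  move=> hf fg /idl2P[a [b E]] Hfg.
  have k_d : idl [:: F] (f - pihomog mdeg k (b * l)).
    have := congr1 (pihomog mdeg k) E.
    rewrite linearD /= (pihomog_dE hf) => ->; rewrite addrK.
    have [dk|kd] := leqP d k; last by rewrite (pihomogMr0 _ hF kd); case: (is_ideal_idl [:: F]).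
    by rewrite -(subnK dk) (pihomogMr _ _ hF); apply/F1; eexists.
  case: k hf E k_d => [|k] hf E k_d.
    by left; move: k_d; rewrite (pihomogMr0 _ hG) // subr0.
  right; exists k, (pihomog mdeg k b); rewrite -(addn1 k) (pihomogMr _ _ hG) in k_d.
  split=> //; first exact: pihomogP.
    by apply: cop; apply: (idlc (a := 1) (b := - g) (is_ideal_idl [:: F]) Hfg k_d); ring.
  by move=> H; apply: (idlc (a := 1) (b := l) (is_ideal_idl [:: F]) k_d H); ring.
have main k : forall da db f g, (da + db <= k)%N -> f \is da.-homog -> g \is db.-homog ->
    idl [:: F] (f * g) -> idl [:: F] f \/ idl [:: F] g.
  elim: k => [|k IH] da db f g ab hf hg H; have ff : isform f by [exists da]; have gg : isform g by [exists db];
    have Hl : idl [:: F; l] (f * g) by [have /F1[c ->] := H; apply/idl2P; exists c, 0; ring];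
    have H' : idl [:: F] (g * f) by [rewrite mulrC].
    case: (prl _ _ ff gg Hl) => [Hf|Hg].
      case: (step _ _ _ hf gg Hf H); [by left|move=> [k' [f1 [ak _ _ _]]]; move: ab; rewrite ak; lia].
    case: (step _ _ _ hg ff Hg H'); [by right|move=> [k' [f1 [ak _ _ _]]]; move: ab; rewrite ak; lia].
  case: (prl _ _ ff gg Hl) => [Hf|Hg].
    case: (step _ _ _ hf gg Hf H) => [|[k' [f1 [ak h1 Hf1 imp]]]]; first by left.
    have kk : (k' + db <= k)%N by move: ab; rewrite ak; lia.
    by have [/imp|] := IH _ _ _ _ kk h1 hg Hf1; [left|right].
  case: (step _ _ _ hg ff Hg H') => [|[k' [f1 [ak h1 Hf1 imp]]]]; first by right.
  have kk : (k' + da <= k)%N by move: ab; rewrite ak; lia.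
  by have [/imp|] := IH _ _ _ _ kk h1 hf Hf1; [right|left].
by move=> f g [a hf] [b hg]; apply: main hf hg; exact: leqnn.
Qed.
End Prime.

(** * General members of a linear system *)

Section Bertini.
Variable K : numClosedFieldType.
Hypothesis unc : ~ countable [set: K].
Local Notation P := {mpoly K[4]}.
Local Notation P2 := {mpoly K[2]}.
Local Notation j0 := (inord 0 : 'I_4).
Local Notation j1 := (inord 1 : 'I_4).

Lemma eval_pev n (x : 'I_n.+1 -> {poly K}) (f : {mpoly K[n.+1]}) s :
  (pev x f).[s] = eval_at f (\row_i (x i).[s]).
Proof.
rewrite /pev /=; elim/mpoly_ring_ind: f => [c|i|f g Hf Hg|f g Hf Hg].
- by rewrite mmapC hornerC evE.
- by rewrite mmapX mmap1U evE mxE.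
- by rewrite mmapD hornerD evE Hf Hg.
- by rewrite rmorphM /= hornerM evE Hf Hg.
Qed.

Lemma poly_zeros (p : {poly K}) : p != 0 -> exists r : seq K, forall s, p.[s] = 0 -> s \in r.
Proof.
have [r E] := closed_field_poly_normal p => p0; exists r => s ps.
have : root p s by apply/eqP.
by rewrite E rootZ ?lead_coef_eq0 // root_prod_XsubC.
Qed.

Section Member.
Variables (F : P) (d : nat) (N : 'M[K]_4) (p3 : 'rV[K]_4).
Hypothesis (uN : N \in unitmx) (d0 : (0 < d)%N) (hF : F \is d.-homog).
Hypothesis (p3N : p3 *m N = e3 K) (Fp3 : eval_at F p3 != 0).
Hypothesis smooth : forall x, x != 0 -> eval_at F x = 0 -> grad F x != 0.
Local Notation base := (base N).

(** The axis of the pencil is spanned by [p2] and [p3] and is not contained in the surface, as [F]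
    is nonzero at [p3]. Up to scale its points other than [p2] are [p3 + s p2], and those on the
    surface have [s] a root of a nonzero polynomial. *)
Lemma line_zeros : exists zs : seq 'rV[K]_4, (forall z, z \in zs -> z != 0 /\ base z = 0) /\
  forall x, x != 0 -> base x = 0 -> eval_at F x = 0 -> exists2 z, z \in zs & exists2 c, c != 0 & x = c *: z.
Proof.
pose p2 : 'rV[K]_4 := delta_mx 0 (inord 2) *m invmx N.
pose p := pev (fun i => (p3 0 i)%:P + 'X * (p2 0 i)%:P) F.
have Ep s : p.[s] = eval_at F (p3 + s *: p2).
  by rewrite eval_pev; congr eval_at; apply/rowP => i; rewrite !mxE hornerD hornerM !hornerC hornerX.
have p0 : p != 0.
  by apply: contraNneq Fp3 => z; rewrite -[p3]addr0 -[0 in X in _ + X](scale0r p2) -Ep z horner0.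
have [rs Hrs] := poly_zeros p0.
have p2N : p2 *m N = delta_mx 0 (inord 2) by rewrite mulmxKV.
have bE x : base x = \row_i (x *m N) 0 (inord i).
  by apply/rowP => i; rewrite [LHS]mxE [RHS]mxE eval_el.
have ni (i : 'I_2) (j : nat) : (1 < j < 4)%N -> ((inord i : 'I_4) == inord j) = false.
  by move=> /andP[j1 j4]; rewrite -val_eqE /= !inordK //; case: i => [[|[|]]] //= _; lia.
have b3 : base p3 = 0.
  apply/rowP => i; rewrite bE p3N !mxE; have := ni i 3%N isT.
  by rewrite -val_eqE /= !inordK //; case: i => [[|[|]]] //=.
have b2 : base p2 = 0.
  by apply/rowP => i; rewrite bE p2N !mxE eqxx /= ni.
have baseD x y : base (x + y) = base x + base y.
  by apply/rowP => i; rewrite !bE mulmxDl !mxE.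
have baseZ c x : base (c *: x) = c *: base x.
  by apply/rowP => i; rewrite !bE -scalemxAl !mxE.
exists (p2 :: [seq p3 + r *: p2 | r <- rs]); split.
  move=> z; rewrite inE => /orP[/eqP ->|/mapP[r _ ->]].
    split=> //; apply: contraTneq isT => z0; have := p2N; rewrite z0 mul0mx => /rowP/(_ (inord 2)).
    by rewrite !mxE !eqxx => /eqP; rewrite eq_sym oner_eq0.
  split; last by rewrite baseD baseZ b2 b3 scaler0 addr0.
  apply: contraTneq isT => z0; have := congr1 (mulmx^~ N) z0.
  rewrite mulmxDl -scalemxAl p3N p2N mul0mx => /rowP/(_ (inord 3)).
  rewrite !mxE -?val_eqE /= ?inordK //= ?andbF ?mulr0 ?addr0 => /eqP.
  by rewrite oner_eq0.
move=> x x0 bx Fx; pose a := (x *m N) 0 (inord 3); pose b := (x *m N) 0 (inord 2).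
have xE : x = a *: p3 + b *: p2.
  rewrite -[x](mulmxK uN) -[p3](mulmxK uN) p3N /p2 !scalemxAl -mulmxDl; congr (_ *m _).
  have bb (i : 'I_2) : (x *m N) 0 (inord i) = 0 by have := congr1 (fun u : 'rV[K]_2 => u 0 i) bx; rewrite bE [LHS]mxE [RHS]mxE.
  rewrite /a /b; move: (x *m N) bb => y bb; apply/rowP => i; rewrite -[i in LHS]inord_val !mxE.
  case: i => [[|[|[|[|//]]]] Hi] /=; rewrite -?val_eqE /= ?inordK //= ?mulr0 ?mulr1 ?addr0 ?add0r //.
  - exact: (bb 0).
  - exact: (bb 1).
have [a0|a0] := eqVneq a 0.
  exists p2; first by rewrite mem_head.
  exists b; last by rewrite xE a0 scale0r add0r.
  by apply: contraNneq x0 => b0; rewrite xE a0 b0 !scale0r addr0.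
have xE' : x = a *: (p3 + (b / a) *: p2) by rewrite scalerDr scalerA mulrC divfK.
exists (p3 + (b / a) *: p2); last by exists a.
rewrite inE; apply/orP; right; apply/mapP; exists (b / a) => //; apply: Hrs; rewrite Ep; apply/eqP.
by move/eqP: Fx; rewrite xE' (eval_scale _ _ hF) mulf_eq0 expf_eq0 (negbTE a0) andbF.
Qed.

Variables (fam : seq P) (n : nat) (qs : seq 'rV[K]_4) (w w' : 'rV[K]_4 -> 'rV[K]_4).
Hypothesis (n0 : (0 < n)%N) (hfam : forall Q, Q \in fam -> Q \is n.-homog).
Hypothesis free : forall x, x != 0 -> eval_at F x = 0 -> ~ isnode qs x ->
  exists2 Q, Q \in fam & eval_at Q x != 0.
Hypothesis qbase : forall q, q \in qs -> base q != 0.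
Hypothesis nodew : forall q, q \in qs -> exists2 Q, Q \in fam & hess Q q (w q) (w q) != 0.
Hypothesis nodew' : forall q, q \in qs -> exists2 Q, Q \in fam &
  [/\ hess Q q (w q) (w q) = 0, hess Q q (w q) (w' q) = 0 & hess Q q (w' q) (w' q) != 0].

(** Each open condition is proved by contradiction: the forbidden equality, differentiated by every
    derivation that kills the data, becomes a linear relation on the [D t_i]. Genericity then
    annihilates the corresponding quantity for every form in [fam], against the hypothesis on one of
    them. *)
Lemma generic_member : exists t : seq K, let G := \sum_(i < size fam) t`_i *: fam`_i in
  package F G d n N p3 (pullback N) qs /\
  forall q, q \in qs -> hess G q (w q) (w q) != 0 /\
    hess G q (w q) (w' q) ^+ 2 != hess G q (w q) (w q) * hess G q (w' q) (w' q).
Proof.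
have [zs [zs0 Hzs]] := line_zeros.
pose c (f : P) : seq K := [seq f@_m | m <- msupp f].
pose hs := [seq hess Q q (w q) (w q) | Q <- fam, q <- qs] ++
  [seq hess Q q (w q) (w' q) | Q <- fam, q <- qs] ++ [seq hess Q q (w' q) (w' q) | Q <- fam, q <- qs].
pose C := c F ++ flatten (map c fam) ++ hs ++ [seq eval_at Q z | Q <- fam, z <- zs].
have [t _ Ht] := generic_params unc (size fam) C.
exists t => G.
have cP D f : is_der D -> (forall z, z \in c f -> D z = 0) -> forall m, D f@_m = 0.
  move=> dD H m; have [/map_f mf|/memN_msupp_eq0 ->] := boolP (m \in msupp f); last exact: der0.
  by apply: H; exact: mf.
have DF D : is_der D -> (forall c, c \in C -> D c = 0) -> forall m, D F@_m = 0.
  by move=> dD HD m; apply: cP => // z zc; apply: HD; rewrite !mem_cat zc.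
have Dfam D : is_der D -> (forall c, c \in C -> D c = 0) -> forall i m, (i < size fam)%N -> D (fam`_i)@_m = 0.
  move=> dD HD i m im; apply: cP => // z zc; apply: HD; rewrite !mem_cat; apply/orP; right.
  by apply/orP; left; apply/flattenP; exists (c fam`_i) => //; apply: map_f; exact: mem_nth.
have hG : G \is n.-homog by apply: rpred_sum => i _; apply: rpredZ; apply: hfam; exact: mem_nth.
have famP Q : Q \in fam -> exists2 i, (i < size fam)%N & Q = fam`_i.
  by move=> Qf; exists (index Q fam); rewrite ?index_mem // nth_index.
have lin_gen (L : P -> K) : (forall D, is_der D -> (forall c, c \in C -> D c = 0) ->
    \sum_(i < size fam) D t`_i * L fam`_i = 0) -> forall Q, Q \in fam -> L Q = 0.
  by move=> H Q /famP[i ifam ->]; apply: (Ht (fun i => L fam`_i)).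
have hessG q u v : hess G q u v = \sum_(i < size fam) t`_i * hess fam`_i q u v.
  rewrite /G; elim/big_rec2: _ => [|i y f _ E].
    by rewrite /hess big1 // => j _; rewrite mderiv0 df0 mulr0.
  rewrite hessD E; congr (_ + _); rewrite /hess mulr_sumr; apply: eq_bigr => j _.
  by rewrite mderivZ dfZ; ring.
have Dh D q u v : is_der D -> (forall i, (i < size fam)%N -> D (hess fam`_i q u v) = 0) ->
    D (hess G q u v) = \sum_(i < size fam) D t`_i * hess fam`_i q u v.
  move=> dD H; rewrite hessG der_sum //; apply: eq_bigr => i _.
  by rewrite dD.2 H ?mulr0 ?addr0.
have Ch (D : K -> K) q : (forall c, c \in C -> D c = 0) -> q \in qs -> forall i, (i < size fam)%N ->
   [/\ D (hess fam`_i q (w q) (w q)) = 0, D (hess fam`_i q (w q) (w' q)) = 0 &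
     D (hess fam`_i q (w' q) (w' q)) = 0].
  move=> HD qq i im; have fi : fam`_i \in fam by exact: mem_nth.
  split; apply: HD; rewrite !mem_cat; apply/orP; right; apply/orP; right; apply/orP; left.
  - by rewrite (allpairs_f (fun Q q => hess Q q (w q) (w q)) fi qq).
  - by rewrite (allpairs_f (fun Q q => hess Q q (w q) (w' q)) fi qq) orbT.
  - by rewrite (allpairs_f (fun Q q => hess Q q (w' q) (w' q)) fi qq) !orbT.
have Hz x : eval_at (el N j0) x = 0 -> eval_at (el N j1) x = 0 -> eval_at F x = 0 -> eval_at G x = 0 -> x = 0.
  move=> x0 x1 Fx Gx; apply/eqP/negPn/negP => xn0.
  have bx : base x = 0.
    by apply/rowP => i; rewrite [LHS]mxE [RHS]mxE; case: (ord2E i) => ->; [exact: x0|exact: x1].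
  have [z zz [a a0 xE]] := Hzs x xn0 bx Fx; have [zn0 bz] := zs0 _ zz.
  have Fz : eval_at F z = 0.
    by apply/eqP; move/eqP: Fx; rewrite xE (eval_scale _ _ hF) mulf_eq0 expf_eq0 (negbTE a0) andbF.
  have Gz : eval_at G z = 0.
    by apply/eqP; move/eqP: Gx; rewrite xE (eval_scale _ _ hG) mulf_eq0 expf_eq0 (negbTE a0) andbF.
  have nz : ~ isnode qs z.
    case=> q /qbase bq /sub_rVP[k zE]; have : base z = k *: base q.
      by apply/rowP => i; rewrite !mxE zE (eval_scale _ _ (el_homog _ _)) expr1.
    move=> /esym/eqP; rewrite bz scaler_eq0 (negbTE bq) orbF => /eqP k0.
    by move: zn0; rewrite zE k0 scale0r eqxx.
  have [Q Qf] := free zn0 Fz nz; move/eqP; apply.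
  apply: (lin_gen (fun Q => eval_at Q z)) => // D dD HD.
  have := congr1 D Gz; rewrite der0 // eval_at_sum der_sum // => E.
  rewrite -[RHS]E; apply: eq_bigr => i _; rewrite evE dD.2 [D (eval_at _ _)]HD ?mulr0 ?addr0 //.
  rewrite !mem_cat; apply/orP; right; apply/orP; right; apply/orP; right.
  by apply: allpairs_f => //; exact: mem_nth.
split.
  split=> //.
  - by move=> k; rewrite /pullback /= mmapC.
  - by move=> i; rewrite /pullback /= mmapX mmap1U.
  - by move=> b; apply: (pullback_inj unc uN d0 hF hG p3N Fp3).
  - exact: (integral_pencil unc uN d0 hF hG Hz).
  (* If [grad G] were a multiple of [grad F] at [x], the term coming from the motion of [x] would be
     a multiple of the derivative of [F(x) = 0] and drop out. *)
  move=> x x0 Fx Gx nx; apply: indepP; first exact: smooth.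
  move=> /sub_rVP[k E]; have [Q Qf] := free x0 Fx nx; move/eqP; apply.
  apply: (lin_gen (fun Q => eval_at Q x)) => // D dD HD.
  have := congr1 D Gx; rewrite der0 // /G (der_eval_comb dD t (Q := fun i => fam`_i)); last first.
    by move=> i m; apply: Dfam.
  rewrite -/G [differential G _ _]differential_dot E dotZl -differential_dot -(der_eval dD); last exact: DF.
  by rewrite Fx (der0 dD) mulr0 addr0.
move=> q qq.
have A0 : hess G q (w q) (w q) != 0.
  apply/eqP => E; have [Q Qf] := nodew qq; move/eqP; apply.
  apply: (lin_gen (fun Q => hess Q q (w q) (w q))) => // D dD HD.
  rewrite -Dh // ?E ?(der0 dD) // => i im; by have [] := Ch D q HD qq i im.
split=> //; apply/eqP => E; have [Q Qf [Qww Qww' /eqP]] := nodew' qq; apply.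
(* The derivative, in the direction [Q], of the discriminant [B ^+ 2 - A C] of the quadratic part of
   [G]. *)
pose L Q := 2%:R * hess G q (w q) (w' q) * hess Q q (w q) (w' q) -
  hess Q q (w q) (w q) * hess G q (w' q) (w' q) - hess G q (w q) (w q) * hess Q q (w' q) (w' q).
have : L Q = 0.
  apply: lin_gen => // D dD HD.
  have H1 := Dh D q (w q) (w q) dD (fun i im => let: And3 h _ _ := Ch D q HD qq i im in h).
  have H2 := Dh D q (w q) (w' q) dD (fun i im => let: And3 _ h _ := Ch D q HD qq i im in h).
  have H3 := Dh D q (w' q) (w' q) dD (fun i im => let: And3 _ _ h := Ch D q HD qq i im in h).
  have := congr1 D E; rewrite expr2 !dD.2 H1 H2 H3 => E'.
  transitivity (2%:R * hess G q (w q) (w' q) * (\sum_(i < size fam) D t`_i * hess fam`_i q (w q) (w' q))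
    - (\sum_(i < size fam) D t`_i * hess fam`_i q (w q) (w q)) * hess G q (w' q) (w' q)
    - hess G q (w q) (w q) * (\sum_(i < size fam) D t`_i * hess fam`_i q (w' q) (w' q))).
    rewrite /L; move: (hess G q (w q) (w' q)) (hess G q (w q) (w q)) (hess G q (w' q) (w' q)) => B A' C'.
    by rewrite !mulr_sumr mulr_suml -!sumrB; apply: eq_bigr => i _; ring.
  apply/eqP; rewrite subr_eq0 subr_eq addrC -E'; apply/eqP; ring.
rewrite /L Qww Qww' mulr0 mul0r subrr sub0r => /eqP.
by rewrite oppr_eq0 mulf_eq0 (negbTE A0) => /eqP.
Qed.
End Member.
End Bertini.

(** * Sections of a smooth surface with prescribed nodes *)

Section NodalSections.
Variable K : numClosedFieldType.
Hypothesis unc : ~ countable [set: K].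
Local Notation P := {mpoly K[4]}.
Local Notation P2 := {mpoly K[2]}.
Local Notation j0 := (inord 0 : 'I_4).
Local Notation j1 := (inord 1 : 'I_4).

Lemma low_degree (F G : P) d n e f : F \is d.-homog -> G \is n.-homog -> f \is e.-homog -> (e < n)%N ->
  idl [:: F; G] f -> idl [:: F] f.
Proof.
move=> hF hG hf en /idl2P[a [b E]]; have := congr1 (pihomog mdeg e) E.
rewrite linearD /= (pihomog_dE hf) (pihomogMr0 _ hG en) addr0 => ->.
have [de|ed] := leqP d e; last by rewrite (pihomogMr0 _ hF ed); case: (is_ideal_idl [:: F]).
by rewrite -(subnK de) (pihomogMr _ _ hF); exists (pihomog mdeg (e - d) a) => /=; rewrite subrr.
Qed.

Lemma low_degree0 (F : P) d e f : F \is d.-homog -> f \is e.-homog -> (e < d)%N -> idl [:: F] f -> f = 0.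
Proof.
move=> hF hf ed [a /= /eqP]; rewrite subr_eq0 => /eqP E.
by have := congr1 (pihomog mdeg e) E; rewrite (pihomog_dE hf) (pihomogMr0 _ hF ed).
Qed.

Section Surface.
Variables (F : P) (d : nat) (N : 'M[K]_4) (p3 : 'rV[K]_4).
Hypothesis (uN : N \in unitmx) (d0 : (0 < d)%N) (hF : F \is d.-homog).
Hypothesis (p3N : p3 *m N = e3 K) (Fp3 : eval_at F p3 != 0).
Hypothesis smooth : forall x, x != 0 -> eval_at F x = 0 -> grad F x != 0.
Local Notation base := (base N).

(** The primality criterion is applied to a general plane section, without nodes and with [V] the
    constants: there [e (e - h)] has degree 0, so it lies in the ideal only if it is 0. Primality
    then passes to the surface. *)
Lemma surface_prime f g : isform f -> isform g -> idl [:: F] (f * g) -> idl [:: F] f \/ idl [:: F] g.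
Proof.
pose fam : seq P := [seq 'X_i | i <- enum 'I_4].
have [|||||//|t [pk _]] := @generic_member _ unc F d N p3 uN d0 hF p3N Fp3 smooth fam 1 [::] (fun=> 0) (fun=> 0).
- by [].
- by move=> Q /mapP[i _ ->]; exact: X_homog.
- move=> x x0 _ _; case/rV0Pn: x0 => i xi; exists 'X_i; last by rewrite evE.
  by apply: map_f; rewrite mem_enum.
- by [].
- by [].
apply: (prime_by_section unc pk) => f' g'; set G := \sum_(i < _) _ in pk *.
apply: (@nodes_prime _ unc _ _ _ _ _ _ _ _ pk 0%N (fun h => h \is 0.-homog)) => //.
- by move=> h k hh hk; exact: rpredD.
- by move=> x _ _; exists 1; rewrite ?evE ?oner_neq0 //; exact: dhomog1.
move=> e h hh he H; have hp : e * (e - h) \is 0.-homog.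
  exact: (dhomogM he (rpredB he hh)).
have /(low_degree0 hF hp d0) /eqP := low_degree hF (pk_G pk) hp (isT : (0 < 1)%N) H.
by rewrite mulf_eq0 => /orP[] /eqP ->; [left|right]; case: (is_ideal_idl [:: F; G]).
Qed.

Lemma surface_vanishing f e : f \is e.-homog -> (0 < e)%N ->
  (forall x, x != 0 -> eval_at F x = 0 -> eval_at f x = 0) -> idl [:: F] f.
Proof.
move=> hf e0 H; have ff : isform f by exists e.
have [k Hk] : exists k, idl [:: F] (f ^+ k).
  apply: (nullstellensatz unc); first exact: is_ideal_idl.
  move=> x Hx; have [->|x0] := eqVneq x 0; first exact: eval_homog0 hf e0.
  by apply: H => //; apply: Hx; exists 1 => /=; rewrite mul1r subrr.
elim: k Hk => [|k IH]; first by rewrite expr0 => H1; apply: (idl1 (a := f) (is_ideal_idl [:: F]) H1); rewrite mulr1.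
by rewrite exprS => /(surface_prime ff (formX k ff)) [].
Qed.

(** [F (y + s p3)] is a polynomial in [s] whose coefficient of degree [d] is [F (p3)], hence not a
    constant. The proof sees that coefficient as the value at 0 of the reversed polynomial [r]. *)
Lemma project_surface y : exists s, eval_at F (y + s *: p3) = 0.
Proof.
pose p := pev (fun i => (y 0 i)%:P + 'X * (p3 0 i)%:P) F.
pose r := pev (fun i => (p3 0 i)%:P + 'X * (y 0 i)%:P) F.
have Ep s : p.[s] = eval_at F (y + s *: p3).
  by rewrite eval_pev; congr eval_at; apply/rowP => i; rewrite !mxE hornerD hornerM !hornerC hornerX.
have Er s : r.[s] = eval_at F (p3 + s *: y).
  by rewrite eval_pev; congr eval_at; apply/rowP => i; rewrite !mxE hornerD hornerM !hornerC hornerX.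
have [s1|s1] := eqVneq (size p) 1%N; last first.
  by have /closed_rootP[s /rootP ps] := s1; exists s; rewrite -Ep.
exfalso; have pC := size1_polyC (eq_leq s1).
have /eqP H : r - (p`_0)%:P * 'X^d == 0.
  apply/negPn/negP => n0; have [c] := poly_nonroot (mulf_neq0 (negbT (polyX_eq0 K)) n0).
  move/eqP; apply; rewrite hornerM hornerX; have [->|c0] := eqVneq c 0; first by rewrite mul0r.
  have -> : (r - (p`_0)%:P * 'X^d).[c] = 0; last by rewrite mulr0.
  rewrite hornerD hornerN hornerM hornerC hornerXn Er.
  have -> : p3 + c *: y = c *: (y + c^-1 *: p3) by rewrite scalerDr scalerA mulfV // scale1r addrC.
  have Epc u : p.[u] = p`_0 by rewrite {1}pC hornerC.
  by rewrite (eval_scale _ _ hF) -Ep Epc mulrC subrr.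
move/eqP: Fp3; apply; rewrite -[p3]addr0 -[0 in X in _ + X](scale0r y) -Er.
move/eqP: H; rewrite subr_eq0 => /eqP ->.
by rewrite hornerM hornerXn expr0n eqn0Ngt d0 mulr0.
Qed.

Lemma hess_prod (h h' M : P) q v v' : eval_at h q = 0 -> eval_at h' q = 0 ->
  hess (h * h' * M) q v v' =
    (differential h q v * differential h' q v' + differential h q v' * differential h' q v) * eval_at M q.
Proof. by move=> hq h'q; rewrite !hessM !dfE !evE hq h'q; ring. Qed.

(** Covector of the member of the pencil through [q]. *)
Definition dirv q : 'rV[K]_4 :=
  base q 0 1 *: (\row_k N k j0) - base q 0 0 *: (\row_k N k j1).
Lemma dirvE q z : eval_at (blin (base q)) (base z) = dot (dirv q) z.
Proof.
rewrite /blin !evE /dirv dotDl -scaleNr !dotZl -!eval_lin_dot mulNr.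
by rewrite !mxE.
Qed.

(** The tangent plane of the surface is framed by [q], a direction [w] along the pencil member and a
    transversal [w']. The covectors [dirv q] and [grad F q] are independent because [p3] lies in
    every member of the pencil but is not tangent to the surface at [q]. *)
Lemma node_directions q : q != 0 -> eval_at F q = 0 -> base q != 0 -> differential F q p3 != 0 ->
  exists w w' al, [/\ differential F q w = 0, differential F q w' = 0,
    dot (dirv q) w = 0 /\ dot (dirv q) w' = 1, [/\ dot al q = 0, dot al w = 1 & dot al w' = 0] &
    forall v, differential F q v = 0 -> exists a b c : K, v = a *: q + b *: w + c *: w'].
Proof.
move=> q0 Fq bq Fp; have b3 : base p3 = 0.
  apply/rowP => i; rewrite [LHS]mxE eval_el p3N !mxE.
  suff -> : ((inord i : 'I_4) == inord 3) = false by rewrite andbF.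
  by case: i => [[|[|//]] Hi]; rewrite -val_eqE /= !inordK.
have d3 : dot (dirv q) p3 = 0.
  by rewrite -dirvE b3 (eval_homog0 (blin_homog _)).
have dq : dot (dirv q) q = 0 by rewrite -dirvE /blin !evE; ring.
have dn0 : dirv q != 0.
  apply: contraNneq bq => E; have H z : eval_at (blin (base q)) (base z) = 0.
    by rewrite dirvE E -[0]/(const_mx 0) /dot big1 // => i _; rewrite mxE mul0r.
  pose z0 : 'rV[K]_4 := delta_mx 0 j0 *m invmx N; pose z1 : 'rV[K]_4 := delta_mx 0 j1 *m invmx N.
  have bz0 : base z0 = delta_mx 0 0.
    apply/rowP => i; rewrite [LHS]mxE eval_el mulmxKV // !mxE; congr (_%:R).
    by rewrite eqxx; case: (ord2E i) => ->; rewrite -!val_eqE /= !inordK.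
  have bz1 : base z1 = delta_mx 0 1.
    apply/rowP => i; rewrite [LHS]mxE eval_el mulmxKV // !mxE; congr (_%:R).
    by rewrite eqxx; case: (ord2E i) => ->; rewrite -!val_eqE /= !inordK.
  have := H z0; have := H z1; rewrite bz0 bz1 /blin !evE.
  move: (base q) => z; rewrite !mxE /= !mulr0 !mulr1 subr0 sub0r => /eqP; rewrite oppr_eq0 => /eqP E0 E1.
  by apply/eqP/rowP => i; case: (ord2E i) => ->; rewrite [RHS]mxE.
have gq : dot (grad F q) q = 0 by apply: gradx hF Fq.
have ind : indep (dirv q) (grad F q).
  apply: (indepP dn0) => /sub_rVP[k E]; move/eqP: Fp; apply.
  by rewrite differential_dot E dotZl d3 mulr0.
have [w [dw gw qw kerw]] := kernel2 ind q0 dq gq.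
have [w' [gw' dw']] := dual_pair (indepC ind).
have dotC (a b : 'rV[K]_4) : dot a b = dot b a by apply: eq_bigr => i _; rewrite mulrC.
rewrite dotC in gw'; rewrite dotC in dw'.
have [al0 [alq alw]] := dual_pair qw.
exists w, w', (al0 - dot al0 w' *: dirv q); split.
- by rewrite differential_dot.
- by rewrite differential_dot.
- by [].
- by rewrite -scaleNr !dotDl !dotZl dq dw dw' alq alw; split; ring.
move=> v; rewrite differential_dot => gv; pose c := dot (dirv q) v.
have [||a [b E]] := kerw (v - c *: w').
- by rewrite -scaleNr dotDr dotZr dw' /c mulr1 subrr.
- by rewrite -scaleNr dotDr dotZr gw' gv mulr0 addr0.
by exists a, b, c; rewrite -E subrK.
Qed.

(** Solves the quadratic form [A b ^+ 2 + 2 B b + C] on [b w + w']. The nonzero discriminant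
    separates the two roots, and [A != 0] says that the pencil direction [w] is not a branch. *)
Lemma make_node G q w w' : q != 0 -> (forall v, differential G q v = 0) -> eval_at F q = 0 ->
  differential F q w = 0 -> differential F q w' = 0 ->
  dot (dirv q) w = 0 -> dot (dirv q) w' = 1 ->
  (forall v, differential F q v = 0 -> exists a b c : K, v = a *: q + b *: w + c *: w') ->
  hess G q w w != 0 -> hess G q w w' ^+ 2 != hess G q w w * hess G q w' w' -> node_at F G N q.
Proof.
move=> q0 Gq Fq Fw Fw' dw dw' ker A0 BC.
have [s Es] : exists s, s ^+ 2 = hess G q w w' ^+ 2 - hess G q w w * hess G q w' w'.
  by eexists; exact: sqrtCK.
set A := hess G q w w in A0 BC Es; set B := hess G q w w' in BC Es; set C := hess G q w' w' in BC Es.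
have s0 : s != 0.
  by apply: contraNneq BC => z; move: Es; rewrite z expr0n => /esym/eqP; rewrite subr_eq0.
split=> //.
  have /rV0Pn[i gi] := smooth q0 Fq; exists (delta_mx 0 i); apply: contraNneq gi.
  rewrite /differential (bigD1 i) //= big1 ?addr0 => [|j ji]; last by rewrite mxE (negbTE ji) andbF mulr0.
  by rewrite !mxE !eqxx mulr1 => ->.
pose a1 := (- B + s) / A; pose a2 := (- B - s) / A.
have Ea1 : A * a1 = - B + s by rewrite /a1 mulrC divfK.
have Ea2 : A * a2 = - B - s by rewrite /a2 mulrC divfK.
have a12 : a1 - a2 != 0.
  apply: contraNneq s0 => z; have : A * (a1 - a2) = 2%:R * s by rewrite mulrBr Ea1 Ea2; ring.
  by rewrite z mulr0 => /esym/eqP; rewrite mulf_eq0 pnatr_eq0.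
have hE b b' : hess G q (b *: w + w') (b' *: w + w') = A * b * b' + B * (b + b') + C.
  rewrite !(hessDr, hessDl, hessZr, hessZl) -/A -/B -/C (hessC G q w' w) -/B; ring.
have root b e : e ^+ 2 = s ^+ 2 -> A * b = - B + e -> A * b * b + B * (b + b) + C = 0.
  move=> Ee Eb; apply: (mulfI A0); rewrite mulr0.
  transitivity ((A * b) ^+ 2 + 2%:R * B * (A * b) + A * C); first by ring.
  rewrite Eb; transitivity (e ^+ 2 - B ^+ 2 + A * C); first by ring.
  by rewrite Ee Es; ring.
exists (a1 *: w + w'), (a2 *: w + w'); split.
- by rewrite !dfvE Fw Fw' mulr0 addr0.
- by rewrite !dfvE Fw Fw' mulr0 addr0.
- move=> v /ker[a [b [c ->]]]; exists a, ((b - a2 * c) / (a1 - a2)), (c - (b - a2 * c) / (a1 - a2)).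
  rewrite -!addrA; congr (_ + _); apply/rowP => i; rewrite !mxE.
  by field.
- split; [rewrite hE; exact: (root _ s)|rewrite hE; exact: (root _ (- s) (sqrrN s))|rewrite hE].
  apply: contraNneq s0 => z; have : A * (A * a1 * a2 + B * (a1 + a2) + C) = - (2%:R * s ^+ 2).
    transitivity ((A * a1) * (A * a2) + B * (A * a1 + A * a2) + A * C); first by ring.
    by rewrite Ea1 Ea2 Es; transitivity (2%:R * (A * C - B ^+ 2) + (B ^+ 2 - A * C - s ^+ 2)); [ring|rewrite Es; ring].
  rewrite z mulr0 => /esym/eqP; rewrite oppr_eq0 mulf_eq0 pnatr_eq0 /= sqrf_eq0 //.
- by rewrite !dirvE !dotDr !dotZr dw dw' !mulr0 add0r oner_neq0.
Qed.

Section Nodes.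
Variables (k m r : nat) (q : 'I_k -> 'rV[K]_4) (f : 'I_k -> P).
Hypothesis (m0 : (0 < m)%N) (hf : forall i, f i \is m.-1.-homog).
Hypothesis fq : forall i j, eval_at (f i) (q j) = (i == j)%:R.
Hypothesis q0 : forall i, q i != 0.
Hypothesis Fq : forall i, eval_at F (q i) = 0.
Hypothesis bq : forall i, base (q i) != 0.
Hypothesis Fp : forall i, differential F (q i) p3 != 0.
Let qs := [seq q i | i <- enum 'I_k].
Let n := (m + m + r)%N.

Definition through_nodes (h : P) : Prop := h \is m.-homog /\ forall i, eval_at h (q i) = 0.

Lemma lin_f v i : dot v (q i) = 0 -> through_nodes (lin v * f i).
Proof.
move=> vq; split; first by have -> : m = (1 + m.-1)%N by [rewrite add1n prednK]; apply: dhomogM => //; exact: lin_homog.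
by move=> j; rewrite evE fq; case: eqVneq => [<-|_]; rewrite ?mulr0 // eval_lin_dot vq mul0r.
Qed.

Lemma dlin_f v i u : dot v (q i) = 0 -> differential (lin v * f i) (q i) u = dot v u.
Proof. by move=> vq; rewrite dfE fq eqxx mulr1 !eval_lin_dot df_lin eval_lin_dot vq mul0r addr0. Qed.

(** At a point where some [f i] is nonzero, [f i] times linear forms through [q i] suffices unless
    the point is [q i]. Where all [f i] vanish, the interpolated [hL a] takes the same value as the
    pure power of ['X_a]. *)
Lemma through_family : exists H : seq P, (forall h, h \in H -> through_nodes h) /\
  forall x, x != 0 -> ~ isnode qs x -> exists2 h, h \in H & eval_at h x != 0.
Proof.
have /choice[c qc] : forall i, exists c, q i 0 c != 0 by move=> i; apply/rV0Pn.
pose mn i a b : 'rV[K]_4 := q i 0 a *: delta_mx 0 b - q i 0 b *: delta_mx 0 a.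
have dmn i a b x : dot (mn i a b) x = q i 0 a * x 0 b - q i 0 b * x 0 a.
  have dd c' : dot (delta_mx 0 c') x = x 0 c'.
    rewrite /dot (bigD1 c') //= big1 ?addr0 => [|j jc]; first by rewrite mxE !eqxx mul1r.
    by rewrite mxE (negbTE jc) andbF mul0r.
  by rewrite /mn dotDl -scaleNr !dotZl !dd mulNr.
pose hL a : P := 'X_a ^+ m - \sum_i (q i 0 a ^+ m / q i 0 (c i)) *: ('X_(c i) * f i).
pose H := [seq lin (mn i ab.1 ab.2) * f i | i <- enum 'I_k, ab <- enum {: 'I_4 * 'I_4}] ++
  [seq hL a | a <- enum 'I_4].
exists H; split=> [h|x x0 nx].
  rewrite mem_cat => /orP[/allpairsP[[i [a b]] /= [_ _ ->]]|/mapP[a _ ->]].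
    by apply: lin_f; rewrite dmn mulrC subrr.
  split.
    apply: rpredB; first exact: Xn_homog.
    apply: rpred_sum => i _; apply: rpredZ; have -> : m = (1 + m.-1)%N by rewrite add1n prednK.
    by apply: dhomogM => //; exact: X_homog.
  move=> j; rewrite /hL evE evE evE evE eval_at_sum (bigD1 j) //= big1 => [|i ij].
    by rewrite !evE fq eqxx mulr1 divfK // addr0 subrr.
  by rewrite !evE fq (negbTE ij) !mulr0.
have [[i fi]|nf] := pselect (exists i, eval_at (f i) x != 0).
  have [[[a b] ab]|nab] := pselect (exists ab : 'I_4 * 'I_4, dot (mn i ab.1 ab.2) x != 0).
    exists (lin (mn i a b) * f i); last by rewrite evE eval_lin_dot mulf_neq0.
    rewrite mem_cat; apply/orP; left.
    by apply: (allpairs_f (fun i ab => lin (mn i ab.1 ab.2) * f i) (x := i) (y := (a, b))); rewrite mem_enum.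
  case: nx; exists (q i); first by rewrite map_f ?mem_enum.
  apply/sub_rVP; exists (x 0 (c i) / q i 0 (c i)); apply/rowP => b; rewrite mxE.
  have : dot (mn i (c i) b) x = 0 by apply/eqP/negPn/negP => ab; apply: nab; exists (c i, b).
  rewrite dmn => /eqP; rewrite subr_eq0 => /eqP E; apply: (mulfI (qc i)); rewrite E.
  by rewrite mulrA mulrCA divff // mulr1 mulrC.
case/rV0Pn: x0 => a xa; exists (hL a); first by rewrite mem_cat map_f ?orbT ?mem_enum.
rewrite /hL !evE eval_at_sum big1 ?subr0 ?expf_neq0 // => i _.
rewrite !evE; have -> : eval_at (f i) x = 0 by apply/eqP/negPn/negP => fi; apply: nf; exists i.
by rewrite !mulr0.
Qed.

(** Products of two forms through the nodes are singular there. The squares built on [al] and [dirv]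
    make the quadratic parts at [q i] varied enough for a nondegenerate member, and the powers of
    variables adjust the degree. *)
Lemma nodal_section : (0 < n)%N -> exists2 G, package F G d n N p3 (pullback N) qs &
  forall i, node_at F G N (q i).
Proof.
move=> n0.
have /choice[c qc] : forall i, exists c, q i 0 c != 0 by move=> i; apply/rV0Pn.
have /choice[wa Hwa] : forall x, exists w : 'rV[K]_4 * 'rV[K]_4 * 'rV[K]_4, x \in qs ->
   [/\ differential F x w.1.1 = 0, differential F x w.1.2 = 0,
    dot (dirv x) w.1.1 = 0 /\ dot (dirv x) w.1.2 = 1,
    [/\ dot w.2 x = 0, dot w.2 w.1.1 = 1 & dot w.2 w.1.2 = 0] &
    forall v, differential F x v = 0 -> exists a b c : K, v = a *: x + b *: w.1.1 + c *: w.1.2].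
  move=> x; have [/mapP[i _ ->]|xq] := boolP (x \in qs); last by exists (0, 0, 0).
  have [w [w' [al H]]] := node_directions (q0 i) (Fq i) (bq i) (Fp i).
  by exists (w, w', al).
have qi i : q i \in qs by rewrite map_f ?mem_enum.
have dq i : dot (dirv (q i)) (q i) = 0 by rewrite -dirvE /blin !evE; ring.
pose w x := (wa x).1.1; pose w' x := (wa x).1.2; pose al x := (wa x).2.
have alq i : dot (al (q i)) (q i) = 0 by have [_ _ _ [? _ _] _] := Hwa _ (qi i).
have [H [HV Hfree]] := through_family.
pose H' := H ++ [seq lin (al (q i)) * f i | i <- enum 'I_k] ++ [seq lin (dirv (q i)) * f i | i <- enum 'I_k].
have HV' h : h \in H' -> through_nodes h.
  by rewrite !mem_cat => /orP[/HV //|/orP[]/mapP[i _ ->]]; apply: lin_f.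
pose fam := [seq hh.1 * hh.2 * 'X_c ^+ r | hh <- [seq (h, h') | h <- H', h' <- H'], c <- enum 'I_4].
have famI h h' c' : h \in H' -> h' \in H' -> h * h' * 'X_c' ^+ r \in fam.
  move=> hH hH'; apply: (allpairs_f (fun hh c => hh.1 * hh.2 * 'X_c ^+ r) (x := (h, h'))); last by rewrite mem_enum.
  exact: (allpairs_f (fun h h' => (h, h'))).
have famE Q : Q \in fam -> exists h h' c', [/\ through_nodes h, through_nodes h' & Q = h * h' * 'X_c' ^+ r].
  by move=> /allpairsP[[_ c'] /= [/allpairsP[[h h'] /= [hH hH' ->]] _ ->]]; exists h, h', c'; split=> //; apply: HV'.
have alH i : lin (al (q i)) * f i \in H' by rewrite !mem_cat (map_f (fun i => lin (al (q i)) * f i)) ?orbT ?mem_enum.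
have duH i : lin (dirv (q i)) * f i \in H' by rewrite !mem_cat (map_f (fun i => lin (dirv (q i)) * f i)) ?orbT ?mem_enum.
have Mq i : eval_at ('X_(c i) ^+ r : P) (q i) != 0 by rewrite !evE expf_neq0.
have [|||||t [pk Ht]] := @generic_member _ unc F d N p3 uN d0 hF p3N Fp3 smooth fam n qs w w' n0.
- move=> Q /famE[h [h' [c' [[hh _] [hh' _] ->]]]]; apply: dhomogM; first exact: dhomogM.
  exact: Xn_homog.
- move=> x x0 _ nx; have [h hH hx] := Hfree x x0 nx; have hH' : h \in H' by rewrite mem_cat hH.
  case/rV0Pn: x0 => c' xc; exists (h * h * 'X_c' ^+ r); first exact: famI.
  by rewrite !evE !mulf_neq0 // expf_neq0.
- by move=> x /mapP[i _ ->].
- move=> x /mapP[i _ ->]; exists (lin (al (q i)) * f i * (lin (al (q i)) * f i) * 'X_(c i) ^+ r); first exact: famI.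
  have [_ _ _ [_ aw aw'] _] := Hwa _ (qi i); have [_ z] := lin_f (alq i).
  rewrite hess_prod // !(dlin_f _ (alq i)) -/(w _) aw mulf_neq0 //.
  by rewrite mulr1 -(natrD K 1 1) pnatr_eq0.
- move=> x /mapP[i _ ->]; exists (lin (dirv (q i)) * f i * (lin (dirv (q i)) * f i) * 'X_(c i) ^+ r); first exact: famI.
  have [_ _ [dw dw'] _ _] := Hwa _ (qi i); have [_ z] := lin_f (dq i).
  rewrite !hess_prod // !(dlin_f _ (dq i)) -/(w _) -/(w' _) in dw dw' *; rewrite dw dw'.
  split; [by ring|by ring|rewrite mulf_neq0 //].
  by rewrite mulr1 -(natrD K 1 1) pnatr_eq0.
set G := \sum_(i < size fam) t`_i *: fam`_i in pk Ht; exists G => // i.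
have [Fw Fw' [dw dw'] _ ker] := Hwa _ (qi i); have [A0 BC] := Ht _ (qi i).
apply: (make_node (q0 i) _ (Fq i) Fw Fw' dw dw' ker A0 BC) => v.
rewrite /G df_sum big1 // => j _; have [|h [h' [c' [[_ hq] [_ hq'] ->]]]] := famE fam`_j; first by rewrite mem_nth.
by rewrite dfZ !dfE !evE hq hq'; ring.
Qed.

(** Since [r > 0], a form of degree [m + m] in the ideal of [F] and [G] is already a multiple of
    [F], which is prime. *)
Lemma nodal_section_prime G : (0 < r)%N -> package F G d n N p3 (pullback N) qs ->
  (forall i, node_at F G N (q i)) -> (forall i, eval_at G (q i) = 0) ->
  forall g h, isform g -> isform h -> idl [:: F; G] (g * h) -> idl [:: F; G] g \/ idl [:: F; G] h.
Proof.
move=> r0 pk Gn Gq; apply: (@nodes_prime _ unc _ _ _ _ _ _ _ _ pk m through_nodes).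
- by move=> h [].
- by move=> h h' [hh hq] [hh' hq']; split=> [|i]; [exact: rpredD|rewrite evE hq hq' addr0].
- by move=> h x [_ hq] /mapP[i _ ->].
- by move=> x /mapP[i _ ->].
- move=> x [x0 _ _] nx; have [H [HV Hf]] := through_family; have [h hH hx] := Hf x x0 nx.
  by exists h => //; exact: HV.
move=> e h [hh _] he H; have heh : e - h \is m.-homog by exact: rpredB.
have nn : (m + m < n)%N by rewrite /n -[ltnLHS]addn0 ltn_add2l.
have HF := low_degree hF (pk_G pk) (dhomogM he heh) nn H.
have sub f' : idl [:: F] f' -> idl [:: F; G] f'.
  by case=> a /= /eqP; rewrite subr_eq0 => /eqP ->; apply/idl2P; exists a, 0; ring.
by have [||/sub|/sub] := surface_prime _ _ HF; [exists m|exists m|left|right].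
Qed.
End Nodes.
End Surface.
End NodalSections.

(** * General points *)

Section DetPoints.
Variables (K : fieldType) (T : Type) (S : T -> Prop) (phi : nat -> T -> K).

(** A new point is found where the determinant, expanded along its last row, does not vanish: the
    coefficients are signed minors, and the last of them is the determinant of the previous
    points. *)
Lemma det_points k : (forall a : nat -> K, (forall x, S x -> \sum_(j < k) a j * phi j x = 0) ->
    forall j, (j < k)%N -> a j = 0) ->
  exists pts : 'I_k -> T, (forall i, S (pts i)) /\ \det (\matrix_(i < k, j < k) phi j (pts i)) != 0.
Proof.
elim: k => [|k IH] H.
  have f : 'I_0 -> T by case.
  by exists f; split=> [[]//|]; rewrite det_mx00 oner_neq0.
have [a Ha j jk|pts [Sp dn0]] := IH.
  have := H (fun i => if (i < k)%N then a i else 0); move=> /(_ _ j (ltnW jk)); rewrite jk; apply=> x Sx.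
  rewrite big_ord_recr /= ltnn mul0r addr0 -[RHS](Ha x Sx).
  by apply: eq_bigr => i _; rewrite ltn_ord.
pose a (j : nat) := (-1) ^+ (k + j) * \det (\matrix_(i < k, j' < k) phi (bump j j') (pts i)).
have [x Sx ax] : exists2 x, S x & \sum_(j < k.+1) a j * phi j x != 0.
  apply: contrapT => nx; move: dn0; have := H a; move=> /(_ _ k (ltnSn k)) E.
  suff: a k = 0.
    rewrite /a => /eqP; rewrite mulf_eq0 signr_eq0 /= => /eqP z; rewrite -z; apply/negP/negPn/eqP.
    by congr (\det _); apply/matrixP => i j; rewrite !mxE /bump leqNgt ltn_ord.
  by apply: E => x Sx; apply/eqP/negPn/negP => ax; apply: nx; exists x.
pose pts' (i : 'I_k.+1) := if unlift ord_max i is Some j then pts j else x.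
exists pts'; split=> [i|]; first by rewrite /pts'; case: unliftP.
rewrite (expand_det_row _ ord_max); congr (_ != 0): ax; apply: eq_bigr => j _.
rewrite mxE /pts' unlift_none mulrC; congr (_ * _); rewrite /cofactor /a /=; congr (_ * \det _).
by apply/matrixP => i j'; rewrite !mxE liftK.
Qed.
End DetPoints.

Section Multihomogeneous.
Variables (K : numClosedFieldType) (k : nat).
Local Notation Q := {mpoly K[k * 4]}.

Definition multihomog (e : 'I_k -> nat) (f : Q) : Prop :=
  forall mon, mon \in msupp f -> forall i, (\sum_(j < 4) mon (mxvec_index i j))%N = e i.

Lemma multihomog_sum (I : eqType) (r : seq I) (F : I -> Q) e :
  (forall i, i \in r -> multihomog e (F i)) -> multihomog e (\sum_(i <- r) F i).
Proof.
move=> H; rewrite big_seq; elim/big_ind: _ => [|f g Hf Hg mon /msuppD_le|//].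
  by move=> mon; rewrite msupp0.
by rewrite mem_cat => /orP[/Hf|/Hg].
Qed.
Lemma multihomogZ c f e : multihomog e f -> multihomog e (c *: f).
Proof. by move=> H mon /msuppZ_le; exact: H. Qed.
Lemma multihomogM f g e e' : multihomog e f -> multihomog e' g ->
  multihomog (fun i => e i + e' i)%N (f * g).
Proof.
move=> Hf Hg mon /msuppM_le/allpairsP[[m1 m2] /= [/Hf E1 /Hg E2 ->]] i.
by rewrite -E1 -E2 -big_split; apply: eq_bigr => j _; rewrite mnmDE.
Qed.
Lemma multihomog1 : multihomog (fun=> 0%N) 1.
Proof.
by move=> mon; rewrite msupp1 inE => /eqP -> i; rewrite big1 // => j _; rewrite mnmE.
Qed.
Lemma multihomog_prod (I : Type) (r : seq I) (F : I -> Q) (e : I -> 'I_k -> nat) :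
  (forall l, multihomog (e l) (F l)) -> multihomog (fun i => \sum_(l <- r) e l i)%N (\prod_(l <- r) F l).
Proof.
move=> H; elim: r => [|l r IH].
  by rewrite big_nil => mon; rewrite msupp1 inE => /eqP -> i; rewrite big_nil big1 // => j _; rewrite mnmE.
rewrite big_cons => mon /(multihomogM (H l) IH) E i; rewrite E big_cons //.
Qed.
Lemma multihomogX f e a : multihomog e f -> multihomog (fun i => a * e i)%N (f ^+ a).
Proof.
move=> Hf; elim: a => [|a IH]; first exact: multihomog1.
by rewrite exprS => mon /(multihomogM Hf IH) E i; rewrite E mulSn.
Qed.

Definition at_row (i : 'I_k) : {rmorphism {mpoly K[4]} -> Q} :=
  mmap (@mpolyC (k * 4) K) (fun l => 'X_(mxvec_index i l)).

Lemma eval_at_row i f (q : 'M[K]_(k, 4)) : eval_at (at_row i f) (mxvec q) = eval_at f (row i q).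
Proof.
rewrite /at_row /= eval_mmap; congr eval_at; apply/rowP => l; rewrite !mxE evE mxvecE //.
Qed.

Lemma multihomog_at_row i f D : f \is D.-homog -> multihomog (fun i' => (i' == i) * D)%N (at_row i f).
Proof.
move=> hf; rewrite [f]mpolyE rmorph_sum /=; apply: multihomog_sum => m mf.
rewrite mmapZ mul_mpolyC; apply: multihomogZ; rewrite mmapX /mmap1.
have hX l : multihomog (fun i' => (i' == i) : nat) 'X_(mxvec_index i l).
  move=> mon; rewrite msuppX inE => /eqP -> i'; case: eqVneq => [->|ni].
    rewrite (bigD1 l) //= big1 => [|j jl]; first by rewrite mnm1E eqxx.
    rewrite mnm1E; case: eqP => // /(congr1 (fun x => (enum_val (cast_ord (esym (mxvec_cast _ _)) x)).2)).
    by rewrite !cast_ordK !enum_rankK /= => E; rewrite E eqxx in jl.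
  rewrite big1 // => j _; rewrite mnm1E; case: eqP => //.
  move/(congr1 (fun x => (enum_val (cast_ord (esym (mxvec_cast _ _)) x)).1)).
  by rewrite !cast_ordK !enum_rankK /= => E; rewrite E eqxx in ni.
move=> mon /(multihomog_prod (fun l => multihomogX (a := m l) (hX l))) E i'.
rewrite E -(dhomog_mf hf mf : mdeg m = D) mdegE big_distrr /=.
by apply: eq_bigr => l _; rewrite mulnC.
Qed.
End Multihomogeneous.

Section GeneralPoints.
Variable K : numClosedFieldType.
Hypothesis unc : ~ countable [set: K].
Local Notation P := {mpoly K[4]}.
Local Notation j0 := (inord 0 : 'I_4).
Local Notation j1 := (inord 1 : 'I_4).
Local Notation j2 := (inord 2 : 'I_4).
Variables (F : P) (d : nat) (N : 'M[K]_4) (p3 : 'rV[K]_4).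
Hypothesis (uN : N \in unitmx) (d1 : (1 < d)%N) (hF : F \is d.-homog).
Hypothesis (p3N : p3 *m N = e3 K) (Fp3 : eval_at F p3 != 0).
Hypothesis smooth : forall x, x != 0 -> eval_at F x = 0 -> grad F x != 0.
Variable s : nat.
Hypothesis s0 : (0 < s)%N.

(** For [j < s * s], the monomials with exponents below [s] on the first two forms, completed by the
    third to a common degree. None involves the fourth form, so they are functions of the projection
    from [p3]. *)
Definition ternary (j : nat) : P :=
  el N j0 ^+ (j %/ s) * el N j1 ^+ (j %% s) * el N j2 ^+ (s.-1 + s.-1 - j %/ s - j %% s).
(** Its nonvanishing at a point puts the point off the axis of the pencil and makes [p3] transversal
    to the surface there; as a factor of the determinant it yields both conditions for general
    points. *)
Definition polar : P := el N j0 * dird p3 F.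

Lemma ternary_homog j : (j < s * s)%N -> ternary j \is (s.-1 + s.-1).-homog.
Proof.
move=> js; have a1 : (j %/ s <= s.-1)%N by rewrite -ltnS prednK // ltn_divLR.
have a2 : (j %% s <= s.-1)%N by rewrite -ltnS prednK // ltn_pmod.
have E : (s.-1 + s.-1 = j %/ s + j %% s + (s.-1 + s.-1 - j %/ s - j %% s))%N by lia.
rewrite {1}E; have hl (i : 'I_4) (u : nat) : el N i ^+ u \is u.-homog.
  by have := dhomogMn u (el_homog N i); rewrite mul1n.
by apply: dhomogM => //; apply: dhomogM.
Qed.

Lemma polar_homog : polar \is d.-homog.
Proof.
have -> : d = (1 + d.-1)%N by rewrite add1n prednK // ltnW.
apply: dhomogM; first exact: el_homog.
by apply: rpred_sum => i _; apply: rpredZ; exact: mderiv_homog.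
Qed.

Let d0 : (0 < d)%N. Proof. exact: ltnW. Qed.

Lemma el_p3 j : (j < 3)%N -> eval_at (el N (inord j)) p3 = 0.
Proof.
move=> j3; rewrite eval_el p3N mxE; suff -> : ((inord j : 'I_4) == inord 3) = false by rewrite andbF.
have j4 : (j < 4)%N by exact: leqW.
by rewrite -val_eqE /= !inordK //; apply/eqP => E; rewrite E in j3.
Qed.

Lemma polar_notin : ~ idl [:: F] polar.
Proof.
move=> H; have hp : dird p3 F \is d.-1.-homog.
  by apply: rpred_sum => i _; apply: rpredZ; exact: mderiv_homog.
have [||H1|H1] := surface_prime unc uN d0 hF p3N Fp3 smooth _ _ H.
- by exists 1%N; exact: el_homog.
- by exists d.-1.
- have z := low_degree0 hF (el_homog N j0) d1 H1.
  have := eval_el N j0 (delta_mx 0 j0 *m invmx N); rewrite z evE mulmxKV // mxE !eqxx => /esym/eqP.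
  by rewrite oner_eq0.
- have dd : (d.-1 < d)%N by rewrite prednK.
  have z := low_degree0 hF hp dd H1; have := eval_dird p3 F p3; rewrite z evE (euler _ hF) => /esym/eqP.
  by rewrite mulf_eq0 (negbTE Fp3) orbF pnatr_eq0 eqn0Ngt d0.
Qed.

Definition onS (x : 'rV[K]_4) : Prop := x != 0 /\ eval_at F x = 0.

(** [F] is prime and does not divide [polar], so the combination of monomials vanishes on the
    surface; being constant along lines through [p3], all of which meet the surface, it vanishes
    everywhere. *)
Lemma ternary_indep k (a : nat -> K) : (k <= s * s)%N ->
  (forall x, onS x -> \sum_(j < k) a j * eval_at (ternary j * polar) x = 0) ->
  forall j, (j < k)%N -> a j = 0.
Proof.
move=> ks H; pose g := \sum_(j < k) a j *: ternary j.
have hg : g \is (s.-1 + s.-1).-homog.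
  by apply: rpred_sum => j _; apply: rpredZ; apply: ternary_homog; exact: leq_trans ks.
have Hg : idl [:: F] (g * polar).
  apply: (surface_vanishing unc uN d0 hF p3N Fp3 smooth (dhomogM hg polar_homog)); first by rewrite addn_gt0 d0 orbT.
  move=> x x0 Fx; have xS : onS x by []. 
  rewrite -[RHS](H x xS) evE eval_at_sum mulr_suml; apply: eq_bigr => j _.
  by rewrite eval_atZ eval_atM mulrA.
have [||[c /= /eqP gF]|/polar_notin //] := surface_prime unc uN d0 hF p3N Fp3 smooth _ _ Hg.
- by exists (s.-1 + s.-1)%N.
- by exists d; exact: polar_homog.
have g0 y : eval_at g y = 0.
  have [t Ft] := project_surface d0 hF Fp3 y.
  have E : eval_at g (y + t *: p3) = 0 by move: gF; rewrite subr_eq0 => /eqP ->; rewrite evE Ft mulr0.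
  rewrite -[RHS]E !eval_at_sum; apply: eq_bigr => j _; rewrite !evE.
  have eD i : (i < 3)%N -> eval_at (el N (inord i)) (y + t *: p3) = eval_at (el N (inord i)) y.
    by move=> i3; rewrite eval_lin_dot dotDr dotZr -!eval_lin_dot (el_p3 i3) mulr0 addr0.
  by rewrite !eD.
pose p := \sum_(j < k) (a j)%:P * 'X^j.
have p0 : p = 0.
  apply/eqP/negPn/negP => /poly_nonroot[v]; move/eqP; apply.
  (* Kronecker substitution [(v ^+ s, v, 1)]: the monomial of index [j] takes the value [v ^+ j]. *)
  pose y : 'rV[K]_4 := \row_i (if i == j0 then v ^+ s else if i == j1 then v else 1) *m invmx N.
  have := g0 y; rewrite eval_at_sum /p horner_sum => E; rewrite -[RHS]E; apply: eq_bigr => j _.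
  rewrite hornerM hornerC hornerXn evE /ternary !evE !eval_el /y mulmxKV // !mxE eqxx.
  have -> : (j1 == j0) = false by rewrite -val_eqE /= !inordK.
  have -> : (j2 == j0) = false by rewrite -val_eqE /= !inordK.
  have -> : (j2 == j1) = false by rewrite -val_eqE /= !inordK.
  by rewrite eqxx expr1n mulr1 -exprM -exprD mulnC -divn_eq.
move=> j jk; have := congr1 (fun r : {poly K} => r`_j) p0; rewrite coef0 /p coef_sum.
rewrite (bigD1 (Ordinal jk)) //= big1 => [|i ij]; first by rewrite coefCM coefXn eqxx mulr1 addr0.
rewrite coefCM coefXn; case: eqP => [E|]; last by rewrite mulr0.
by case/eqP: ij; apply: val_inj.
Qed.

(** [Phi] is the determinant of the values of the products of [ternary] and [polar] at the points,
    of the same degree in each point. When it is nonzero, the inverse matrix gives forms dual to the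
    points. *)
Theorem general_points k : (k <= s * s)%N -> exists (e : 'I_k -> nat) (Phi : {mpoly K[k * 4]}),
  [/\ forall mon, mon \in msupp Phi -> forall i, (\sum_(j < 4) mon (mxvec_index i j))%N = e i,
    exists2 q : 'M[K]_(k, 4), forall i, onS (row i q) & eval_at Phi (mxvec q) != 0 &
    forall q : 'M[K]_(k, 4), (forall i, onS (row i q)) -> eval_at Phi (mxvec q) != 0 ->
      exists f : 'I_k -> P, [/\ forall i, f i \is (s.-1 + s.-1).-homog,
        forall i j, eval_at (f i) (row j q) = (i == j)%:R,
        forall i, base N (row i q) != 0 & forall i, differential F (row i q) p3 != 0]].
Proof.
move=> ks; pose D := (s.-1 + s.-1 + d)%N.
pose A : 'M[{mpoly K[k * 4]}]_k := \matrix_(i, j) at_row K i (ternary j * polar).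
exists (fun=> D), (\det A).
have EA (q : 'M[K]_(k, 4)) : eval_at (\det A) (mxvec q) =
    \det (\matrix_(i, j) eval_at (ternary j * polar) (row i q)).
  rewrite /eval_at -(det_map_mx (meval (fun i => mxvec q 0 i))); congr (\det _).
  by apply/matrixP => i j; rewrite [LHS]mxE [RHS]mxE [A i j]mxE; exact: eval_at_row.
split.
- have H (sg : 'I_k -> 'I_k) : multihomog (fun=> D) (\prod_i A i (sg i)).
    have hA l : multihomog (fun i => (i == l) * D)%N (A l (sg l)).
      rewrite mxE; apply: multihomog_at_row; apply: dhomogM; last exact: polar_homog.
      by apply: ternary_homog; exact: leq_trans (ltn_ord _) ks.
    move=> mon /(multihomog_prod hA) E i; rewrite E (bigD1 i) //= eqxx mul1n big1 ?addn0 // => l li.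
    by rewrite eq_sym (negbTE li) mul0n.
  rewrite /determinant; apply: multihomog_sum => sg _; rewrite mulr_sign.
  by case: ifP => _; [rewrite -scaleN1r; apply: multihomogZ|]; exact: H.
- have [pts [Sp dn0]] := det_points (S := onS) (phi := fun j => eval_at (ternary j * polar))
    (fun a Ha => ternary_indep ks Ha).
  exists (\matrix_i pts i); first by move=> i; rewrite rowK.
  by rewrite EA; under eq_mx => i j do rewrite rowK.
move=> q Sq; rewrite EA; set B := \matrix_(i, j) _ => dB.
have uB : B \in unitmx by rewrite unitmxE unitfE.
have qn0 i : eval_at polar (row i q) != 0.
  apply: contraNneq dB => z; rewrite (expand_det_row _ i) big1 // => j _.
  by rewrite mxE evE z mulr0 mul0r.
have tE i j : B i j = eval_at (ternary j) (row i q) * eval_at polar (row i q) by rewrite mxE evE.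
(* Row [i] of [B] carries the value of [polar] at point [i], which is divided out so that only the
   [ternary] forms enter [f]. *)
exists (fun i => \sum_j (invmx B j i * eval_at polar (row i q)) *: ternary j); split.
- move=> i; apply: rpred_sum => j _; apply: rpredZ; apply: ternary_homog; exact: leq_trans ks.
- move=> i j; rewrite eval_at_sum.
  transitivity (eval_at polar (row i q) / eval_at polar (row j q) * (B *m invmx B) j i).
    rewrite mxE mulr_sumr; apply: eq_bigr => l _; rewrite evE tE.
    by field; exact: qn0.
  by rewrite mulmxV // mxE eq_sym; case: eqVneq => [->|_]; rewrite ?mulr0 // mulr1 divff.
- move=> i; apply: contraNneq (qn0 i) => z; rewrite /polar evE.
  by have := congr1 (fun v : 'rV[K]_2 => v 0 0) z; rewrite [LHS]mxE [RHS]mxE => ->; rewrite mul0r.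
- move=> i; apply: contraNneq (qn0 i) => z; rewrite /polar evE eval_dird z mulr0 //.
Qed.
End GeneralPoints.

Lemma sub_col2 (K : fieldType) n (x w v : 'rV[K]_n) :
  (v <= col_mx x w)%MS <-> exists s t, v = s *: x + t *: w.
Proof.
rewrite -addsmxE; split=> [/sub_addsmxP[[a b] /= ->]|[s [t ->]]].
  by exists (a 0 0), (b 0 0); rewrite {1}(mx11_scalar a) {1}(mx11_scalar b) !mul_scalar_mx.
by rewrite addmx_sub_adds ?scalemx_sub.
Qed.

(** * The curve and its singular points *)

Section ClosedSets.
Variables (K : numClosedFieldType) (n : nat).
Local Notation P := {mpoly K[n.+1]}.
Implicit Types (f g : P) (x y : 'rV[K]_n.+1) (Z : set 'rV[K]_n.+1).

Definition ishom f : Prop := exists m, f \is m.-homog.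
Definition vanish Z f : Prop := forall x, Z x -> eval_at f x = 0.

Lemma homM f g : ishom f -> ishom g -> ishom (f * g).
Proof. by move=> [m hf] [k hg]; exists (m + k)%N; apply: dhomogM. Qed.

Definition point x : set 'rV[K]_n.+1 := [set y | (y == x)%MS].

Lemma pointP x y : x != 0 -> point x y <-> exists2 c, c != 0 & y = c *: x.
Proof.
move=> x0; rewrite /point /=; split=> [/andP[/sub_rVP[c E] /sub_rVP[b E']]|[c c0 ->]].
  exists c => //; apply: contraNneq x0 => c0; rewrite E' E c0 scale0r scaler0 //.
apply/andP; split; first exact: scalemx_sub.
by apply/sub_rVP; exists c^-1; rewrite scalerA mulVf // scale1r.
Qed.

Definition minor x a b : P := x 0 a *: 'X_b - x 0 b *: 'X_a.

Lemma minor_hom x a b : ishom (minor x a b).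
Proof. by exists 1%N; apply: rpredB; apply: rpredZ; exact: X_homog. Qed.

Lemma minors_colinear x y : x != 0 -> (forall a b, eval_at (minor x a b) y = 0) -> exists c, y = c *: x.
Proof.
case/rV0Pn => a xa H; exists (y 0 a / x 0 a); apply/rowP => b; rewrite mxE.
have := H a b; rewrite /minor !evE => /eqP; rewrite subr_eq0 => /eqP E.
by apply: (mulfI xa); rewrite E mulrA mulrCA divff // mulr1 mulrC.
Qed.

Lemma point_closed x : x != 0 -> Zariski_closed (point x).
Proof.
move=> x0; exists [set f | exists a b, f = minor x a b]; split.
  by move=> f [a [b ->]]; exact: minor_hom.
apply/seteqP; split=> y.
  move/(pointP y x0) => [c c0 ->]; split; first by rewrite scaler_eq0 negb_or c0.
  by move=> f [a [b ->]]; rewrite /minor !evE !mxE; ring.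
move=> [y0 H]; have [|c E] := minors_colinear x0 (y := y); first by move=> a b; apply: H; exists a, b.
by apply/pointP => //; exists c => //; apply: contraNneq y0 => c0; rewrite E c0 scale0r.
Qed.

(** Irreducibility is applied to one point and to the common zeros of the forms vanishing at the
    others; products of linear forms through these show that this closed set contains nothing
    else. *)
Lemma irr_finite Z (s : seq 'rV[K]_n.+1) : Zariski_closed Z -> irreducible Z ->
  (forall x, x \in s -> x != 0) -> (forall z, Z z -> exists2 x, x \in s & point x z) ->
  single_point Z.
Proof.
move=> cZ irr s0 H.
have [x xs Zx] : exists2 x, x \in s & Z `<=` point x.
  elim: s s0 H => [|x s IH] s0 H; first by case: irr => [[z /H[]]].
  pose E (f : P) := ishom f /\ forall y, y \in s -> eval_at f y = 0.
  have cE : Zariski_closed (zero_locus E) by exists E; split=> // f [].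
  have sE z : zero_locus E z -> exists2 y, y \in s & point y z.
    move=> [z0 Hz]; apply: contrapT => nz.
    have /choice[mm Hm] : forall y : 'rV[K]_n.+1, exists ab : 'I_n.+1 * 'I_n.+1, y \in s -> eval_at (minor y ab.1 ab.2) z != 0.
      move=> y; have [ys|] := boolP (y \in s); last by exists (0, 0).
      apply: contrapT => nab; apply: nz; exists y => //; have y0 : y != 0 by apply: s0; rewrite inE ys orbT.
      have [|c E'] := minors_colinear y0 (y := z).
        move=> a b; apply/eqP/negPn/negP => ab; apply: nab; exists (a, b) => //.
      apply/pointP => //; exists c => //; apply: contraNneq z0 => c0; rewrite E' c0 scale0r //.
    have : eval_at (\prod_(y <- s) minor y (mm y).1 (mm y).2) z = 0.
      apply: Hz; split.
        elim: (s) => [|y t IHt]; first by rewrite big_nil; exists 0%N; exact: dhomog1.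
        by rewrite big_cons; apply: homM => //; exact: minor_hom.
      move=> y ys; rewrite eval_at_prod (big_rem y) //= /minor !evE; ring.
    rewrite eval_at_prod => /eqP; rewrite prodf_seq_eq0 => /hasP[y ys] /=.
    by apply/negP; exact: Hm.
  have x0 : x != 0 by apply: s0; rewrite mem_head.
  have [|Zx|ZE] := irr.2 _ _ (point_closed x0) cE.
  - move=> z Zz; have [y + yz] := H z Zz; rewrite inE => /orP[/eqP <-|ys]; first by left.
    right; have y0 : y != 0 by apply: s0; rewrite inE ys orbT.
    have [c c0 ->] := (pointP z y0).1 yz; split; first by rewrite scaler_eq0 negb_or c0.
    by move=> f [[m hf] Hf]; rewrite (eval_scale _ _ hf) Hf ?mulr0.
  - by exists x => //; exact: mem_head.
  - have [|z /ZE/sE //|y ys Zy] := IH; first by move=> y ys; apply: s0; rewrite inE ys orbT.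
    by exists y => //; rewrite inE ys orbT.
exists x; first exact: s0.
apply/seteqP; split=> // y yx; have x0 := s0 x xs.
have [[z Zz] _] := irr; have /pointP : point x z by exact: Zx.
move=> /(_ x0)[c c0 E]; have /pointP : point x y by [].
move=> /(_ x0)[c' c'0 ->].
have [E0 [hE ZE]] := cZ; rewrite ZE in Zz *; case: Zz => z0 Hz; split.
  by rewrite scaler_eq0 negb_or c'0.
move=> f Ef; have [m hf] := hE f Ef; rewrite (eval_scale _ _ hf).
have := Hz f Ef; rewrite E (eval_scale _ _ hf) => /eqP.
by rewrite mulf_eq0 expf_eq0 (negbTE c0) andbF /= => /eqP ->; rewrite mulr0.
Qed.
End ClosedSets.

Section CurvePoints.
Variable K : numClosedFieldType.
Hypothesis unc : ~ countable [set: K].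
Local Notation P := {mpoly K[4]}.
Local Notation P2 := {mpoly K[2]}.
Variables (F G : P) (d n : nat) (N : 'M[K]_4) (p3 : 'rV[K]_4) (io : {rmorphism P2 -> P}).
Variable qs : seq 'rV[K]_4.
Hypothesis pk : package F G d n N p3 io qs.
Local Notation I := (idl [:: F; G]).
Local Notation base := (base N).
Hypothesis prI : forall f g, isform f -> isform g -> I (f * g) -> I f \/ I g.
Hypothesis (d1 : (1 < d)%N) (n1 : (1 < n)%N).
Let HI : is_ideal I. Proof. exact: is_ideal_idl. Qed.

Definition curve : set 'rV[K]_4 := [set x | oncurve F G x].

Lemma curveI f : vanishing_ideal curve f <-> I f.
Proof. by split=> [H|/I_van H x xX]; [apply: (pk_van unc pk)|exact: H]. Qed.

Lemma curve_scale x c : c != 0 -> curve x -> curve (c *: x).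
Proof.
move=> c0 [x0 Fx Gx]; split; first by rewrite scaler_eq0 negb_or c0.
  by rewrite (eval_scale _ _ (pk_F pk)) Fx mulr0.
by rewrite (eval_scale _ _ (pk_G pk)) Gx mulr0.
Qed.

(** Every coordinate is integral over the pencil, so on the fibre over [y] its value, normalized by
    the scale of the base point, is a root of a fixed monic polynomial. *)
Lemma fiber_finite y : y != 0 -> exists pts : seq 'rV[K]_4, forall x, curve x -> eval_at (blin y) (base x) = 0 ->
  exists2 p, p \in pts & exists c, x = c *: p.
Proof.
move=> y0; have H a : exists rs : seq K, forall x c, curve x -> c != 0 -> base x = c *: y -> x 0 a / c \in rs.
  have [r [b [br hb E]]] := pk_integral pk (X_homog K a).
  pose p := \sum_(i < r.+1) (eval_at (b i) y)%:P * 'X^i.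
  have p0 : p != 0.
    apply/eqP => z; have := congr1 (fun p : {poly K} => p`_r) z; rewrite coef0 /p coef_sum big_ord_recr /=.
    rewrite coefCM coefXn eqxx br evE mulr1 big1 ?add0r => [/eqP|i _]; first by rewrite oner_eq0.
    by rewrite coefCM coefXn gtn_eqF // mulr0.
  have [rs Hrs] := poly_zeros p0; exists rs => x c xX c0 bx; apply: Hrs.
  apply: (mulfI (expf_neq0 r c0)); rewrite mulr0 /p horner_sum mulr_sumr.
  rewrite -[RHS](I_van xX E) eval_at_sum; apply: eq_bigr => i _.
  have ir : (i <= r)%N by rewrite -ltnS.
  rewrite hornerM hornerC hornerXn evE (pk_eval pk) bx (eval_scale _ _ (hb i ir)) !evE muln1.
  rewrite expr_div_n -{1}(subnK ir) exprD; field; exact: expf_neq0.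
have /choice[rs Hrs] := H.
pose pts := [seq (\row_(i < 4) [:: t.1.1; t.1.2; t.2.1; t.2.2]`_i : 'rV[K]_4) | t <-
   [seq (ab, cd) | ab <- [seq (a, b) | a <- rs (inord 0), b <- rs (inord 1)],
                   cd <- [seq (a, b) | a <- rs (inord 2), b <- rs (inord 3)]]].
exists pts => x xX bx; have bx0 := pk_base pk xX.
have [c bE] : exists c, base x = c *: y.
  case/rV0Pn: y0 => i yi; exists (base x 0 i / y 0 i); apply/rowP => j; rewrite [RHS]mxE.
  move: bx; rewrite /blin !evE => /eqP; rewrite subr_eq0 => /eqP E.
  have {}E : y 0 i * base x 0 j = base x 0 i * y 0 j.
    by case: (ord2E i) (ord2E j) => -> [] ->; rewrite ?E; [exact: mulrC|rewrite -E; exact: mulrC|exact: mulrC|exact: mulrC].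
  by apply: (mulfI yi); rewrite E; field.
have c0 : c != 0 by apply: contraNneq bx0 => c0; rewrite bE c0 scale0r.
exists (c^-1 *: x); last by exists c; rewrite scalerA mulfV // scale1r.
apply/mapP; exists ((x 0 (inord 0) / c, x 0 (inord 1) / c), (x 0 (inord 2) / c, x 0 (inord 3) / c)).
  by apply: (allpairs_f (fun a b => (a, b))); apply: (allpairs_f (fun a b => (a, b))); apply: Hrs.
apply/rowP => i; rewrite !mxE mulrC -[i in LHS]inord_val.
by case: i => [[|[|[|[|//]]]] Hi].
Qed.

(** After cancelling powers of [f], its integral equation shows that a nonzero binary form pulls
    back to a multiple of [f] modulo the ideal; the zeros of [f] lie in finitely many fibres. *)
Lemma finite_zeros f : isform f -> ~ I f -> exists pts : seq 'rV[K]_4, (forall p, p \in pts -> p != 0) /\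
  forall x, curve x -> eval_at f x = 0 -> exists2 p, p \in pts & point p x.
Proof.
move=> ff nf; have [m hf] := ff.
have [r [b [br hb E]]] := pk_integral pk hf.
have ex : exists j, b j != 0 by exists r; rewrite br oner_neq0.
case: (ex_minnP ex) => j bj jmin.
have jr : (j <= r)%N by apply: jmin; rewrite br oner_neq0.
have Hb : exists e c, [/\ b j \is e.-homog & I (io (b j) + f * c)].
  exists ((r - j) * m)%N.
  pose c := \sum_(j.+1 <= i < r.+1) io (b i) * f ^+ (i - j.+1).
  have cE : f * c = \sum_(j.+1 <= i < r.+1) io (b i) * f ^+ (i - j).
    rewrite mulr_sumr [LHS]big_nat [RHS]big_nat; apply: eq_bigr => i /andP[ji _].
    have -> : (i - j = (i - j.+1).+1)%N by rewrite -subSn.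
    by rewrite exprS; ring.
  exists c; split; first exact: hb.
  have hfc : f * c \is ((r - j) * m).-homog.
    rewrite cE big_nat; apply: rpred_sum => i /andP[ji ir].
    have -> : ((r - j) * m = (r - i) * m + (i - j) * m)%N.
      by rewrite -mulnDl; congr (_ * _)%N; rewrite addnBA ?(ltnW ji) // subnK.
    apply: dhomogM; first by apply: (pk_homog pk); apply: hb.
    by rewrite mulnC; apply: dhomogMn.
  have ha : io (b j) \is ((r - j) * m).-homog by apply: (pk_homog pk); apply: hb.
  have Hac : I (f ^+ j * (io (b j) + f * c)).
    apply: (idl1 (a := 1) HI E).
    rewrite -(big_mkord xpredT (fun i => io (b i) * f ^+ i)) (@big_cat_nat _ _ _ j) //=; last exact: leqW.
    rewrite big_nat big1 ?add0r => [|i /andP[_ ij]]; last first.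
      have -> : b i = 0 by apply/eqP/negPn/negP => /jmin; rewrite leqNgt ij.
      by rewrite rmorph0 mul0r.
    rewrite mul1r big_ltn ?ltnS // cE mulrDr mulr_sumr; congr (_ + _); first exact: mulrC.
    rewrite [LHS]big_nat [RHS]big_nat; apply: eq_bigr => i /andP[ji _].
    by rewrite mulrCA -exprD subnKC // ltnW.
  have [||H|//] := prI _ _ Hac; first exact: formX.
    by exists ((r - j) * m)%N; exact: rpredD.
  case: nf; elim: (j) H => [|l IH]; last by rewrite exprS => /(prI ff (formX l ff))[].
  by rewrite expr0 => H1; apply: (idl1 (a := f) HI H1); rewrite mulr1.
have [e [c [hbj Hbc]]] := Hb.
suff [pts Hpts] : exists pts : seq 'rV[K]_4, forall x, curve x -> eval_at (b j) (base x) = 0 ->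
    exists2 p, p \in pts & exists c, x = c *: p.
  exists [seq p <- pts | p != 0]; split=> [p|x xX fx]; first by rewrite mem_filter => /andP[].
  have [|p pp [a xE]] := Hpts x xX.
    by have := I_van xX Hbc; rewrite !evE (pk_eval pk) fx mul0r addr0.
  have x0 : x != 0 by case: xX.
  have p0 : p != 0 by apply: contraNneq x0 => p0; rewrite xE p0 scaler0.
  exists p; first by rewrite mem_filter p0.
  by apply/pointP => //; exists a => //; apply: contraNneq x0 => a0; rewrite xE a0 scale0r.
apply: (binary_ind unc (Q := fun b => exists pts : seq 'rV[K]_4, forall x, curve x -> eval_at b (base x) = 0 ->
    exists2 p, p \in pts & exists c, x = c *: p) _ _ hbj bj) => [c' c0|y b' y0 [pts Hpts]].
  by exists [::] => x _; rewrite evE => /eqP; rewrite (negbTE c0).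
have [pts' Hpts'] := fiber_finite y0; exists (pts ++ pts') => x xX; rewrite evE => /eqP.
rewrite mulf_eq0 => /orP[] /eqP /[dup] Hx.
  by move=> /(Hpts' x xX)[p pp H]; exists p => //; rewrite mem_cat pp orbT.
by move=> /(Hpts x xX)[p pp H]; exists p => //; rewrite mem_cat pp.
Qed.

Lemma I_low f m : f \is m.-homog -> (m < n)%N -> (m < d)%N -> I f -> f = 0.
Proof.
move=> hf mn md H; apply: (low_degree0 (pk_F pk) hf md).
exact: (low_degree (pk_F pk) (pk_G pk) hf mn).
Qed.

Lemma curve_nonempty : curve !=set0.
Proof.
apply: contrapT => ne; have : I 1 by apply/curveI => x xX; case: ne; exists x.
have h1 : (1 : P) \is 0.-homog by exact: dhomog1.
by move=> /(I_low h1 (ltnW n1) (ltnW d1)) /eqP; rewrite oner_eq0.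
Qed.

Lemma curve_not_point x : ~ (curve `<=` point x).
Proof.
move=> H; have [y yX] := curve_nonempty; have [y0 _ _] := yX.
have x0 : x != 0.
  by apply: contraNneq y0 => x0; have /andP[/sub_rVP[c ->] _] := H y yX; rewrite x0 scaler0.
have mI a b : minor x a b = 0.
  apply: (@I_low _ 1%N) => //; first by apply: rpredB; apply: rpredZ; exact: X_homog.
  apply/curveI => z /H /(pointP z x0)[c _ ->]; rewrite /minor !evE !mxE; ring.
case/rV0Pn: (x0) => a xa; have [b ba] : exists b : 'I_4, b != a.
  by have [->|ne] := eqVneq a 0; [exists 1|exists 0; rewrite eq_sym].
have := congr1 (fun f : P => eval_at f (delta_mx 0 b)) (mI a b).
by rewrite /minor !evE !mxE !eqxx /= eq_sym (negbTE ba) mulr0 subr0 mulr1 => /eqP; rewrite (negbTE xa).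
Qed.

Lemma curve_irreducible : irreducible curve.
Proof.
split; first exact: curve_nonempty.
move=> Y Z [EY [hY ->]] [EZ [hZ ->]] H; apply: contrapT => /not_orP[nY nZ].
have wit E : (forall f, E f -> exists m, f \is m.-homog) -> ~ (curve `<=` zero_locus E) ->
    exists f, [/\ E f, isform f & ~ I f].
  move=> hE nE; apply: contrapT => nf; apply: nE => x xX; split; first by case: xX.
  move=> f Ef; apply: (I_van xX); apply: contrapT => If; apply: nf; exists f; split=> //; exact: hE.
have [f [Ef ff nf]] := wit _ hY nY; have [g [Eg fg ng]] := wit _ hZ nZ.
have : I (f * g).
  by apply/curveI => x /H[[_ Hx]|[_ Hx]]; [rewrite evE (Hx f Ef) mul0r|rewrite evE (Hx g Eg) mulr0].
by move=> /(prI ff fg)[].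
Qed.

Lemma curve_closed : Zariski_closed curve.
Proof.
exists [set f | f = F \/ f = G]; split.
  by move=> f [] ->; [exists d; exact: pk_F pk|exists n; exact: pk_G pk].
apply/seteqP; split=> x; first by case=> x0 Fx Gx; split=> // f [] ->.
by case=> x0 H; split=> //; apply: H; [left|right].
Qed.

Lemma curve_integral : integral_curve curve.
Proof.
split; [exact: curve_closed|exact: curve_irreducible| |].
  by move=> [x x0 E]; apply: (@curve_not_point x); rewrite E.
move=> Z cZ iZ ZX ZnX; have [E [hE ZE]] := cZ.
have [f [Ef ff nf]] : exists f, [/\ E f, isform f & ~ I f].
  apply: contrapT => nf; apply: ZnX; apply/seteqP; split=> // x xX; rewrite ZE.
  split; first by case: xX.
  move=> f Ef; apply: (I_van xX); apply: contrapT => If; apply: nf; exists f; split=> //; exact: hE.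
have [pts [p0 Hp]] := finite_zeros ff nf.
apply: (irr_finite cZ iZ p0) => z Zz; apply: Hp; first exact: ZX.
by move: Zz; rewrite ZE => -[_]; apply.
Qed.

Lemma curve_tangent x v : curve x ->
  (cone_tangent_space curve x v <-> differential F x v = 0 /\ differential G x v = 0).
Proof.
move=> xX; have [_ Fx Gx] := xX; split=> [H|[Fv Gv] f /curveI/idl2P[a [b ->]]]; last first.
  by rewrite !dfE Fx Gx Fv Gv; ring.
by split; apply: H; apply/curveI; apply/idl2P; [exists 1, 0|exists 0, 1]; ring.
Qed.

Lemma curve_regular x : curve x -> ~ isnode qs x -> curve_regular_at curve x.
Proof.
move=> xX nx; have [x0 Fx Gx] := xX; have ind := pk_reg pk x0 Fx Gx nx.
have [w [Fw Gw xw kerw]] := kernel2 ind x0 (gradx (pk_F pk) Fx) (gradx (pk_G pk) Gx).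
exists (col_mx x w : 'M_(1 + 1, 4)); first exact: indep_row_free.
move=> v; split.
  move=> /(curve_tangent _ xX); rewrite !differential_dot => -[Fv Gv].
  by apply/sub_col2; exact: kerw.
move=> /sub_col2[a [b ->]]; apply/(curve_tangent _ xX).
rewrite !differential_dot !dotDr !dotZr.
by rewrite Fw Gw (gradx (pk_F pk) Fx) (gradx (pk_G pk) Gx) !mulr0 addr0.
Qed.
End CurvePoints.

(** * Initial forms and the tangent cone at a node *)

Section Order.
Variables (K : numClosedFieldType) (n : nat).
Hypothesis unc : ~ countable [set: K].
Local Notation P := {mpoly K[n.+1]}.
Implicit Types (f g h : P) (p v w : 'rV[K]_n.+1) (T : 'I_n.+1 -> {poly K}).

Lemma pev_ext T T' f : (forall i, T i = T' i) -> pev T f = pev T' f.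
Proof. by move=> E; apply: eq_bigr => m _; congr (_ * _); exact: mmap1_eq. Qed.

Lemma pev_scale (c : {poly K}) T f m : f \is m.-homog -> pev (fun i => c * T i) f = c ^+ m * pev T f.
Proof.
move=> hf; rewrite /pev /= /mmap big_distrr /= big_seq [RHS]big_seq; apply: eq_bigr => k kf.
rewrite mulrCA; congr (_ * _); have <- : mdeg k = m := dhomog_mf hf kf.
rewrite /mmap1 mdegE -prodrXr -big_split /=; apply: eq_bigr => i _; exact: exprMn.
Qed.

Lemma pev_translate p f T : pev T (translate p f) = pev (fun i => (p 0 i)%:P + T i) f.
Proof.
rewrite /translate /pev /=; elim/mpoly_ring_ind: f => [c|i|f g Hf Hg|f g Hf Hg].
- by rewrite comp_mpolyC !mmapC.
- by rewrite comp_mpolyXU -tnth_nth tnth_mktuple mmapX mmapD !mmapX !mmap1U mmapC addrC.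
- by rewrite comp_mpolyD !mmapD Hf Hg.
- by rewrite rmorphM !rmorphM /= Hf Hg.
Qed.

Lemma pev_high g k : (forall m, m \in msupp g -> (k < mdeg m)%N) -> forall T,
  exists c, pev (fun i => 'X * T i) g = 'X^(k.+1) * c.
Proof.
move=> H T; exists (\sum_(m <- msupp g) (g@_m)%:P * ('X^(mdeg m - k.+1) * mmap1 T m)).
rewrite /pev /= /mmap big_distrr big_seq [RHS]big_seq; apply: eq_bigr => m mg /=.
rewrite mulrCA; congr (_ * _); rewrite mulrA -exprD subnKC; last exact: H.
by rewrite /mmap1 mdegE -prodrXr -big_split /=; apply: eq_bigr => i _; exact: exprMn.
Qed.

Lemma high_order g k : (forall v, exists c, pev (fun i => 'X * (v 0 i)%:P) g = 'X^(k.+1) * c) ->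
  forall m, m \in msupp g -> (k < mdeg m)%N.
Proof.
move=> H m mg; rewrite ltnNge; apply/negP => mk.
have E v j : (pev (fun i => 'X * (v 0 i)%:P) g)`_j = eval_at (pihomog mdeg j g) v.
  rewrite {1}[g](pihomog_partitionE (mf := mdeg) (k := msize g)) //= rmorph_sum coef_sum.
  have He (i : nat) : (pev (fun l => 'X * (v 0 l)%:P) (pihomog mdeg i g))`_j = (i == j)%:R * eval_at (pihomog mdeg i g) v.
    rewrite (pev_scale _ _ (pihomogP _ _ _)) /pev /= pevC coefXnM coefC.
    case: ltngtP => [ij|ij|->]; rewrite ?subnn ?mul1r // ?mul0r //.
    by rewrite subn_eq0 leqNgt ij.
  under eq_bigr => i _ do rewrite He.
  have [jg|jg] := ltnP j (msize g).
    rewrite (bigD1 (Ordinal jg)) //= eqxx mul1r big1 ?addr0 // => i ij.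
    by case: eqP => [e|]; rewrite ?mul0r //; case/eqP: ij; apply: val_inj.
  rewrite big1 => [|i _]; last by rewrite ltn_eqF ?mul0r // (leq_trans (ltn_ord i)).
  rewrite pihomogE big_seq_cond big1 ?evE // => k' /andP[kg /eqP ke].
  by have := msize_mdeg_lt kg; rewrite ke ltnNge jg.
have z : pihomog mdeg (mdeg m) g = 0.
  apply: (eval_inj0 unc) => v; have [c Ec] := H v.
  by rewrite -E Ec coefXnM ltnS mk.
have : g@_m = 0.
  rewrite [g](pihomog_partitionE (mf := mdeg) (k := msize g)) //= raddf_sum /=.
  rewrite big1 // => i _; have [e|ne] := eqVneq (mdeg m) i; first by rewrite -e z mcoeff0.
  by apply: (dhomog_nemf_coeff (pihomogP _ _ _)).
by move/eqP; rewrite mcoeff_eq0 mg.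
Qed.

Lemma pev_homog_germ h k v (c : 'I_n.+1 -> {poly K}) : h \is k.-homog -> exists e,
  pev (fun i => 'X * ((v 0 i)%:P + 'X * c i)) h = 'X^k * ((eval_at h v)%:P + 'X * e).
Proof.
move=> hh; rewrite (pev_scale _ _ hh).
have [e E] := taylor1 (@polyC K) h (fun i => (v 0 i)%:P) c 'X.
exists (\sum_i mmap (@polyC K) (fun i => (v 0 i)%:P) h^`M(i) * c i + 'X * e).
congr (_ * _); rewrite /pev /= E pevC; ring.
Qed.

(** Turns the condition on monomials into one on arcs: along an arc leaving [p] in the direction
    [v], the coefficient of order [k] is the value of the initial form at [v]. *)
Lemma tangent_cone_elim (X : set 'rV[K]_n.+1) p k h : tangent_cone_ideal X p k h -> h \is k.-homog /\
  exists2 f, vanishing_ideal X f & forall v x, germ p v x ->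
    exists c, pev x f = 'X^k * ((eval_at h v)%:P + 'X * c).
Proof.
move=> [hh [f Xf Hf]]; split=> //; exists f => // v x [c Hc].
have [e1 E1] := pev_homog_germ v c hh; have [e2 E2] := pev_high Hf (fun i => (v 0 i)%:P + 'X * c i).
exists (e1 + e2).
rewrite (pev_ext f Hc) -(pev_translate p f (fun i => 'X * ((v 0 i)%:P + 'X * c i))).
by move: E2; rewrite rmorphB E1 => /eqP; rewrite subr_eq => /eqP ->; rewrite exprS; ring.
Qed.

Lemma tangent_cone_intro (X : set 'rV[K]_n.+1) p k h f : h \is k.-homog -> vanishing_ideal X f ->
  (forall v, exists c, pev (fun i => (p 0 i)%:P + 'X * (v 0 i)%:P) f = 'X^k * ((eval_at h v)%:P + 'X * c)) ->
  tangent_cone_ideal X p k h.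
Proof.
move=> hh Xf H; split=> //; exists f => //; apply: high_order => v; have [c E] := H v.
exists c; rewrite rmorphB pev_translate E (pev_scale _ _ hh) /pev /= pevC exprS; ring.
Qed.

Lemma line_germ p v : germ p v (fun i => (p 0 i)%:P + 'X * (v 0 i)%:P).
Proof. by exists (fun=> 0) => i; rewrite mulr0 addr0. Qed.

Lemma pev_line2 G p v : eval_at G p = 0 -> (forall u, differential G p u = 0) ->
  exists c, 2%:R * pev (fun i => (p 0 i)%:P + 'X * (v 0 i)%:P) G = 'X^2 * ((hess G p v v)%:P + 'X * c).
Proof.
move=> Gp Gv; set x := (fun i : 'I_n.+1 => (p 0 i)%:P + 'X * (v 0 i)%:P); have gx : germ p v x := line_germ p v.
have [c1 E1] := pev_germ G gx; rewrite Gp Gv !polyC0 !add0r in E1.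
have [c2 E2] := pev_diff_germ G v gx; rewrite Gv !polyC0 !add0r in E2.
have E3 : (pev x G)^`() = 'X * ((hess G p v v)%:P + 'X * c2).
  rewrite deriv_pev -E2; apply: eq_bigr => i _; congr (_ * _).
  by rewrite /x !(derivD, derivM, derivC, derivX) !(mulr0, addr0, mul0r, add0r, mul1r).
have [c0 [c3 E4]] := poly_split c1; rewrite E4 in E1.
have := congr1 (fun r : {poly K} => r`_1) E3.
rewrite E1 coef_deriv !coefXM /= !coefD !coefC !coefXM /= !addr0 => E5.
exists (2%:R * c3); rewrite -E5 polyCMn; ring.
Qed.

Lemma plane_ideal (p u : 'rV[K]_n.+1) (L M : 'rV[K]_n.+1) h : indep p u ->
  (forall v, dot L v = 0 -> dot M v = 0 -> exists s t, v = s *: p + t *: u) ->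
  (forall s t, eval_at h (s *: p + t *: u) = 0) -> exists a b, h = a * lin L + b * lin M.
Proof.
move=> pu ker Hh; have [b1 [b1p b1u]] := dual_pair pu; have [b0 [b0u b0p]] := dual_pair (indepC pu).
pose A := b0^T *m p + b1^T *m u.
have vA v : v *m A = dot b0 v *: p + dot b1 v *: u.
  rewrite mulmxDr !mulmxA; congr (_ + _).
    by rewrite [v *m _]mx11_scalar mul_scalar_mx dotE.
  by rewrite [v *m _]mx11_scalar mul_scalar_mx dotE.
have [|c ->] := @proj_ideal K unc n.+1 A h; first by move=> y; rewrite vA.
have /choice[ab Hab] : forall j, exists ab : K * K, (\row_i ((i == j)%:R - A i j)) = ab.1 *: L + ab.2 *: M.
  move=> j; have [v Lv Mv|a [b E]] := @span_dual K n.+1 L M (\row_i ((i == j)%:R - A i j)); last by exists (a, b).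
  have [s [t vE]] := ker v Lv Mv.
  have : dot (\row_i ((i == j)%:R - A i j)) v = v 0 j - (v *m A) 0 j.
    rewrite /dot [(v *m A) 0 j]mxE; under eq_bigr => i _ do rewrite mxE mulrBl.
    rewrite sumrB; congr (_ - _); last by apply: eq_bigr => i _; rewrite mulrC.
    by rewrite (bigD1 j) //= eqxx mul1r big1 ?addr0 // => i /negbTE ->; rewrite mul0r.
  move=> ->; rewrite vA vE !dotDr !dotZr b0p b0u b1p b1u !mxE; ring.
exists (\sum_j c j * (ab j).1%:MP), (\sum_j c j * (ab j).2%:MP).
rewrite !mulr_suml -big_split; apply: eq_bigr => j _ /=.
by rewrite Hab linD !linZ -!mul_mpolyC; ring.
Qed.
End Order.

Lemma row_free3P (K : fieldType) n (p u v : 'rV[K]_n) : row_free (col_mx p (col_mx u v)) <->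
  forall a b c, a *: p + b *: u + c *: v = 0 -> [/\ a = 0, b = 0 & c = 0].
Proof.
have E a b c : row_mx a%:M (row_mx b%:M c%:M) *m col_mx p (col_mx u v) = a *: p + b *: u + c *: v.
  by rewrite !mul_row_col !mul_scalar_mx addrA.
split=> [H a b c|H].
  rewrite -E -(mul0mx _ (col_mx p (col_mx u v))) => /(row_free_inj H).
  rewrite -[RHS](@row_mx0 _ 1 1 (1 + 1)) => /eq_row_mx[].
  move=> /matrixP/(_ 0 0); rewrite !mxE eqxx mulr1n => ->.
  rewrite -[RHS](@row_mx0 _ 1 1 1) => /eq_row_mx[].
  move=> /matrixP/(_ 0 0); rewrite !mxE eqxx mulr1n => ->.
  by move=> /matrixP/(_ 0 0); rewrite !mxE eqxx mulr1n => ->.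
rewrite -kermx_eq0; apply/eqP/row_matrixP => i; rewrite row0.
set c := row i _; have : c *m col_mx p (col_mx u v) = 0 by rewrite /c -row_mul mulmx_ker row0.
rewrite -[c]hsubmxK -[rsubmx c]hsubmxK.
rewrite [lsubmx c]mx11_scalar [lsubmx (rsubmx c)]mx11_scalar [rsubmx (rsubmx c)]mx11_scalar E.
by move=> /H[-> -> ->]; rewrite !raddf0 !row_mx0.
Qed.

Section NodePoints.
Variable K : numClosedFieldType.
Hypothesis unc : ~ countable [set: K].
Local Notation P := {mpoly K[4]}.
Local Notation P2 := {mpoly K[2]}.
Variables (F G : P) (d n : nat) (N : 'M[K]_4) (p3 : 'rV[K]_4) (io : {rmorphism P2 -> P}).
Variable qs : seq 'rV[K]_4.
Hypothesis pk : package F G d n N p3 io qs.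
Local Notation I := (idl [:: F; G]).
Local Notation base := (base N).
Local Notation X := (curve F G).

Lemma node_independent p w1 w2 : p != 0 -> (forall v, differential G p v = 0) ->
  hess G p w1 w1 = 0 -> hess G p w2 w2 = 0 -> hess G p w1 w2 != 0 ->
  forall a b c, a *: p + b *: w1 + c *: w2 = 0 -> [/\ a = 0, b = 0 & c = 0].
Proof.
move=> p0 Gv h11 h22 h12 a b c E.
have he w : hess G p p w = 0 := hess_euler w (pk_G pk) Gv.
have b0 : b = 0.
  have : hess G p (a *: p + b *: w1 + c *: w2) w2 = 0.
    by rewrite E; have := hessZl G p w2 w2 0; rewrite scale0r mul0r.
  rewrite !hessDl !hessZl he h22 !mulr0 add0r addr0 => /eqP.
  by rewrite mulf_eq0 (negbTE h12) orbF => /eqP.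
have c0 : c = 0.
  have : hess G p (a *: p + b *: w1 + c *: w2) w1 = 0.
    by rewrite E; have := hessZl G p w1 w1 0; rewrite scale0r mul0r.
  rewrite !hessDl !hessZl he h11 (hessC G p w2 w1) !mulr0 !add0r => /eqP.
  by rewrite mulf_eq0 (negbTE h12) orbF => /eqP.
split=> //; move/eqP: E; rewrite b0 c0 !scale0r !addr0 scaler_eq0 (negbTE p0) orbF => /eqP //.
Qed.

(** The Hessian ignores [p], so [s p + t w] with [t != 0] is again a branch direction; elements of
    the ideal vanish to any order along the branch, so their initial forms are 0 in its direction.
    For [t = 0] the arc stays on the line of [p], where the ideal vanishes identically. *)
Lemma branch_vanishing p w w' k h : X p -> (forall v, differential G p v = 0) ->
  (exists e, differential F p e != 0) -> differential F p w = 0 -> differential F p w' = 0 ->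
  hess G p w w = 0 -> hess G p w w' != 0 -> tangent_cone_ideal X p k h ->
  forall s t, eval_at h (s *: p + t *: w) = 0.
Proof.
move=> pX Gv [e Fe] Fw Fw' hww hww' /tangent_cone_elim[hh [f /(curveI unc pk) fI H]] s t.
have [p0 Fp Gp] := pX.
have he u : hess G p p u = 0 := hess_euler u (pk_G pk) Gv.
have Fpp : differential F p p = 0 by rewrite (euler _ (pk_F pk)) Fp mulr0.
suff [x gx [c E]] : exists2 x, germ p (s *: p + t *: w) x & exists c, pev x f = 'X^(k.+1) * c.
  have [c' E'] := H _ _ gx; have := congr1 (fun r : {poly K} => r`_k) E'.
  by rewrite E exprSr -mulrA !coefXnM ltnn subnn coefXM coefD coefC coefXM /= addr0.
have [t0|t0] := eqVneq t 0.
  pose x i := (p 0 i)%:P + 'X * ((s *: p + t *: w) 0 i)%:P.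
  exists x; first exact: line_germ.
  exists 0; rewrite mulr0; apply/eqP/negPn/negP => /poly_nonroot[z]; move/eqP; apply.
  rewrite eval_pev; have -> : (\row_i (x i).[z]) = (1 + z * s) *: p.
    apply/rowP => i; rewrite mxE [RHS]mxE /x t0 scale0r addr0 hornerD hornerM !hornerC hornerX mxE; ring.
  move/idl2P: fI => [a [b ->]].
  by rewrite !evE (eval_scale _ _ (pk_F pk)) (eval_scale _ _ (pk_G pk)) Fp Gp; ring.
have [|||x [gx Fx Gx]] := @branch K _ F G p (s *: p + t *: w) w' e Fp _ Fw' Fe Gp Gv _ _ k.+1.
- by rewrite !dfvE Fpp Fw !mulr0 addr0.
- by rewrite !(hessDr, hessDl, hessZl, hessZr) hww (hessC G p w p) !he; ring.
- by rewrite hessDl !hessZl he mulr0 add0r mulf_neq0.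
by exists x => //; exact: pev_ideal fI Fx Gx.
Qed.

(** The union of the two planes has ideal generated by [L], the linear part of [F], and [Q2], the
    Hessian form of [G]. A form [A L + B Q2] is realized as an initial form by translating [A] and
    [B] back to [p] and multiplying them with [F] and [G]. *)
Lemma node_cone p k h w1 w2 : X p -> (forall v, differential G p v = 0) ->
  differential F p w1 = 0 -> differential F p w2 = 0 ->
  (forall v, differential F p v = 0 -> exists a b c : K, v = a *: p + b *: w1 + c *: w2) ->
  hess G p w1 w1 = 0 -> hess G p w2 w2 = 0 -> hess G p w1 w2 != 0 -> h \is k.-homog ->
  (forall s t, eval_at h (s *: p + t *: w1) = 0) -> (forall s t, eval_at h (s *: p + t *: w2) = 0) ->
  tangent_cone_ideal X p k h.
Proof.
move=> pX Gv Fw1 Fw2 ker h11 h22 h12 hh H1 H2; have [p0 Fp Gp] := pX.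
have he u : hess G p p u = 0 := hess_euler u (pk_G pk) Gv.
have Fpp : differential F p p = 0 by rewrite (euler _ (pk_F pk)) Fp mulr0.
have ind := node_independent p0 Gv h11 h22 h12.
pose L := grad F p; pose al w := grad (dird w G) p.
have dal w v : dot (al w) v = hess G p v w by rewrite -differential_dot -hess_dird.
have dL v : dot L v = differential F p v by rewrite differential_dot.
have p1 : indep p w1 by move=> s t E; have [|-> -> _] := ind s t 0; rewrite ?scale0r ?addr0.
have p2 : indep p w2 by move=> s t E; have [|-> _ ->] := ind s 0 t; rewrite ?scale0r ?addr0.
have ker1 v : dot L v = 0 -> dot (al w1) v = 0 -> exists s t, v = s *: p + t *: w1.
  rewrite dL dal => /ker[a [b [c ->]]]; rewrite !hessDl !hessZl he h11 (hessC G p w2) !mulr0 !add0r.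
  by move/eqP; rewrite mulf_eq0 (negbTE h12) orbF => /eqP ->; exists a, b; rewrite scale0r addr0.
have ker2 v : dot L v = 0 -> dot (al w2) v = 0 -> exists s t, v = s *: p + t *: w2.
  rewrite dL dal => /ker[a [b [c ->]]]; rewrite !hessDl !hessZl he h22 !mulr0 !add0r addr0.
  by move/eqP; rewrite mulf_eq0 (negbTE h12) orbF => /eqP ->; exists a, c; rewrite scale0r addr0.
(* Vanishing on the first plane leaves [b] times [lin (al w1)]. On the second plane [al w1] is
   nonzero away from the line of [p], so [b] vanishes there, and on that line too because its
   restriction is polynomial in [u]. *)
have two g : (forall s t, eval_at g (s *: p + t *: w1) = 0) -> (forall s t, eval_at g (s *: p + t *: w2) = 0) ->
    exists a b, g = a * lin L + b * (lin (al w1) * lin (al w2)).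
  move=> g1 g2; have [a [b E]] := plane_ideal unc p1 ker1 g1.
  have [s t|a' [b' E']] := plane_ideal unc p2 ker2 (h := b); last first.
    by exists (a + a' * lin (al w1)), b'; rewrite E E'; ring.
  have b0 u : u != 0 -> eval_at b (s *: p + u *: w2) = 0.
    move=> u0; have := g2 s u; rewrite E !evE !eval_lin_dot dL dal.
    rewrite !dfvE Fpp Fw2 !hessDl !hessZl he (hessC G p w2) !mulr0 !addr0 !add0r mulr0 add0r => /eqP.
    by rewrite !mulf_eq0 (negbTE u0) (negbTE h12) !orbF => /eqP.
  pose pi := pev (fun i => (s * p 0 i)%:P + 'X * (w2 0 i)%:P) b.
  have Epi u : pi.[u] = eval_at b (s *: p + u *: w2).
    by rewrite eval_pev; congr eval_at; apply/rowP => i; rewrite !mxE hornerD hornerM !hornerC hornerX.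
  have : pi = 0.
    apply/eqP/negPn/negP => pin0; have [u] := poly_nonroot (mulf_neq0 (negbT (polyX_eq0 K)) pin0).
    rewrite hornerM hornerX mulf_eq0 negb_or => /andP[u0]; rewrite Epi b0 // eqxx //.
  by rewrite -Epi => ->; rewrite horner0.
pose Q2 : P := \sum_i 'X_i * lin (grad G^`M(i) p).
have hQ2 : Q2 \is 2.-homog.
  by apply: rpred_sum => i _; exact: (dhomogM (X_homog K i) (lin_homog _)).
have eQ2 v : eval_at Q2 v = hess G p v v.
  by rewrite eval_at_sum; apply: eq_bigr => i _; rewrite !evE eval_lin_dot -differential_dot.
have [a [b E]] := two h H1 H2.
have [||a2 [b2 E2]] := two Q2.
- by move=> s t; rewrite eQ2 !(hessDr, hessDl, hessZl, hessZr) h11 (hessC G p w1 p) !he; ring.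
- by move=> s t; rewrite eQ2 !(hessDr, hessDl, hessZl, hessZr) h22 (hessC G p w2 p) !he; ring.
have hL : lin L \is 1.-homog := lin_homog _.
have hal : lin (al w1) * lin (al w2) \is 2.-homog := dhomogM (lin_homog _) (lin_homog _).
pose cc := (pihomog mdeg 0 b2)@_0.
have {}E2 : Q2 = pihomog mdeg 1 a2 * lin L + cc%:MP * (lin (al w1) * lin (al w2)).
  rewrite -{1}(pihomog_dE hQ2) E2 linearD /=.
  have -> : pihomog mdeg 2 (a2 * lin L) = pihomog mdeg 1 a2 * lin L := pihomogMr 1 a2 hL.
  have -> : pihomog mdeg 2 (b2 * (lin (al w1) * lin (al w2))) = pihomog mdeg 0 b2 * (lin (al w1) * lin (al w2)).
    exact: (pihomogMr 0 b2 hal).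
  by rewrite {1}(homog0_const (pihomogP _ 0 b2)).
have b20 : cc != 0.
  have /eqP := congr1 (fun g => eval_at g (w1 + w2)) E2.
  rewrite eQ2 !evE !eval_lin_dot dL !dal !dfvE Fw1 Fw2 !(hessDr, hessDl) h11 h22 (hessC G p w2 w1).
  rewrite !(addr0, add0r, mulr0) => E0; apply: contraTneq E0 => ->; rewrite mul0r.
  by rewrite -mulr2n mulrn_eq0.
have {}E : exists A B, h = A * lin L + B * Q2.
  exists (a - b * ((cc)^-1)%:MP * pihomog mdeg 1 a2), (b * ((cc)^-1)%:MP).
  have e1 : ((cc)^-1)%:MP * (cc)%:MP = 1 :> P by rewrite -mpolyCM mulVf.
  rewrite E E2; transitivity (a * lin L + b * (((cc)^-1)%:MP * (cc)%:MP) * (lin (al w1) * lin (al w2))).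
    by rewrite e1; ring.
  ring.
have {E}[A [B [hA hB E]]] : exists A B, [/\ A = 0 \/ (0 < k)%N /\ A \is k.-1.-homog,
    B = 0 \/ (1 < k)%N /\ B \is k.-2.-homog & h = A * lin L + B * Q2].
  move: E => [A [B E]]; have := congr1 (pihomog mdeg k) E; rewrite linearD /= (pihomog_dE hh) => {}E.
  have EA : exists2 A', A' = 0 \/ (0 < k)%N /\ A' \is k.-1.-homog & pihomog mdeg k (A * lin L) = A' * lin L.
    case: (k) => [|k']; first by exists 0; [left|rewrite mul0r (pihomogMr0 _ hL)].
    by exists (pihomog mdeg k' A); [right; split=> //; exact: pihomogP|rewrite -(addn1 k') (pihomogMr _ _ hL)].
  have EB : exists2 B', B' = 0 \/ (1 < k)%N /\ B' \is k.-2.-homog & pihomog mdeg k (B * Q2) = B' * Q2.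
    case: (k) => [|[|k']]; [by exists 0; [left|rewrite mul0r (pihomogMr0 _ hQ2)]..|].
    by exists (pihomog mdeg k' B); [right; split=> //; exact: pihomogP|rewrite -(addn2 k') (pihomogMr _ _ hQ2)].
  by have [A' hA EA'] := EA; have [B' hB EB'] := EB; exists A', B'; split=> //; rewrite E EA' EB'.
(* The factor 2 is there because [Q2] is twice the quadratic part of [G] at [p]. *)
pose f := translate (- p) A * F + translate (- p) B * (2%:R * G).
apply: (tangent_cone_intro unc (f := f) hh).
  by apply/(curveI unc pk); apply/idl2P; exists (translate (- p) A), (translate (- p) B * 2%:R); rewrite /f; ring.
move=> v; have tr C : pev (fun i => (p 0 i)%:P + 'X * (v 0 i)%:P) (translate (- p) C) = pev (fun i => 'X * (v 0 i)%:P) C.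
  by rewrite pev_translate; apply: pev_ext => i; rewrite mxE polyCN addrA addNr add0r.
have [cF EF] := pev_germ F (line_germ p v); have [cG EG] := pev_line2 v Gp Gv.
have EhA : exists e, pev (fun i => (p 0 i)%:P + 'X * (v 0 i)%:P) (translate (- p) A * F) =
    'X^k * ((eval_at (A * lin L) v)%:P + 'X * e).
  rewrite rmorphM tr EF Fp polyC0 add0r; case: hA => [->|[k0 hA]].
    by exists 0; rewrite rmorph0 !evE !mul0r mulr0 addr0 mulr0.
  exists ((eval_at A v)%:P * cF); rewrite (pev_scale _ _ hA) /pev /= pevC -{2}(prednK k0) exprS.
  by rewrite evE eval_lin_dot dL polyCM; ring.
have EhB : exists e, pev (fun i => (p 0 i)%:P + 'X * (v 0 i)%:P) (translate (- p) B * (2%:R * G)) =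
    'X^k * ((eval_at (B * Q2) v)%:P + 'X * e).
  rewrite rmorphM tr [pev _ (2%:R * G)]rmorphM rmorph_nat EG; case: hB => [->|[k1 hB]].
    by exists 0; rewrite rmorph0 !evE !mul0r mulr0 addr0 mulr0.
  exists ((eval_at B v)%:P * cG); rewrite (pev_scale _ _ hB) /pev /= pevC.
  have -> : 'X^k = 'X^2 * 'X^(k.-2) :> {poly K} by rewrite -exprD; congr ('X^_); case: (k) k1 => [|[|]].
  by rewrite evE eQ2 polyCM; ring.
have [e1 E1] := EhA; have [e2 E2'] := EhB; exists (e1 + e2).
have Eh : eval_at h v = eval_at (A * lin L) v + eval_at (B * Q2) v by rewrite [in LHS]E eval_atD.
by rewrite /f rmorphD E1 E2' Eh polyCD; ring.
Qed.

Lemma node_is_node p : X p -> node_at F G N p -> is_node X p.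
Proof.
move=> pX [Gv Fe [w1 [w2 [Fw1 Fw2 ker [h11 h22 h12] _]]]]; split=> //.
exists w1, w2; split.
  by apply/row_free3P; apply: node_independent => //; case: pX.
move=> k h hh; split=> [H w|H].
  move=> /orP[] /sub_col2[s [t ->]].
    exact: (branch_vanishing pX Gv Fe Fw1 Fw2 h11 h12 H).
  by apply: (branch_vanishing pX Gv Fe Fw2 Fw1 h22 _ H); rewrite hessC.
apply: (node_cone pX Gv Fw1 Fw2 ker h11 h22 h12 hh) => s t; apply: H; apply/orP.
  by left; apply/sub_col2; exists s, t.
by right; apply/sub_col2; exists s, t.
Qed.

Lemma node_at_scale q c : c != 0 -> node_at F G N q -> node_at F G N (c *: q).
Proof.
move=> c0 [Gv [e Fe] [w1 [w2 [Fw1 Fw2 ker [h11 h22 h12] [u1 u2]]]]].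
have Fs v : differential F (c *: q) v = c ^+ d.-1 * differential F q v := df_homog _ _ _ (pk_F pk).
have hs v w : hess G (c *: q) v w = c ^+ n.-2 * hess G q v w.
  rewrite mulr_sumr; apply: eq_bigr => i _.
  by rewrite (df_homog _ _ _ (mderiv_homog i (pk_G pk))); ring.
have bs : base (c *: q) = c *: base q.
  by apply/rowP => i; rewrite !mxE (eval_scale _ _ (el_homog _ _)) expr1.
have us w : eval_at (blin (base (c *: q))) (base w) = c * eval_at (blin (base q)) (base w).
  by rewrite bs /blin !evE !mxE; ring.
split.
- by move=> v; rewrite (df_homog _ _ _ (pk_G pk)) Gv mulr0.
- by exists e; rewrite Fs mulf_neq0 // expf_neq0.
exists w1, w2; split; rewrite ?Fs ?hs ?us ?Fw1 ?Fw2 ?h11 ?h22 ?mulr0 //.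
- move=> v; rewrite Fs => /eqP; rewrite mulf_eq0 expf_eq0 (negbTE c0) andbF => /eqP/ker[a [b [e' ->]]].
  by exists (a / c), b, e'; rewrite scalerA divfK.
- by split=> //; rewrite mulf_neq0 // expf_neq0.
- by split; rewrite mulf_neq0.
Qed.

(** At a point outside [qs] the linear parts of [F] and [G] are initial forms, so both planes of a
    node would lie in the two-dimensional kernel of these covectors, which has no room for three
    independent vectors. *)
Lemma node_in_nodes x : is_node X x -> isnode qs x.
Proof.
move=> [xX [u [v [rf H]]]]; apply: contrapT => nx; have [x0 Fx Gx] := xX.
have ind := pk_reg pk x0 Fx Gx nx; have ind3 := (row_free3P x u v).1 rf.
have tc f m : f \is m.-homog -> eval_at f x = 0 -> I f -> tangent_cone_ideal X x 1 (lin (grad f x)).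
  move=> hf fx fI; apply: (tangent_cone_intro unc (f := f) (lin_homog _)); first exact/(curveI unc pk).
  move=> w; have [c E] := pev_germ f (line_germ x w); exists c.
  by rewrite E fx eval_lin_dot differential_dot expr1 polyC0 add0r.
have tF : tangent_cone_ideal X x 1 (lin (grad F x)).
  by apply: (tc _ _ (pk_F pk)) => //; apply/idl2P; exists 1, 0; ring.
have tG : tangent_cone_ideal X x 1 (lin (grad G x)).
  by apply: (tc _ _ (pk_G pk)) => //; apply/idl2P; exists 0, 1; ring.
have H1 a w : tangent_cone_ideal X x 1 (lin a) -> (w <= col_mx x u)%MS || (w <= col_mx x v)%MS -> dot a w = 0.
  by move=> ta hw; rewrite -eval_lin_dot; apply: (H 1%N _ (lin_homog a)).1.
have uu : (u <= col_mx x u)%MS by apply/sub_col2; exists 0, 1; rewrite scale0r add0r scale1r.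
have vv : (v <= col_mx x v)%MS by apply/sub_col2; exists 0, 1; rewrite scale0r add0r scale1r.
have [w [Fw Gw xw kerw]] := kernel2 ind x0 (gradx (pk_F pk) Fx) (gradx (pk_G pk) Gx).
have [s1 [t1 E1]] := kerw u (H1 _ _ tF (introT orP (or_introl uu))) (H1 _ _ tG (introT orP (or_introl uu))).
have [s2 [t2 E2]] := kerw v (H1 _ _ tF (introT orP (or_intror vv))) (H1 _ _ tG (introT orP (or_intror vv))).
have [|_ t20 t10] := ind3 (t1 * s2 - t2 * s1) t2 (- t1).
  by rewrite E1 E2; apply/rowP => i; rewrite !mxE; ring.
have [|_ /eqP] := ind3 (- s1) 1 0; last by rewrite oner_eq0.
move/eqP: t10; rewrite oppr_eq0 => /eqP t10.
by rewrite E1 t10 !scale0r !addr0 scale1r scaleNr addNr.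
Qed.
End NodePoints.

Notation o0 := (@Ordinal 4 0 isT).
Notation o1 := (@Ordinal 4 1 isT).
Notation o2 := (@Ordinal 4 2 isT).
Notation o3 := (@Ordinal 4 3 isT).

Lemma ord4_cases (Q : 'I_4 -> Prop) : Q o0 -> Q o1 -> Q o2 -> Q o3 -> forall l, Q l.
Proof.
move=> H0 H1 H2 H3 [[|[|[|[|//]]]] Hi]; [move: H0|move: H1|move: H2|move: H3];
  by congr Q; apply: val_inj.
Qed.

Lemma sum4 (V : nmodType) (f : 'I_4 -> V) : \sum_l f l = f o0 + f o1 + f o2 + f o3.
Proof.
rewrite !big_ord_recl big_ord0 addr0 !addrA.
by congr (_ + _ + _ + _); congr f; apply: val_inj.
Qed.

(** * Blowing up the nodes *)

Section Cross.
Variable R : comNzRingType.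
Implicit Types (al be c a x : 'I_4 -> R).

Definition det3 al be c (i j k : 'I_4) : R :=
  al i * (be j * c k - be k * c j) - al j * (be i * c k - be k * c i) + al k * (be i * c j - be j * c i).

(** The contraction of the three covectors with the volume form. *)
Definition cross al be c (l : 'I_4) : R :=
  [:: - det3 al be c o1 o2 o3; det3 al be c o0 o2 o3; - det3 al be c o0 o1 o3; det3 al be c o0 o1 o2]`_l.

Definition pair al x : R := \sum_l al l * x l.

Lemma cross_cramer al be c a x l :
  pair a (cross al be c) * x l = pair a x * cross al be c l - pair c x * cross al be a l +
    pair be x * cross al c a l - pair al x * cross be c a l.
Proof.
rewrite /pair !sum4 /cross /det3 /=.
elim/ord4_cases: l => /=; ring.
Qed.

Lemma cross_l al be c : pair al (cross al be c) = 0.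
Proof. by rewrite /pair sum4 /cross /det3 /=; ring. Qed.
Lemma cross_m al be c : pair be (cross al be c) = 0.
Proof. by rewrite /pair sum4 /cross /det3 /=; ring. Qed.
Lemma cross_alt al be c a : pair a (cross al be c) = - pair c (cross al be a).
Proof. by rewrite /pair !sum4 /cross /det3 /=; ring. Qed.

Lemma crossZm al be c k l : cross al (fun i => k * be i) c l = k * cross al be c l.
Proof. by elim/ord4_cases: l; rewrite /cross /det3 /=; ring. Qed.
Lemma cross_ext al al' be be' c c' l : al =1 al' -> be =1 be' -> c =1 c' -> cross al be c l = cross al' be' c' l.
Proof. by move=> E1 E2 E3; rewrite /cross /det3 !E1 !E2 !E3. Qed.

Lemma cross_minor al be i j : i != j -> al i * be j - al j * be i != 0 ->
  exists k l, cross al be (fun s => (s == k)%:R) l != 0.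
Proof.
move=> ij mn0.
have [k [l E]] : exists k l, cross al be (fun s => (s == k)%:R) l = al i * be j - al j * be i \/
    cross al be (fun s => (s == k)%:R) l = - (al i * be j - al j * be i).
  elim/ord4_cases: i ij mn0 => + _; elim/ord4_cases: j => // _.
  all: try (exists o2, o3; rewrite /cross /det3 /=; (left; ring) || (right; ring)).
  all: try (exists o1, o3; rewrite /cross /det3 /=; (left; ring) || (right; ring)).
  all: try (exists o1, o2; rewrite /cross /det3 /=; (left; ring) || (right; ring)).
  all: try (exists o0, o3; rewrite /cross /det3 /=; (left; ring) || (right; ring)).
  all: try (exists o0, o2; rewrite /cross /det3 /=; (left; ring) || (right; ring)).
  all: try (exists o0, o1; rewrite /cross /det3 /=; (left; ring) || (right; ring)).
by exists k, l; case: E => ->; rewrite ?oppr_eq0.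
Qed.
End Cross.

Lemma cross_morph (R S : comNzRingType) (phi : {rmorphism R -> S}) (al be c : 'I_4 -> R) l :
  phi (cross al be c l) = cross (phi \o al) (phi \o be) (phi \o c) l.
Proof.
by elim/ord4_cases: l; rewrite /cross /det3 /= ?(rmorphN, rmorphD, rmorphB, rmorphM).
Qed.

Lemma indep_minor (K : numClosedFieldType) n (a b : 'rV[K]_n) : indep a b ->
  exists i j, i != j /\ a 0 i * b 0 j - a 0 j * b 0 i != 0.
Proof.
move=> ind; have a0 : a != 0.
  apply/eqP => a0; have [|/eqP] := ind 1 0; first by rewrite a0 scaler0 scale0r addr0.
  by rewrite oner_eq0.
case/rV0Pn: a0 => i ai; apply: contrapT => H.
have [|_ /eqP] := ind (b 0 i) (- a 0 i); last by rewrite oppr_eq0 (negbTE ai).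
apply/rowP => j; rewrite !mxE.
have [->|ne] := eqVneq j i; first by ring.
apply/eqP/negPn/negP => nz; apply: H; exists i, j; split; first by rewrite eq_sym.
by move: nz; rewrite -oppr_eq0; congr (_ != _); ring.
Qed.

Section Germs.
Variable K : numClosedFieldType.

Lemma pev_at0 k (f : {mpoly K[k.+1]}) q w x : germ q w x -> (pev x f).[0] = eval_at f q.
Proof. by move=> gx; have [c ->] := pev_germ f gx; rewrite !hornerE ?mul0r ?addr0. Qed.

Lemma germ_deriv0 k (q w : 'rV[K]_k.+1) x i : germ q w x -> (x i)^`().[0] = w 0 i.
Proof.
move=> [c ->]; rewrite !(derivD, derivM, derivC, derivX) !hornerE.
by rewrite ?(mul0r, mul1r, addr0, add0r).
Qed.

Lemma unit_divides (u f g : {poly K}) k : u.[0] != 0 -> u * f = 'X^k * g -> exists r, f = 'X^k * r.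
Proof.
move=> u0; elim: k f g => [|k IH] f g E; first by exists f; rewrite expr0 mul1r.
have [c [r fE]] := poly_split f.
have c0 : c = 0.
  have := congr1 (horner^~ 0) E; rewrite fE exprS -mulrA !hornerM hornerD hornerM hornerX hornerC !mul0r addr0 => /eqP.
  by rewrite mulf_eq0 (negbTE u0) => /eqP.
have [|s Es] := IH r g.
  have X0 : 'X != 0 :> {poly K} by rewrite polyX_eq0.
  apply: (mulfI X0); transitivity (u * f); first by rewrite fE c0 polyC0 add0r mulrCA.
  by rewrite E exprS mulrA.
by exists s; rewrite fE c0 polyC0 add0r Es exprS mulrA.
Qed.
End Germs.

(** * Dimension of the space of forms through the nodes *)

Section Adjoint.
Variables (K : numClosedFieldType) (F G : {mpoly K[4]}) (d n ka da db k : nat) (q : 'I_k -> 'rV[K]_4).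
Local Notation P := {mpoly K[4]}.
Hypothesis (hF : F \is d.-homog) (hG : G \is n.-homog) (Ea : (da + d = ka)%N) (Eb : (db + n = ka)%N).
Hypothesis syz : forall a b : P, a \is da.-homog -> b \is db.-homog -> a * F + b * G = 0 -> a = 0 /\ b = 0.
Hypothesis (Fq : forall i, eval_at F (q i) = 0) (Gq : forall i, eval_at G (q i) = 0).
Hypothesis dual : forall i, exists f : P, [/\ f \is ka.-homog, eval_at f (q i) = 1 & forall j, j != i -> eval_at f (q j) = 0].
Local Notation V := (dhomog 4 K ka).
Local Notation U := (dhomog 4 K da * dhomog 4 K db)%type.
Local Notation vl := (@mpoly_of_dhomog 4 K _).

Definition nodal_values (v : V) : 'rV[K]_k := \row_j eval_at (vl v) (q j).
Lemma nodal_values_linear : linear nodal_values.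
Proof. by move=> c u v; apply/rowP => j; rewrite !mxE linearP /= eval_atD eval_atZ. Qed.
HB.instance Definition _ := GRing.isLinear.Build K V 'rV[K]_k _ nodal_values nodal_values_linear.

Lemma relation_homog (u : U) : vl u.1 * F + vl u.2 * G \is ka.-homog.
Proof.
by apply: rpredD; [rewrite -Ea|rewrite -Eb]; apply: dhomogM => //; exact: dhomog_is_dhomog.
Qed.
Definition relation_form (u : U) : V := DHomog (relation_homog u).
Lemma relation_form_linear : linear relation_form.
Proof.
move=> c u v; by apply: val_inj; rewrite /= !mulrDl -!scalerAl scalerDr addrACA.
Qed.
HB.instance Definition _ := GRing.isLinear.Build K U V _ relation_form relation_form_linear.

Let ev := linfun nodal_values.
Let re := linfun relation_form.

Lemma re_inj : lker re == 0%VS.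
Proof.
apply/lker0P => u v; rewrite !lfunE => E; apply/eqP; rewrite -subr_eq0; apply/eqP.
have : relation_form (u - v) = 0 by rewrite linearB /= E subrr.
move: (u - v) => [a b] /(congr1 vl) /= E0.
have [a0 b0] := syz (dhomog_is_dhomog a) (dhomog_is_dhomog b) E0.
have -> : a = 0 by apply: val_inj.
by have -> : b = 0 by apply: val_inj.
Qed.

Lemma ev_full : (limg ev = fullv)%VS.
Proof.
apply/eqP; rewrite eqEsubv subvf; apply/subvP => v _.
have /choice[f Hf] := dual.
have hf i : f i \is ka.-homog by case: (Hf i).
apply/memv_imgP; exists (\sum_i v 0 i *: (DHomog (hf i) : V)); first exact: memvf.
rewrite lfunE /= linear_sum /=; apply/rowP => j; rewrite summxE (bigD1 j) //= big1 => [|i ij].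
  by rewrite linearZ /= !mxE; case: (Hf j) => _ -> _; rewrite mulr1 addr0.
by rewrite linearZ /= !mxE; case: (Hf i) => _ _ ->; rewrite ?mulr0 // eq_sym.
Qed.

Lemma adjoint_basis : exists r (b : 'I_r -> P),
  [/\ ('C(da + 3, 3) + 'C(db + 3, 3) + k + r = 'C(ka + 3, 3))%N,
    forall i, b i \is ka.-homog, forall i j, eval_at (b i) (q j) = 0,
    forall a : 'I_r -> K, idl [:: F; G] (\sum_i a i *: b i) -> forall i, a i = 0 &
    forall Q, Q \is ka.-homog -> (forall j, eval_at Q (q j) = 0) ->
      exists a : 'I_r -> K, idl [:: F; G] (Q - \sum_i a i *: b i)].
Proof.
set Z := lker ev; set W := limg re; set Y := (Z :\: W)%VS.
have WZ : (W <= Z)%VS.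
  apply/subvP => _ /memv_imgP[u _ ->]; rewrite memv_ker lfunE /= lfunE /=; apply/eqP/rowP => j.
  by rewrite !mxE /= !evE Fq Gq !mulr0 addr0.
have dimV m : dim (dhomog 4 K m) = 'C(m + 3, 3) by rewrite -[LHS]/('C(m + 3, m)) -bin_sub ?leq_addr // addKn.
have dZ : (\dim Z + k = 'C(ka + 3, 3))%N.
  have := limg_ker_dim ev fullv; rewrite capfv ev_full !dimvf dimV => <-; congr (_ + _)%N.
  by rewrite -[RHS]/(1 * k)%N mul1n.
have dW : (\dim W = 'C(da + 3, 3) + 'C(db + 3, 3))%N.
  rewrite (limg_dim_eq (f := re)) ?(eqP re_inj) ?capv0 // dimvf -!dimV //.
have dY : (\dim W + \dim Y = \dim Z)%N.
  by rewrite -(dimv_cap_compl Z W) (capv_idPr WZ).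
have IW (v : V) : idl [:: F; G] (vl v) -> v \in W.
  move=> /idl2P[a [b E]]; apply/memv_imgP.
  have ha := pihomogP mdeg da a; have hb := pihomogP mdeg db b.
  exists (DHomog ha, DHomog hb); first exact: memvf.
  rewrite lfunE /=; apply: val_inj => /=.
  have hv : vl v \is ka.-homog := dhomog_is_dhomog v.
  rewrite -[LHS](pihomog_dE hv) E linearD /= -{1}Ea -{1}Eb (pihomogMr _ _ hF) (pihomogMr _ _ hG) //.
have WI (v : V) : v \in W -> idl [:: F; G] (vl v).
  by move=> /memv_imgP[u _ ->]; rewrite lfunE /=; apply/idl2P; exists (vl u.1), (vl u.2).
pose b (i : 'I_(\dim Y)) : P := vl (vbasis Y)`_i.
have sumE (a : 'I_(\dim Y) -> K) : \sum_i a i *: b i = vl (\sum_i a i *: (vbasis Y)`_i).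
  by rewrite linear_sum; apply: eq_bigr => i _; rewrite linearZ.
have inY (i : 'I_(\dim Y)) : (vbasis Y)`_i \in Y by apply: vbasis_mem; rewrite mem_nth // size_tuple.
exists (\dim Y), b; split.
- by rewrite -dW -dZ -dY; lia.
- by move=> i; exact: dhomog_is_dhomog.
- move=> i j; have : (vbasis Y)`_i \in Z by apply: subvP (diffvSl Z W) _ (inY i).
  by rewrite memv_ker lfunE /= => /eqP /rowP /(_ j); rewrite !mxE.
- move=> a; rewrite sumE => /IW sW.
  have sY : \sum_i a i *: (vbasis Y)`_i \in Y by apply: memv_suml => i _; apply: memvZ.
  have s0 : \sum_i a i *: (vbasis Y)`_i = 0.
    by apply/eqP; rewrite -memv0 -(capv_diff Z W) memv_cap sY sW.
  have /freeP fr : free (vbasis Y) := basis_free (vbasisP Y).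
  exact: fr s0.
move=> Q hQ Q0; pose v : V := DHomog hQ.
have vZ : v \in Z by rewrite memv_ker lfunE /=; apply/eqP/rowP => j; rewrite !mxE /= Q0.
have : v \in (Y + W)%VS by rewrite addv_diff; apply: subvP (addvSl Z W) _ vZ.
move=> /memv_addP[y yY [w wW E]]; exists (fun i => coord (vbasis Y) i y).
have -> : Q - \sum_i coord (vbasis Y) i y *: b i = vl w; last exact: WI.
rewrite sumE -(coord_vbasis yY) -[Q]/(vl v) E linearD /= addrC addKr //.
Qed.
End Adjoint.

Section Chain.
Variable K : numClosedFieldType.

Lemma mmap_homog n m (f : {mpoly K[n]}) (a : 'I_n -> {mpoly K[m]}) D e :
  (forall i, a i \is D.-homog) -> f \is e.-homog -> mmap (@mpolyC m K) a f \is (e * D).-homog.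
Proof.
move=> ha hf; rewrite /mmap big_seq; apply: rpred_sum => k kf; rewrite mul_mpolyC; apply: rpredZ.
have <- : mdeg k = e := dhomog_mf hf kf; rewrite mdegE /mmap1 big_distrl /=.
elim/big_rec2: _ => [|i u p _ IH]; first exact: dhomog1.
by apply: dhomogM => //; rewrite mulnC; apply: dhomogMn.
Qed.

Lemma chain_rule n m (f : {mpoly K[n.+1]}) (a : 'I_n.+1 -> {mpoly K[m.+1]}) x v :
  differential (mmap (@mpolyC m.+1 K) a f) x v =
  differential f (\row_i eval_at (a i) x) (\row_i differential (a i) x v).
Proof.
elim/mpoly_ring_ind: f => [c|i|f g Hf Hg|f g Hf Hg].
- by rewrite mmapC !dfC.
- by rewrite mmapX mmap1U dfU mxE.
- by rewrite mmapD !dfD Hf Hg.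
- by rewrite rmorphM /= !dfM Hf Hg !eval_mmap.
Qed.
End Chain.

Lemma relation_degree a b D n m : (m + m <= n)%N ->
  (a + b + D + n - m - m = a + (b + (D + n - m) - m))%N.
Proof. by lia. Qed.

(** * The normalization as a closure in Segre coordinates *)

Section Normalization.
Variable K : numClosedFieldType.
Hypothesis unc : ~ countable [set: K].
Local Notation P := {mpoly K[4]}.
Local Notation P2 := {mpoly K[2]}.
Variables (F G : P) (d n : nat) (N : 'M[K]_4) (p3 : 'rV[K]_4) (io : {rmorphism P2 -> P}).
Variable qs : seq 'rV[K]_4.
Hypothesis pk : package F G d n N p3 io qs.
Local Notation I := (idl [:: F; G]).
Local Notation X := (curve F G).
Hypothesis prI : forall f g, isform f -> isform g -> I (f * g) -> I f \/ I g.
Hypothesis (d1 : (1 < d)%N) (n1 : (1 < n)%N).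
Let HI : is_ideal I. Proof. exact: is_ideal_idl. Qed.

Definition tangents (p w1 w2 : 'rV[K]_4) : Prop :=
  [/\ differential F p w1 = 0, differential F p w2 = 0,
    forall v, differential F p v = 0 -> exists a b c : K, v = a *: p + b *: w1 + c *: w2,
    [/\ hess G p w1 w1 = 0, hess G p w2 w2 = 0 & hess G p w1 w2 != 0] &
    (exists e, differential F p e != 0) /\ forall v, differential G p v = 0].

Lemma tangentsC p w1 w2 : tangents p w1 w2 -> tangents p w2 w1.
Proof.
move=> [F1 F2 ker [h11 h22 h12] Fe]; split=> //; last by rewrite hessC.
by move=> v /ker[a [b [c ->]]]; exists a, c, b; rewrite addrAC.
Qed.

Lemma node_tangents p : node_at F G N p -> exists w1 w2, tangents p w1 w2.
Proof. by move=> [Gv Fe [w1 [w2 [F1 F2 ker hh _]]]]; exists w1, w2. Qed.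

Variables (M m n' : nat) (h : 'I_M -> P) (ix : 'I_4 -> 'I_M -> 'I_n'.+1) (rx : 'I_n'.+1 -> 'I_4 * 'I_M).
Hypothesis (rxK : forall i, ix (rx i).1 (rx i).2 = i) (ixK : forall l j, rx (ix l j) = (l, j)).
Hypothesis (m0 : (0 < m)%N) (mn : (m + m <= n)%N).
Hypothesis hm : forall j, h j \is m.-homog.
Hypothesis hnode : forall p, X p -> isnode qs p -> forall j, eval_at (h j) p = 0.
Hypothesis hfree : forall x, X x -> ~ isnode qs x -> exists j, eval_at (h j) x != 0.
Hypothesis hspan : forall p, X p -> isnode qs p -> forall a : 'rV[K]_4, dot a p = 0 ->
  exists c : 'I_M -> K, forall u, \sum_j c j * differential (h j) p u = dot a u.
Hypothesis nodes : forall p, X p -> isnode qs p -> node_at F G N p.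
Local Notation Pt := {mpoly K[n'.+1]}.

Definition hv x : 'rV[K]_M := \row_j eval_at (h j) x.
Definition dhv x w : 'rV[K]_M := \row_j differential (h j) x w.
(** Segre coordinates [x_l z_j] of a pair of points; [rx] and [ix] translate between one index and
    two. *)
Definition ten (x : 'rV[K]_4) (z : 'rV[K]_M) : 'rV[K]_n'.+1 := \row_i (x 0 (rx i).1 * z 0 (rx i).2).
Definition emb x := ten x (hv x).
Definition demb x w := ten w (hv x) + ten x (dhv x w).
(** On a tensor this is a multiple of its first factor, so any nonzero column recovers the point of
    the curve. *)
Definition colv j (y : 'rV[K]_n'.+1) : 'rV[K]_4 := \row_l y 0 (ix l j).
Definition embf (i : 'I_n'.+1) : P := 'X_((rx i).1) * h (rx i).2.
Definition pull : {rmorphism Pt -> P} := mmap (@mpolyC 4 K) embf.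
Definition cev j : {rmorphism P -> Pt} := mmap (@mpolyC n'.+1 K) (fun l => 'X_(ix l j)).

Lemma colv_ten j x z : colv j (ten x z) = z 0 j *: x.
Proof. by apply/rowP => l; rewrite !mxE ixK mulrC. Qed.
Lemma colvD j y y' : colv j (y + y') = colv j y + colv j y'.
Proof. by apply/rowP => l; rewrite !mxE. Qed.
Lemma colvZ j c y : colv j (c *: y) = c *: colv j y.
Proof. by apply/rowP => l; rewrite !mxE. Qed.
Lemma tenZl c x z : ten (c *: x) z = c *: ten x z.
Proof. by apply/rowP => l; rewrite !mxE mulrA. Qed.
Lemma tenZr c x z : ten x (c *: z) = c *: ten x z.
Proof. by apply/rowP => l; rewrite !mxE mulrCA. Qed.
Lemma ten_ix x z l j : ten x z 0 (ix l j) = x 0 l * z 0 j.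
Proof. by rewrite mxE ixK. Qed.

Lemma eval_embf x : \row_i eval_at (embf i) x = emb x.
Proof. by apply/rowP => i; rewrite !mxE evE evE. Qed.
Lemma eval_pull g x : eval_at (pull g) x = eval_at g (emb x).
Proof. by rewrite /pull /= eval_mmap eval_embf. Qed.
Lemma d_pull g x v : differential (pull g) x v = differential g (emb x) (demb x v).
Proof.
rewrite /pull /= chain_rule eval_embf; congr differential; apply/rowP => i.
by rewrite !mxE dfM dfU evE.
Qed.
Lemma pull_homog g e : g \is e.-homog -> pull g \is (e * m.+1).-homog.
Proof.
apply: mmap_homog => i; exact: (dhomogM (X_homog K _) (hm _)).
Qed.
Lemma eval_cev j g y : eval_at (cev j g) y = eval_at g (colv j y).
Proof. by rewrite /cev /= eval_mmap; congr eval_at; apply/rowP => i; rewrite !mxE evE. Qed.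
Lemma d_cev j g y v : differential (cev j g) y v = differential g (colv j y) (colv j v).
Proof.
rewrite /cev /= chain_rule; congr differential; apply/rowP => i; first by rewrite !mxE evE.
by rewrite !mxE dfU.
Qed.
Lemma cev_homog j g e : g \is e.-homog -> cev j g \is e.-homog.
Proof. by move=> hg; have := mmap_homog (fun l => X_homog K (ix l j)) hg; rewrite muln1. Qed.
Lemma emb_scale c x : emb (c *: x) = c ^+ m.+1 *: emb x.
Proof.
by apply/rowP => i; rewrite !mxE (eval_scale _ _ (hm _)) exprS; ring.
Qed.

(** The closure of the image of [emb]: [pull g] in the ideal means that [g] vanishes on that
    image. *)
Definition Xt : set 'rV[K]_n'.+1 := zero_locus [set g | ishom g /\ I (pull g)].

Lemma relation g y : ishom g -> (forall x, X x -> eval_at g (emb x) = 0) -> Xt y -> eval_at g y = 0.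
Proof.
move=> hg H [_]; apply; split=> //; apply: (pk_van unc pk) => x xX; rewrite eval_pull; exact: H.
Qed.

Lemma not_all_nodes : exists2 x, X x & ~ isnode qs x.
Proof.
apply: contrapT => H; have [] := curve_integral unc pk prI d1 n1 => cX irr nsp _; apply: nsp.
apply: (irr_finite (s := [seq p <- qs | p != 0]) cX irr); first by move=> x; rewrite mem_filter => /andP[].
move=> x xX; have [q qq /sub_rVP[c xE]] : isnode qs x by apply: contrapT => nx; apply: H; exists x.
have x0 : x != 0 by case: xX.
have q0 : q != 0 by apply: contraNneq x0 => q0; rewrite xE q0 scaler0.
exists q; first by rewrite mem_filter q0.
by apply/pointP => //; exists c => //; apply: contraNneq x0 => c0; rewrite xE c0 scale0r.
Qed.

Lemma some_h : exists j, ~ I (h j).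
Proof.
have [x xX nx] := not_all_nodes; have [j hj] := hfree xX nx; exists j => /(I_van xX) z.
by rewrite z eqxx in hj.
Qed.

Lemma emb_neq0 x j : x != 0 -> eval_at (h j) x != 0 -> emb x != 0.
Proof.
move=> /rV0Pn[l xl] hj; apply/rV0Pn; exists (ix l j); rewrite ten_ix mxE mulf_neq0 //.
Qed.

Lemma emb_Xt x : X x -> emb x != 0 -> Xt (emb x).
Proof. by move=> xX e0; split=> // g [_ Hg]; rewrite -eval_pull; exact: (I_van xX). Qed.

(** [emb] is zero at the nodes, so nothing is known there; multiplying by some [h j] outside the
    prime ideal and cancelling it removes the difficulty. *)
Lemma vanish_Xt g : ishom g -> vanish Xt g -> I (pull g).
Proof.
move=> [e hg] H; have [j nj] := some_h.
have fh : isform (h j) by exists m.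
have fp : isform (pull g) by exists (e * m.+1)%N; exact: pull_homog.
have [||//] := prI fh fp; last by [].
apply: (pk_van unc pk) => x xX; rewrite evE eval_pull.
have [z|hj] := eqVneq (eval_at (h j) x) 0; first by rewrite z mul0r.
by rewrite H ?mulr0 //; apply: emb_Xt => //; apply: (emb_neq0 _ hj); case: xX.
Qed.

(** Three kinds of relations hold on the image of [emb] and hence on its closure: rank one, [F] and
    [G] on a column, and proportionality of the second factor to the values of [h]. *)
Lemma Xt_points y : Xt y -> exists x z, [/\ X x, z != 0, y = ten x z &
  forall i j, eval_at (h i) x * z 0 j = eval_at (h j) x * z 0 i].
Proof.
move=> yX; have [y0 _] := yX; case/rV0Pn: (y0) => i0 yi0.
set l0 := (rx i0).1; set k0 := (rx i0).2; rewrite -(rxK i0) -/l0 -/k0 in yi0.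
pose z : 'rV[K]_M := \row_j (y 0 (ix l0 j) / y 0 (ix l0 k0)).
have minr l j : y 0 (ix l j) * y 0 (ix l0 k0) = y 0 (ix l k0) * y 0 (ix l0 j).
  have := @relation ('X_(ix l j) * 'X_(ix l0 k0) - 'X_(ix l k0) * 'X_(ix l0 j)) y.
  rewrite !evE => H; apply/eqP; rewrite -subr_eq0; apply/eqP; apply: H => //.
    by exists 2%N; apply: rpredB; exact: (dhomogM (X_homog K _) (X_homog K _)).
  by move=> x _; rewrite !evE !ten_ix; ring.
have yE : y = ten (colv k0 y) z.
  apply/rowP => i; rewrite -(rxK i) ten_ix !mxE; move: (rx i) => [l j] /=.
  by rewrite mulrA -minr mulfK.
have zk : z 0 k0 = 1 by rewrite mxE divff.
have z0 : z != 0 by apply/rV0Pn; exists k0; rewrite zk oner_neq0.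
exists (colv k0 y), z; split=> //.
  split.
  - by apply: contraNneq y0 => c0; rewrite yE c0; apply/eqP/rowP => i; rewrite !mxE mul0r.
  - rewrite -eval_cev; apply: relation => //; first by exists d; apply: cev_homog; exact: pk_F pk.
    move=> x [_ Fx _]; rewrite eval_cev colv_ten (eval_scale _ _ (pk_F pk)) Fx mulr0 //.
  - rewrite -eval_cev; apply: relation => //; first by exists n; apply: cev_homog; exact: pk_G pk.
    move=> x [_ _ Gx]; rewrite eval_cev colv_ten (eval_scale _ _ (pk_G pk)) Gx mulr0 //.
move=> i j; apply: (mulIf yi0); rewrite !mxE -!mulrA !mulVf // !mulr1.
have := @relation (cev k0 (h i) * 'X_(ix l0 j) - cev k0 (h j) * 'X_(ix l0 i)) y.
rewrite !evE !eval_cev => H; apply/eqP; rewrite -subr_eq0; apply/eqP; apply: H => //.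
  by exists (m + 1)%N; apply: rpredB; apply: dhomogM; rewrite ?X_homog //; exact: cev_homog.
by move=> x _; rewrite !evE !eval_cev !colv_ten !ten_ix !(eval_scale _ _ (hm _)) !mxE; ring.
Qed.

Lemma Xt_regular_point x z : X x -> ~ isnode qs x -> Xt (ten x z) ->
  (forall i j, eval_at (h i) x * z 0 j = eval_at (h j) x * z 0 i) -> exists c, z = c *: hv x.
Proof.
move=> xX nx _ H; have [i hi] := hfree xX nx; exists (z 0 i / eval_at (h i) x).
apply/rowP => j; rewrite !mxE; apply: (mulfI hi); rewrite H; field; exact: hi.
Qed.

Lemma cramer_forms p (H1 H2 g : P) r : X p -> H1 \is m.-homog -> H2 \is m.-homog -> g \is r.-homog ->
  eval_at H1 p = 0 -> eval_at H2 p = 0 -> eval_at g p = 0 ->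
  (forall v, differential F p v = 0 -> differential H1 p v = 0 -> differential H2 p v = 0 -> (v <= p)%MS) ->
  exists D s c0 c1 c2, [/\ s \is D.-homog, eval_at s p != 0, c1 \is (D + r - m).-homog,
    c2 \is (D + r - m).-homog & s * g = c0 * F + c1 * H1 + c2 * H2].
Proof.
move=> [p0 Fp Gp] h1 h2 hg z1 z2 zg ker.
have [|s [c0 [c1 [c2 [s0 E]]]]] := cramer3 unc p0 (homog_on_line (pk_F pk) Fp) (homog_on_line h1 z1)
    (homog_on_line h2 z2) _ (homog_on_line hg zg); first by move=> *; exact: ker.
have [|||k [s' [c' [hs s'0 hc E']]]] := @homog_relation _ _ 3 p g s r
  (fun i => [:: d; m; m]`_i) (fun i => [:: F; H1; H2]`_i) (fun i => [:: c0; c1; c2]`_i) hg.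
- by case=> [[|[|[|//]]] _] //=; exact: pk_F pk.
- exact: s0.
- by rewrite !big_ord_recl big_ord0 /= addr0 E; ring.
exists k, s', (c' ord0), (c' (lift ord0 ord0)), (c' (lift ord0 (lift ord0 ord0))); split=> //.
by rewrite E' !big_ord_recl big_ord0 /= addr0 addrA.
Qed.

Section AtNode.
Variables (p w1 w2 : 'rV[K]_4).
Hypothesis (pX : X p) (np : isnode qs p) (tp : tangents p w1 w2).
Let p0 : p != 0. Proof. by case: pX. Qed.
Let Fp : eval_at F p = 0. Proof. by case: pX. Qed.
Let Gp : eval_at G p = 0. Proof. by case: pX. Qed.
Let hp j : eval_at (h j) p = 0. Proof. exact: hnode. Qed.
Let h12 := hess G p w1 w2.
Let h120 : h12 != 0. Proof. by case: tp => _ _ _ [_ _]. Qed.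

Lemma tangents_indep a b c : a *: p + b *: w1 + c *: w2 = 0 -> [/\ a = 0, b = 0 & c = 0].
Proof. by have [_ _ _ [h11 h22 hn] [_ Gv]] := tp; apply: (node_independent pk p0 Gv h11 h22 hn). Qed.

(** [H1] and [H2] are members of the linear system whose differentials at the node are
    dual to the two branch directions; [s z_j = c1 Z1 + c2 Z2] and the quadratic
    relation cut out the two points of the blow-up above the node. *)
Lemma node_relations : exists (b1 b2 : 'I_M -> K),
  (forall u, \sum_j b1 j * differential (h j) p u = hess G p u w2) /\
  (forall u, \sum_j b2 j * differential (h j) p u = hess G p u w1) /\
  let H1 := \sum_j b1 j *: h j in let H2 := \sum_j b2 j *: h j in
  (forall j, exists D s c0 c1 c2, [/\ s \is D.-homog, eval_at s p != 0, c1 \is D.-homog, c2 \is D.-homog &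
     s * h j = c0 * F + c1 * H1 + c2 * H2] /\
     (h12 * eval_at c1 p = eval_at s p * differential (h j) p w1 /\
      h12 * eval_at c2 p = eval_at s p * differential (h j) p w2)) /\
  exists D g11 g12 g22 a b, [/\ g11 \is D.-homog, g12 \is D.-homog, g22 \is D.-homog,
     g11 * H1 ^+ 2 + g12 * H1 * H2 + g22 * H2 ^+ 2 = a * F + b * G &
     [/\ eval_at g11 p = 0, eval_at g12 p != 0 & eval_at g22 p = 0]].
Proof.
have [F1 F2 ker [h11 h22 _] [[e Fe] Gv]] := tp.
have he u : hess G p p u = 0 := hess_euler u (pk_G pk) Gv.
have dd w u : dot (grad (dird w G) p) u = hess G p u w by rewrite -differential_dot -hess_dird.
have [b1 E1] : exists c : 'I_M -> K, forall u, \sum_j c j * differential (h j) p u = hess G p u w2.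
  by have [|c Hc] := hspan pX np (a := grad (dird w2 G) p); [rewrite dd he|exists c => u; rewrite Hc dd].
have [b2 E2] : exists c : 'I_M -> K, forall u, \sum_j c j * differential (h j) p u = hess G p u w1.
  by have [|c Hc] := hspan pX np (a := grad (dird w1 G) p); [rewrite dd he|exists c => u; rewrite Hc dd].
exists b1, b2; split=> //; split=> // H1 H2.
have d1' u : differential H1 p u = hess G p u w2.
  by rewrite -E1 /H1 df_sum; apply: eq_bigr => j _; rewrite dfZ.
have d2' u : differential H2 p u = hess G p u w1.
  by rewrite -E2 /H2 df_sum; apply: eq_bigr => j _; rewrite dfZ.
have hH1 : H1 \is m.-homog by apply: rpred_sum => j _; exact: rpredZ.
have hH2 : H2 \is m.-homog by apply: rpred_sum => j _; exact: rpredZ.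
have z1 : eval_at H1 p = 0 by rewrite eval_at_sum big1 // => j _; rewrite evE hp mulr0.
have z2 : eval_at H2 p = 0 by rewrite eval_at_sum big1 // => j _; rewrite evE hp mulr0.
have h21 : hess G p w2 w1 = h12 by rewrite hessC.
have kk v : differential F p v = 0 -> differential H1 p v = 0 -> differential H2 p v = 0 -> (v <= p)%MS.
  move=> /ker[a [b [c ->]]]; rewrite d1' d2' !hessDl !hessZl !he h11 h22 h21 -/h12 !mulr0 !add0r !addr0.
  move=> /eqP; rewrite mulf_eq0 (negbTE h120) orbF => /eqP ->.
  move=> /eqP; rewrite mulf_eq0 (negbTE h120) orbF => /eqP ->.
  by rewrite !scale0r !addr0 scalemx_sub.
have cf := fun g r hg zg => @cramer_forms p H1 H2 g r pX hH1 hH2 hg z1 z2 zg kk.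
have tan g s c0 c1 c2 u : s * g = c0 * F + c1 * H1 + c2 * H2 -> eval_at g p = 0 -> differential F p u = 0 ->
    eval_at s p * differential g p u = eval_at c1 p * hess G p u w2 + eval_at c2 p * hess G p u w1.
  move=> E gp Fu; have := congr1 (fun f => differential f p u) E.
  by rewrite !dfE gp Fp Fu z1 z2 d1' d2' !mulr0 !add0r.
split.
  move=> j; have [D [s [c0 [c1 [c2 [hs s0 hc1 hc2 E]]]]]] := cf (h j) m (hm j) (hp j).
  rewrite addnK in hc1 hc2; exists D, s, c0, c1, c2; split; [by split|split].
    by rewrite (tan _ _ _ _ _ w1 E (hp j) F1) h11 -/h12; ring.
  by rewrite (tan _ _ _ _ _ w2 E (hp j) F2) h22 h21; ring.
have [D [s [c0 [c1 [c2 [hs s0 hc1 hc2 E]]]]]] := cf G n (pk_G pk) Gp.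
have c1p : eval_at c1 p = 0.
  have := tan _ _ _ _ _ w1 E Gp F1; rewrite Gv h11 -/h12 !mulr0 addr0 => /esym/eqP.
  by rewrite mulf_eq0 (negbTE h120) orbF => /eqP.
have c2p : eval_at c2 p = 0.
  have := tan _ _ _ _ _ w2 E Gp F2; rewrite Gv h22 h21 !mulr0 add0r => /esym/eqP.
  by rewrite mulf_eq0 (negbTE h120) orbF => /eqP.
(* [c1] and [c2] vanish at [p], so each is expanded once more in [H1] and [H2]: modulo [F], a unit
   times [G] becomes a quadratic form in them. *)
have [D1 [s1 [a0 [a1 [a2 [hs1 s10 ha1 ha2 Ea]]]]]] := cf c1 _ hc1 c1p.
have [D2 [s2 [e0 [e1 [e2 [hs2 s20 he1 he2 Ee]]]]]] := cf c2 _ hc2 c2p.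
have [g11 Eg11] : exists g, g = s2 * a1 by eexists.
have [g12 Eg12] : exists g, g = s2 * a2 + s1 * e1 by eexists.
have [g22 Eg22] : exists g, g = s1 * e2 by eexists.
have [al Eal] : exists al, al = s1 * s2 * c0 + s2 * a0 * H1 + s1 * e0 * H2 by eexists.
have R : s1 * s2 * s * G = al * F + g11 * (H1 * H1) + g12 * (H1 * H2) + g22 * (H2 * H2).
  transitivity (s1 * s2 * (s * G)); first by ring.
  rewrite E; transitivity (s1 * s2 * c0 * F + s2 * H1 * (s1 * c1) + s1 * H2 * (s2 * c2)); first by ring.
  by rewrite Ea Ee Eal Eg11 Eg12 Eg22; ring.
have alp : eval_at al p = 0.
  have := congr1 (fun f => differential f p e) R.
  rewrite /= !dfE !evE Gv Gp z1 z2 Fp !(mulr0, mul0r, addr0, add0r) => /esym/eqP.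
  by rewrite mulf_eq0 (negbTE Fe) orbF => /eqP.
(* Second derivatives on pairs of branch directions isolate the three coefficients: [g11] and [g22]
   vanish at [p] because the branches are isotropic. *)
have HH u v : differential F p u = 0 -> differential F p v = 0 ->
    eval_at s1 p * eval_at s2 p * eval_at s p * hess G p u v =
    eval_at g11 p * (2%:R * hess G p u w2 * hess G p v w2) +
    eval_at g12 p * (hess G p u w2 * hess G p v w1 + hess G p v w2 * hess G p u w1) +
    eval_at g22 p * (2%:R * hess G p u w1 * hess G p v w1).
  move=> Fu Fv; have := congr1 (fun f => hess f p u v) R.
  rewrite /= !(hessD, hessM) !dfE !evE !d1' !d2' !Gv Gp z1 z2 Fp alp Fu Fv.
  by rewrite !(mulr0, mul0r, addr0, add0r) => ->; ring.
have S0 : eval_at s1 p * eval_at s2 p * eval_at s p != 0 by rewrite !mulf_neq0.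
exists (D1 + D2 + D + n - m - m)%N, g11, g12, g22, (- al), (s1 * s2 * s); split.
- by rewrite Eg11; rewrite (addnC D1) relation_degree //; apply: dhomogM.
- rewrite Eg12; apply: rpredD.
    by rewrite (addnC D1) relation_degree //; apply: dhomogM.
  by rewrite relation_degree //; apply: dhomogM.
- by rewrite Eg22; rewrite relation_degree //; apply: dhomogM.
- by rewrite R; ring.
have E11 := HH _ _ F1 F1; have E12 := HH _ _ F1 F2; have E22 := HH _ _ F2 F2.
rewrite h11 -/h12 !(mulr0, mul0r, addr0) in E11; rewrite h22 h21 !(mulr0, mul0r, add0r) in E22.
rewrite h11 h22 -/h12 h21 !(mulr0, mul0r, add0r, addr0) in E12.
split.
- by move/esym/eqP: E11; rewrite !mulf_eq0 pnatr_eq0 (negbTE h120) !orbF => /eqP.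
- by apply/eqP => z; move/eqP: E12; rewrite z mul0r mulf_eq0 (negbTE S0) (negbTE h120).
- by move/esym/eqP: E22; rewrite !mulf_eq0 pnatr_eq0 (negbTE h120) !orbF => /eqP.
Qed.

(** On the closure the linear relations express [z] through two numbers [Z1] and [Z2], and the
    quadratic one leaves only [Z1 Z2 = 0] above the node: one point for each branch. *)
Lemma Xt_node_points z : Xt (ten p z) -> z != 0 ->
  exists c, z = c *: dhv p w1 \/ z = c *: dhv p w2.
Proof.
move=> yX /rV0Pn[k zk]; have [b1 [b2 [E1 [E2 [R2 [D [g11 [g12 [g22 [a [b [hg11 hg12 hg22 R3 [g110 g120 g220]]]]]]]]]]]]] := node_relations.
case/rV0Pn: p0 => l pl.
pose H1 := \sum_j b1 j *: h j; pose H2 := \sum_j b2 j *: h j.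
pose L1 : Pt := \sum_j b1 j *: 'X_(ix l j); pose L2 : Pt := \sum_j b2 j *: 'X_(ix l j).
pose Z1 := \sum_j b1 j * z 0 j; pose Z2 := \sum_j b2 j * z 0 j.
have hL1 : L1 \is 1.-homog by apply: rpred_sum => j _; apply: rpredZ; exact: X_homog.
have hL2 : L2 \is 1.-homog by apply: rpred_sum => j _; apply: rpredZ; exact: X_homog.
have eL1 x z' : eval_at L1 (ten x z') = x 0 l * \sum_j b1 j * z' 0 j.
  by rewrite eval_at_sum mulr_sumr; apply: eq_bigr => j _; rewrite !evE ten_ix; ring.
have eL2 x z' : eval_at L2 (ten x z') = x 0 l * \sum_j b2 j * z' 0 j.
  by rewrite eval_at_sum mulr_sumr; apply: eq_bigr => j _; rewrite !evE ten_ix; ring.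
have eH1 x : \sum_j b1 j * hv x 0 j = eval_at H1 x.
  by rewrite eval_at_sum; apply: eq_bigr => j _; rewrite evE mxE.
have eH2 x : \sum_j b2 j * hv x 0 j = eval_at H2 x.
  by rewrite eval_at_sum; apply: eq_bigr => j _; rewrite evE mxE.
have zE j : h12 * z 0 j = differential (h j) p w1 * Z1 + differential (h j) p w2 * Z2.
  have [D' [s [c0 [c1 [c2 [[hs s0 hc1 hc2 E] [e1 e2]]]]]]] := R2 j.
  have := @relation (cev k s * 'X_(ix l j) - cev k c1 * L1 - cev k c2 * L2) (ten p z) _ _ yX.
  rewrite !evE !eval_cev !colv_ten !(eval_scale _ _ hs, eval_scale _ _ hc1, eval_scale _ _ hc2) eL1 eL2 ten_ix -/Z1 -/Z2 => H.
  have {}H : z 0 k ^+ D' * p 0 l * (eval_at s p * z 0 j - eval_at c1 p * Z1 - eval_at c2 p * Z2) = 0.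
    rewrite -[RHS]H; first by ring.
      exists (D' + 1)%N; apply: rpredB; first apply: rpredB; apply: dhomogM => //; rewrite ?X_homog //; exact: cev_homog.
    move=> x [_ Fx _]; rewrite !evE !eval_cev !colv_ten !(eval_scale _ _ hs, eval_scale _ _ hc1, eval_scale _ _ hc2) eL1 eL2 ten_ix eH1 eH2.
    have := congr1 (fun f => eval_at f x) E; rewrite !evE Fx mulr0 add0r -/H1 -/H2 => Ex.
    transitivity (hv x 0 k ^+ D' * x 0 l * (eval_at s x * hv x 0 j - eval_at c1 x * eval_at H1 x - eval_at c2 x * eval_at H2 x)); first by ring.
    by rewrite [hv x 0 j]mxE Ex; ring.
  move/eqP: H; rewrite !mulf_eq0 expf_eq0 (negbTE zk) (negbTE pl) andbF /= => /eqP H.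
  apply: (mulfI s0); transitivity (h12 * (eval_at s p * z 0 j - eval_at c1 p * Z1 - eval_at c2 p * Z2) +
    (h12 * eval_at c1 p) * Z1 + (h12 * eval_at c2 p) * Z2); first by ring.
  by rewrite H e1 e2; ring.
have Z12 : Z1 * Z2 = 0.
  have := @relation (cev k g11 * (L1 * L1) + cev k g12 * (L1 * L2) + cev k g22 * (L2 * L2)) (ten p z) _ _ yX.
  rewrite !evE !eval_cev !colv_ten !(eval_scale _ _ hg11, eval_scale _ _ hg12, eval_scale _ _ hg22) eL1 eL2 -/Z1 -/Z2 g110 g220 => H.
  have {}H : z 0 k ^+ D * eval_at g12 p * p 0 l ^+ 2 * (Z1 * Z2) = 0.
    rewrite -[RHS]H; first by ring.
      exists (D + (1 + 1))%N; apply: rpredD; first apply: rpredD; apply: dhomogM => //; try exact: cev_homog; exact: dhomogM.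
    move=> x [_ Fx Gx]; rewrite !evE !eval_cev !colv_ten !(eval_scale _ _ hg11, eval_scale _ _ hg12, eval_scale _ _ hg22) eL1 eL2 eH1 eH2.
    have := congr1 (fun f => eval_at f x) R3; rewrite !evE Fx Gx !mulr0 add0r -/H1 -/H2 => Ex.
    transitivity (hv x 0 k ^+ D * x 0 l ^+ 2 * (eval_at g11 x * eval_at H1 x ^+ 2 +
       eval_at g12 x * eval_at H1 x * eval_at H2 x + eval_at g22 x * eval_at H2 x ^+ 2)); first by ring.
    by rewrite Ex mulr0.
  have c0 : z 0 k ^+ D * eval_at g12 p * p 0 l ^+ 2 != 0 by rewrite !mulf_neq0 // expf_neq0.
  by apply: (mulfI c0); rewrite H mulr0.
have zE' j : z 0 j = differential (h j) p w1 * (Z1 / h12) + differential (h j) p w2 * (Z2 / h12).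
  by apply: (mulfI h120); rewrite zE; field; exact: h120.
move/eqP: Z12; rewrite mulf_eq0 => /orP[] /eqP Z0.
  by exists (Z2 / h12); right; apply/rowP => j; rewrite !mxE zE' Z0 mul0r mulr0 add0r mulrC.
by exists (Z1 / h12); left; apply/rowP => j; rewrite !mxE zE' Z0 mul0r mulr0 addr0 mulrC.
Qed.
End AtNode.
Lemma relation_tangent g y u : ishom g -> (forall x, X x -> eval_at g (emb x) = 0) ->
  cone_tangent_space Xt y u -> differential g y u = 0.
Proof. by move=> hg H; apply=> z zX; apply: relation. Qed.

Lemma Xt_scale c y : c != 0 -> Xt y -> Xt (c *: y).
Proof.
move=> c0 [y0 H]; split; first by rewrite scaler_eq0 negb_or c0.
by move=> g [[e hg] Hg]; rewrite (eval_scale _ _ hg) H ?mulr0 //; split=> //; exists e.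
Qed.

(** Only homogeneous equations are tested, and the vector [t] stays fixed when [y] is rescaled;
    lifted arcs verify exactly this. *)
Definition tangent_pair y t : Prop := forall e g, g \is e.-homog -> I (pull g) ->
  eval_at g y = 0 /\ differential g y t = 0.

Lemma tangent_pair_scale c y t : tangent_pair y t -> tangent_pair (c *: y) t.
Proof.
move=> H e g hg Hg; have [g0 dg0] := H e g hg Hg.
by rewrite (eval_scale _ _ hg) (df_homog _ _ _ hg) g0 dg0 !mulr0.
Qed.

Lemma tangent_homog y u : (forall e g, g \is e.-homog -> I (pull g) -> differential g y u = 0) ->
  cone_tangent_space Xt y u.
Proof.
move=> H g Hg; rewrite [g](pihomog_partitionE (mf := mdeg) (k := msize g)) // df_sum big1 // => e _.
apply: (H e); first exact: pihomogP.
apply: vanish_Xt; first by exists (val e); exact: pihomogP.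
move=> z zX; apply: vanishing_pihomog => a a0; apply: Hg; exact: Xt_scale.
Qed.

Lemma span2_swap (u1 u2 u3 e1 e2 : 'rV[K]_4) : indep u1 u2 ->
  (exists s t, u1 = s *: e1 + t *: e2) -> (exists s t, u2 = s *: e1 + t *: e2) ->
  (exists s t, u3 = s *: e1 + t *: e2) -> exists s t, u3 = s *: u1 + t *: u2.
Proof.
move=> ind [a [b E1]] [c [f E2]] [p [q E3]].
have D0 : a * f - b * c != 0.
  apply/eqP => D0.
  have [|f0 /eqP] := ind f (- b).
    rewrite E1 E2; apply/rowP => i; rewrite !mxE.
    by transitivity ((a * f - b * c) * e1 0 i); [ring|rewrite D0 mul0r].
  rewrite oppr_eq0 => /eqP b0.
  have [|/eqP + _] := ind c (- a).
    rewrite E1 E2; apply/rowP => i; rewrite !mxE.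
    by transitivity (- (a * f - b * c) * e2 0 i); [ring|rewrite D0 oppr0 mul0r].
  move=> /eqP c0; have [|_ /eqP] := ind 0 1; last by rewrite oner_eq0.
  by rewrite E2 c0 f0 !scale0r addr0 scaler0 add0r.
exists ((p * f - q * c) / (a * f - b * c)), ((a * q - b * p) / (a * f - b * c)).
by rewrite E1 E2 E3; apply/rowP => i; rewrite !mxE; field.
Qed.

(** The column map is injective on the tangent space and sends it into a plane, while [y] and [t]
    are already two independent tangent vectors. *)
Lemma regular_criterion y t j e1 e2 : Xt y -> indep y t -> tangent_pair y t ->
  (forall u, cone_tangent_space Xt y u -> exists a b, colv j u = a *: e1 + b *: e2) ->
  (forall u, cone_tangent_space Xt y u -> colv j u = 0 -> u = 0) -> curve_regular_at Xt y.
Proof.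
move=> yX ind tp up1 up2.
have Ty : cone_tangent_space Xt y y.
  by apply: tangent_homog => e g hg Hg; rewrite (euler _ hg) (tp e g hg Hg).1 mulr0.
have Tt : cone_tangent_space Xt y t.
  by apply: tangent_homog => e g hg Hg; exact: (tp e g hg Hg).2.
have Tlin a b u v : cone_tangent_space Xt y u -> cone_tangent_space Xt y v -> cone_tangent_space Xt y (a *: u + b *: v).
  by move=> Hu Hv g Hg; rewrite !dfvE Hu // Hv // !mulr0 addr0.
have ind' : indep (colv j y) (colv j t).
  move=> a b E; apply: ind; apply: up2; first exact: Tlin.
  by rewrite colvD !colvZ.
exists (col_mx y t : 'M_(1 + 1, n'.+1)); first exact: indep_row_free.
move=> u; split=> [Tu|/sub_col2[a [b ->]]]; last exact: Tlin.
have [a [b E]] := span2_swap ind' (up1 _ Ty) (up1 _ Tt) (up1 _ Tu).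
apply/sub_col2; exists a, b; apply/eqP; rewrite -subr_eq0; apply/eqP; apply: up2.
  have -> : u - (a *: y + b *: t) = 1 *: u + (-1) *: (a *: y + b *: t) by rewrite scale1r scaleN1r.
  by apply: (Tlin) => //; exact: Tlin.
by rewrite -scaleN1r colvD colvZ colvD !colvZ E scaleN1r subrr.
Qed.

Lemma tangent_minor x z u l l0 j j0 : cone_tangent_space Xt (ten x z) u ->
  u 0 (ix l j) * (x 0 l0 * z 0 j0) + (x 0 l * z 0 j) * u 0 (ix l0 j0) =
  u 0 (ix l j0) * (x 0 l0 * z 0 j) + (x 0 l * z 0 j0) * u 0 (ix l0 j).
Proof.
move=> /(@relation_tangent ('X_(ix l j) * 'X_(ix l0 j0) - 'X_(ix l j0) * 'X_(ix l0 j))) H.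
apply/eqP; rewrite -subr_eq0; apply/eqP.
rewrite -[RHS]H; first by rewrite !dfE !evE !ten_ix; ring.
  by exists 2%N; apply: rpredB; exact: (dhomogM (X_homog K _) (X_homog K _)).
by move=> x' _; rewrite !evE !ten_ix; ring.
Qed.

Lemma tangent_colv0 x z u l0 j0 : cone_tangent_space Xt (ten x z) u -> x 0 l0 != 0 -> z 0 j0 != 0 ->
  colv j0 u = 0 -> (forall j, u 0 (ix l0 j) = 0) -> u = 0.
Proof.
move=> Tu xl zj c0 H; apply/rowP => i; rewrite -(rxK i) [RHS]mxE; move: (rx i) => [l j] /=.
have cz l' : u 0 (ix l' j0) = 0 by have := congr1 (fun v : 'rV[K]_4 => v 0 l') c0; rewrite !mxE.
have := tangent_minor l l0 j j0 Tu; rewrite !cz H !mulr0 mul0r !addr0 => /eqP.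
by rewrite !mulf_eq0 (negbTE xl) (negbTE zj) !orbF => /eqP.
Qed.

Lemma tangent_F x z u j : cone_tangent_space Xt (ten x z) u -> z 0 j != 0 ->
  differential F x (colv j u) = 0 /\ differential G x (colv j u) = 0.
Proof.
move=> Tu zj; split.
  have := @relation_tangent (cev j F) _ _ _ _ Tu; rewrite d_cev colv_ten (df_homog _ _ _ (pk_F pk)) => H.
  apply: (mulfI (expf_neq0 d.-1 zj)); rewrite mulr0 H //.
    by exists d; apply: cev_homog; exact: pk_F pk.
  by move=> x' [_ Fx _]; rewrite eval_cev colv_ten (eval_scale _ _ (pk_F pk)) Fx mulr0.
have := @relation_tangent (cev j G) _ _ _ _ Tu; rewrite d_cev colv_ten (df_homog _ _ _ (pk_G pk)) => H.
apply: (mulfI (expf_neq0 n.-1 zj)); rewrite mulr0 H //.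
  by exists n; apply: cev_homog; exact: pk_G pk.
by move=> x' [_ _ Gx]; rewrite eval_cev colv_ten (eval_scale _ _ (pk_G pk)) Gx mulr0.
Qed.

Lemma tangent_h x z u l0 j0 i j : cone_tangent_space Xt (ten x z) u -> z 0 j0 != 0 ->
  differential (h i) x (colv j0 u) * (x 0 l0 * z 0 j) + eval_at (h i) x * z 0 j0 * u 0 (ix l0 j) =
  differential (h j) x (colv j0 u) * (x 0 l0 * z 0 i) + eval_at (h j) x * z 0 j0 * u 0 (ix l0 i).
Proof.
move=> Tu zj; have := @relation_tangent (cev j0 (h i) * 'X_(ix l0 j) - cev j0 (h j) * 'X_(ix l0 i)) _ _ _ _ Tu.
rewrite !dfE !evE !d_cev !eval_cev colv_ten !(df_homog _ _ _ (hm _)) !(eval_scale _ _ (hm _)) !ten_ix => H.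
apply: (mulfI (expf_neq0 m.-1 zj)); apply/eqP; rewrite -subr_eq0; apply/eqP; rewrite -[RHS]H.
- by have -> : z 0 j0 ^+ m = z 0 j0 ^+ m.-1 * z 0 j0 by [rewrite -exprSr prednK]; ring.
- by exists (m + 1)%N; apply: rpredB; apply: dhomogM; rewrite ?X_homog //; exact: cev_homog.
- by move=> x' _; rewrite !evE !eval_cev !colv_ten !ten_ix !(eval_scale _ _ (hm _)) !mxE; ring.
Qed.

Lemma emb_pair x w : X x -> differential F x w = 0 -> differential G x w = 0 -> tangent_pair (emb x) (demb x w).
Proof.
move=> xX Fw Gw e g hg Hg; split; first by rewrite -eval_pull; exact: (I_van xX Hg).
rewrite -d_pull; move/(curveI unc pk): Hg => Hg.
by apply: ((curve_tangent unc pk w xX).2 (conj Fw Gw)).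
Qed.

Lemma Xt_regular_emb x c : X x -> ~ isnode qs x -> c != 0 -> curve_regular_at Xt (c *: emb x).
Proof.
move=> xX nx c0; have [x0 Fx Gx] := xX; have [j hj] := hfree xX nx.
have /rV0Pn[l xl] := x0.
have ind := pk_reg pk x0 Fx Gx nx.
have [w [Fw Gw xw kerw]] := kernel2 ind x0 (gradx (pk_F pk) Fx) (gradx (pk_G pk) Gx).
have yE : c *: emb x = ten x (c *: hv x) by rewrite /emb tenZr.
have zj : (c *: hv x) 0 j != 0 by rewrite !mxE mulf_neq0.
apply: (@regular_criterion _ (demb x w) j x w).
- by apply: Xt_scale => //; apply: emb_Xt => //; exact: emb_neq0 hj.
- move=> a b E; have := congr1 (colv j) E; rewrite /demb /emb colvD !colvZ colvD !colv_ten !mxE => E'.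
  have [|_ /eqP] := xw (a * c * eval_at (h j) x + b * differential (h j) x w) (b * eval_at (h j) x).
    rewrite -[RHS](_ : colv j 0 = 0); last by apply/rowP => i; rewrite !mxE.
    rewrite -E'; apply/rowP => i; rewrite !mxE; ring.
  rewrite mulf_eq0 (negbTE hj) orbF => /eqP b0; split=> //.
  move/eqP: E; rewrite b0 scale0r addr0 !scaler_eq0 (negbTE c0) (negbTE (emb_neq0 x0 hj)) !orbF => /eqP //.
- by apply: tangent_pair_scale; apply: emb_pair; rewrite // differential_dot.
- rewrite yE => u Tu; have [Fu Gu] := tangent_F Tu zj; rewrite !differential_dot in Fu Gu.
  exact: kerw.
rewrite yE => u Tu cu0; apply: (tangent_colv0 Tu xl zj cu0) => i.
have := tangent_h l j i Tu zj; rewrite cu0 !df0v !mul0r !add0r.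
have -> : u 0 (ix l j) = 0 by have := congr1 (fun v : 'rV[K]_4 => v 0 l) cu0; rewrite !mxE.
by rewrite mulr0 => /eqP; rewrite !mulf_eq0 (negbTE hj) (negbTE zj) => /eqP.
Qed.

Lemma pev_comp k (x : 'I_4 -> {poly K}) (a : 'I_k.+1 -> P) (g : {mpoly K[k.+1]}) :
  pev x (mmap (@mpolyC 4 K) a g) = pev (fun i => pev x (a i)) g.
Proof.
pose al : {rmorphism {mpoly K[k.+1]} -> P} := mmap (@mpolyC 4 K) a.
rewrite -[mmap _ _ g]/(al g); elim/mpoly_ring_ind: g => [c|i|f g Hf Hg|f g Hf Hg].
- by rewrite /al /pev /= !mmapC.
- by rewrite /al /pev /= !mmapX !mmap1U.
- by rewrite !rmorphD Hf Hg.
- by rewrite !rmorphM Hf Hg.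
Qed.

Section NodeTangent.
Variables (p w1 w2 : 'rV[K]_4).
Hypothesis (pX : X p) (np : isnode qs p) (tp : tangents p w1 w2).
Let p0 : p != 0. Proof. by case: pX. Qed.
Let Fp : eval_at F p = 0. Proof. by case: pX. Qed.
Let Gp : eval_at G p = 0. Proof. by case: pX. Qed.
Let hp j : eval_at (h j) p = 0. Proof. exact: hnode. Qed.

(** An arc on the branch [w1] and its lift [Y]: every [h j] vanishes at [p], so the embedding of the
    arc is divisible by the parameter, and [Y] is the quotient, starting at the point of the blow-up
    above this branch. *)
Definition node_jet (ze : 'rV[K]_M) (c2 : 'rV[K]_4) k (x : 'I_4 -> {poly K}) (Y : 'I_n'.+1 -> {poly K}) : Prop := exists c : 'I_4 -> {poly K},
  [/\ forall i, x i = (p 0 i)%:P + 'X * ((w1 0 i)%:P + 'X * ((c2 0 i)%:P + 'X * c i)),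
    exists a, pev x F = 'X^k * a, exists b, pev x G = 'X^k * b,
    germ (ten p (dhv p w1)) (ten w1 (dhv p w1) + ten p ze) Y & forall i, pev x (embf i) = 'X * Y i].

(** [ze] is computed from the two-jet alone, which does not depend on [k]; hence the tangent vector
    of the lift is the same for arcs of all orders. *)
Lemma node_branch : exists ze (c2 : 'rV[K]_4), forall k, exists x Y, node_jet ze c2 k x Y.
Proof.
have [F1 F2 ker [h11 h22 h12] [[e0 Fe] Gv]] := tp.
have [c2 Hc2] := branch_jet Fp F1 F2 Fe Gp Gv h11 h12.
pose x1 i := (p 0 i)%:P + 'X * ((w1 0 i)%:P + 'X * (c2 0 i)%:P).
have g1 : germ p w1 x1 by exists (fun i => (c2 0 i)%:P).
have /choice[e He] := fun j => pev_germ (h j) g1.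
have /choice[e' He'] := fun j => poly_split (e j); have /choice[e'' He''] := He'.
exists (\row_j e' j), c2 => k.
have [x [c [xE Fx Gx]]] := Hc2 k.
have hE j : exists r, pev x (h j) = 'X * ((differential (h j) p w1)%:P + 'X * ((e' j)%:P + 'X * r)).
  have [u Eu] := taylor0 (@polyC K) (h j) x x1.
  exists (e'' j + \sum_i u i * c i).
  have -> : pev x (h j) = pev x1 (h j) + \sum_i u i * (x i - x1 i).
    by apply/eqP; rewrite addrC -subr_eq /pev /= Eu.
  have -> : \sum_i u i * (x i - x1 i) = 'X^3 * \sum_i u i * c i.
    by rewrite mulr_sumr; apply: eq_bigr => i _; rewrite xE /x1; ring.
  by rewrite He hp polyC0 He''; ring.
have /choice[r Hr] := hE.
pose Y i := ((p 0 (rx i).1)%:P + 'X * ((w1 0 (rx i).1)%:P + 'X * ((c2 0 (rx i).1)%:P + 'X * c (rx i).1))) *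
   ((differential (h (rx i).2) p w1)%:P + 'X * ((e' (rx i).2)%:P + 'X * r (rx i).2)).
exists x, Y, c; split=> //.
  exists (fun i => (p 0 (rx i).1)%:P * r (rx i).2 + (w1 0 (rx i).1)%:P * ((e' (rx i).2)%:P + 'X * r (rx i).2) +
    ((c2 0 (rx i).1)%:P + 'X * c (rx i).1) * ((differential (h (rx i).2) p w1)%:P + 'X * ((e' (rx i).2)%:P + 'X * r (rx i).2))).
  by move=> i; rewrite /Y !mxE polyCD !polyCM; ring.
by move=> i; rewrite /embf rmorphM Hr /pev /= mmapX mmap1U xE /Y; ring.
Qed.

Lemma node_jet_pull ze c2 k x Y e g : node_jet ze c2 k x Y -> g \is e.-homog ->
  pev x (pull g) = 'X^e * pev Y g.
Proof.
move=> [c [_ _ _ _ EY]] hg; rewrite /pull pev_comp -(pev_scale _ _ hg); apply: pev_ext => i; exact: EY.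
Qed.

(** An equation of degree [e] restricted to the embedded arc is ['X^e] times its restriction to the
    lift. Arcs of order [e + 2] therefore show that value and first derivative vanish on the
    lift. *)
Lemma node_pair_jet ze c2 : (forall k, exists x Y, node_jet ze c2 k x Y) ->
  tangent_pair (ten p (dhv p w1)) (ten w1 (dhv p w1) + ten p ze).
Proof.
move=> H k g hg Hg; have [x [Y jet]] := H k.+2.
have EY := node_jet_pull jet hg; have [c [_ Fx Gx gY _]] := jet.
have [c' Ec'] := pev_ideal Hg Fx Gx.
have [c3 E3] := pev_germ g gY; rewrite Ec' E3 in EY.
have := congr1 (fun q : {poly K} => q`_k) EY; have := congr1 (fun q : {poly K} => q`_k.+1) EY.
rewrite !coefXnM ltnn subnn !ltnS leqnn leqnSn ltnNge leqnSn /= subSnn.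
by rewrite !coefD !coefC !coefXM /= !coefD !coefC !coefXM /= !addr0 add0r => <- <-.
Qed.

Lemma node_pair : exists ze, tangent_pair (ten p (dhv p w1)) (ten w1 (dhv p w1) + ten p ze).
Proof. by have [ze [c2 /node_pair_jet H]] := node_branch; exists ze. Qed.

Lemma dhv_neq0 : exists j, differential (h j) p w1 != 0.
Proof.
have [b1 [_ [E1 _]]] := node_relations pX np tp.
have [_ _ _ [_ _ h12] _] := tp.
apply: contrapT => nj; move/eqP: h12; apply; rewrite -E1 big1 // => j _.
by have [->|nz] := eqVneq (differential (h j) p w1) 0; rewrite ?mulr0 //; case: nj; exists j.
Qed.

Lemma node_pair_indep ze c : c != 0 -> indep (c *: ten p (dhv p w1)) (ten w1 (dhv p w1) + ten p ze).
Proof.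
move=> c0 a b E; have [j hj] := dhv_neq0; have := congr1 (colv j) E.
rewrite colvD !colvZ colvD !colv_ten !mxE => E'.
have ti (x y : K) : x *: p + y *: w1 + 0 *: w2 = 0 -> y = 0 by move=> H; case: (tangents_indep pX tp H).
have : b * differential (h j) p w1 = 0.
  apply: (ti (a * c * differential (h j) p w1 + b * ze 0 j)); rewrite -[RHS](_ : colv j 0 = 0); last by apply/rowP => i; rewrite !mxE.
  rewrite -E'; apply/rowP => i; rewrite !mxE; ring.
move=> /eqP; rewrite mulf_eq0 (negbTE hj) orbF => /eqP b0; split=> //.
move/eqP: E'; rewrite b0 scale0r addr0 (_ : colv j 0 = 0); last by apply/rowP => i; rewrite !mxE.
by rewrite !scaler_eq0 (negbTE c0) (negbTE hj) (negbTE p0) !orbF => /eqP.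
Qed.

Lemma node_point_Xt c : c != 0 -> Xt (c *: ten p (dhv p w1)).
Proof.
move=> c0; have [ze Hze] := node_pair; apply: Xt_scale => //; split.
  have [j hj] := dhv_neq0; case/rV0Pn: p0 => l pl; apply/rV0Pn; exists (ix l j).
  by rewrite ten_ix mxE mulf_neq0.
by move=> g [[e hg] Hg]; case: (Hze e g hg Hg).
Qed.

(** The graph relations confine the column of a tangent vector to the plane of [p] and [w1]. Over a
    zero column, differentiating the quadratic relation where the first coordinate is nonzero and
    the second is 0 gives [D2 = 0]; the linear relations then give [D1 = 0] and the remaining
    coordinates. *)
Lemma Xt_regular_node c : c != 0 -> curve_regular_at Xt (c *: ten p (dhv p w1)).
Proof.
move=> c0; have [ze Hze] := node_pair; have [j hj] := dhv_neq0; have /rV0Pn[l pl] := p0.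
have [F1 F2 ker [h11 h22 h12] [_ Gv]] := tp.
have [b1 [b2 [E1 [E2 [R2 [D [g11 [g12 [g22 [a [b [hg11 hg12 hg22 R3 [g110 g120 g220]]]]]]]]]]]]] := node_relations pX np tp.
have he v : hess G p p v = 0 := hess_euler v (pk_G pk) Gv.
have yE : c *: ten p (dhv p w1) = ten p (c *: dhv p w1) by rewrite tenZr.
have zj : (c *: dhv p w1) 0 j != 0 by rewrite !mxE mulf_neq0.
apply: (@regular_criterion _ (ten w1 (dhv p w1) + ten p ze) j p w1).
- exact: node_point_Xt.
- exact: node_pair_indep.
- exact: tangent_pair_scale.
- rewrite yE => u Tu; have [/ker[a' [b' [c' vE]]] _] := tangent_F Tu zj.
  set v := colv j u in vE *.
  have hh i k : differential (h i) p v * differential (h k) p w1 = differential (h k) p v * differential (h i) p w1.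
    have := tangent_h l i k Tu zj; rewrite -/v !hp !mul0r !addr0 !mxE => H.
    apply: (mulfI (mulf_neq0 pl c0)).
    transitivity (differential (h i) p v * (p 0 l * (c * differential (h k) p w1))); first by ring.
    by rewrite H; ring.
  have : hess G p v w1 * hess G p w1 w2 = hess G p v w2 * hess G p w1 w1.
    rewrite -!E2 -!E1 !big_distrlr /= exchange_big; apply: eq_bigr => i _; apply: eq_bigr => k _ /=.
    transitivity (b1 i * b2 k * (differential (h k) p v * differential (h i) p w1)); first by ring.
    by rewrite hh; ring.
  rewrite h11 mulr0 => /eqP; rewrite mulf_eq0 (negbTE h12) orbF vE !hessDl !hessZl he h11 (hessC G p w2) !mulr0 !add0r.
  by rewrite mulf_eq0 (negbTE h12) orbF => /eqP ->; exists a', b'; rewrite scale0r addr0.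
rewrite yE => u Tu cu0; apply: (tangent_colv0 Tu pl zj cu0).
set z := c *: dhv p w1 in Tu zj *.
pose H1 := \sum_j b1 j *: h j; pose H2 := \sum_j b2 j *: h j.
pose L1 : Pt := \sum_j b1 j *: 'X_(ix l j); pose L2 : Pt := \sum_j b2 j *: 'X_(ix l j).
pose D1 := \sum_j b1 j * u 0 (ix l j); pose D2 := \sum_j b2 j * u 0 (ix l j).
have hL1 : L1 \is 1.-homog by apply: rpred_sum => i _; apply: rpredZ; exact: X_homog.
have hL2 : L2 \is 1.-homog by apply: rpred_sum => i _; apply: rpredZ; exact: X_homog.
have eL1 x z' : eval_at L1 (ten x z') = x 0 l * \sum_j b1 j * z' 0 j.
  by rewrite eval_at_sum mulr_sumr; apply: eq_bigr => i _; rewrite !evE ten_ix; ring.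
have eL2 x z' : eval_at L2 (ten x z') = x 0 l * \sum_j b2 j * z' 0 j.
  by rewrite eval_at_sum mulr_sumr; apply: eq_bigr => i _; rewrite !evE ten_ix; ring.
have eH1 x : \sum_j b1 j * hv x 0 j = eval_at H1 x.
  by rewrite eval_at_sum; apply: eq_bigr => i _; rewrite evE mxE.
have eH2 x : \sum_j b2 j * hv x 0 j = eval_at H2 x.
  by rewrite eval_at_sum; apply: eq_bigr => i _; rewrite evE mxE.
have dL1 y : differential L1 y u = D1 by rewrite df_sum; apply: eq_bigr => i _; rewrite dfZ dfU.
have dL2 y : differential L2 y u = D2 by rewrite df_sum; apply: eq_bigr => i _; rewrite dfZ dfU.
have Z1 : \sum_j b1 j * z 0 j = c * hess G p w1 w2.
  by rewrite -E1 mulr_sumr; apply: eq_bigr => i _; rewrite !mxE; ring.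
have Z2 : \sum_j b2 j * z 0 j = 0.
  transitivity (c * hess G p w1 w1); last by rewrite h11 mulr0.
  by rewrite -E2 mulr_sumr; apply: eq_bigr => i _; rewrite !mxE; ring.
have D20 : D2 = 0.
  have := @relation_tangent (cev j g11 * (L1 * L1) + cev j g12 * (L1 * L2) + cev j g22 * (L2 * L2)) _ _ _ _ Tu.
  rewrite !dfE !evE !d_cev !eval_cev !colv_ten cu0 !df0v !(eval_scale _ _ hg11, eval_scale _ _ hg12, eval_scale _ _ hg22).
  rewrite eL1 eL2 dL1 dL2 Z1 Z2 g110 g220 => H.
  have k0 : z 0 j ^+ D * eval_at g12 p * (p 0 l * (c * hess G p w1 w2)) != 0.
    by rewrite !mulf_neq0 // expf_neq0.
  apply: (mulfI k0); rewrite mulr0 -[RHS]H; first by ring.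
    exists (D + (1 + 1))%N; apply: rpredD; first apply: rpredD; apply: dhomogM => //; try exact: cev_homog; exact: dhomogM.
  move=> x [_ Fx Gx]; rewrite !evE !eval_cev !colv_ten !(eval_scale _ _ hg11, eval_scale _ _ hg12, eval_scale _ _ hg22) eL1 eL2 eH1 eH2.
  have := congr1 (fun f => eval_at f x) R3; rewrite !evE Fx Gx !mulr0 add0r -/H1 -/H2 => Ex.
  transitivity (hv x 0 j ^+ D * x 0 l ^+ 2 * (eval_at g11 x * eval_at H1 x ^+ 2 +
     eval_at g12 x * eval_at H1 x * eval_at H2 x + eval_at g22 x * eval_at H2 x ^+ 2)); first by ring.
  by rewrite Ex mulr0.
have lr i : exists s c1, [/\ s != 0, hess G p w1 w2 * c1 = s * differential (h i) p w1 & s * u 0 (ix l i) = c1 * D1].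
  have [D' [s [c0' [c1 [c2 [[hs s0 hc1 hc2 E] [e1 e2]]]]]]] := R2 i.
  exists (eval_at s p), (eval_at c1 p); split=> //.
  have := @relation_tangent (cev j s * 'X_(ix l i) - cev j c1 * L1 - cev j c2 * L2) _ _ _ _ Tu.
  rewrite !dfE !evE !d_cev !eval_cev !colv_ten cu0 !df0v !(eval_scale _ _ hs, eval_scale _ _ hc1, eval_scale _ _ hc2).
  rewrite dL1 dL2 D20 => H.
  apply/eqP; rewrite -subr_eq0; apply/eqP; apply: (mulfI (expf_neq0 D' zj)); rewrite mulr0 -[RHS]H; first by ring.
    exists (D' + 1)%N; apply: rpredB; first apply: rpredB; apply: dhomogM => //; rewrite ?X_homog //; exact: cev_homog.
  move=> x [_ Fx _]; rewrite !evE !eval_cev !colv_ten !(eval_scale _ _ hs, eval_scale _ _ hc1, eval_scale _ _ hc2) eL1 eL2 ten_ix eH1 eH2.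
  have := congr1 (fun f => eval_at f x) E; rewrite !evE Fx mulr0 add0r -/H1 -/H2 => Ex.
  transitivity (hv x 0 j ^+ D' * x 0 l * (eval_at s x * hv x 0 i - eval_at c1 x * eval_at H1 x - eval_at c2 x * eval_at H2 x)); first by ring.
  by rewrite [hv x 0 i]mxE Ex; ring.
have D10 : D1 = 0.
  have [s [c1 [s0 e1 E]]] := lr j; have c10 : c1 != 0.
    apply: contraNneq (mulf_neq0 s0 hj) => z0; rewrite -e1 z0 mulr0 //.
  apply: (mulfI c10); rewrite mulr0 -E.
  by have -> : u 0 (ix l j) = 0 by [have := congr1 (fun v : 'rV[K]_4 => v 0 l) cu0; rewrite !mxE]; rewrite mulr0.
by move=> i; have [s [c1 [s0 _ E]]] := lr i; apply: (mulfI s0); rewrite E D10 !mulr0.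
Qed.
End NodeTangent.

Lemma Xt_cases y : Xt y -> (exists x c, [/\ X x, ~ isnode qs x, c != 0 & y = c *: emb x]) \/
  exists p w1 w2 c, [/\ X p, isnode qs p, tangents p w1 w2, c != 0 & y = c *: ten p (dhv p w1)].
Proof.
move=> yX; have [x [z [xX z0 yE H]]] := Xt_points yX.
have [nx|nx] := pselect (isnode qs x); last first.
  have [|c zE] := Xt_regular_point xX nx _ H; first by rewrite -yE.
  left; exists x, c; split=> //; last by rewrite yE zE tenZr.
  by apply: contraNneq z0 => c0; rewrite zE c0 scale0r.
have [w1 [w2 tp]] := node_tangents (nodes xX nx).
right; have [|c zE] := Xt_node_points xX nx tp _ z0; first by rewrite -yE.
have c0 : c != 0 by apply: contraNneq z0 => c0; case: zE => ->; rewrite c0 scale0r.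
case: zE => zE; [exists x, w1, w2, c|exists x, w2, w1, c]; split=> //; try exact: tangentsC;
  by rewrite yE zE tenZr.
Qed.

Lemma Xt_regular y : Xt y -> curve_regular_at Xt y.
Proof.
move=> /Xt_cases[[x [c [xX nx c0 ->]]]|[p [w1 [w2 [c [pX np tp c0 ->]]]]]]; first exact: Xt_regular_emb.
exact: (Xt_regular_node pX np tp c0).
Qed.

Lemma Xt_nonempty : Xt !=set0.
Proof.
have [x xX nx] := not_all_nodes; have [j hj] := hfree xX nx; exists (emb x).
by apply: emb_Xt => //; apply: emb_neq0 hj; case: xX.
Qed.

Lemma Xt_separate E : (forall f, E f -> exists m, f \is m.-homog) -> ~ (Xt `<=` zero_locus E) ->
  exists g, [/\ E g, ishom g & ~ I (pull g)].
Proof.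
move=> hE nE; apply: contrapT => ng; apply: nE => y yX; split; first by case: yX.
move=> g Eg; apply: contrapT => gy; apply: ng; exists g; split=> //; first exact: hE.
by move=> Ig; apply: gy; case: yX => _; apply; split=> //; exact: hE.
Qed.

Lemma Xt_closed : Zariski_closed Xt.
Proof. by exists [set g | ishom g /\ I (pull g)]; split=> // g [[e]]; exists e. Qed.

Lemma pull_form g : ishom g -> isform (pull g).
Proof. by move=> [e hg]; exists (e * m.+1)%N; exact: pull_homog. Qed.

Lemma Xt_irreducible : irreducible Xt.
Proof.
split; first exact: Xt_nonempty.
move=> Y Z [EY [hY ->]] [EZ [hZ ->]] H; apply: contrapT => /not_orP[nY nZ].
have [f [Ef hf nf]] := Xt_separate hY nY; have [g [Eg hg ng]] := Xt_separate hZ nZ.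
have : I (pull (f * g)).
  apply: vanish_Xt; first exact: homM.
  by move=> y /H[[_ Hy]|[_ Hy]]; rewrite evE; [rewrite (Hy f Ef) mul0r|rewrite (Hy g Eg) mulr0].
have -> : pull (f * g) = pull f * pull g := rmorphM pull f g.
move=> H'; have [If|Ig] := prI (pull_form hf) (pull_form hg) H'; [exact: (nf If)|exact: (ng Ig)].
Qed.

Lemma Xt_not_point : ~ single_point Xt.
Proof.
move=> [y y0 E]; have [cX irr nsp _] := curve_integral unc pk prI d1 n1; apply: nsp.
apply: (irr_finite (s := [seq p <- qs ++ [seq colv j y | j <- enum 'I_M] | p != 0]) cX irr).
  by move=> p; rewrite mem_filter => /andP[].
move=> x xX; have [x0 _ _] := xX; have [[q qq /sub_rVP[c xE]]|nx] := pselect (isnode qs x).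
  have q0 : q != 0 by apply: contraNneq x0 => q0; rewrite xE q0 scaler0.
  exists q; first by rewrite mem_filter q0 mem_cat qq.
  by apply/pointP => //; exists c => //; apply: contraNneq x0 => c0; rewrite xE c0 scale0r.
have [j hj] := hfree xX nx; have : Xt (emb x) by apply: emb_Xt => //; exact: emb_neq0 hj.
rewrite E => /(pointP _ y0)[c c0 /(congr1 (colv j))]; rewrite colv_ten colvZ mxE => Ex.
have xE : x = (c / eval_at (h j) x) *: colv j y.
  by rewrite mulrC -scalerA -Ex scalerA mulVf // scale1r.
have k0 : colv j y != 0 by apply: contraNneq x0 => k0; rewrite xE k0 scaler0.
exists (colv j y); first by rewrite mem_filter k0 mem_cat (map_f (fun j => colv j y)) ?orbT // mem_enum.
by apply/pointP => //; exists (c / eval_at (h j) x) => //; rewrite mulf_neq0 ?invr_eq0.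
Qed.

Lemma Xt_integral : integral_curve Xt.
Proof.
split; [exact: Xt_closed|exact: Xt_irreducible|exact: Xt_not_point|].
move=> Z cZ iZ ZX ZnX; have [E [hE ZE]] := cZ.
have [|g [Eg hg ng]] := Xt_separate hE.
  by move=> H; apply: ZnX; apply/seteqP; split=> //; rewrite ZE.
have [pts [p0 Hp]] := finite_zeros unc pk prI (pull_form hg) ng.
have /choice[U HU] : forall q, exists u : 'rV[K]_4 * 'rV[K]_4, X q -> isnode qs q -> tangents q u.1 u.2.
  move=> q; have [[qX nq]|nq] := pselect (X q /\ isnode qs q).
    by have [w1 [w2 tp]] := node_tangents (nodes qX nq); exists (w1, w2).
  by exists (0, 0) => qX nq'; case: nq.
pose s := [seq emb p | p <- pts] ++ [seq ten q (dhv q (U q).1) | q <- qs] ++ [seq ten q (dhv q (U q).2) | q <- qs].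
apply: (irr_finite (s := [seq y <- s | y != 0]) cZ iZ) => [y|y Zy]; first by rewrite mem_filter => /andP[].
have yX := ZX y Zy; have y0 : y != 0 by case: yX.
suff [u us [c yE]] : exists2 u, u \in s & exists c, y = c *: u.
  have u0 : u != 0 by apply: contraNneq y0 => u0; rewrite yE u0 scaler0.
  exists u; first by rewrite mem_filter u0.
  by apply/pointP => //; exists c => //; apply: contraNneq y0 => c0; rewrite yE c0 scale0r.
have [x [z [xX z0 yE H]]] := Xt_points yX.
have [nx|nx] := pselect (isnode qs x); last first.
  have [|c zE] := Xt_regular_point xX nx _ H; first by rewrite -yE.
  have {}yE : y = c *: emb x by rewrite yE zE tenZr.
  have c0 : c != 0 by apply: contraNneq y0 => c0; rewrite yE c0 scale0r.
  have gx : eval_at (pull g) x = 0.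
    have [e hg'] := hg; have : eval_at g y = 0 by move: Zy; rewrite ZE => -[_]; apply.
    by rewrite eval_pull yE (eval_scale _ _ hg') => /eqP; rewrite mulf_eq0 expf_eq0 (negbTE c0) andbF => /eqP.
  have [p pp px] := Hp x xX gx; have [b b0 xE] := (pointP x (p0 p pp)).1 px.
  exists (emb p); first by rewrite mem_cat map_f.
  by exists (c * b ^+ m.+1); rewrite yE xE emb_scale scalerA.
have [q qq /sub_rVP[b xE]] := nx; have x0 : x != 0 by case: xX.
have b0 : b != 0 by apply: contraNneq x0 => b0; rewrite xE b0 scale0r.
have qX : X q.
  by have := curve_scale pk (invr_neq0 b0) xX; rewrite xE scalerA mulVf // scale1r.
have nq : isnode qs q by exists q.
have {}yE : y = ten q (b *: z) by rewrite yE xE tenZl tenZr.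
have [||c zE] := Xt_node_points qX nq (HU q qX nq) (z := b *: z); first by rewrite -yE.
  by rewrite scaler_eq0 negb_or b0.
by case: zE => zE; [exists (ten q (dhv q (U q).1))|exists (ten q (dhv q (U q).2))];
  rewrite ?mem_cat ?(map_f (fun q => ten q (dhv q (U q).1))) ?(map_f (fun q => ten q (dhv q (U q).2))) ?orbT //;
  exists c; rewrite yE zE tenZr.
Qed.

Lemma Xt_smooth : smooth_curve Xt.
Proof. split; [exact: Xt_integral|exact: Xt_regular]. Qed.

(** All nonzero columns are proportional on [Xt], and there is one at every point of it; 0 is a
    default value outside. *)
Definition nu y : 'rV[K]_4 := if [pick j | colv j y != 0] is Some j then colv j y else 0.

Lemma nu_ten x z : x != 0 -> z != 0 -> exists2 c, c != 0 & nu (ten x z) = c *: x.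
Proof.
move=> x0 /rV0Pn[j zj]; rewrite /nu; case: pickP => [k|/(_ j)]; rewrite colv_ten; last first.
  by rewrite scaler_eq0 negb_or zj x0.
by rewrite scaler_eq0 negb_or => /andP[zk _]; exists (z 0 k).
Qed.

Lemma scale_eqmx k (x : 'rV[K]_k) b c : b != 0 -> c != 0 -> (b *: x == c *: x)%MS.
Proof.
move=> b0 c0; apply/andP; split; apply/sub_rVP; [exists (b / c)|exists (c / b)];
  by rewrite scalerA mulfVK.
Qed.

(** The columns define the morphism locally by linear forms, and the forms [embf] give its inverse,
    defined exactly off the nodes. *)
Lemma Xt_normalization : normalization Xt X nu.
Proof.
have evf i y : eval_forms (fun l => 'X_(ix l i) : Pt) y = colv i y by apply/rowP => l; rewrite !mxE evE.
split; first exact: Xt_smooth.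
  split=> y yX; have [x [z [xX z0 yE _]]] := Xt_points yX; have [x0 _ _] := xX.
    by have [c c0 E] := nu_ten x0 z0; rewrite yE E; exact: (curve_scale pk c0 xX).
  case/rV0Pn: (z0) => j zj; exists 1%N, (fun l => 'X_(ix l j)); split; first by move=> l; exact: X_homog.
    by rewrite evf yE colv_ten scaler_eq0 negb_or zj.
  move=> y' yX'; have [x' [z' [xX' z0' -> _]]] := Xt_points yX'; have [x0' _ _] := xX'.
  rewrite evf colv_ten scaler_eq0 negb_or => /andP[zj' _]; have [c c0 ->] := nu_ten x0' z0'.
  exact: scale_eqmx.
exists m.+1, embf; have evE' x : eval_forms embf x = emb x by exact: eval_embf.
split.
- by move=> i; exact: (dhomogM (X_homog K _) (hm _)).
- have [x xX nx] := not_all_nodes; have [j hj] := hfree xX nx; exists x => //.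
  by rewrite evE'; apply: emb_neq0 hj; case: xX.
- move=> x xX; rewrite evE' => e0; split; first exact: emb_Xt.
  have x0 : x != 0 by case: xX.
  have h0 : hv x != 0.
    by apply: contraNneq e0 => h0; apply/eqP/rowP => i; rewrite /emb h0 !mxE mulr0.
  by have [c c0 ->] := nu_ten x0 h0; rewrite -[X in (_ == X)%MS]scale1r; apply: scale_eqmx; rewrite ?oner_eq0.
move=> y yX; have [x [z [xX z0 yE H]]] := Xt_points yX; have x0 : x != 0 by case: xX.
have [c c0 E] := nu_ten x0 z0; rewrite evE' yE E emb_scale => e0.
have ex0 : emb x != 0 by apply: contraNneq e0 => ->; rewrite scaler0.
have nx : ~ isnode qs x.
  move=> nx; move/eqP: ex0; apply; apply/rowP => i; rewrite !mxE hnode ?mulr0 //.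
have [|b zE] := Xt_regular_point xX nx _ H; first by rewrite -yE.
have b0 : b != 0 by apply: contraNneq z0 => b0; rewrite zE b0 scale0r.
rewrite zE tenZr -/(emb x).
by apply: scale_eqmx => //; exact: expf_neq0.
Qed.

Lemma I_cancel b f : isform b -> ~ I b -> I (b * f) -> I f.
Proof.
move=> fb nb H; have [e hb] := fb.
rewrite [f](pihomog_partitionE (mf := mdeg) (k := msize f)) //; apply: (idl_sum _ HI) => k _.
have fk : isform (pihomog mdeg k f) by exists (val k); exact: pihomogP.
have [||//] := prI fb fk; last by [].
rewrite mulrC -(pihomogMr _ _ hb); apply: (pk_van unc pk) => x xX; apply: vanishing_pihomog => a a0.
by rewrite mulrC; apply: I_van H; exact: (curve_scale pk a0 xX).
Qed.

Lemma pull_nonzero B e y : B \is e.-homog -> Xt y -> eval_at B y != 0 -> ~ I (pull B).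
Proof.
move=> hB [_ H] By HI'; move/eqP: By; apply; apply: H; split=> //; by exists e.
Qed.

(** * The tangent field of the curve and its behaviour along the branches *)

Definition gradf (f : P) : 'I_4 -> P := fun i => f^`M(i).
(** Contracting [dF], [dG] and [c] with the volume form gives a polynomial vector field tangent to
    the curve and killed by [c]. Its pairing [Dl c a] with [a] is, up to sign, the determinant of
    the four covectors. *)
Definition vf (c : 'rV[K]_4) l : P := cross (gradf F) (gradf G) (fun i => (c 0 i)%:MP) l.
Definition vv c x : 'rV[K]_4 := \row_l eval_at (vf c l) x.
Definition Dl (c a : 'rV[K]_4) : P := \sum_l a 0 l *: vf c l.

Lemma eval_vf c l x : eval_at (vf c l) x = cross (fun i => grad F x 0 i) (fun i => grad G x 0 i) (fun i => c 0 i) l.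
Proof.
rewrite /vf /eval_at cross_morph; apply: cross_ext => i /=; rewrite ?mxE // mevalC //.
Qed.

Lemma eval_Dl c a x : eval_at (Dl c a) x = dot a (vv c x).
Proof. by rewrite eval_at_sum; apply: eq_bigr => l _; rewrite evE mxE. Qed.

Lemma vf_homog c l : vf c l \is (d.-1 + n.-1).-homog.
Proof.
have hF i : F^`M(i) \is d.-1.-homog := mderiv_homog i (pk_F pk).
have hG i : G^`M(i) \is n.-1.-homog := mderiv_homog i (pk_G pk).
have hc i j : F^`M(i) * (G^`M(j) * (c 0 l)%:MP) \is (d.-1 + n.-1).-homog.
  by rewrite mulrA mulrC mul_mpolyC; apply: rpredZ; apply: dhomogM.
have h3 i j k : det3 (gradf F) (gradf G) (fun i => (c 0 i)%:MP) i j k \is (d.-1 + n.-1).-homog.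
  rewrite /det3 /gradf.
  have hm' i' j' k' : F^`M(i') * (G^`M(j') * (c 0 k')%:MP) \is (d.-1 + n.-1).-homog.
    by rewrite mulrA mulrC mul_mpolyC; apply: rpredZ; apply: dhomogM.
  by rewrite !mulrBr; apply: rpredD; [apply: rpredB|]; apply: rpredB; exact: hm'.
by elim/ord4_cases: l {hc}; rewrite /vf /cross /= ?rpredN; exact: h3.
Qed.

Lemma Dl_homog c a : Dl c a \is (d.-1 + n.-1).-homog.
Proof. by apply: rpred_sum => l _; apply: rpredZ; exact: vf_homog. Qed.

Lemma dF_vv c x : differential F x (vv c x) = 0.
Proof.
rewrite -[RHS](cross_l (fun i => grad F x 0 i) (fun i => grad G x 0 i) (fun i => c 0 i)).
by apply: eq_bigr => l _; rewrite [vv _ _ _ _]mxE eval_vf mxE.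
Qed.
Lemma dG_vv c x : differential G x (vv c x) = 0.
Proof.
rewrite -[RHS](cross_m (fun i => grad F x 0 i) (fun i => grad G x 0 i) (fun i => c 0 i)).
by apply: eq_bigr => l _; rewrite [vv _ _ _ _]mxE eval_vf mxE.
Qed.

Lemma eval_DlC c a x : eval_at (Dl c a) x = - eval_at (Dl a c) x.
Proof.
have E a' c' : eval_at (Dl c' a') x = pair (fun i => a' 0 i) (cross (fun i => grad F x 0 i) (fun i => grad G x 0 i) (fun i => c' 0 i)).
  by rewrite eval_Dl; apply: eq_bigr => l _; rewrite [vv _ _ _ _]mxE eval_vf.
rewrite (E a c) (E c a); exact: cross_alt.
Qed.

(** By Euler [dF] and [dG] kill [x], so Cramer's rule keeps only the terms of [c] and [a].
    Consequently the fields for different [c] agree up to scale and a radial part. *)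
Lemma Dl_cramer c a x : X x -> eval_at (Dl c a) x *: x = dot a x *: vv c x - dot c x *: vv a x.
Proof.
move=> [x0 Fx Gx]; apply/rowP => l.
have pF : pair (fun i => grad F x 0 i) (fun i => x 0 i) = 0 := gradx (pk_F pk) Fx.
have pG : pair (fun i => grad G x 0 i) (fun i => x 0 i) = 0 := gradx (pk_G pk) Gx.
have := cross_cramer (fun i => grad F x 0 i) (fun i => grad G x 0 i) (fun i => c 0 i) (fun i => a 0 i) (fun i => x 0 i) l.
rewrite pF pG !mul0r subr0 addr0 => E.
rewrite ![in RHS]mxE [LHS]mxE !eval_vf -E eval_Dl; congr (_ * _).
by apply: eq_bigr => k _; rewrite [vv _ _ _ _]mxE eval_vf.
Qed.

Lemma Dl_nonzero x : X x -> ~ isnode qs x -> exists c a, eval_at (Dl c a) x != 0.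
Proof.
move=> [x0 Fx Gx] nx; have ind := pk_reg pk x0 Fx Gx nx.
have [i [j [ij mn0]]] : exists i j : 'I_4, i != j /\ grad F x 0 i * grad G x 0 j - grad F x 0 j * grad G x 0 i != 0.
  exact: indep_minor.
have [k [l H]] := cross_minor ij mn0.
exists (delta_mx 0 k), (delta_mx 0 l); rewrite eval_Dl /dot (bigD1 l) //= big1 => [|i' ne].
  rewrite !mxE !eqxx mul1r addr0 eval_vf.
  by rewrite (cross_ext (c' := fun s => (s == k)%:R) _ (fun=> erefl) (fun=> erefl)) // => s; rewrite mxE eqxx.
by rewrite !mxE eqxx (negbTE ne) mul0r.
Qed.

Lemma dembZ x c v : demb x (c *: v) = c *: demb x v.
Proof. by apply/rowP => i; rewrite /demb !mxE dfZv; ring. Qed.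
Lemma demb_self x : demb x x = m.+1%:R *: emb x.
Proof. by apply/rowP => i; rewrite /demb /emb !mxE (euler _ (hm _)) -natr1; ring. Qed.

Definition demf c i : P := vf c (rx i).1 * h (rx i).2 + 'X_((rx i).1) * \sum_k (h (rx i).2)^`M(k) * vf c k.
(** The form [A . dy] pulled back by [emb] and contracted with the field of [c]: it turns a 1-form
    on the normalization into a polynomial on the original space. *)
Definition NN (A : 'I_n'.+1 -> Pt) c : P := \sum_i pull (A i) * demf c i.

Lemma eval_demf c i x : eval_at (demf c i) x = demb x (vv c x) 0 i.
Proof.
rewrite /demf !evE eval_at_sum /demb !mxE; congr (_ + _ * _).
by apply: eq_bigr => k _; rewrite evE mxE.
Qed.

Lemma eval_NN A c x : eval_at (NN A c) x = \sum_i eval_at (A i) (emb x) * demb x (vv c x) 0 i.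
Proof. by rewrite eval_at_sum; apply: eq_bigr => i _; rewrite evE eval_pull eval_demf. Qed.

Lemma demf_homog c i : demf c i \is (d.-1 + n.-1 + m).-homog.
Proof.
apply: rpredD; first by apply: dhomogM; [exact: vf_homog|exact: hm].
have -> : (d.-1 + n.-1 + m = 1 + (m.-1 + (d.-1 + n.-1)))%N by lia.
apply: (dhomogM (X_homog K _)); apply: rpred_sum => k _; apply: dhomogM; last exact: vf_homog.
exact: mderiv_homog.
Qed.

Lemma NN_homog A e c : (forall i, A i \is e.-homog) -> NN A c \is (e * m.+1 + (d.-1 + n.-1 + m)).-homog.
Proof.
move=> hA; apply: rpred_sum => i _; apply: dhomogM; [exact: pull_homog|exact: demf_homog].
Qed.

Lemma regular_span y y' t u : curve_regular_at Xt y -> cone_tangent_space Xt y y' ->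
  cone_tangent_space Xt y t -> indep y' t -> cone_tangent_space Xt y u -> exists a b, u = a *: y' + b *: t.
Proof.
move=> [T fT HT] /HT y'T /HT tT ind /HT uT; apply/sub_col2.
have sT : (col_mx y' t <= T)%MS by rewrite -addsmxE addsmx_sub y'T tT.
have [_] := mxrank_leqif_eq sT; rewrite (eqP fT) (eqP (indep_row_free ind)) eqxx => /esym/andP[_ Ts].
exact: submx_trans uT Ts.
Qed.

Lemma tangent_pair_space y t : tangent_pair y t -> cone_tangent_space Xt y t.
Proof. by move=> H; apply: tangent_homog => e g hg Hg; exact: (H e g hg Hg).2. Qed.

Lemma tangent_self y : Xt y -> cone_tangent_space Xt y y.
Proof.
move=> yX; apply: tangent_homog => e g hg Hg; rewrite (euler _ hg).
by have -> : eval_at g y = 0 by [apply: yX.2; split=> //; exists e]; rewrite mulr0.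
Qed.

Lemma emb_indep x w j c : c != 0 -> eval_at (h j) x != 0 -> x != 0 -> indep x w -> indep (c *: emb x) (demb x w).
Proof.
move=> c0 hj x0 xw a b E; have := congr1 (colv j) E.
rewrite /demb /emb colvD !colvZ colvD !colv_ten !mxE => E'.
have [|_ /eqP] := xw (a * c * eval_at (h j) x + b * differential (h j) x w) (b * eval_at (h j) x).
  rewrite -[RHS](_ : colv j 0 = 0); last by apply/rowP => i; rewrite !mxE.
  rewrite -E'; apply/rowP => i; rewrite !mxE; ring.
rewrite mulf_eq0 (negbTE hj) orbF => /eqP b0; split=> //.
move/eqP: E; rewrite b0 scale0r addr0 !scaler_eq0 (negbTE c0) (negbTE (emb_neq0 x0 hj)) !orbF => /eqP //.
Qed.

Lemma dot_vv c x : dot c (vv c x) = 0.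
Proof.
have := eval_DlC c c x; rewrite eval_Dl => /eqP; rewrite -subr_eq0 opprK -mulr2n mulrn_eq0 /= => /eqP //.
Qed.

Lemma vv_indep x c : X x -> ~ isnode qs x -> dot c x != 0 -> indep x (vv c x).
Proof.
move=> xX nx cx s t E.
have s0 : s = 0.
  have := congr1 (dot c) E; rewrite dotDr !dotZr dot_vv mulr0 addr0 dot0r => /eqP.
  by rewrite mulf_eq0 (negbTE cx) orbF => /eqP.
split=> //; apply/eqP/negPn/negP => t0.
have v0 : vv c x = 0.
  by move/eqP: E; rewrite s0 scale0r add0r scaler_eq0 (negbTE t0) => /eqP.
have va a : vv a x = 0.
  have := Dl_cramer c a xX; rewrite eval_Dl v0 dot0r scale0r scaler0 sub0r => /esym/eqP.
  by rewrite oppr_eq0 scaler_eq0 (negbTE cx) => /eqP.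
by have [c' [a']] := Dl_nonzero xX nx; rewrite eval_Dl va dot0r eqxx.
Qed.

Lemma vv_tangent x c : X x -> tangent_pair (emb x) (demb x (vv c x)).
Proof. by move=> xX; apply: emb_pair => //; [exact: dF_vv|exact: dG_vv]. Qed.

Lemma form_regular A e x c u : X x -> ~ isnode qs x -> (forall i, A i \is e.-homog) ->
  (forall y, Xt y -> \sum_i eval_at (A i) y * y 0 i = 0) -> (forall c, eval_at (NN A c) x = 0) ->
  c != 0 -> cone_tangent_space Xt (c *: emb x) u -> \sum_i eval_at (A i) (c *: emb x) * u 0 i = 0.
Proof.
move=> xX nx hA Ay HN c0 Tu; have [j hj] := hfree xX nx; have [x0 _ _] := xX.
have [c' cx] : exists c', dot c' x != 0.
  case/rV0Pn: x0 => l xl; exists (delta_mx 0 l); rewrite /dot (bigD1 l) //= big1 => [|i ne].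
    by rewrite mxE !eqxx mul1r addr0.
  by rewrite mxE eqxx (negbTE ne) mul0r.
have eX : Xt (emb x) := emb_Xt xX (emb_neq0 x0 hj).
have [|||||a [b ->]] := regular_span (y := c *: emb x) (y' := c *: emb x) (t := demb x (vv c' x)) (u := u).
- by apply: Xt_regular; exact: Xt_scale.
- by apply: tangent_self; exact: Xt_scale.
- by apply: tangent_pair_space; apply: tangent_pair_scale; exact: vv_tangent.
- by apply: (emb_indep c0 hj x0); exact: vv_indep.
- by [].
transitivity (c ^+ e * (a * c * \sum_i eval_at (A i) (emb x) * emb x 0 i + b * eval_at (NN A c') x)); last first.
  by rewrite Ay // HN !mulr0 addr0 mulr0.
rewrite eval_NN !mulr_sumr -big_split mulr_sumr; apply: eq_bigr => i _ /=.
have -> : (a *: (c *: emb x) + b *: demb x (vv c' x)) 0 i = a * (c * emb x 0 i) + b * demb x (vv c' x) 0 i.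
  by rewrite [LHS]mxE; congr (_ + _); rewrite !mxE.
by rewrite (eval_scale _ _ (hA i)); ring.
Qed.

Definition cong (t p q : {poly K}) : Prop := exists r, p = q + t * r.

Lemma cong_sum t (J : Type) (s : seq J) (p q : J -> {poly K}) :
  (forall i, cong t (p i) (q i)) -> cong t (\sum_(i <- s) p i) (\sum_(i <- s) q i).
Proof.
move=> H; elim/big_rec2: _ => [|i p' q' _ [r ->]]; first by exists 0; rewrite mulr0 addr0.
by have [r' ->] := H i; exists (r + r'); ring.
Qed.

Lemma congM t a p q : cong t p q -> cong t (a * p) (a * q).
Proof. by move=> [r ->]; exists (a * r); ring. Qed.

Lemma cong_trans t p q r : cong t p q -> cong t q r -> cong t p r.
Proof. by move=> [s ->] [s' ->]; exists (s + s'); ring. Qed.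

Lemma congD t p q p' q' : cong t p q -> cong t p' q' -> cong t (p + p') (q + q').
Proof. by move=> [s ->] [s' ->]; exists (s + s'); ring. Qed.

Lemma euler_poly (f : P) e : f \is e.-homog -> \sum_l ('X_l : P) * f^`M(l) = (e%:R%:MP : P) * f.
Proof.
move=> hf; apply: (eval_inj unc) => x; rewrite eval_atM eval_atC -(euler _ hf) eval_at_sum.
by apply: eq_bigr => l _; rewrite !evE mulrC.
Qed.

Lemma pevU x i : pev x ('X_i : P) = x i.
Proof. by rewrite /pev /= mmapX mmap1U. Qed.
Lemma pev_cst x c : pev x (c%:MP : P) = c%:P.
Proof. by rewrite /pev /= mmapC. Qed.
Lemma pevZ x c (f : P) : pev x (c *: f) = c%:P * pev x f.
Proof. by rewrite -mul_mpolyC rmorphM /= -/(pev x) pev_cst. Qed.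
Lemma pev_euler x (f : P) e : f \is e.-homog -> \sum_l pev x f^`M(l) * x l = e%:R * pev x f.
Proof.
move=> hf; have := congr1 (pev x) (euler_poly hf); rewrite rmorphM pev_cst polyC_natr rmorph_sum => <-.
apply: eq_bigr => l _; transitivity (pev x 'X_l * pev x f^`M(l)); [by rewrite pevU mulrC|exact/esym/rmorphM].
Qed.
Lemma pev_lin x (c : 'rV[K]_4) : pev x (lin c) = \sum_l (c 0 l)%:P * x l.
Proof. by rewrite rmorph_sum; apply: eq_bigr => l _; rewrite pevZ pevU. Qed.

Definition pair_deriv (c : 'rV[K]_4) (x : 'I_4 -> {poly K}) : {poly K} := \sum_l (c 0 l)%:P * (x l)^`().

Lemma pev_vf x c l : pev x (vf c l) =
  cross (fun i => pev x F^`M(i)) (fun i => pev x G^`M(i)) (fun i => (c 0 i)%:P) l.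
Proof. by rewrite /vf cross_morph; apply: cross_ext => i //=; rewrite pev_cst. Qed.

Lemma pev_Dl x c a : pev x (Dl c a) = pair (fun i => (a 0 i)%:P)
  (cross (fun i => pev x F^`M(i)) (fun i => pev x G^`M(i)) (fun i => (c 0 i)%:P)).
Proof. by rewrite rmorph_sum; apply: eq_bigr => l _; rewrite pevZ pev_vf. Qed.

Lemma cong_pair_gradient (f : P) e (x : 'I_4 -> {poly K}) k : f \is e.-homog -> (exists a, pev x f = 'X^(k.+1) * a) ->
  (exists r, pair (fun i => pev x f^`M(i)) x = 'X^k * r) /\
  exists r, pair (fun i => pev x f^`M(i)) (fun i => (x i)^`()) = 'X^k * r.
Proof.
move=> hf [a E]; split.
  by rewrite /pair (pev_euler _ hf) E; exists (e%:R * 'X * a); rewrite exprSr; ring.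
rewrite /pair -deriv_pev E derivM derivXn; exists (a *+ k.+1 + 'X * a^`()).
by rewrite /= exprSr mulrDr mulrA mulrnAl mulrnAr.
Qed.

Lemma sum_jet (R : comNzRingType) k (u D L L' : R) (f y y' : 'I_k -> R) :
  \sum_i (u * f i) * (D * (L * y' i - L' * y i)) =
  u * (D * L) * (\sum_i f i * y' i) - u * (D * L') * (\sum_i f i * y i).
Proof. by rewrite !mulr_sumr -sumrB; apply: eq_bigr => i _; ring. Qed.

Lemma sum_jet2 (R : comNzRingType) k (t D L L' s T : R) (f y y' : 'I_k -> R) :
  \sum_i (T * f i) * (D * (L * (y i + t * y' i) - L' * (t * (s * y i)))) =
  T * t * (D * (L * \sum_i f i * y' i)) + D * (L - L' * (t * s)) * (T * \sum_i f i * y i).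
Proof. by rewrite !mulr_sumr -big_split; apply: eq_bigr => i _ /=; ring. Qed.

Lemma cramer_ring (R : comNzRingType) (CX AX CX' AX' D z z' V W t rG rF rG' rF' t1 t2 : R) :
  D * z' = AX' * V - CX' * W + t * rG' * t1 - t * rF' * t2 ->
  D * z = AX * V - CX * W + t * rG * t1 - t * rF * t2 ->
  (CX * AX' - AX * CX') * V = D * (CX * z' - CX' * z) +
    t * (- (CX * (rG' * t1 - rF' * t2)) + CX' * (rG * t1 - rF * t2)).
Proof.
move=> E' E; transitivity (CX * (D * z') - CX' * (D * z) +
  t * (- (CX * (rG' * t1 - rF' * t2)) + CX' * (rG * t1 - rF * t2))); last by ring.
by rewrite E E'; ring.
Qed.

(** Along an arc satisfying the equations to order [k + 1], Euler's relation and the velocity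
    relation hold modulo ['X^k]. Cramer's rule then compares the field with the velocity of the arc,
    up to a radial term. *)
Lemma cramer_branch x k c a l : (exists r, pev x F = 'X^(k.+1) * r) -> (exists r, pev x G = 'X^(k.+1) * r) ->
  cong 'X^k ((pev x (lin c) * pair_deriv a x - pev x (lin a) * pair_deriv c x) * pev x (vf c l))
    (pev x (Dl c a) * (pev x (lin c) * (x l)^`() - pair_deriv c x * x l)).
Proof.
move=> /(cong_pair_gradient (pk_F pk))[[rF EF] [rF' EF']] /(cong_pair_gradient (pk_G pk))[[rG EG] [rG' EG']].
have cr z := cross_cramer (fun i => pev x F^`M(i)) (fun i => pev x G^`M(i)) (fun i => (c 0 i)%:P) (fun i => (a 0 i)%:P) z l.
have := cr x; have := cr (fun i => (x i)^`()); rewrite -!pev_Dl -!pev_vf EF EG EF' EG'.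
have pl (c' : 'rV[K]_4) : pair (fun i => (c' 0 i)%:P) x = pev x (lin c') by rewrite pev_lin.
have pd (c' : 'rV[K]_4) : pair (fun i => (c' 0 i)%:P) (fun i => (x i)^`()) = pair_deriv c' x by [].
rewrite !pl !pd.
set t1 := cross _ _ _ _; set t2 := cross _ _ _ _ => E' E.
exists (- (pev x (lin c) * (rG' * t1 - rF' * t2)) + pair_deriv c x * (rG * t1 - rF * t2)).
exact: cramer_ring E' E.
Qed.

Section NodeBranch.
Variables (p w1 w2 : 'rV[K]_4).
Hypothesis (pX : X p) (np : isnode qs p) (tp : tangents p w1 w2).
Let p0 : p != 0. Proof. by case: pX. Qed.
Let Fp : eval_at F p = 0. Proof. by case: pX. Qed.
Let Gp : eval_at G p = 0. Proof. by case: pX. Qed.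
Let Gv v : differential G p v = 0. Proof. by case: tp => _ _ _ _ [_]. Qed.
Let G0 i : eval_at G^`M(i) p = 0. Proof. 
have := Gv (delta_mx 0 i); rewrite /differential (bigD1 i) //= big1 => [|j ne]; first by rewrite mxE !eqxx mulr1 addr0.
by rewrite mxE eqxx (negbTE ne) mulr0.
Qed.
Let hessp u : hess G p p u = 0. Proof. exact: (hess_euler u (pk_G pk) Gv). Qed.

Let tangents_indep_dev a b c : a *: p + b *: w1 + c *: w2 = 0 -> [/\ a = 0, b = 0 & c = 0].
Proof. by move=> H; exact: (tangents_indep pX tp H). Qed.

Definition nal : 'I_4 -> K := fun i => grad F p 0 i.
Definition nbe : 'I_4 -> K := fun i => differential G^`M(i) p w1.

(** [Dl c a] vanishes at the node; the second condition makes it vanish simply along the branch, and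
    the third makes [c] and [a] coordinates on the plane of [p] and [w1]. *)
Lemma node_frame : exists c a : 'rV[K]_4, [/\ dot c p != 0,
  pair (fun i => a 0 i) (cross nal nbe (fun i => c 0 i)) != 0 &
  dot c p * dot a w1 - dot a p * dot c w1 != 0].
Proof.
have [F1 F2 ker [h11 h22 h12] [[e Fe] _]] := tp.
have nbE (u : 'rV[K]_4) : pair nbe (fun i => u 0 i) = hess G p w1 u.
  by apply: eq_bigr => i _; rewrite mulrC.
have naE (u : 'rV[K]_4) : pair nal (fun i => u 0 i) = differential F p u.
  by apply: eq_bigr => i _; rewrite /nal mxE.
have ind : indep (grad F p) (\row_i nbe i).
  move=> s t E.
  have Eu u : s * differential F p u + t * hess G p w1 u = 0.
    rewrite -naE -nbE /pair !mulr_sumr -big_split big1 // => i _ /=.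
    have := congr1 (fun v : 'rV[K]_4 => v 0 i * u 0 i) E; rewrite !mxE mul0r => <-; rewrite /nal mxE; ring.
  have := Eu w2; rewrite F2 mulr0 add0r => /eqP; rewrite mulf_eq0 (negbTE h12) orbF => /eqP t0.
  have := Eu e; rewrite t0 mul0r addr0 => /eqP; rewrite mulf_eq0 (negbTE Fe) orbF => /eqP //.
have [i [j [ij mn0]]] := indep_minor ind.
have mn1 : nal i * nbe j - nal j * nbe i != 0 by move: mn0; rewrite [(\row_i nbe i) 0 j]mxE [(\row_i nbe i) 0 i]mxE.
have [k [l H]] := cross_minor ij mn1.
pose c : 'rV[K]_4 := delta_mx 0 k; pose a : 'rV[K]_4 := delta_mx 0 l.
have D0 : pair (fun i => a 0 i) (cross nal nbe (fun i => c 0 i)) != 0.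
  rewrite /pair (bigD1 l) //= big1 => [|i' ne].
    rewrite mxE !eqxx mul1r addr0.
    by rewrite (cross_ext (c' := fun s => (s == k)%:R) _ (fun=> erefl) (fun=> erefl)) // => s; rewrite mxE eqxx.
  by rewrite mxE eqxx (negbTE ne) mul0r.
have xp v : differential F p v = 0 -> hess G p w1 v = 0 -> forall c a : 'rV[K]_4, forall l,
    pair (fun i => a 0 i) (cross nal nbe (fun i => c 0 i)) * v 0 l =
    dot a v * cross nal nbe (fun i => c 0 i) l - dot c v * cross nal nbe (fun i => a 0 i) l.
  move=> Fv hv' c' a' l'; rewrite cross_cramer naE nbE Fv hv' !mul0r subr0 addr0 //.
have Fpp : differential F p p = 0 by rewrite (euler _ (pk_F pk)) Fp mulr0.
have hpp : hess G p w1 p = 0 by rewrite hessC.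
have pw : indep p w1.
  move=> s t E; have [|-> -> _] := @tangents_indep_dev s t 0; last by [].
  by rewrite scale0r addr0.
have E0 : dot c p * dot a w1 - dot a p * dot c w1 != 0.
  apply/eqP => E0.
  have comb (s t : K) : s * dot a p + t * dot a w1 = 0 -> s * dot c p + t * dot c w1 = 0 -> s = 0 /\ t = 0.
    move=> Ea Ec; apply: pw; apply/rowP => l'; rewrite !mxE; apply: (mulfI D0); rewrite mulr0.
    transitivity (s * (pair (fun i => a 0 i) (cross nal nbe (fun i => c 0 i)) * p 0 l') +
      t * (pair (fun i => a 0 i) (cross nal nbe (fun i => c 0 i)) * w1 0 l')); first by ring.
    rewrite (xp p Fpp hpp) (xp w1 F1 h11).
    transitivity ((s * dot a p + t * dot a w1) * cross nal nbe (fun i => c 0 i) l' -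
      (s * dot c p + t * dot c w1) * cross nal nbe (fun i => a 0 i) l'); first by ring.
    by rewrite Ea Ec; ring.
  have [||cw0 cp0] := comb (dot c w1) (- dot c p).
  - by rewrite -[RHS]oppr0 -E0; ring.
  - by ring.
  have [||aw0 ap0] := comb (dot a w1) (- dot a p).
  - by ring.
  - by rewrite -[RHS]E0; ring.
  move/eqP: cp0; rewrite oppr_eq0 => /eqP cp0; move/eqP: ap0; rewrite oppr_eq0 => /eqP ap0.
  by have [||/eqP] := comb 1 0; rewrite ?ap0 ?cp0 ?oner_eq0 ?mulr0 ?mul0r ?addr0.
have [cp|cp] := eqVneq (dot c p) 0; last by exists c, a.
exists a, c; split.
- by apply: contraNneq E0 => ap; rewrite cp ap !mul0r subr0.
- by rewrite cross_alt oppr_eq0.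
- by rewrite -oppr_eq0; move: E0; congr (_ != _); ring.
Qed.

Lemma Dl_branch x c a : germ p w1 x -> exists2 Q, pev x (Dl c a) = 'X * Q &
  Q.[0] = pair (fun i => a 0 i) (cross nal nbe (fun i => c 0 i)).
Proof.
move=> gx; have /choice[r Hr] := fun i => pev_germ F^`M(i) gx; have /choice[s Hs] := fun i => pev_germ G^`M(i) gx.
exists (pair (fun i => (a 0 i)%:P) (cross (fun i => pev x F^`M(i)) (fun i => (nbe i)%:P + 'X * s i) (fun i => (c 0 i)%:P))).
  have E l : cross (fun i => pev x F^`M(i)) (fun i => pev x G^`M(i)) (fun i => (c 0 i)%:P) l =
      'X * cross (fun i => pev x F^`M(i)) (fun i => (nbe i)%:P + 'X * s i) (fun i => (c 0 i)%:P) l.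
    by rewrite -crossZm; apply: cross_ext => // i; rewrite Hs G0 add0r.
  by rewrite pev_Dl /pair mulr_sumr; apply: eq_bigr => l _; rewrite E mulrCA.
rewrite /pair horner_sum; apply: eq_bigr => l _; rewrite hornerM hornerC -[X in _ * X]/(horner_eval 0 _) cross_morph.
congr (_ * _); apply: cross_ext => i /=; rewrite /horner_eval.
- by rewrite Hr !hornerE ?mul0r ?addr0 /nal mxE.
- by rewrite !hornerE ?mul0r ?addr0.
- by rewrite hornerC.
Qed.

Lemma Dl_node c a : eval_at (Dl c a) p = 0 /\
  differential (Dl c a) p w1 = pair (fun i => a 0 i) (cross nal nbe (fun i => c 0 i)).
Proof.
have [Q E <-] := Dl_branch c a (line_germ p w1); have [r] := pev_germ (Dl c a) (line_germ p w1).
rewrite E => E'; split; first by have := congr1 (fun q : {poly K} => q`_0) E'; rewrite coefD coefC !coefXM /= addr0.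
have e0 : eval_at (Dl c a) p = 0 by have := congr1 (fun q : {poly K} => q`_0) E'; rewrite coefD coefC !coefXM /= addr0.
move: E'; rewrite e0 add0r => /(mulfI (negbT (polyX_eq0 _))) ->.
by rewrite !hornerE ?mul0r ?addr0.
Qed.

Lemma demf_branch ze c2 k x Y c a i : node_jet p w1 ze c2 k.+1 x Y ->
  cong 'X^k ((pev x (lin c) * pair_deriv a x - pev x (lin a) * pair_deriv c x) * pev x (demf c i))
    (pev x (Dl c a) * (pev x (lin c) * (Y i + 'X * (Y i)^`()) - pair_deriv c x * ('X * (m.+1%:R * Y i)))).
Proof.
move=> [c3 [_ Fx Gx _ EY]]; set l := (rx i).1; set j := (rx i).2.
set E := (_ - _ : {poly K}); have cr l' := cramer_branch c a l' Fx Gx; rewrite -/E in cr.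
have YE : 'X * Y i = x l * pev x (h j) by rewrite -EY /embf rmorphM pevU.
have YE' : Y i + 'X * (Y i)^`() = (x l)^`() * pev x (h j) + x l * \sum_k pev x (h j)^`M(k) * (x k)^`().
  by rewrite -deriv_pev -derivM -YE derivM derivX mul1r.
have -> : pev x (demf c i) = pev x (h j) * pev x (vf c l) + \sum_k (x l * pev x (h j)^`M(k)) * pev x (vf c k).
  rewrite /demf -/l -/j rmorphD !rmorphM pevU [pev x (vf c l) * _]mulrC; congr (_ + _).
  have -> : pev x (\sum_k (h j)^`M(k) * vf c k) = \sum_k pev x (h j)^`M(k) * pev x (vf c k).
    by rewrite rmorph_sum; apply: eq_bigr => k' _; rewrite rmorphM.
  by rewrite mulr_sumr; apply: eq_bigr => k' _; rewrite mulrA.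
rewrite mulrDr [X in X + _]mulrCA [X in _ + X]mulr_sumr.
have -> : pev x (Dl c a) * (pev x (lin c) * (Y i + 'X * (Y i)^`()) - pair_deriv c x * ('X * (m.+1%:R * Y i))) =
    pev x (h j) * (pev x (Dl c a) * (pev x (lin c) * (x l)^`() - pair_deriv c x * x l)) +
    \sum_k (x l * pev x (h j)^`M(k)) * (pev x (Dl c a) * (pev x (lin c) * (x k)^`() - pair_deriv c x * x k)).
  have eh := pev_euler x (hm j).
  transitivity (pev x (h j) * (pev x (Dl c a) * (pev x (lin c) * (x l)^`() - pair_deriv c x * x l)) +
    (x l * (pev x (Dl c a) * pev x (lin c)) * (\sum_k pev x (h j)^`M(k) * (x k)^`()) -
     x l * (pev x (Dl c a) * pair_deriv c x) * (\sum_k pev x (h j)^`M(k) * x k))).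
    have -> : 'X * (m.+1%:R * Y i) = m.+1%:R * (x l * pev x (h j)) by rewrite -YE mulrCA.
    rewrite eh YE' -natr1; ring.
  by congr (_ + _); exact/esym/sum_jet.
apply: congD; first by apply: congM; exact: cr.
by apply: cong_sum => k'; rewrite mulrCA; apply: congM; exact: cr.
Qed.

(** [A] has degree [e] and the embedded arc is ['X] times its lift [Y], whence ['X^(e.+1)]; what
    remains is [A . dY] along the lift. *)
Lemma form_branch ze c2 k x Y e A c a : node_jet p w1 ze c2 k.+1 x Y -> (forall i, A i \is e.-homog) ->
  (forall y, Xt y -> \sum_i eval_at (A i) y * y 0 i = 0) -> (e <= k)%N ->
  cong 'X^k ((pev x (lin c) * pair_deriv a x - pev x (lin a) * pair_deriv c x) * pev x (NN A c))
    ('X^(e.+1) * (pev x (Dl c a) * (pev x (lin c) * \sum_i pev Y (A i) * (Y i)^`()))).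
Proof.
move=> jet hA Ay ek; have [c3 [_ Fx Gx _ EY]] := jet.
set E := (_ - _ : {poly K}).
have [r0 S0] : exists r, 'X^e * \sum_i pev Y (A i) * Y i = 'X^k * r.
  have hg : \sum_i A i * 'X_i \is (e + 1).-homog.
    by apply: rpred_sum => i _; apply: dhomogM => //; exact: X_homog.
  have Ig : I (pull (\sum_i A i * 'X_i)).
    apply: vanish_Xt; first by exists (e + 1)%N.
    by move=> y yX; rewrite -[RHS](Ay y yX) eval_at_sum; apply: eq_bigr => i _; rewrite !evE.
  have [r Er] := pev_ideal Ig Fx Gx; exists r.
  have := node_jet_pull jet hg; rewrite Er => Er'.
  have X0 : 'X != 0 :> {poly K} by rewrite polyX_eq0.
  apply: (mulfI X0); rewrite mulrA -exprS -addn1 mulrA -exprS Er'; congr (_ * _).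
  by rewrite rmorph_sum; apply: eq_bigr => i _; rewrite rmorphM; congr (_ * _); rewrite /pev /= mmapX mmap1U.
have H1 : cong 'X^k (E * pev x (NN A c)) (\sum_i ('X^e * pev Y (A i)) *
    (pev x (Dl c a) * (pev x (lin c) * (Y i + 'X * (Y i)^`()) - pair_deriv c x * ('X * (m.+1%:R * Y i))))).
  rewrite rmorph_sum mulr_sumr; apply: cong_sum => i.
  rewrite rmorphM (node_jet_pull jet (hA i)).
  have -> : E * ('X^e * pev Y (A i) * pev x (demf c i)) = 'X^e * pev Y (A i) * (E * pev x (demf c i)) by exact: mulrCA.
  by apply: congM; exact: (demf_branch c a i jet).
apply: (cong_trans H1); exists (pev x (Dl c a) * (pev x (lin c) - pair_deriv c x * ('X * m.+1%:R)) * r0).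
transitivity ('X^(e.+1) * (pev x (Dl c a) * (pev x (lin c) * \sum_i pev Y (A i) * (Y i)^`())) +
  pev x (Dl c a) * (pev x (lin c) - pair_deriv c x * ('X * m.+1%:R)) * ('X^e * \sum_i pev Y (A i) * Y i)).
  by rewrite exprS [X in X * _]mulrC; exact: sum_jet2.
by rewrite S0; ring.
Qed.

Lemma jet_germ ze c2 k x Y : node_jet p w1 ze c2 k x Y -> germ p w1 x.
Proof. by move=> [c [xE _ _ _ _]]; exists (fun i => (c2 0 i)%:P + 'X * c i). Qed.

Lemma pair_deriv0 x (c : 'rV[K]_4) : germ p w1 x -> (pair_deriv c x).[0] = dot c w1.
Proof.
move=> gx; rewrite /pair_deriv horner_sum; apply: eq_bigr => i _.
by rewrite hornerM hornerC (germ_deriv0 i gx).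
Qed.

(** [Dl] contributes one more factor ['X] at the node. A denominator [pull B] with [B] nonzero at
    the lifted point has order [e.+1] only, and this discrepancy is the origin of the vanishing
    condition at the nodes. *)
Lemma form_order ze c2 k x Y e A c : node_jet p w1 ze c2 k.+1 x Y -> (forall i, A i \is e.-homog) ->
  (forall y, Xt y -> \sum_i eval_at (A i) y * y 0 i = 0) -> (e.+2 <= k)%N -> dot c p != 0 ->
  exists r, pev x (NN A c) = 'X^(e.+2) * r.
Proof.
move=> jet hA Ay ek cp; have gx := jet_germ jet.
have [a E0] : exists a, dot c p * dot a w1 - dot a p * dot c w1 != 0.
  apply: contrapT => Ha; have pw s t : s *: p + t *: w1 = 0 -> t = 0.
    by move=> H; have [|_ -> _] := @tangents_indep_dev s t 0; rewrite ?scale0r ?addr0.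
  have [/eqP] : dot c p = 0; last by rewrite (negbTE cp).
  apply: (pw (- dot c w1)); apply/rowP => l; rewrite !mxE.
  apply/eqP/negPn/negP => nz; apply: Ha; exists (delta_mx 0 l).
  have dl v : dot (delta_mx 0 l) v = v 0 l.
    rewrite /dot (bigD1 l) //= big1 => [|i ne]; first by rewrite mxE !eqxx mul1r addr0.
    by rewrite mxE eqxx (negbTE ne) mul0r.
  by rewrite !dl; move: nz; congr (_ != _); ring.
have [r E] := form_branch c a jet hA Ay (ltnW (ltnW ek)).
have [Q DQ _] := Dl_branch c a gx.
set EE := (_ - _ : {poly K}) in E.
have EE0 : EE.[0] != 0.
  by rewrite hornerD hornerN !hornerM !(pair_deriv0 _ gx) !(pev_at0 _ gx) !eval_lin_dot.
apply: (unit_divides (g := Q * (pev x (lin c) * \sum_i pev Y (A i) * (Y i)^`()) + 'X^(k - e.+2) * r) EE0).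
rewrite E DQ; have -> : 'X^k = 'X^(e.+2) * 'X^(k - e.+2) :> {poly K} by rewrite -exprD subnKC.
by rewrite !exprS; ring.
Qed.

(** Dividing the identity along the branch by its exact power of ['X] leaves the value of [A] on the
    tangent vector of the lift, times nonzero constants. *)
Lemma form_node e A c u : (forall i, A i \is e.-homog) ->
  (forall y, Xt y -> \sum_i eval_at (A i) y * y 0 i = 0) -> (forall c, I (NN A c)) -> c != 0 ->
  cone_tangent_space Xt (c *: ten p (dhv p w1)) u ->
  \sum_i eval_at (A i) (c *: ten p (dhv p w1)) * u 0 i = 0.
Proof.
move=> hA Ay HN c0 Tu; set y0 := ten p (dhv p w1) in Tu *.
have [ze [c2 H]] := node_branch pX np tp.
have tp0 := node_pair_jet H; set t0 := ten w1 (dhv p w1) + ten p ze in tp0.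
have Xy : Xt y0 by have := node_point_Xt pX np tp (oner_neq0 K); rewrite scale1r.
have At0 : \sum_i eval_at (A i) y0 * t0 0 i = 0.
  have [c1 [a1 [c1p D0 _]]] := node_frame.
  have [x [Y jet]] := H e.+4; have gx := jet_germ jet.
  have [r E] := form_branch c1 a1 jet hA Ay (leq_trans (leqnSn _) (leq_trans (leqnSn _) (leqnSn _))).
  have [_ [_ Fx Gx gY _]] := jet.
  have [r' Er] := pev_ideal (HN c1) Fx Gx.
  have [Q DQ Q0] := Dl_branch c1 a1 gx.
  set S := \sum_i _ in E; set EE := (_ - _ : {poly K}) in E.
  have E2 : Q * (pev x (lin c1) * S) = 'X * ('X * EE * r' - r).
    have X0 : 'X^(e.+2) != 0 :> {poly K} by rewrite expf_neq0 // polyX_eq0.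
    apply: (mulfI X0); transitivity ('X^(e.+1) * (pev x (Dl c1 a1) * (pev x (lin c1) * S))).
      by rewrite DQ !exprS; ring.
    transitivity (EE * pev x (NN A c1) - 'X^(e.+3) * r); first by rewrite E addrK.
    by rewrite Er !exprS; ring.
  have := congr1 (horner^~ 0) E2; rewrite /= !hornerM hornerX mul0r Q0 (pev_at0 _ gx) eval_lin_dot => /eqP.
  rewrite !mulf_eq0 (negbTE D0) (negbTE c1p) /= => /eqP S0.
  rewrite -[RHS]S0 horner_sum; apply: eq_bigr => i _.
  by rewrite hornerM (pev_at0 _ gY) (germ_deriv0 i gY).
have [|||||a [b ->]] := regular_span (y := c *: y0) (y' := c *: y0) (t := t0) (u := u).
- by apply: Xt_regular; exact: Xt_scale.
- by apply: tangent_self; exact: Xt_scale.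
- by apply: tangent_pair_space; exact: tangent_pair_scale.
- exact: (@node_pair_indep _ _ _ pX np tp ze c c0).
- by [].
transitivity (c ^+ e * (a * c * \sum_i eval_at (A i) y0 * y0 0 i + b * \sum_i eval_at (A i) y0 * t0 0 i)); last first.
  by rewrite Ay // At0 !mulr0 addr0 mulr0.
rewrite !mulr_sumr -big_split mulr_sumr; apply: eq_bigr => i _ /=.
have -> : (a *: (c *: y0) + b *: t0) 0 i = a * (c * y0 0 i) + b * t0 0 i.
  by rewrite [LHS]mxE; congr (_ + _); rewrite !mxE.
by rewrite (eval_scale _ _ (hA i)); ring.
Qed.
End NodeBranch.

Lemma form_zero e A y u : (forall i, A i \is e.-homog) ->
  (forall y, Xt y -> \sum_i eval_at (A i) y * y 0 i = 0) -> (forall c, I (NN A c)) ->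
  Xt y -> cone_tangent_space Xt y u -> \sum_i eval_at (A i) y * u 0 i = 0.
Proof.
move=> hA Ay HN /Xt_cases[[x [c [xX nx c0 ->]]]|[p [w1 [w2 [c [pX np tp c0 ->]]]]]] Tu.
  by apply: (form_regular xX nx hA Ay _ c0 Tu) => c'; exact: (I_van xX (HN c')).
exact: (form_node pX np tp hA Ay HN c0 Tu).
Qed.

(** [(A, B)] represents, as [A . dy / B], the form [Q (c.x d(a.x) - a.x d(c.x)) / Dl c a]. *)
Definition rep Q e (A : 'I_n'.+1 -> Pt) (B : Pt) : Prop :=
  [/\ forall i, A i \is e.-homog, B \is e.+1.-homog,
    forall y, Xt y -> \sum_i eval_at (A i) y * y 0 i = 0 &
    forall c, I (NN A c - Q * (pull B * lin c))].

Lemma pullM f g : pull (f * g) = pull f * pull g. Proof. exact: rmorphM. Qed.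
Lemma pullD f g : pull (f + g) = pull f + pull g. Proof. exact: rmorphD. Qed.
Lemma dotBr (a v w : 'rV[K]_4) : dot a (v - w) = dot a v - dot a w.
Proof. by rewrite -scaleN1r dotDr dotZr mulN1r. Qed.

Lemma sum_comb (R : comNzRingType) k (a b : R) (f g w : 'I_k -> R) :
  \sum_i (a * f i + b * g i) * w i = a * (\sum_i f i * w i) + b * (\sum_i g i * w i).
Proof. by rewrite !mulr_sumr -big_split; apply: eq_bigr => i _ /=; ring. Qed.

Lemma NN_lin (f g : Pt) (A A' : 'I_n'.+1 -> Pt) c :
  NN (fun i => f * A i + g * A' i) c = pull f * NN A c + pull g * NN A' c.
Proof.
by rewrite /NN -sum_comb; apply: eq_bigr => i _; rewrite pullD !pullM.
Qed.

Lemma agree_ring (R : comNzRingType) (b b' N1 N2 Q l : R) :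
  b' * N1 + (- b) * N2 = b' * (N1 - Q * (b * l)) + (- b) * (N2 - Q * (b' * l)).
Proof. by ring. Qed.
Lemma comb_ring (R : comNzRingType) (b b' N1 N2 Q Q' k l : R) :
  b' * N1 + (k * b) * N2 - (Q + k * Q') * (b * b' * l) = b' * (N1 - Q * (b * l)) + (k * b) * (N2 - Q' * (b' * l)).
Proof. by ring. Qed.

(** The difference [B' A - B A'] has contraction in the ideal for every [c], so [form_zero] applies
    to it at every point, those above the nodes included. *)
Lemma rep_agree Q e A B e' A' B' y u : rep Q e A B -> rep Q e' A' B' -> Xt y -> cone_tangent_space Xt y u ->
  eval_at B' y * (\sum_i eval_at (A i) y * u 0 i) = eval_at B y * (\sum_i eval_at (A' i) y * u 0 i).
Proof.
move=> [hA hB Ay HN] [hA' hB' Ay' HN'] yX Tu.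
have lin_sum (v : 'rV[K]_n'.+1) z : \sum_i eval_at (B' * A i + (- B) * A' i) z * v 0 i =
    eval_at B' z * (\sum_i eval_at (A i) z * v 0 i) - eval_at B z * (\sum_i eval_at (A' i) z * v 0 i).
  by rewrite !mulr_sumr -sumrB; apply: eq_bigr => i _; rewrite !evE; ring.
apply/eqP; rewrite -subr_eq0 -lin_sum; apply/eqP.
apply: (form_zero (e := (e'.+1 + e)%N) _ _ _ yX Tu).
- move=> i; apply: rpredD; first exact: dhomogM.
  by have -> : (e'.+1 + e = e.+1 + e')%N by [lia]; apply: dhomogM; rewrite ?rpredN.
- by move=> z zX; rewrite lin_sum Ay // Ay' // !mulr0 subrr.
move=> c; rewrite NN_lin rmorphN.
exact: (idlc HI (HN c) (HN' c) (agree_ring _ _ _ _ _ _)).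
Qed.

Lemma rep_comb Q Q' e e' A B A' B' (k : K) : rep Q e A B -> rep Q' e' A' B' ->
  rep (Q + k *: Q') (e + e').+1 (fun i => B' * A i + (k%:MP * B) * A' i) (B * B').
Proof.
move=> [hA hB Ay HN] [hA' hB' Ay' HN']; split.
- move=> i; apply: rpredD; first by have -> : ((e + e').+1 = e'.+1 + e)%N by [lia]; apply: dhomogM.
  by rewrite -addSn; apply: dhomogM => //; rewrite mul_mpolyC; exact: rpredZ.
- by rewrite -addSn -addnS; apply: dhomogM.
- move=> y yX; transitivity (eval_at B' y * (\sum_i eval_at (A i) y * y 0 i) + k * eval_at B y * (\sum_i eval_at (A' i) y * y 0 i)).
    by rewrite -sum_comb; apply: eq_bigr => i _; rewrite !evE.
  by rewrite Ay // Ay' // !mulr0 addr0.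
move=> c; rewrite NN_lin !pullM -mul_mpolyC.
have -> : pull k%:MP = k%:MP by rewrite /pull /= mmapC.
exact: (idlc HI (HN c) (HN' c) (comb_ring _ _ _ _ _ _ _ _)).
Qed.

Lemma sum_ix (V : nmodType) (f : 'I_n'.+1 -> V) : \sum_i f i = \sum_l \sum_j f (ix l j).
Proof.
rewrite pair_big /= (reindex (fun lj : 'I_4 * 'I_M => ix lj.1 lj.2)) //=.
by exists rx => [[l j] _|i _] /=; rewrite ?ixK ?rxK.
Qed.

(** The form [R (c.x d(a.x) - a.x d(c.x))] with [x] read in column [j]. *)
Definition tf (R : Pt) (c a : 'rV[K]_4) j (i : 'I_n'.+1) : Pt :=
  if (rx i).2 == j then R * (cev j (lin c) * (a 0 (rx i).1)%:MP - cev j (lin a) * (c 0 (rx i).1)%:MP) else 0.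

Lemma tf_sum R c a j (y u : 'rV[K]_n'.+1) : \sum_i eval_at (tf R c a j i) y * u 0 i =
  eval_at R y * (dot c (colv j y) * dot a (colv j u) - dot a (colv j y) * dot c (colv j u)).
Proof.
rewrite sum_ix {2 4}/dot !mulr_sumr -sumrB mulr_sumr; apply: eq_bigr => l _.
rewrite (bigD1 j) //= big1 => [|k kj].
  by rewrite addr0 /tf ixK eqxx !evE !eval_cev !eval_lin_dot !mxE; ring.
by rewrite /tf ixK (negbTE kj) evE mul0r.
Qed.

Lemma tf_homog R c a j D i : R \is D.-homog -> tf R c a j i \is D.+1.-homog.
Proof.
move=> hR; rewrite /tf; case: ifP => _; last exact: rpred0.
rewrite -(addn1 D); apply: dhomogM => //; apply: rpredB; rewrite mulrC mul_mpolyC; apply: rpredZ;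
  by apply: cev_homog; exact: lin_homog.
Qed.

Lemma Dl_plucker c a c' x : X x -> eval_at (Dl c a) x * dot c' x =
  eval_at (Dl c' a) x * dot c x - eval_at (Dl c' c) x * dot a x.
Proof.
move=> xX; have H := congr1 (dot c') (Dl_cramer c a xX).
have H1 : dot c' (eval_at (Dl c a) x *: x) = eval_at (Dl c a) x * dot c' x := dotZr _ _ _.
have H2 : dot c' (dot a x *: vv c x - dot c x *: vv a x) = dot a x * dot c' (vv c x) - dot c x * dot c' (vv a x).
  by rewrite dotBr; congr (_ - _); exact: dotZr.
have H3 : dot c' (vv c x) = - eval_at (Dl c' c) x := etrans (esym (eval_Dl c c' x)) (eval_DlC c c' x).
have H4 : dot c' (vv a x) = - eval_at (Dl c' a) x := etrans (esym (eval_Dl a c' x)) (eval_DlC a c' x).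
have gen (t ax cx v1 v2 e1 e2 : K) : t = ax * v1 - cx * v2 -> v1 = - e1 -> v2 = - e2 -> t = e2 * cx - e1 * ax.
  by move=> -> -> ->; ring.
exact: gen (etrans (esym H1) (etrans H H2)) H3 H4.
Qed.

Lemma NN_tf R c a j c' x : X x -> eval_at (NN (tf R c a j) c') x =
  eval_at R (emb x) * eval_at (h j) x ^+ 2 * dot c' x * eval_at (Dl c a) x.
Proof.
move=> xX; rewrite eval_NN tf_sum /demb colvD !colv_ten !mxE !dotDr !dotZr -(eval_Dl c' a) -(eval_Dl c' c).
have gen (r t a1 a2 b1 b2 c1 c2 f : K) : f * c1 = a1 * b1 - a2 * b2 ->
    r * (t * b1 * (t * a1 + c2 * b2) - t * b2 * (t * a2 + c2 * b1)) = r * t ^+ 2 * c1 * f.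
  by move=> E; transitivity (r * t ^+ 2 * (f * c1)); [rewrite E; ring|ring].
exact: (gen _ _ _ _ _ _ _ _ _ (Dl_plucker c a c' xX)).
Qed.

Lemma rep_tf Q R B c a j D : R \is D.-homog -> B \is D.+2.-homog ->
  (forall x, X x -> eval_at R (emb x) * eval_at (h j) x ^+ 2 * eval_at (Dl c a) x = eval_at Q x * eval_at B (emb x)) ->
  rep Q D.+1 (tf R c a j) B.
Proof.
move=> hR hB H; split=> //; first by move=> i; exact: tf_homog.
  by move=> y _; rewrite tf_sum; ring.
move=> c'; apply: (pk_van unc pk) => x xX; rewrite !evE NN_tf // eval_pull eval_lin_dot mulrA -H //; ring.
Qed.

(** * Regular 1-forms and the genus *)

Section Differentials.
Variables (ka : nat) (Q : P).
Hypothesis (kaE : ka.+2 = (d.-1 + n.-1)%N) (hQ : Q \is ka.-homog) (mka : (m <= ka)%N).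
Hypothesis Qnode : forall p, X p -> isnode qs p -> eval_at Q p = 0.

Lemma rep_regular x : X x -> ~ isnode qs x -> exists e A B, rep Q e A B /\ eval_at B (emb x) != 0.
Proof.
move=> xX nx; have [j hj] := hfree xX nx; have [c [a ca]] := Dl_nonzero xX nx.
have hB : cev j (Dl c a) \is ka.+2.-homog by apply: cev_homog; rewrite kaE; exact: Dl_homog.
exists ka.+1, (tf (cev j Q) c a j), (cev j (Dl c a)); split.
  apply: rep_tf => //; first exact: cev_homog.
  have hD : Dl c a \is ka.+2.-homog by rewrite kaE; exact: Dl_homog.
  move=> z zX; rewrite !eval_cev !colv_ten (eval_scale _ _ hQ) (eval_scale _ _ hD) !mxE !exprS; ring.
by rewrite eval_cev colv_ten (eval_scale _ _ (Dl_homog _ _)) !mxE mulf_neq0 // expf_neq0.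
Qed.

(** [Q] and [Dl c a] both vanish at the node. Locally each is a combination of [H1] and [H2] modulo
    [F]; replacing these by the linear coordinates [L1] and [L2] of the blow-up removes the common
    zero, and the new denominator is nonzero because [Dl c a] vanishes simply along the branch. *)
Lemma rep_node p w1 w2 : X p -> isnode qs p -> tangents p w1 w2 ->
  exists e A B, rep Q e A B /\ eval_at B (ten p (dhv p w1)) != 0.
Proof.
move=> pX np tp; have [p0 Fp Gp] := pX.
have [F1 F2 ker [h11 h22 h12] [_ Gv]] := tp.
have he u : hess G p p u = 0 := hess_euler u (pk_G pk) Gv.
have hp j : eval_at (h j) p = 0 by exact: hnode.
have [b1 [b2 [E1 [E2 _]]]] := node_relations pX np tp.
pose H1 := \sum_j b1 j *: h j; pose H2 := \sum_j b2 j *: h j.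
have d1' u : differential H1 p u = hess G p u w2.
  by rewrite -E1 /H1 df_sum; apply: eq_bigr => j _; rewrite dfZ.
have d2' u : differential H2 p u = hess G p u w1.
  by rewrite -E2 /H2 df_sum; apply: eq_bigr => j _; rewrite dfZ.
have hH1 : H1 \is m.-homog by apply: rpred_sum => j _; exact: rpredZ.
have hH2 : H2 \is m.-homog by apply: rpred_sum => j _; exact: rpredZ.
have z1 : eval_at H1 p = 0 by rewrite eval_at_sum big1 // => j _; rewrite evE hp mulr0.
have z2 : eval_at H2 p = 0 by rewrite eval_at_sum big1 // => j _; rewrite evE hp mulr0.
have kk v : differential F p v = 0 -> differential H1 p v = 0 -> differential H2 p v = 0 -> (v <= p)%MS.
  move=> /ker[a [b [c ->]]]; rewrite d1' d2' !hessDl !hessZl !he h11 h22 (hessC G p w2) !mulr0 !add0r !addr0.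
  move=> /eqP; rewrite mulf_eq0 (negbTE h12) orbF => /eqP ->.
  move=> /eqP; rewrite mulf_eq0 (negbTE h12) orbF => /eqP ->.
  by rewrite !scale0r !addr0 scalemx_sub.
have [c [a [_ D0 _]]] := node_frame pX tp.
have [Dp dD] := Dl_node tp c a.
have hD : Dl c a \is ka.+2.-homog by rewrite kaE; exact: Dl_homog.
have [D1 [s [q0 [q1 [q2 [hs s0 hq1 hq2 Es]]]]]] := cramer_forms pX hH1 hH2 hQ z1 z2 (Qnode pX np) kk.
have [D2 [s' [e0 [e1 [e2 [hs' s'0 he1 he2 Es']]]]]] := cramer_forms pX hH1 hH2 hD z1 z2 Dp kk.
have e1p : eval_at e1 p != 0.
  have := congr1 (fun f => differential f p w1) Es'.
  rewrite /= !dfE Dp Fp z1 z2 F1 d1' d2' h11 dD !(mulr0, mul0r, addr0, add0r) => E.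
  have : eval_at s' p * pair (fun i => a 0 i) (cross (nal p) (nbe p w1) (fun i => c 0 i)) != 0 by rewrite mulf_neq0.
  by rewrite E mulf_eq0 negb_or => /andP[].
have [j hj] := dhv_neq0 pX np tp; have /rV0Pn[l pl] := p0.
pose L1 : Pt := \sum_j b1 j *: 'X_(ix l j); pose L2 : Pt := \sum_j b2 j *: 'X_(ix l j).
have hL1 : L1 \is 1.-homog by apply: rpred_sum => i _; apply: rpredZ; exact: X_homog.
have hL2 : L2 \is 1.-homog by apply: rpred_sum => i _; apply: rpredZ; exact: X_homog.
have eL1 x z : eval_at L1 (ten x z) = x 0 l * \sum_j b1 j * z 0 j.
  by rewrite eval_at_sum mulr_sumr; apply: eq_bigr => i _; rewrite !evE ten_ix; ring.
have eL2 x z : eval_at L2 (ten x z) = x 0 l * \sum_j b2 j * z 0 j.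
  by rewrite eval_at_sum mulr_sumr; apply: eq_bigr => i _; rewrite !evE ten_ix; ring.
have eH1 x : \sum_j b1 j * hv x 0 j = eval_at H1 x.
  by rewrite eval_at_sum; apply: eq_bigr => i _; rewrite evE mxE.
have eH2 x : \sum_j b2 j * hv x 0 j = eval_at H2 x.
  by rewrite eval_at_sum; apply: eq_bigr => i _; rewrite evE mxE.
pose R := (cev j q1 * L1 + cev j q2 * L2) * cev j s'.
pose B := cev j s * (cev j e1 * L1 + cev j e2 * L2).
exists (D1 + (ka - m) + 1 + D2).+1, (tf R c a j), B; split.
  apply: rep_tf.
  - apply: dhomogM; last exact: cev_homog.
    by rewrite (addnBA _ mka); apply: rpredD; apply: dhomogM => //; exact: cev_homog.
  - have -> : (D1 + (ka - m) + 1 + D2).+2 = (D1 + (D2 + ka.+2 - m + 1))%N by clear -mka; lia.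
    by apply: dhomogM; first exact: cev_homog; apply: rpredD; apply: dhomogM => //; exact: cev_homog.
  - move=> x [_ Fx _].
    rewrite /R /B !evE !eval_cev !colv_ten eL1 eL2 eH1 eH2 (eval_scale _ _ hs) (eval_scale _ _ hs').
    rewrite (eval_scale _ _ hq1) (eval_scale _ _ hq2) (eval_scale _ _ he1) (eval_scale _ _ he2).
    have := congr1 (fun f => eval_at f x) Es; have := congr1 (fun f => eval_at f x) Es'.
    rewrite /= !evE Fx !mulr0 !add0r -/H1 -/H2 => Ex' Ex.
    have -> : (D2 + ka.+2 - m = 2 + D2 + (ka - m))%N by clear -mka; lia.
    rewrite -(addnBA _ mka); set t := hv x 0 j; have <- : t = eval_at (h j) x by rewrite /t mxE.
    rewrite !exprD.
    transitivity (t ^+ D1 * t ^+ (ka - m) * t ^+ D2 * x 0 l * (eval_at q1 x * eval_at H1 x + eval_at q2 x * eval_at H2 x) * eval_at s' x * t ^+ 2 * eval_at (Dl c a) x); first by ring.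
    rewrite -Ex; transitivity (eval_at Q x * (t ^+ D1 * eval_at s x * (t ^+ 2 * t ^+ D2 * t ^+ (ka - m)) * x 0 l * (eval_at s' x * eval_at (Dl c a) x))); first by ring.
    by rewrite Ex'; ring.
rewrite /B !evE !eval_cev !colv_ten eL1 eL2 (eval_scale _ _ hs) (eval_scale _ _ he1).
have -> : \sum_j b1 j * dhv p w1 0 j = hess G p w1 w2 by rewrite -E1; apply: eq_bigr => i _; rewrite mxE.
have -> : \sum_j b2 j * dhv p w1 0 j = hess G p w1 w1 by rewrite -E2; apply: eq_bigr => i _; rewrite mxE.
by rewrite h11 !mulr0 addr0 mxE !mulf_neq0 // expf_neq0.
Qed.

Lemma rep_exists y : Xt y -> exists e A B, rep Q e A B /\ eval_at B y != 0.
Proof.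
move=> /Xt_cases[[x [c [xX nx c0 ->]]]|[p [w1 [w2 [c [pX np tp c0 ->]]]]]].
  have [e [A [B [H Bx]]]] := rep_regular xX nx; exists e, A, B; split=> //; have [_ hB _ _] := H.
  by rewrite (eval_scale _ _ hB) mulf_neq0 // expf_neq0.
have [e [A [B [H Bx]]]] := rep_node pX np tp; exists e, A, B; split=> //; have [_ hB _ _] := H.
by rewrite (eval_scale _ _ hB) mulf_neq0 // expf_neq0.
Qed.
End Differentials.

(** The value given by any representation whose denominator is nonzero at [y]; by [rep_agree] all
    choices agree on tangent vectors. *)
Definition omega Q (y u : 'rV[K]_n'.+1) : K := xget 0 [set k | exists e (A : 'I_n'.+1 -> Pt) B,
  [/\ rep Q e A B, eval_at B y != 0 & k = (\sum_i eval_at (A i) y * u 0 i) / eval_at B y]].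

Lemma omegaE Q e A B y u : rep Q e A B -> Xt y -> cone_tangent_space Xt y u -> eval_at B y != 0 ->
  omega Q y u = (\sum_i eval_at (A i) y * u 0 i) / eval_at B y.
Proof.
move=> H yX Tu By; rewrite /omega; case: xgetP => [k _ [e' [A' [B' [H' By' ->]]]]|/(_ ((\sum_i eval_at (A i) y * u 0 i) / eval_at B y))[]]; last first.
  by exists e, A, B.
apply: (mulfI (mulf_neq0 By By')); have := rep_agree H H' yX Tu => E.
transitivity (eval_at B y * (\sum_i eval_at (A' i) y * u 0 i)); first by field.
by rewrite -E; field.
Qed.

Definition od (x : 'I_4 -> {poly K}) j (f : P) : Prop := exists r, pev x f = 'X^j * r.

Lemma order2 p w x f : germ p w x -> od x 2 f -> eval_at f p = 0 /\ differential f p w = 0.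
Proof.
move=> gx [r E]; have [c E'] := pev_germ f gx; rewrite E in E'; split.
  have := congr1 (fun q : {poly K} => q`_0) E'.
  by rewrite coefXnM /= coefD coefC coefXM /= addr0.
have := congr1 (fun q : {poly K} => q`_1) E'.
by rewrite coefXnM /= coefD coefC coefXM /= coefD coefC coefXM /= add0r addr0.
Qed.

Lemma od_le x i j f : (i <= j)%N -> od x j f -> od x i f.
Proof. by move=> ij [r E]; exists ('X^(j - i) * r); rewrite E mulrA -exprD subnKC. Qed.

Section NodeDivide.
Variables (p w1 w2 : 'rV[K]_4) (k : nat) (x1 x2 : 'I_4 -> {poly K}).
Hypothesis (pX : X p) (np : isnode qs p) (tp : tangents p w1 w2).
Hypothesis (g1 : germ p w1 x1) (g2 : germ p w2 x2).
Hypothesis (F1 : od x1 k F) (G1 : od x1 k G) (F2 : od x2 k F) (G2 : od x2 k G).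
Let L := loc p I.
Let HL : is_ideal L. Proof. exact: is_ideal_loc. Qed.

Lemma od_local w x g : germ p w x -> od x k F -> od x k G -> L g -> od x k g.
Proof.
move=> gx Fx Gx [t t0 /pev_ideal H]; have [c E] := H x k Fx Gx.
have {}E : pev x t * pev x g = 'X^k * c by rewrite -rmorphM.
by apply: (unit_divides _ E); rewrite (pev_at0 _ gx).
Qed.

Lemma node_parameter : exists H, [/\ H \is m.-homog, eval_at H p = 0, differential H p w1 != 0 & differential H p w2 != 0].
Proof.
have [_ _ _ [h11 h22 h12] _] := tp; have [b1 [b2 [E1 [E2 _]]]] := node_relations pX np tp.
exists (\sum_j (b1 j + b2 j) *: h j).
have dE u : differential (\sum_j (b1 j + b2 j) *: h j) p u = hess G p u w2 + hess G p u w1.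
  by rewrite -E1 -E2 df_sum -big_split; apply: eq_bigr => j _; rewrite dfZ mulrDl.
split.
- by apply: rpred_sum => j _; apply: rpredZ; exact: hm.
- by rewrite eval_at_sum big1 // => j _; rewrite evE hnode ?mulr0.
- by rewrite dE h11 addr0.
- by rewrite dE h22 add0r hessC.
Qed.

Variable H : P.
Hypothesis (hH : H \is m.-homog) (Hp : eval_at H p = 0).
Hypothesis (dH1 : differential H p w1 != 0) (dH2 : differential H p w2 != 0).

Lemma parameter_germ w x g : germ p w x -> eval_at g p = 0 ->
  exists2 v, pev x g = 'X * v & v.[0] = differential g p w.
Proof.
move=> gx gp; have [c E] := pev_germ g gx; exists ((differential g p w)%:P + 'X * c).
  by rewrite E gp add0r.
by rewrite !hornerE ?mul0r ?addr0.
Qed.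

Lemma od_quotient w x i s f C g : germ p w x -> od x k F -> od x k G -> (i.+1 <= k)%N ->
  eval_at g p = 0 -> differential g p w != 0 -> L (s * f - C * g) -> od x i.+1 f -> od x i C.
Proof.
move=> gx Fx Gx ik gp dg /(od_local gx Fx Gx)[r E] [r' E'].
have [v Ev v0] := parameter_germ gx gp.
have X0 : 'X != 0 :> {poly K} by rewrite polyX_eq0.
have vn : v.[0] != 0 by rewrite v0.
apply: (unit_divides (g := pev x s * r' - 'X^(k - i.+1) * r) vn); apply: (mulfI X0).
have {}E : pev x s * ('X^(i.+1) * r') - pev x C * ('X * v) = 'X^k * r.
  by rewrite -E -E' -Ev rmorphB !rmorphM.
have Ek : 'X^k = 'X^(i.+1) * 'X^(k - i.+1) :> {poly K} by rewrite -exprD subnKC.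
transitivity (pev x s * ('X^(i.+1) * r') - 'X^k * r); first by rewrite -E; ring.
by rewrite Ek exprS; ring.
Qed.

(** Order at least 2 on both branches allows a division by [H], which costs one order; the reserve
    [i > 0] guarantees order 2 before every division. *)
Lemma divide_power j : forall i f, (0 < i)%N -> (i + j <= k)%N -> isform f -> od x1 (i + j) f -> od x2 (i + j) f ->
  exists s C, [/\ isform s, isform C, eval_at s p != 0, L (s * f - C * H ^+ j) & od x1 i C /\ od x2 i C].
Proof.
elim: j => [|j IH] i f i0 ik ff o1 o2.
  exists 1, f; split=> //; [by exists 0%N; exact: dhomog1|by rewrite evE oner_neq0| |by rewrite addn0 in o1 o2].
  by rewrite expr0 mulr1 mul1r subrr; case: HL.
rewrite addnS in ik o1 o2.
have [fp df1] := order2 g1 (od_le (leq_add i0 (leq0n j) : (2 <= (i + j).+1)%N) o1).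
have [_ df2] := order2 g2 (od_le (leq_add i0 (leq0n j) : (2 <= (i + j).+1)%N) o2).
have [Fw1 Fw2 ker [h11 h22 h12] _] := tp.
have [s [C [fs fC s0 LC]]] := node_quotient unc pk pX (nodes pX np) Fw1 Fw2 ker h11 h22 h12 hH Hp dH1 dH2 ff fp df1 df2.
have oC1 := od_quotient g1 F1 G1 ik Hp dH1 LC o1.
have oC2 := od_quotient g2 F2 G2 ik Hp dH2 LC o2.
have [s' [C' [fs' fC' s'0 LC' o']]] := IH i C i0 (ltnW ik) fC oC1 oC2.
exists (s' * s), C'; split=> //; [exact: formM|by rewrite evE mulf_neq0|].
by apply: (idlc (a := s') (b := H) HL LC LC'); rewrite exprS; ring.
Qed.

Lemma exact_order w x e s b C u : germ p w x -> od x k F -> od x k G -> (e.+2 <= k)%N ->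
  differential H p w != 0 -> eval_at s p != 0 -> L (s * b - C * H ^+ e) -> od x 1 C ->
  pev x b = 'X^(e.+1) * u -> u.[0] != 0 -> eval_at C p = 0 /\ differential C p w != 0.
Proof.
move=> gx Fx Gx ek dH s0 LC [rC oC] Eb u0.
have Cp : eval_at C p = 0.
  by rewrite -(pev_at0 C gx) oC expr1 hornerM hornerX mul0r.
split=> //; have [v Ev v0] := parameter_germ gx Hp; have [y Ey y0] := parameter_germ gx Cp.
have [r E] := od_local gx Fx Gx LC.
have E2 : y * v ^+ e = pev x s * u - 'X * ('X^(k - e.+2) * r).
  have X0 : 'X^(e.+1) != 0 :> {poly K} by rewrite expf_neq0 // polyX_eq0.
  apply: (mulfI X0).
  have Ek : 'X^k = 'X^(e.+2) * 'X^(k - e.+2) :> {poly K} by rewrite -exprD subnKC.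
  have {}E : pev x s * ('X^(e.+1) * u) - 'X * y * ('X * v) ^+ e = 'X^k * r.
    by rewrite -E -Eb -Ev -Ey rmorphB !rmorphM rmorphXn.
  transitivity ('X * y * ('X * v) ^+ e); first by rewrite exprMn exprS; ring.
  transitivity (pev x s * ('X^(e.+1) * u) - 'X^k * r); first by rewrite -E; ring.
  by rewrite Ek !exprS; ring.
apply/eqP => d0; rewrite d0 in y0.
have := congr1 (horner^~ 0) E2; rewrite /= hornerM y0 mul0r hornerD hornerN !hornerM hornerX mul0r subr0 (pev_at0 _ gx) => /esym/eqP.
by rewrite mulf_eq0 (negbTE s0) (negbTE u0).
Qed.
End NodeDivide.

(** After dividing by [H ^+ e], the numerator has order at least 2 and the denominator order exactly
    1 on both branches; the latter then serves as the transversal function of [node_quotient]. *)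
Lemma node_divide p w1 w2 k x1 x2 e f b u1 u2 : X p -> isnode qs p -> tangents p w1 w2 ->
  germ p w1 x1 -> germ p w2 x2 -> od x1 k F -> od x1 k G -> od x2 k F -> od x2 k G -> (e.+2 <= k)%N ->
  isform f -> isform b -> od x1 e.+2 f -> od x2 e.+2 f ->
  pev x1 b = 'X^(e.+1) * u1 -> pev x2 b = 'X^(e.+1) * u2 -> u1.[0] != 0 -> u2.[0] != 0 ->
  exists s C, eval_at s p != 0 /\ loc p I (s * f - C * b).
Proof.
move=> pX np tp g1 g2 F1 G1 F2 G2 ek ff fb o1 o2 b1 b2 u10 u20.
have HL : is_ideal (loc p I) by exact: is_ideal_loc.
have [H [hH Hp dH1 dH2]] := node_parameter pX np tp.
have [s [C [fs fC s0 LC [oC1 oC2]]]] := divide_power pX np tp g1 g2 F1 G1 F2 G2 hH Hp dH1 dH2 (isT : 0 < 2)%N ek ff o1 o2.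
have [||s' [C' [fs' fC' s'0 LC' [oC1' oC2']]]] :=
  divide_power pX np tp g1 g2 F1 G1 F2 G2 hH Hp dH1 dH2 (isT : 0 < 1)%N (ltnW ek) fb; [by exists u1|by exists u2|].
have [Cp' dC1] := exact_order Hp g1 F1 G1 ek dH1 s'0 LC' oC1' b1 u10.
have [_ dC2] := exact_order Hp g2 F2 G2 ek dH2 s'0 LC' oC2' b2 u20.
have [Cp d1'] := order2 g1 oC1; have [_ d2'] := order2 g2 oC2.
have [Fw1 Fw2 ker [h11 h22 h12] _] := tp; have [eb hC'] := fC'.
have [s3 [C3 [_ _ s30 L3]]] := node_quotient unc pk pX (nodes pX np) Fw1 Fw2 ker h11 h22 h12 hC' Cp' dC1 dC2 fC Cp d1' d2'.
exists (s3 * s), (C3 * s'); split; first by rewrite evE mulf_neq0.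
have L4 := idlc (a := s3) (b := H ^+ e) HL LC L3 erefl.
by apply: (idlc (a := 1) (b := - C3) HL L4 LC'); ring.
Qed.

Lemma separating_form k (y1 y2 : 'rV[K]_k) : y1 != 0 -> y2 != 0 ->
  exists L : {mpoly K[k]}, [/\ L \is 1.-homog, eval_at L y1 != 0 & eval_at L y2 != 0].
Proof.
move=> /rV0Pn[i yi] /rV0Pn[j yj].
have [zi|zi] := eqVneq (y2 0 i) 0; last by exists 'X_i; rewrite !evE; split=> //; exact: X_homog.
have [zj|zj] := eqVneq (y1 0 j) 0; last by exists 'X_j; rewrite !evE; split=> //; exact: X_homog.
by exists ('X_i + 'X_j); rewrite !evE zi zj addr0 add0r; split=> //; apply: rpredD; exact: X_homog.
Qed.

Lemma dot_nonzero (x : 'rV[K]_4) : x != 0 -> exists c, dot c x != 0.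
Proof.
case/rV0Pn => l xl; exists (delta_mx 0 l); rewrite /dot (bigD1 l) //= big1 => [|i ne].
  by rewrite mxE !eqxx mul1r addr0.
by rewrite mxE eqxx (negbTE ne) mul0r.
Qed.

Lemma sum_diff (R : comNzRingType) k (s t : R) (f a b : 'I_k -> R) :
  (\sum_i f i * a i) * s - (\sum_i f i * b i) * t = \sum_i f i * (s * a i - t * b i).
Proof. by rewrite !mulr_suml -sumrB; apply: eq_bigr => i _; ring. Qed.
Lemma sum_scale (R : comNzRingType) k (s : R) (f a : 'I_k -> R) :
  \sum_i f i * (s * a i) = s * \sum_i f i * a i.
Proof. by rewrite mulr_sumr; apply: eq_bigr => i _; ring. Qed.

Lemma demb_lin x s t v w i : demb x (s *: v - t *: w) 0 i = s * demb x v 0 i - t * demb x w 0 i.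
Proof. by rewrite /demb !mxE !dfBv !dfZv; ring. Qed.

(** * From regular 1-forms to forms through the nodes *)

Section FromForm.
Variables (ka : nat) (om : 'rV[K]_n'.+1 -> 'rV[K]_n'.+1 -> K).
Hypothesis (kaE : ka.+2 = (d.-1 + n.-1)%N) (reg : regular_1form Xt om).

Definition locrep e (A : 'I_n'.+1 -> Pt) (B : Pt) : Prop :=
  [/\ forall i, A i \is e.-homog, B \is e.+1.-homog &
    forall y v, Xt y -> eval_at B y != 0 -> cone_tangent_space Xt y v ->
      om y v = (\sum_i eval_at (A i) y * v 0 i) / eval_at B y].

Lemma locrep_exists y : Xt y -> exists e A B, locrep e A B /\ eval_at B y != 0.
Proof. by move=> /reg.2[e [A [B [hA hB By H]]]]; exists e, A, B. Qed.

Lemma locrep_radial e A B y0 : locrep e A B -> Xt y0 -> eval_at B y0 != 0 ->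
  forall y, Xt y -> \sum_i eval_at (A i) y * y 0 i = 0.
Proof.
move=> [hA hB HAB] y0X By0.
have E (y : 'rV[K]_n'.+1) : eval_at (\sum_i A i * 'X_i) y = \sum_i eval_at (A i) y * y 0 i.
  by rewrite eval_at_sum; apply: eq_bigr => i _; rewrite !evE.
have hg : \sum_i A i * 'X_i \is (e + 1).-homog.
  by apply: rpred_sum => i _; apply: dhomogM => //; exact: X_homog.
have Ig : I (pull (\sum_i A i * 'X_i)).
  apply: (I_cancel (b := pull B)); [by apply: pull_form; exists e.+1|exact: (pull_nonzero hB y0X By0)|].
  rewrite -pullM; apply: vanish_Xt; first by exists (e.+1 + (e + 1))%N; exact: dhomogM.
  move=> y yX; rewrite evE E; have [->|By] := eqVneq (eval_at B y) 0; first by rewrite mul0r.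
  by have := HAB y y yX By (tangent_self yX); rewrite (reg.1 y yX) => /esym/eqP; rewrite mulf_eq0 invr_eq0 (negbTE By) orbF => /eqP ->; rewrite mulr0.
by move=> y yX; rewrite -E; apply: yX.2; split=> //; exists (e + 1)%N.
Qed.

Lemma lin_neq0 c : c != 0 -> ~ I (lin c).
Proof.
move=> c0 /(I_low pk (lin_homog c) n1 d1) E; case/rV0Pn: c0 => i /eqP; apply.
have := congr1 (fun f => eval_at f (delta_mx 0 i)) E; rewrite eval_lin_dot evE /dot (bigD1 i) //= big1 => [|j ne].
  by rewrite mxE !eqxx mulr1 addr0.
by rewrite mxE eqxx (negbTE ne) mulr0.
Qed.

(** The contraction divided by [pull B] and [lin c] is one rational function on the curve, whatever
    local expression and [c] are used: where both denominators are nonzero, both expressions compute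
    [om], and the tangent fields agree up to scale and a radial part. This function will be the
    residue form. *)
Lemma locrep_compat e A B e' A' B' y0 y0' c c' : locrep e A B -> locrep e' A' B' ->
  Xt y0 -> eval_at B y0 != 0 -> Xt y0' -> eval_at B' y0' != 0 ->
  I (NN A c * (pull B' * lin c') - NN A' c' * (pull B * lin c)).
Proof.
move=> HA HA' y0X By0 y0X' By0'; have Ay := locrep_radial HA y0X By0.
have [hA hB HAB] := HA; have [hA' hB' HAB'] := HA'.
have fB : isform (pull B) by apply: pull_form; exists e.+1.
have fB' : isform (pull B') by apply: pull_form; exists e'.+1.
apply: (I_cancel fB (pull_nonzero hB y0X By0)); apply: (I_cancel fB' (pull_nonzero hB' y0X' By0')).
apply: (pk_van unc pk) => x xX; rewrite eval_atM eval_atM !eval_pull.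
have [->|Bx] := eqVneq (eval_at B (emb x)) 0; first by rewrite mul0r mulr0.
have [->|Bx'] := eqVneq (eval_at B' (emb x)) 0; first by rewrite mul0r.
have -> : eval_at (NN A c * (pull B' * lin c') - NN A' c' * (pull B * lin c)) x =
    (\sum_i eval_at (A i) (emb x) * demb x (vv c x) 0 i) * (eval_at B' (emb x) * dot c' x) -
    (\sum_i eval_at (A' i) (emb x) * demb x (vv c' x) 0 i) * (eval_at B (emb x) * dot c x).
  rewrite eval_atB eval_atM eval_atM eval_atM eval_atM.
  by congr (_ * (_ * _) - _ * (_ * _)); first [exact: eval_NN|exact: eval_pull|exact: eval_lin_dot].
have e0 : emb x != 0.
  by apply: contraNneq Bx => ->; rewrite -[0](scale0r 0) (eval_scale _ _ hB) exprS !mul0r.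
have eX := emb_Xt xX e0; have T c1 := tangent_pair_space (vv_tangent c1 xX).
have E1 := HAB _ _ eX Bx (T c); have E2 := HAB' _ _ eX Bx' (T c'); have E3 := HAB _ _ eX Bx (T c').
have key : (\sum_i eval_at (A i) (emb x) * demb x (vv c x) 0 i) * dot c' x =
    (\sum_i eval_at (A i) (emb x) * demb x (vv c' x) 0 i) * dot c x.
  apply/eqP; rewrite -subr_eq0; apply/eqP.
  transitivity (\sum_i eval_at (A i) (emb x) * demb x (dot c' x *: vv c x - dot c x *: vv c' x) 0 i).
    rewrite sum_diff; apply: eq_bigr => i _; congr (_ * _).
    exact/esym/demb_lin.
  rewrite -(Dl_cramer c c' xX) dembZ demb_self.
  transitivity (eval_at (Dl c c') x * m.+1%:R * \sum_i eval_at (A i) (emb x) * emb x 0 i); last by rewrite Ay // mulr0.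
  by rewrite -sum_scale; apply: eq_bigr => i _; congr (_ * _); rewrite [LHS]mxE [X in _ * X]mxE mulrA.
have E4 := etrans (esym E2) E3.
have gen (a1 a2 a3 b1 b2 t1 t2 : K) : a1 * t2 = a3 * t1 -> a2 / b2 = a3 / b1 -> b1 != 0 -> b2 != 0 ->
    b2 * (b1 * (a1 * (b2 * t2) - a2 * (b1 * t1))) = 0.
  move=> k1 k2 b10 b20; have E5 : a2 * b1 = a3 * b2 by transitivity (a2 / b2 * (b2 * b1)); [field|rewrite k2; field].
  by transitivity (b2 * (b1 * (b2 * (a1 * t2) - t1 * (a2 * b1)))); [ring|rewrite E5 k1; ring].
exact: (gen _ _ _ _ _ _ _ key E4 Bx Bx').
Qed.

Variables (e0 : nat) (A0 : 'I_n'.+1 -> Pt) (B0 : Pt) (z0 : 'rV[K]_n'.+1) (c0 : 'rV[K]_4).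
Hypothesis (R0 : locrep e0 A0 B0) (z0X : Xt z0) (Bz0 : eval_at B0 z0 != 0) (c00 : c0 != 0).
Let N0 := NN A0 c0.
Let a0 := pull B0 * lin c0.

(** Expressions of the rational function [N0 / a0], described without reference to [om] so as to be
    stable under the combinations needed below. *)
Definition gr e (A : 'I_n'.+1 -> Pt) (B : Pt) : Prop :=
  [/\ forall i, A i \is e.-homog, B \is e.+1.-homog,
    forall y, Xt y -> \sum_i eval_at (A i) y * y 0 i = 0 &
    forall c, I (N0 * (pull B * lin c) - NN A c * a0)].

Lemma locrep_gr e A B y : locrep e A B -> Xt y -> eval_at B y != 0 -> gr e A B.
Proof.
move=> H yX By; have [hA hB _] := H; split=> //; first exact: (locrep_radial H yX By).
by move=> c; exact: (locrep_compat c0 c R0 H z0X Bz0 yX By).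
Qed.

Lemma gr_ring (R : comNzRingType) (g1 g2 b1 b2 v0 v1 n2 l a : R) :
  v0 * ((g1 * b1 + g2 * b2) * l) - (g1 * v1 + g2 * n2) * a =
  g1 * (v0 * (b1 * l) - v1 * a) + g2 * (v0 * (b2 * l) - n2 * a).
Proof. by ring. Qed.

Lemma gr_comb e1 A1 B1 e2 A2 B2 g1 g2 D1 D2 : gr e1 A1 B1 -> gr e2 A2 B2 -> g1 \is D1.-homog ->
  g2 \is D2.-homog -> (D1 + e1 = D2 + e2)%N ->
  gr (D1 + e1) (fun i => g1 * A1 i + g2 * A2 i) (g1 * B1 + g2 * B2).
Proof.
move=> [hA1 hB1 Ay1 H1] [hA2 hB2 Ay2 H2] hg1 hg2 E; split.
- by move=> i; apply: rpredD; [|rewrite E]; exact: dhomogM.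
- by rewrite -addnS; apply: rpredD; [|rewrite addnS E -addnS]; exact: dhomogM.
- move=> y yX; transitivity (eval_at g1 y * (\sum_i eval_at (A1 i) y * y 0 i) + eval_at g2 y * (\sum_i eval_at (A2 i) y * y 0 i)).
    by rewrite -sum_comb; apply: eq_bigr => i _; rewrite !evE.
  by rewrite Ay1 // Ay2 // !mulr0 addr0.
by move=> c; rewrite NN_lin pullD !pullM; exact: (idlc HI (H1 c) (H2 c) (gr_ring _ _ _ _ _ _ _ _ _)).
Qed.

(** A node has two points above it, and the division at the node needs one denominator that is
    nonzero at both. When the two given ones each fail at one point, they are added after powers of
    a linear form nonzero at both points have equalized the degrees. *)
Lemma gr_both y1 y2 : Xt y1 -> Xt y2 -> exists e A B, gr e A B /\ (eval_at B y1 != 0 /\ eval_at B y2 != 0).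
Proof.
move=> X1 X2; have [e1 [A1 [B1 [L1 By1]]]] := locrep_exists X1; have [e2 [A2 [B2 [L2 By2]]]] := locrep_exists X2.
have G1 := locrep_gr L1 X1 By1; have G2 := locrep_gr L2 X2 By2.
have [z12|?] := eqVneq (eval_at B1 y2) 0; last by exists e1, A1, B1.
have [z21|?] := eqVneq (eval_at B2 y1) 0; last by exists e2, A2, B2.
have [L [hL Ly1 Ly2]] : exists L : Pt, [/\ L \is 1.-homog, eval_at L y1 != 0 & eval_at L y2 != 0].
  by apply: separating_form; [case: X1|case: X2].
have hLk k : L ^+ k \is k.-homog by have := dhomogMn k hL; rewrite mul1n.
exists (e2 + e1)%N, (fun i => L ^+ e2 * A1 i + L ^+ e1 * A2 i), (L ^+ e2 * B1 + L ^+ e1 * B2); split.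
  exact: (gr_comb G1 G2 (hLk e2) (hLk e1) (addnC e2 e1)).
have eX k y : eval_at (L ^+ k) y = eval_at L y ^+ k by rewrite evE.
by rewrite !eval_atD !eval_atM !eX z12 z21 !mulr0 addr0 add0r; split; rewrite mulf_neq0 // expf_neq0.
Qed.

Lemma a0_nzd f : I (a0 * f) -> I f.
Proof.
have [_ hB _] := R0; rewrite /a0 -mulrA => H.
apply: (I_cancel (b := lin c0)); [by exists 1%N; exact: lin_homog|exact: lin_neq0|].
apply: (I_cancel (b := pull B0)) H; [by apply: pull_form; exists e0.+1|exact: (pull_nonzero hB z0X Bz0)].
Qed.

Lemma local_regular x : X x -> ~ isnode qs x -> loc x (adj I a0) N0.
Proof.
move=> xX nx; have [x0 _ _] := xX; have [j hj] := hfree xX nx.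
have eX := emb_Xt xX (emb_neq0 x0 hj).
have [e [A [B [L By]]]] := locrep_exists eX; have [_ _ _ H] := locrep_gr L eX By.
have [c cx] := dot_nonzero x0; exists (pull B * lin c).
  by rewrite eval_atM eval_pull eval_lin_dot mulf_neq0.
by exists (NN A c); rewrite [pull B * _ * _]mulrC; exact: H.
Qed.

Lemma jet_od p w1 ze c2 k x Y : node_jet p w1 ze c2 k x Y -> od x k F /\ od x k G.
Proof. by move=> [c [_ Fx Gx _ _]]. Qed.

Lemma jet_pull p w1 ze c2 k x Y e B : node_jet p w1 ze c2 k x Y -> B \is e.-homog ->
  exists2 u, pev x (pull B) = 'X^e * u & u.[0] = eval_at B (ten p (dhv p w1)).
Proof.
move=> jet hB; exists (pev Y B); first exact: (node_jet_pull jet hB).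
by have [c [_ _ _ gY _]] := jet; exact: pev_at0 gY.
Qed.

Lemma local_ring (R : comNzRingType) (t s C l b f a v1 : R) :
  b * ((t * s * l) * v1 - (t * C) * a) = (t * s) * (v1 * (b * l) - f * a) + a * (t * (s * f - C * b)).
Proof. by ring. Qed.

(** The numerator has order at least [e + 2] and the denominator order exactly [e + 1] along both
    branches, so [node_divide] gives a quotient in the local ring of the singular curve. *)
Lemma local_node p : X p -> isnode qs p -> loc p (adj I a0) N0.
Proof.
move=> pX np; have [p0 _ _] := pX; have [w1 [w2 tp]] := node_tangents (nodes pX np).
have tp' := tangentsC tp.
have X1 := node_point_Xt pX np tp (oner_neq0 K); rewrite scale1r in X1.
have X2 := node_point_Xt pX np tp' (oner_neq0 K); rewrite scale1r in X2.
have [e [A [B [[hA hB Ay H] [By1 By2]]]]] := gr_both X1 X2.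
have [c cp] := dot_nonzero p0.
have [ze1 [c21 /(_ e.+3)[x1 [Y1 J1]]]] := node_branch pX np tp.
have [ze2 [c22 /(_ e.+3)[x2 [Y2 J2]]]] := node_branch pX np tp'.
have [o1 o1'] := jet_od J1; have [o2 o2'] := jet_od J2.
have [u1 b1 u10] := jet_pull J1 hB; have [u2 b2 u20] := jet_pull J2 hB.
have f1 := form_order pX tp J1 hA Ay (leqnn _) cp.
have f2 := form_order pX tp' J2 hA Ay (leqnn _) cp.
have ff : isform (NN A c) by eexists; exact: NN_homog.
have fb : isform (pull B) by apply: pull_form; exists e.+1.
have [||s [C [s0 [t t0 LL]]]] := node_divide pX np tp (jet_germ J1) (jet_germ J2) o1 o1' o2 o2' (leqnSn _) ff fb f1 f2 b1 b2.
- by rewrite u10.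
- by rewrite u20.
exists (t * s * lin c); first by rewrite !eval_atM eval_lin_dot !mulf_neq0.
exists (t * C); apply: (I_cancel fb (pull_nonzero hB X1 By1)).
exact: (idlc HI (H c) LL (local_ring _ _ _ _ _ (NN A c) _ _)).
Qed.

(** [N0 / a0] is regular in every local ring of the curve, so depth two makes it a polynomial; the
    degrees of [N0] and [a0] differ by [ka]. *)
Lemma residue_form : exists2 Q, Q \is ka.-homog & I (N0 - Q * a0).
Proof.
have [Q0 HQ0] : adj I a0 N0.
  apply: (pk_global unc pk a0_nzd) => x xX.
  by have [nx|nx] := pselect (isnode qs x); [exact: local_node|exact: local_regular].
have [hA hB _] := R0.
have ha : a0 \is (e0.+1 * m.+1 + 1).-homog by apply: dhomogM; [exact: pull_homog|exact: lin_homog].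
have hN : N0 \is (ka + (e0.+1 * m.+1 + 1)).-homog.
  have -> : (ka + (e0.+1 * m.+1 + 1) = e0 * m.+1 + (d.-1 + n.-1 + m))%N by rewrite -kaE; clear; lia.
  exact: NN_homog.
exists (pihomog mdeg ka Q0); first exact: pihomogP.
apply: (pk_van unc pk) => x xX.
have -> : N0 - pihomog mdeg ka Q0 * a0 = pihomog mdeg (ka + (e0.+1 * m.+1 + 1)) (N0 - Q0 * a0).
  by rewrite linearB /= (pihomogMr _ _ ha) (pihomog_dE hN).
apply: vanishing_pihomog => a an0; apply: I_van HQ0; exact: (curve_scale pk an0 xX).
Qed.

Lemma residue_ring (R : comNzRingType) (a v1 b l v0 q : R) :
  a * (v1 - q * (b * l)) = (-1) * (v0 * (b * l) - v1 * a) + (b * l) * (v0 - q * a).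
Proof. by ring. Qed.

Lemma residue_rep Q : I (N0 - Q * a0) -> forall e A B, gr e A B -> rep Q e A B.
Proof.
move=> HQ e A B [hA hB Ay H]; split=> // c; apply: a0_nzd.
exact: (idlc HI (H c) HQ (residue_ring _ _ _ _ _ _)).
Qed.
End FromForm.

(** Along one branch the numerator has at least one order more than [pull B], and the surplus must
    come from [Q]. *)
Lemma rep_node_zero Q e A B p w1 w2 : X p -> isnode qs p -> tangents p w1 w2 -> rep Q e A B ->
  eval_at B (ten p (dhv p w1)) != 0 -> eval_at Q p = 0.
Proof.
move=> pX np tp [hA hB Ay H] By; have [p0 _ _] := pX; have [c cp] := dot_nonzero p0.
have [ze1 [c21 /(_ e.+3)[x1 [Y1 J1]]]] := node_branch pX np tp.
have [o1 o1'] := jet_od J1; have gx := jet_germ J1.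
have [u1 b1 u10] := jet_pull J1 hB.
have [r f1] := form_order pX tp J1 hA Ay (leqnn _) cp.
have [r' E] := pev_ideal (H c) o1 o1'.
have {}E : 'X^(e.+2) * r - pev x1 Q * ('X^(e.+1) * u1 * pev x1 (lin c)) = 'X^(e.+3) * r'.
  by rewrite -E -f1 -b1 rmorphB !rmorphM.
have E2 : pev x1 Q * (u1 * pev x1 (lin c)) = 'X * (r - 'X * r').
  have X0 : 'X^(e.+1) != 0 :> {poly K} by rewrite expf_neq0 // polyX_eq0.
  apply: (mulfI X0); transitivity ('X^(e.+2) * r - 'X^(e.+3) * r'); last by rewrite !exprS; ring.
  by rewrite -E; ring.
have := congr1 (horner^~ 0) E2; rewrite /= !hornerM hornerX mul0r u10 !(pev_at0 _ gx) eval_lin_dot => /eqP.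
by rewrite !mulf_eq0 (negbTE By) (negbTE cp) !orbF => /eqP.
Qed.

Lemma regular_1form_form ka om : ka.+2 = (d.-1 + n.-1)%N -> (m <= ka)%N -> regular_1form Xt om ->
  exists Q, [/\ Q \is ka.-homog, forall p, X p -> isnode qs p -> eval_at Q p = 0 &
    forall y u, Xt y -> cone_tangent_space Xt y u -> om y u = omega Q y u].
Proof.
move=> kaE mka reg; have [z0 z0X] := Xt_nonempty.
have [e0 [A0 [B0 [R0 Bz0]]]] := locrep_exists reg z0X.
have c00 : delta_mx 0 0 != 0 :> 'rV[K]_4 by apply/rV0Pn; exists 0; rewrite mxE eqxx oner_neq0.
have [Q hQ HQ] := residue_form kaE reg R0 z0X Bz0 c00.
have Hrep y : Xt y -> exists e A B, [/\ locrep om e A B, rep Q e A B & eval_at B y != 0].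
  move=> yX; have [e [A [B [L By]]]] := locrep_exists reg yX; exists e, A, B; split=> //.
  exact: (residue_rep R0 z0X Bz0 c00 HQ (locrep_gr reg _ R0 z0X Bz0 L yX By)).
exists Q; split=> //.
  move=> p pX np; have [w1 [w2 tp]] := node_tangents (nodes pX np).
  have X1 := node_point_Xt pX np tp (oner_neq0 K); rewrite scale1r in X1.
  have [e [A [B [_ Hr By]]]] := Hrep _ X1; exact: (rep_node_zero pX np tp Hr By).
move=> y u yX Tu; have [e [A [B [[_ _ HL] Hr By]]]] := Hrep y yX.
by rewrite (HL y u yX By Tu) (omegaE Hr yX Tu By).
Qed.

Section Genus.
Variables (ka da db k : nat) (q : 'I_k -> 'rV[K]_4).
Hypothesis (kaE : ka.+2 = (d.-1 + n.-1)%N) (mka : (m <= ka)%N) (Ea : (da + d = ka)%N) (Eb : (db + n = ka)%N).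
Hypothesis (qX : forall i, X (q i)) (qn : forall i, isnode qs (q i)).
Hypothesis nq : forall p, X p -> isnode qs p -> exists i c, p = c *: q i.
Hypothesis dual : forall i, exists f : P, [/\ f \is ka.-homog, eval_at f (q i) = 1 & forall j, j != i -> eval_at f (q j) = 0].

(** A syzygy is a multiple of the trivial one, so [b] is a multiple of [F]; but the degrees give
    [db = d - 4 < d]. *)
Lemma low_syzygy a b : a \is da.-homog -> b \is db.-homog -> a * F + b * G = 0 -> a = 0 /\ b = 0.
Proof.
move=> ha hb E.
have F0 : F != 0 by apply: contraNneq (pk_Fp3 pk) => ->; rewrite evE.
have := syzygy unc (pk_unit pk) (pk_d0 pk) (pk_F pk) (pk_G pk) (pk_p3 pk) (pk_Fp3 pk) (pk_Hz pk) E.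
move=> [c [bE aE]]; have b0 : b = 0.
  apply: (low_degree0 (pk_F pk) hb); first by move: Ea Eb kaE d1 n1; clear; lia.
  by exists c; rewrite bE subrr.
split=> //; move: E; rewrite b0 mul0r addr0 => /eqP; rewrite mulf_eq0 (negbTE F0) orbF => /eqP //.
Qed.

Lemma omega_comb Q Q' (s : K) : Q \is ka.-homog -> Q' \is ka.-homog ->
  (forall p, X p -> isnode qs p -> eval_at Q p = 0) -> (forall p, X p -> isnode qs p -> eval_at Q' p = 0) ->
  forall y u, Xt y -> cone_tangent_space Xt y u -> omega (Q + s *: Q') y u = omega Q y u + s * omega Q' y u.
Proof.
move=> hQ hQ' Q0 Q0' y u yX Tu.
have [e [A [B [H By]]]] := rep_exists kaE hQ mka Q0 yX.
have [e' [A' [B' [H' By']]]] := rep_exists kaE hQ' mka Q0' yX.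
have By2 : eval_at (B * B') y != 0 by rewrite eval_atM mulf_neq0.
rewrite (omegaE H yX Tu By) (omegaE H' yX Tu By') (omegaE (rep_comb s H H') yX Tu By2).
have -> : \sum_i eval_at (B' * A i + s%:MP * B * A' i) y * u 0 i =
    eval_at B' y * (\sum_i eval_at (A i) y * u 0 i) + (s * eval_at B y) * (\sum_i eval_at (A' i) y * u 0 i).
  by rewrite -sum_comb; apply: eq_bigr => i _; rewrite !evE.
rewrite eval_atM; field; by rewrite By By'.
Qed.

Lemma omega_ideal Q y u : I Q -> Q \is ka.-homog -> Xt y -> cone_tangent_space Xt y u -> omega Q y u = 0.
Proof.
move=> IQ hQ yX Tu.
have [|e [A [B [[hA hB Ay H] By]]]] := rep_exists kaE hQ mka _ yX.
  by move=> p pX _; exact: (I_van pX IQ).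
have H0 : rep Q e A B by [].
rewrite (omegaE H0 yX Tu By) (form_zero hA Ay _ yX Tu) ?mul0r // => c.
by apply: (idlc (a := 1) (b := pull B * lin c) HI (H c) IQ); ring.
Qed.

(** Recovers [Q] from its 1-form at points outside the nodes, which gives linear independence modulo
    the ideal. *)
Lemma omega_emb Q x c : Q \is ka.-homog -> (forall p, X p -> isnode qs p -> eval_at Q p = 0) ->
  X x -> ~ isnode qs x -> omega Q (emb x) (demb x (vv c x)) = eval_at Q x * dot c x.
Proof.
move=> hQ Q0 xX nx; have [j hj] := hfree xX nx; have [x0 _ _] := xX.
have eX := emb_Xt xX (emb_neq0 x0 hj).
have [e [A [B [H By]]]] := rep_exists kaE hQ mka Q0 eX.
have Tu := tangent_pair_space (vv_tangent c xX).
rewrite (omegaE H eX Tu By); have [_ _ _ HN] := H.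
have := I_van xX (HN c); rewrite eval_atB eval_NN eval_atM eval_atM eval_pull eval_lin_dot => /eqP.
by rewrite subr_eq0 => /eqP ->; field.
Qed.

Lemma omega_regular Q : Q \is ka.-homog -> (forall p, X p -> isnode qs p -> eval_at Q p = 0) ->
  regular_1form Xt (omega Q).
Proof.
move=> hQ Q0; split=> y yX; have [e [A [B [H By]]]] := rep_exists kaE hQ mka Q0 yX; have [hA hB Ay _] := H.
  by rewrite (omegaE H yX (tangent_self yX) By) Ay // mul0r.
exists e, A, B; split=> // z v zX Bz Tv; exact: (omegaE H zX Tv Bz).
Qed.

Lemma Xt_genus r : ('C(da + 3, 3) + 'C(db + 3, 3) + k + r = 'C(ka + 3, 3))%N -> has_genus Xt r%:Z.
Proof.
move=> Er.
have Fq i : eval_at F (q i) = 0 by case: (qX i).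
have Gq i : eval_at G (q i) = 0 by case: (qX i).
have [r' [b [Er' hb b0 bfree bspan]]] := adjoint_basis (pk_F pk) (pk_G pk) Ea Eb low_syzygy Fq Gq dual.
have {Er Er'} -> : r = r' by move: Er Er'; clear; lia.
have vanq Q : Q \is ka.-homog -> (forall i, eval_at Q (q i) = 0) -> forall p, X p -> isnode qs p -> eval_at Q p = 0.
  by move=> hQ Q0 p pX np; have [i [c ->]] := nq pX np; rewrite (eval_scale _ _ hQ) Q0 mulr0.
have hsum (a : 'I_r' -> K) (s : seq 'I_r') : \sum_(i <- s) a i *: b i \is ka.-homog.
  by apply: rpred_sum => i _; apply: rpredZ; exact: hb.
have b0' i := vanq (b i) (hb i) (b0 i).
have sum0 (a : 'I_r' -> K) (s : seq 'I_r') p : X p -> isnode qs p -> eval_at (\sum_(i <- s) a i *: b i) p = 0.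
  by move=> pX np; rewrite eval_at_sum big1 // => i _; rewrite eval_atZ b0' // mulr0.
have osum (a : 'I_r' -> K) y u : Xt y -> cone_tangent_space Xt y u ->
    omega (\sum_i a i *: b i) y u = \sum_i a i * omega (b i) y u.
  move=> yX Tu; elim: (index_enum _) => [|i s IH].
    by rewrite !big_nil; apply: omega_ideal => //; [case: HI|exact: rpred0].
  rewrite !big_cons addrC (omega_comb (a i) (hsum a s) (hb i) (sum0 a s) (b0' i) yX Tu) IH addrC //.
exists r', (fun i => omega (b i)); split=> //.
- by move=> i; apply: omega_regular; [exact: hb|exact: b0'].
- move=> a H; apply: bfree; apply: (pk_van unc pk) => x xX.
  have [nx|nx] := pselect (isnode qs x); first exact: sum0.
  have [x0 _ _] := xX; have [c cx] := dot_nonzero x0; have [j hj] := hfree xX nx.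
  have eX := emb_Xt xX (emb_neq0 x0 hj); have Tu := tangent_pair_space (vv_tangent c xX).
  have oE := omega_emb c (hsum a (index_enum _)) (sum0 a (index_enum _)) xX nx.
  have := etrans (esym oE) (etrans (osum a _ _ eX Tu) (H _ _ eX Tu)) => /eqP.
  by rewrite mulf_eq0 (negbTE cx) orbF => /eqP.
move=> om reg; have [Q [hQ Q0 omE]] := regular_1form_form kaE mka reg.
have [a Ha] := bspan Q hQ (fun i => Q0 _ (qX i) (qn i)); exists a => y u yX Tu.
rewrite omE // -osum //; set S := \sum_i _ in Ha *.
have hS : S \is ka.-homog by exact: hsum.
have S0 p : X p -> isnode qs p -> eval_at S p = 0 by exact: sum0.
have hD : Q - S \is ka.-homog by exact: rpredB.
have D0 p : X p -> isnode qs p -> eval_at (Q - S) p = 0.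
  by move=> pX np; rewrite eval_atB Q0 // S0 // subrr.
have := omega_comb 1 hS hD S0 D0 yX Tu.
by rewrite scale1r (addrC S) subrK (omega_ideal Ha hD yX Tu) mulr0 addr0.
Qed.

Lemma X_geometric_genus r : ('C(da + 3, 3) + 'C(db + 3, 3) + k + r = 'C(ka + 3, 3))%N ->
  has_geometric_genus X r%:Z.
Proof. by move=> Er; exists n', Xt, nu; split; [exact: Xt_normalization|exact: Xt_genus]. Qed.
End Genus.

End Normalization.

(** * Reaching every large genus *)

Lemma bin3_superadd a b : ('C(a, 3) + 'C(b, 3) <= 'C(a + b + 1, 3))%N.
Proof.
elim: a => [|a IH]; first by rewrite bin_small // !add0n leq_bin2l // addn1.
have -> : (a.+1 + b + 1 = (a + b + 1).+1)%N by lia.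
rewrite !binS; have H : ('C(a, 2) <= 'C(a + b + 1, 2))%N by apply: leq_bin2l; lia.
lia.
Qed.

(** Genus of a smooth complete intersection of surfaces of degrees [a + 1] and [b + 1];
    [bin3_superadd] shows that the subtraction is not truncated. *)
Definition complete_genus b a := ('C(a + b + 1, 3) - ('C(a, 3) + 'C(b, 3)))%N.

Lemma complete_genusS b a : complete_genus b a.+1 = (complete_genus b a + ('C(a + b + 1, 2) - 'C(a, 2)))%N.
Proof.
rewrite /complete_genus; have -> : (a.+1 + b + 1 = (a + b + 1).+1)%N by lia.
rewrite !binS; have H : ('C(a, 2) <= 'C(a + b + 1, 2))%N by apply: leq_bin2l; lia.
have := bin3_superadd a b; lia.
Qed.

Lemma double_bin2 a : (2 * 'C(a, 2) = a * a.-1)%N.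
Proof. by rewrite bin2 mul2n -[RHS]odd_double_half; case: a => [|a] //=; rewrite oddM /= andNb. Qed.

Lemma genus_step b a : (1 <= 'C(a + b + 1, 2) - 'C(a, 2) + (b == 0))%N && ('C(a + b + 1, 2) - 'C(a, 2) <= a * b.+1 + b.+1 * b.+1)%N.
Proof.
have := double_bin2 (a + b + 1); have := double_bin2 a; have := leq_bin2l 2 (leq_trans (leq_addr b a) (leq_addr 1 (a + b))).
move: 'C(a + b + 1, 2) 'C(a, 2) => u v uv; rewrite addn1 /=.
case: a => [|a] /= Ev Eu; case: b Eu => [|b] /= Eu; apply/andP; split; nia.
Qed.

Lemma complete_genus_large b a : (0 < b)%N -> (a <= complete_genus b a)%N.
Proof.
move=> b0; elim: a => // a IH; rewrite complete_genusS; have /andP[] := genus_step b a.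
by rewrite (gtn_eqF b0) addn0 => H _; lia.
Qed.

(** The least admissible [a] whose complete genus reaches [g] overshoots by [k], at most one step of
    the sequence, of size about [a d]. The room for nodes is [s * s] with [s] near [a / 4]; the
    threshold [32 d] makes this room sufficient. *)
Lemma degree_choice d : (4 <= d)%N -> exists c, forall g, (c <= g)%N -> exists s r k,
  [/\ 0 < s, 0 < r, k <= s * s, 4 <= s.-1 + s.-1 &
  let n := (s.-1 + s.-1).+1 + (s.-1 + s.-1).+1 + r in
  'C(n.-1, 3) + 'C(d.-1, 3) + k + g = 'C(n.-1 + d.-1 + 1, 3)]%N.
Proof.
move=> d4; pose b := d.-1; have b0 : (0 < b)%N by rewrite /b; lia.
exists (complete_genus b (32 * d)%N) => g cg.
have ex : exists a, (32 * d <= a)%N && (g <= complete_genus b a)%N.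
  exists (32 * d + g)%N; rewrite leq_addr /=.
  by apply: leq_trans (complete_genus_large _ b0); exact: leq_addl.
case: (ex_minnP ex) => a /andP[da ga] amin.
have [k [kE kb]] : exists k, complete_genus b a = (g + k)%N /\ (k <= a * d + d * d)%N.
  exists (complete_genus b a - g)%N; split; first by rewrite subnKC.
  (* At the threshold the choice of the constant forces equality with [g], so [k] is 0. Otherwise
     minimality of [a] bounds [k] by the last step. *)
  have [E|ne] := eqVneq a (32 * d)%N; first by rewrite E; move: cg; lia.
  have a0 : (0 < a)%N by lia.
  have aE : a = a.-1.+1 by rewrite prednK.
  have : ~~ (g <= complete_genus b a.-1)%N.
    by apply/negP => H; have := amin a.-1; rewrite H andbT; lia.
  have /andP[_] := genus_step b a.-1; rewrite aE complete_genusS /=.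
  have -> : b.+1 = d by rewrite /b; lia.
  by rewrite -ltnNge; nia.
(* Chosen so that [n = 4 s - 2 + r] equals [a + 1] with [r] between 1 and 4. *)
pose s := ((a + 2) %/ 4)%N; have sE : (s * 4 <= a + 2 < s.+1 * 4)%N.
  by have := divn_eq (a + 2) 4; have := ltn_pmod (a + 2) (isT : 0 < 4)%N; rewrite -/s; lia.
have s8 : (8 <= s)%N by lia.
exists s, (a + 3 - s * 4)%N, k; split; try lia.
  apply: leq_trans kb _.
  have H : (a <= 4 * s + 1)%N by lia.
  have Hd : (8 * d <= s + 1)%N by lia.
  nia.
move=> n; have nE : n.-1 = a by rewrite /n; lia.
rewrite nE -/b; have := bin3_superadd a b; rewrite /complete_genus in kE; lia.
Qed.

(** * Existence *)

Section NodalCurves.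
Variable K : numClosedFieldType.
Hypothesis unc : ~ countable [set: K].
Local Notation P := {mpoly K[4]}.

Lemma coordinates (p : 'rV[K]_4) : p != 0 -> exists2 N : 'M[K]_4, N \in unitmx & p *m N = e3 K.
Proof.
move=> p0; have rp : \rank p = 1%N by apply/eqP; rewrite eqn_leq rank_leq_row lt0n mxrank_eq0.
have := mulmx_ebase p; rewrite rp; set C := col_ebase p; set E := row_ebase p => pE.
have uC : C \in unitmx := col_ebase_unit p; have uE : E \in unitmx := row_ebase_unit p.
have [c c0 cE] : exists2 c, c != 0 & C = c%:M.
  exists (C 0 0); last exact: mx11_scalar.
  by apply: contraTneq uC => c0; rewrite (mx11_scalar C) c0 raddf0 unitmxE det0 unitr0.
exists (c^-1 *: (invmx E *m tperm_mx 0 (inord 3))).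
  rewrite unitmxZ ?unitfE ?invr_eq0 // unitmx_mul unitmx_inv uE /=; exact: unitmx_perm.
rewrite -scalemxAr mulmxA -[in LHS]pE mulmxK // cE mul_scalar_mx -scalemxAl scalerA mulVf // scale1r.
have -> : pid_mx 1 = delta_mx 0 0 :> 'rV[K]_4.
  by apply/rowP => j; rewrite !mxE /= eq_sym; case: j => [[|j] Hj].
by rewrite -rowE; apply/rowP => j; rewrite !mxE perm.tpermL eqxx eq_sym.
Qed.

Section Assembly.
Variables (F : P) (d : nat).
Hypothesis (d4 : (4 <= d)%N) (hF : F \is d.-homog).
Hypothesis smooth : forall x, x != 0 -> eval_at F x = 0 -> grad F x != 0.
Variables (N : 'M[K]_4) (p3 : 'rV[K]_4).
Hypothesis (uN : N \in unitmx) (p3N : p3 *m N = e3 K) (Fp3 : eval_at F p3 != 0).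
Variables (s r k g : nat).
Local Notation t := (s.-1 + s.-1)%N.
Local Notation m := t.+1.
Local Notation n := (m + m + r)%N.
Hypothesis (r0 : (0 < r)%N) (t4 : (4 <= t)%N).
Hypothesis Hg : ('C(n.-1, 3) + 'C(d.-1, 3) + k + g = 'C(n.-1 + d.-1 + 1, 3))%N.

Variables (q : 'I_k -> 'rV[K]_4) (f : 'I_k -> P).
Hypothesis (hf : forall i, f i \is t.-homog) (fq : forall i j, eval_at (f i) (q j) = (i == j)%:R).
Hypothesis (q0 : forall i, q i != 0) (Fq : forall i, eval_at F (q i) = 0).
Hypothesis (bq : forall i, base N (q i) != 0) (Fp : forall i, differential F (q i) p3 != 0).
Let qs := [seq q i | i <- enum 'I_k].

Let d0 : (0 < d)%N. Proof. exact: leq_trans d4. Qed.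
Let m0 : (0 < m)%N. Proof. by []. Qed.

Lemma isnode_scalar x : x != 0 -> isnode qs x -> exists i c, c != 0 /\ x = c *: q i.
Proof.
move=> x0 [y /mapP[i _ ->] /sub_rVP[c xE]]; exists i, c; split=> //.
by apply: contraNneq x0 => c0; rewrite xE c0 scale0r.
Qed.

Lemma isnode_q i : isnode qs (q i).
Proof. by exists (q i); rewrite ?submx_refl // map_f ?mem_enum. Qed.

(** The family is enlarged so that its differentials at each node span all covectors killing the
    node, which the blow-up needs to separate the branches. *)
Lemma node_system : exists H : seq P, (forall h, h \in H -> through_nodes m q h) /\
  (forall x, x != 0 -> ~ isnode qs x -> exists2 h, h \in H & eval_at h x != 0) /\
  forall i a, dot a (q i) = 0 -> exists c : 'I_(size H) -> K,
    forall u, \sum_j c j * differential H`_j (q i) u = dot a u.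
Proof.
have [H [HV Hf]] := through_family m0 hf fq q0.
have /choice[c qc] : forall i, exists c, q i 0 c != 0 by move=> i; apply/rV0Pn.
pose mn i b : 'rV[K]_4 := q i 0 (c i) *: delta_mx 0 b - q i 0 b *: delta_mx 0 (c i).
have dd c' x : dot (delta_mx 0 c') x = x 0 c' :> K.
  rewrite /dot (bigD1 c') //= big1 ?addr0 => [|j jc]; first by rewrite mxE !eqxx mul1r.
  by rewrite mxE (negbTE jc) andbF mul0r.
have dmn i b x : dot (mn i b) x = q i 0 (c i) * x 0 b - q i 0 b * x 0 (c i).
  by rewrite /mn dotDl -scaleNr !dotZl !dd mulNr.
have mnq i b : dot (mn i b) (q i) = 0 by rewrite dmn mulrC subrr.
pose H' := H ++ [seq lin (mn i b) * f i | i <- enum 'I_k, b <- enum 'I_4].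
exists H'; split; [|split].
- move=> h; rewrite mem_cat => /orP[/HV //|/allpairsP[[i b] /= [_ _ ->]]].
  exact: (lin_f m0 hf fq (mnq i b)).
- move=> x x0 nx; have [h hH hx] := Hf x x0 nx; exists h => //; by rewrite mem_cat hH.
move=> i a aq.
pose Sp (a : 'rV[K]_4) := exists c : 'I_(size H') -> K,
  forall u, \sum_j c j * differential H'`_j (q i) u = dot a u.
have SpD b b' : Sp b -> Sp b' -> Sp (b + b').
  move=> [e He] [e' He']; exists (fun j => e j + e' j) => u; rewrite dotDl -He -He' -big_split.
  by apply: eq_bigr => j _; rewrite mulrDl.
have SpZ z b : Sp b -> Sp (z *: b).
  move=> [e He]; exists (fun j => z * e j) => u; rewrite dotZl -He mulr_sumr.
  by apply: eq_bigr => j _; rewrite mulrA.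
have Sp0 : Sp 0.
  by exists (fun=> 0) => u; rewrite -[0 in RHS](scale0r 0) dotZl mul0r big1 // => j _; rewrite mul0r.
have Spm b : Sp (mn i b).
  pose y : P := lin (mn i b) * f i; have hb : y \in H'.
    rewrite mem_cat; apply/orP; right.
    by apply: (allpairs_f (fun i b => lin (mn i b) * f i)); rewrite mem_enum.
  have jb : (index y H' < size H')%N by rewrite index_mem.
  exists (fun j => (j == Ordinal jb)%:R) => u; rewrite (bigD1 (Ordinal jb)) //= big1 => [|j /negbTE ->].
    by rewrite eqxx mul1r addr0 nth_index // (dlin_f fq).
  by rewrite mul0r.
(* The two sides differ by a multiple of [dot a (q i)] on the coordinate [c i], hence by 0. *)
have -> : a = \sum_b (a 0 b / q i 0 (c i)) *: mn i b.
  apply/rowP => l; rewrite summxE.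
  transitivity (a 0 l - (dot a (q i)) / q i 0 (c i) * (l == c i)%:R).
    by rewrite aq mul0r mul0r subr0.
  rewrite /dot !mulr_suml -[a 0 l](_ : \sum_b a 0 b * (l == b)%:R = _); last first.
    rewrite (bigD1 l) //= big1 => [|b bl]; first by rewrite eqxx mulr1 addr0.
    by rewrite eq_sym (negbTE bl) mulr0.
  rewrite -sumrB; apply: eq_bigr => b _; rewrite /mn !mxE /=; field; exact: qc.
by elim/big_ind: _ => // b _; exact: SpZ.
Qed.

Lemma nodal_curve_exists : exists X : set 'rV[K]_4,
  [/\ integral_curve X, X `<=` hypersurface F, nodal X, has_geometric_genus X g%:Z &
    forall x, is_node X x <-> exists i, (x == q i)%MS].
Proof.
have n0 : (0 < n)%N by [].
have n1 : (1 < n)%N by move: t4; clear; lia.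
have d1 : (1 < d)%N by exact: leq_trans d4.
have [G pk Gn] := nodal_section unc uN d0 hF p3N Fp3 smooth (r := r) m0 hf fq q0 Fq bq Fp n0.
rewrite -/qs in pk.
have Gq i : eval_at G (q i) = 0.
  have [Gv _ _] := Gn i; have := euler (q i) (pk_G pk); rewrite Gv => /esym/eqP.
  by rewrite mulf_eq0 pnatr_eq0 /= => /eqP.
have prI := nodal_section_prime unc uN d0 hF p3N Fp3 smooth m0 hf fq q0 Fq r0 pk Gn Gq.
pose X := curve F G; have qX i : X (q i) by [].
have nodesX p : X p -> isnode qs p -> node_at F G N p.
  move=> [p0 _ _] /(isnode_scalar p0)[i [c [c0 ->]]]; exact: (node_at_scale pk c0 (Gn i)).
have [H [HV [Hf Hs]]] := node_system.
(* The added zero form makes the number of forms a successor, so that there are [n'.+1] Segre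
   coordinates even if [H] is empty. *)
pose H' := 0 :: H; pose M := (size H).+1.
pose h (j : 'I_M) : P := H'`_j.
have hV j : through_nodes m q (h j).
  case: j => [[|j] jM]; rewrite /h /=; first by split=> [|i]; rewrite ?rpred0 ?evE.
  by apply: HV; rewrite mem_nth.
have hm j : h j \is m.-homog by case: (hV j).
pose n' := (size H + 3 * M)%N.
pose ix (l : 'I_4) (j : 'I_M) : 'I_n'.+1 := mxvec_index l j.
pose rx (i : 'I_n'.+1) : 'I_4 * 'I_M := enum_val (cast_ord (esym (mxvec_cast 4 M)) i).
have rxK i : ix (rx i).1 (rx i).2 = i.
  by rewrite /ix /rx /mxvec_index -surjective_pairing enum_valK cast_ordKV.
have ixK l j : rx (ix l j) = (l, j) by rewrite /ix /rx /mxvec_index cast_ordK enum_rankK.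
have hnode p : X p -> isnode qs p -> forall j, eval_at (h j) p = 0.
  move=> [p0 _ _] /(isnode_scalar p0)[i [c [c0 ->]]] j.
  by rewrite (eval_scale _ _ (hm j)); case: (hV j) => _ ->; rewrite mulr0.
have hfree x : X x -> ~ isnode qs x -> exists j, eval_at (h j) x != 0.
  move=> [x0 _ _] nx; have [h' hH hx] := Hf x x0 nx.
  have jM : ((index h' H).+1 < M)%N by rewrite ltnS index_mem.
  by exists (Ordinal jM); rewrite /h /= nth_index.
have hspan p : X p -> isnode qs p -> forall a : 'rV[K]_4, dot a p = 0 ->
    exists c : 'I_M -> K, forall u, \sum_j c j * differential (h j) p u = dot a u.
  move=> [p0 _ _] /(isnode_scalar p0)[i [c [c0 ->]]] a; rewrite dotZr => /eqP.
  rewrite mulf_eq0 (negbTE c0) => /eqP /Hs[e He].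
  exists (fun j => if unlift ord0 j is Some j' then e j' / c ^+ t else 0) => u.
  rewrite big_ord_recl unlift_none mul0r add0r -He; apply: eq_bigr => j _.
  rewrite liftK (df_homog _ _ _ (hm _)) /h /=; field; exact: expf_neq0.
exists X; split.
- exact: (curve_integral unc pk prI d1 n1).
- by move=> x [x0 Fx _]; split=> // f' ->.
- move=> x [xX nr]; have nx : isnode qs x by apply: contrapT => nx; apply: nr; exact: (curve_regular unc pk xX nx).
  exact: (node_is_node unc pk xX (nodesX x xX nx)).
(* [n + d - 4] is the degree of the canonical class of the complete intersection; [da] and [db] are
   the degrees of the cofactors of [F] and [G]. *)
- apply: (X_geometric_genus unc pk prI d1 n1 rxK ixK m0 (leq_addr r _) hm hnode hfree hspan nodesX
    (ka := (n + d - 4)%N) (da := (n - 4)%N) (db := (d - 4)%N) (q := q)).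
  + by move: t4 d4; clear; lia.
  + by move: t4 d4; clear; lia.
  + by move: t4 d4; clear; lia.
  + by move: t4 d4; clear; lia.
  + exact: qX.
  + exact: isnode_q.
  + by move=> p [p0 _ _] /(isnode_scalar p0)[i [c [_ ->]]]; exists i, c.
  + move=> i; have /rV0Pn[c qc] := q0 i.
    (* The form [f i] has degree only [t]; a power of a coordinate that is nonzero at [q i] raises
       it, and the scalar restores the value 1. *)
    exists ((q i 0 c ^- (n + d - 4 - t)) *: (f i * 'X_c ^+ (n + d - 4 - t))); split.
    * have -> : (n + d - 4 = t + (n + d - 4 - t))%N by move: t4 d4; clear; lia.
      rewrite addKn; apply: rpredZ; apply: dhomogM => //; exact: Xn_homog.
    * by rewrite evE evE evE evE fq eqxx mul1r mulVf // expf_neq0.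
    * by move=> j ji; rewrite evE evE fq eq_sym (negbTE ji) mul0r mulr0.
  + have -> : (n - 4 + 3 = n.-1)%N by move: t4; clear; lia.
    have -> : (d - 4 + 3 = d.-1)%N by move: d4; clear; lia.
    by have -> : (n + d - 4 + 3 = n.-1 + d.-1 + 1)%N by [move: t4 d4; clear; lia].
move=> x; split=> [nx|[i /(pointP _ (q0 i))[c c0 ->]]].
  have [[x0 _ _] _] := nx; have [i [c [c0 xE]]] := isnode_scalar x0 (node_in_nodes unc pk nx).
  by exists i; apply/pointP => //; exists c.
have cX : X (c *: q i) := curve_scale pk c0 (qX i).
exact: (node_is_node unc pk cX (node_at_scale pk c0 (Gn i))).
Qed.

Lemma nodes_distinct i j : (q i == q j)%MS -> i = j.
Proof.
move=> /(pointP _ (q0 j))[c c0 E]; apply/eqP/negPn/negP => ij.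
have := fq i i; rewrite E (eval_scale _ _ (hf i)) fq eqxx (negbTE ij) mulr0 => /esym/eqP.
by rewrite oner_eq0.
Qed.
End Assembly.

Theorem nodal_curves d : (4 <= d)%N -> exists c : int, forall F : P, F \is d.-homog -> smooth_hypersurface F ->
  forall g : int, c <= g -> exists k : nat,
    for_general_points (hypersurface F) (fun q : 'M[K]_(k, 4) =>
      (forall i j, (row i q == row j q)%MS -> i = j) /\
      exists X : set 'rV[K]_4,
        [/\ integral_curve X, X `<=` hypersurface F, nodal X,
            has_geometric_genus X g &
            forall x, is_node X x <-> exists i, (x == row i q)%MS]).
Proof.
(* The bound is a natural number, so a negative [g] is excluded at once. *)
move=> d4; have [c Hc] := degree_choice d4; exists c%:Z => F hF smF [g|g] // cg.
have [s [r [k [s0 r0 ks t4 Hg]]]] := Hc g cg; exists k.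
have smooth x : x != 0 -> eval_at F x = 0 -> grad F x != 0.
  move=> x0 Fx; have [|i Fi] := smF x; first by split=> // f ->.
  by apply/rV0Pn; exists i; rewrite mxE.
have [p3 Fp3] : exists p, eval_at F p != 0.
  apply: contrapT => nF.
  have F0 x : eval_at F x = 0 by apply/eqP/negPn/negP => Fx; apply: nF; exists x.
  have := smooth (delta_mx 0 0); rewrite (eval_inj0 unc F0) => H.
  have : grad (0 : P) (delta_mx 0 0) != 0.
    by apply: H; [apply/rV0Pn; exists 0; rewrite mxE eqxx oner_neq0|rewrite evE].
  by case/rV0Pn => i; rewrite mxE linear0 evE eqxx.
have d0 : (0 < d)%N by exact: leq_trans d4.
have p30 : p3 != 0 by apply: contraNneq Fp3 => ->; rewrite (eval_homog0 hF d0).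
have [N uN p3N] := coordinates p30.
have [e [Phi [hPhi [q0 Sq0 Pq0] HPhi]]] := general_points unc uN (leq_trans (isT : 1 < 4)%N d4) hF p3N Fp3 smooth s0 ks.
have onSP x : onS F x <-> hypersurface F x.
  by split=> [[x0 Fx]|[x0 H]]; split=> //; [move=> f' ->|exact: H].
exists e, Phi; split=> //; first by exists q0 => // i; apply/onSP.
move=> q Sq Pq; have Sq' i : onS F (row i q) by apply/onSP.
have [f [hf fq bq Fp]] := HPhi q Sq' Pq.
have q0' i : row i q != 0 by case: (Sq' i).
have Fq i : eval_at F (row i q) = 0 by case: (Sq' i).
split; first by move=> i j; exact: (nodes_distinct (q := fun i => row i q) hf fq q0').
exact: (nodal_curve_exists (q := fun i => row i q) d4 hF smooth uN p3N Fp3 r0 t4 Hg hf fq q0' Fq bq Fp).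
Qed.
End NodalCurves.

(** Cantor's nested intervals. *)
Lemma real_uncountable (R : realType) : ~ countable [set: R].
Proof.
move=> /countable_injP[phi phi_inj].
have /choice[f Hf] : forall j, exists x : R, forall y, phi y = j -> y = x.
  move=> j; have [[x xj]|nx] := pselect (exists x, phi x = j).
    by exists x => y yj; apply: phi_inj; rewrite ?classical_sets.in_setT // xj.
  by exists 0 => y yj; case: nx; exists y.
(* Keeps a third of the interval that misses [x]: the right one if [x] lies before it, otherwise the
   left one. *)
pose step (I : R * R) x := if x < (I.1 + I.2 + I.2) / 3%:R then ((I.1 + I.2 + I.2) / 3%:R, I.2)
  else (I.1, (I.1 + I.1 + I.2) / 3%:R).
pose I := fix I j := if j is j'.+1 then step (I j') (f j') else (0, 1) : R * R.
have I_lt j : (I j).1 < (I j).2.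
  elim: j => [|j IH] /=; first exact: ltr01.
  by rewrite /step; case: ifP => _ /=; move: IH; clear; lra.
have I_sub j : (I j).1 <= (I j.+1).1 /\ (I j.+1).2 <= (I j).2.
  by rewrite /= /step; have := I_lt j; case: ifP => _ /=; clear; lra.
have I_out j : f j < (I j.+1).1 \/ (I j.+1).2 < f j.
  rewrite /= /step; have := I_lt j; case: ifP => /= [H _|/negbT H Ij]; first by left.
  by right; move: H Ij; rewrite -leNgt; clear; lra.
have mono i j : (I i).1 <= (I (i + j)%N).1 /\ (I (i + j)%N).2 <= (I i).2.
  elim: j => [|j [IH1 IH2]]; first by rewrite addn0.
  by rewrite addnS; have [H1 H2] := I_sub (i + j)%N; split; [exact: le_trans H1|exact: le_trans IH2].
have cross i j : (I i).1 <= (I j).2.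
  have [ij|/ltnW ji] := leqP i j.
    by rewrite -(subnKC ij); have [H1 _] := mono i (j - i)%N; apply: le_trans H1 (ltW (I_lt _)).
  by rewrite -(subnKC ji); have [_ H2] := mono j (i - j)%N; apply: le_trans (ltW (I_lt _)) H2.
pose A := [set (I j).1 | j in [set: nat]].
have hA : has_sup A by split; [exists (I 0%N).1, 0%N|exists (I 0%N).2 => _ [j _ <-]; exact: cross].
have lo j : (I j).1 <= sup A by apply: sup_upper_bound => //; exists j.
have hi j : sup A <= (I j).2.
  by apply: ge_sup; [case: hA|move=> _ [i _ <-]; exact: cross].
have Ex := Hf _ (sup A) erefl.
by case: (I_out (phi (sup A))); rewrite -Ex ltNge ?lo ?hi.
Qed.

Lemma complex_uncountable (R : realType) : ~ countable [set: R[i]].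
Proof.
move=> /countable_injP[phi phi_inj]; apply: (@real_uncountable R); apply/countable_injP.
exists (fun x => phi (x%:C)%C) => x y _ _ E.
by have [] : (x%:C)%C = (y%:C)%C by apply: phi_inj => //; rewrite classical_sets.in_setT.
Qed.

Theorem corollary3p1 (R : realType) (d : nat) (hd : (4 <= d)%N) :
  exists c : int,
  forall F : {mpoly R[i][4]},
    F \is d.-homog -> smooth_hypersurface F ->
  forall g : int, c <= g ->
  exists k : nat,
    for_general_points (hypersurface F) (fun q : 'M[R[i]]_(k, 4) =>
      (forall i j, (row i q == row j q)%MS -> i = j) /\
      exists X : set 'rV[R[i]]_4,
        [/\ integral_curve X, X `<=` hypersurface F, nodal X,
            has_geometric_genus X g &
            forall x, is_node X x <-> exists i, (x == row i q)%MS]).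
Proof. exact: (nodal_curves (@complex_uncountable R) hd). Qed.
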